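(* Let $\phi\in\mathbb Q(x)$ be a non-special rational map of degree $d\ge2$, let $\alpha\in\mathbb Q$ be a non-exceptional point for $\phi$ and suppose that $G_\infty(\phi,\alpha)$ is abelian. Then: (1) $\phi$ is post-critically finite and all of its critical points are strictly preperiodic; (2) if $d=2$, then $\phi$ is $\mathbb Q$-conjugate to either $\frac{2x^2+4x+4}{-x^2+4}$ or $\frac{1}{2(x-1)^2}$.
   Context: $\phi^{-\infty}(\alpha)=\{\gamma\in\overline{\mathbb Q}:\phi^n(\gamma)=\alpha\text{ for some }n\ge0\}$; $\alpha$ is exceptional if this set is finite. $G_\infty(\phi,\alpha)$ is the Galois group over $\mathbb Q$ of the field generated by $\phi^{-\infty}(\alpha)$. $\phi$ is post-critically finite if every critical point has finite forward orbit. Rational functions $\phi,\psi$ are $L$-conjugate if $\psi=f^{-1}\circ\phi\circ f$ for some $f\in\mathrm{PGL}_2(L)$. $\phi$ of degree $d$ is special if it is $\mathbb Q^c$-conjugate to $x^{d}$, $x^{-d}$, $T_d(x)$ or $-T_d(x)$, where $\mathbb Q^c$ is the cyclotomic closure of $\mathbb Q$ and $T_d$ is the Chebyshev polynomial with $T_d(x+x^{-1})=x^d+x^{-d}$. *)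

(* Defs.v *)
From HB Require Import structures.
From mathcomp Require Import all_boot all_order all_algebra all_field.
Set Implicit Arguments. Unset Strict Implicit. Unset Printing Implicit Defensive.
Import Order.TTheory GRing.Theory Num.Theory.
Local Open Scope ring_scope.

(* Points of P^1(Qbar): [Some x] is the finite point x, [None] is infinity. *)
Definition P1 := option algC.

(* A rational map phi = f/g (f, g coprime) acting on P^1(Qbar). *)
Definition rdeg {R : nzRingType} (f g : {poly R}) : nat :=
  ((maxn (size f) (size g)).-1)%N.

Definition reval (f g : {poly algC}) (P : P1) : P1 :=
  match P with
  | Some x => if g.[x] != 0 then Some (f.[x] / g.[x]) else None
  | None => if (size g < size f)%N then None
            else if size f == size g then Some (lead_coef f / lead_coef g)
            else Some 0
  end.

Definition polyQ (p : {poly rat}) : {poly algC} := map_poly (@ratr algC) p.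

(* Ramification index e_phi(P), computed from the homogenised equation
   e F(X,Y) - c G(X,Y) of the fibre over phi(P) = [c:e]. *)
Definition ramif (f g : {poly algC}) (P : P1) : nat :=
  match P with
  | Some x => match reval f g (Some x) with
              | Some c => mup x (f - c *: g)
              | None => mup x g
              end
  | None => match reval f g None with
            | Some c => let h := f - c *: g in (rdeg f g - (size h).-1)%N
            | None => (rdeg f g - (size g).-1)%N
            end
  end.

Definition critical (f g : {poly algC}) (P : P1) : Prop := (2 <= ramif f g P)%N.

Definition finite_orbit (f g : {poly algC}) (P : P1) : Prop :=
  exists s : seq P1, forall n, iter n (reval f g) P \in s.

Definition post_critically_finite (f g : {poly algC}) : Prop :=
  forall P, critical f g P -> finite_orbit f g P.

Definition periodic (f g : {poly algC}) (P : P1) : Prop :=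
  exists n, (0 < n)%N /\ iter n (reval f g) P = P.

Definition preperiodic (f g : {poly algC}) (P : P1) : Prop :=
  exists m n, (m < n)%N /\ iter m (reval f g) P = iter n (reval f g) P.

Definition strictly_preperiodic (f g : {poly algC}) (P : P1) : Prop :=
  preperiodic f g P /\ ~ periodic f g P.

Definition backward_orbit (f g : {poly algC}) (alpha : algC) (gam : algC) : Prop :=
  exists n, iter n (reval f g) (Some gam) = Some alpha.

Definition exceptional (f g : {poly algC}) (alpha : algC) : Prop :=
  exists s : seq algC, forall gam, backward_orbit f g alpha gam -> gam \in s.

(* G_infty(phi, alpha) is abelian: any two automorphisms of Qbar (every ring
   endomorphism of algC is a Q-automorphism) commute on the generators
   phi^{-infty}(alpha) of the field K; as K is Galois over Q, Gal(K/Q) is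
   exactly the set of restrictions of such automorphisms. *)
Definition Ginf_abelian (f g : {poly algC}) (alpha : algC) : Prop :=
  forall (s t : {rmorphism algC -> algC}) (gam : algC),
    backward_orbit f g alpha gam -> s (t gam) = t (s gam).

Definition in_Qc (x : algC) : Prop :=
  exists (n : nat) (z : algC) (p : {poly rat}), z ^+ n.+1 = 1 /\ x = (polyQ p).[z].

Definition conj_by (a b c e : algC) (f g f' g' : {poly algC}) : Prop :=
  a * e - b * c != 0 /\
  forall P : P1,
    reval f g (reval (a *: 'X + b%:P) (c *: 'X + e%:P) P)
    = reval (a *: 'X + b%:P) (c *: 'X + e%:P) (reval f' g' P).

Definition Qc_conjugate (f g f' g' : {poly algC}) : Prop :=
  exists a b c e, [/\ in_Qc a, in_Qc b, in_Qc c, in_Qc e & conj_by a b c e f g f' g'].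

Definition Q_conjugate (f g f' g' : {poly algC}) : Prop :=
  exists a b c e : rat, conj_by (ratr a) (ratr b) (ratr c) (ratr e) f g f' g'.

(* Chebyshev (Dickson) polynomials: T_0 = 2, T_1 = X, T_{n+2} = X T_{n+1} - T_n,
   the unique polynomials with T_d(x + 1/x) = x^d + x^{-d}. *)
Fixpoint cheb_pair (n : nat) : {poly algC} * {poly algC} :=
  match n with
  | O => (2%:P, 'X)
  | S m => let p := cheb_pair m in (p.2, 'X * p.2 - p.1)
  end.
Definition cheb (n : nat) : {poly algC} := (cheb_pair n).1.

Definition special (f g : {poly algC}) : Prop :=
  let d := rdeg f g in
  [\/ Qc_conjugate f g ('X ^+ d) 1,
      Qc_conjugate f g 1 ('X ^+ d),
      Qc_conjugate f g (cheb d) 1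
    | Qc_conjugate f g (- cheb d) 1].

(* Main.v *)
(** The field K generated by the backward orbit of alpha is studied through
    reduction at places v above large primes p.

    Points of the backward orbit have bounded height, and two conjugates of x
    that are congruent at v force phi(x) to meet a critical value mod v; so K is
    unramified at p. As Gal(K/Q) is abelian, the Frobenius element sigma then
    satisfies sigma x = x^p modulo p, at all places above p simultaneously.
    The pigeonhole principle gives an auxiliary polynomial H such that
    H(x, sigma x) is divisible by a high power of p; by the product formula it
    vanishes, so all points (x, (sigma x - x^p)/p) lie, modulo v, on one curve
    A(x, z) = 0 whose degree in z is less than p. The skew product
    induced by phi on the (x, z) plane preserves the curve of minimal degree,
    and its second coefficient yields a nonzero (p-1)-fold differential that is
    phi-invariant up to p-th powers. Its divisor, written as p-1-m, satisfies
    m(Q) = e(Q) m(phi Q), 0 <= m <= p-1 and sum (p-1-m) <= 2(p-1): modulo p the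
    map phi is a covering of a parabolic orbifold.

    Hence at most four points have m < p-1; they contain the critical values
    and are stable under phi, which for many p makes the critical points preperiodic in
    characteristic 0. A periodic critical point has m = 0, so it belongs to a totally
    invariant set of at most two points: phi is a power map twisted by a
    constant, which Kummer theory and Northcott finiteness show to be a root of
    unity up to conjugacy, or a polynomial satisfying the differential equation of T_d.
    Both are special.

    If d = 2, primes p = 3 mod 4 exclude the signature (2,4,4) because 4 does
    not divide p-1. For (2,2,2,2) the invariance relation gives a constant c with
    c^((p-1)/2) = 1 and an explicit equation of degree at most 2, which would make -2, -1
    or -7 a square modulo p; the prime p = 3 mod 4 is chosen so that 2 (or 7)
    is a square, which is absurd. So no non-special quadratic map satisfies the
    hypotheses. *)
Require Import Defs.
From HB Require Import structures.
From mathcomp Require Import all_boot all_order all_algebra all_field.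
From mathcomp Require Import boolp classical_sets.
From mathcomp Require Import zify ring.
Set Implicit Arguments. Unset Strict Implicit. Unset Printing Implicit Defensive.
Import Order.TTheory GRing.Theory Num.Theory.
Local Open Scope ring_scope.

(** The backward orbit lies in no fixed number field, so every estimate has to be uniform in its
    level. A place is therefore a valuation ring of the whole of [algC], with one residue field for
    all points, and norms are products over automorphisms that represent the conjugates. The height
    bound does not depend on the level because d >= 2.

    The functions of x that enter H are not monomials: x^i with i of size p would cost a constant to
    the power p at the archimedean places. Products of powers of the first log_d(p) iterates of x
    span an equally large space, and all these iterates have bounded height, so the cost is a fixed
    power of p. Hence the degree in sigma x can stay fixed while p grows.

    This makes the degree k0 in z of the curve invertible modulo p, so that the mean beta(x) of its
    roots in z is defined; it is an invariant section of the skew product. Differentiating this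
    invariance once shows that omega = beta' + x^(p-1) satisfies omega(phi) = (phi')^(p-1) omega, so
    the inverse of omega is the coefficient of an invariant (p-1)-fold differential. *)

Notation autC := {rmorphism algC -> algC}.

(** * Automorphisms of [algC] and conjugates *)

Lemma splitting_num_field (x : algC) :
  exists (Qs : splittingFieldType rat) (QsC : {rmorphism Qs -> algC}) (x1 : Qs),
    QsC x1 = x.
Proof.
have [q [Dq mon_q] dv_q] := minCpolyP x.
have [rs Drs] := closed_field_poly_normal (minCpoly x).
rewrite (monicP (minCpoly_monic x)) scale1r in Drs.
have [Qs [QsC [s1 Ds1 gen_s1]]] := num_field_exists rs.
have ax : splitting_field_axiom Qs.
  exists (map_poly (in_alg Qs) q).
    by apply/polyOver1P; exists q.
  exists s1; last exact: gen_s1.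
  rewrite -(@eqp_map _ _ QsC) -map_poly_comp.
  rewrite (@eq_map_poly _ _ _ (@ratr algC)) => [|a]; last first.
    by rewrite /= rmorphZ_num rmorph1 mulr1.
  rewrite -Dq Drs -Ds1 big_map rmorph_prod /=.
  rewrite [X in _ %= X](eq_bigr (fun j => 'X - (QsC j)%:P)) ?eqpxx // => j _.
  by rewrite map_polyXsubC.
pose mx := FieldExt_isSplittingField.Build _ Qs ax.
pose Qt : splittingFieldType rat := HB.pack Qs mx.
have: x \in rs by rewrite -root_prod_XsubC -Drs root_minCpoly.
rewrite -Ds1 => /mapP[x1 _ ->].
by exists Qt, QsC, x1.
Qed.

(** Galois theory in a splitting field of x: an element of its Galois group that moves x extends to
    [algC]. The rationality statements below come from here. *)
Lemma aut_fixed_Crat (x : algC) : (forall s : autC, s x = x) -> x \in Crat.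
Proof.
move=> fx; have [Qs [QsC [x1 Dx]]] := splitting_num_field x.
have gal1 : galois 1 {:Qs}.
  apply/and3P; split; first exact: sub1v.
    by apply/separableP=> y _; apply: pcharf0_separable => i; rewrite -(fmorph_pchar QsC) pchar_num.
  exact: normalFieldf.
suff: x1 \in 1%VS.
  case/vlineP=> a Da; rewrite -Dx Da rmorphZ_num rmorph1 mulr1.
  exact: Crat_rat.
rewrite -(galois_fixedField gal1); apply/fixedFieldP => [|g _]; first exact: memvf.
have [nu Dnu] := extend_algC_subfield_aut QsC g.
by apply: (fmorph_inj QsC); rewrite Dnu Dx fx.
Qed.

HB.instance Definition _ := gen_eqMixin autC.
HB.instance Definition _ := gen_choiceMixin autC.

(** One automorphism per conjugate of [x]: the list stands for the embeddings of Q(x), so that sums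
    and products over it are traces and norms. *)
Definition conj_reps (x : algC) (gs : seq autC) : Prop :=
  uniq [seq (s : autC) x | s <- gs] /\
  forall t : autC, t x \in [seq (s : autC) x | s <- gs].

Lemma conj_reps_exists x : exists gs, conj_reps x gs.
Proof.
have [rs Drs] := closed_field_poly_normal (minCpoly x).
rewrite (monicP (minCpoly_monic x)) scale1r in Drs.
have mem_rs (t : autC) : t x \in rs.
  rewrite -root_prod_XsubC -Drs -(minCpoly_aut t x); exact: root_minCpoly.
suff: forall r : seq algC, exists gs : seq autC,
    uniq [seq (s : autC) x | s <- gs] /\
    forall t : autC, t x \in r -> t x \in [seq (s : autC) x | s <- gs].
  by move/(_ rs) => [gs [u m]]; exists gs; split=> // t; apply: m.
elim=> [|y r [gs [u m]]]; first by exists [::].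
have [[t0 Dt]|no] := pselect (exists t : autC, t x = y); last first.
  exists gs; split=> // t; rewrite inE => /predU1P[Dy|/m //].
  by case: no; exists t.
have [yin|ynin] := boolP (y \in [seq (s : autC) x | s <- gs]).
  by exists gs; split=> // t; rewrite inE => /predU1P[->//|/m //].
exists (t0 :: gs); split=> [|t]; first by rewrite /= Dt ynin.
by rewrite !inE Dt => /predU1P[->|/m ->]; rewrite ?eqxx ?orbT.
Qed.

Section ConjReindex.
Variables (x : algC) (gs : seq autC).
Hypothesis gsP : conj_reps x gs.

Lemma conj_repsP (t : autC) : exists2 s, s \in gs & t x = (s : autC) x.
Proof. by have [_ /(_ t) /mapP] := gsP. Qed.

Lemma conj_reps_uniq : uniq gs.
Proof. by have [/map_uniq] := gsP. Qed.

Lemma conj_reps_inj : {in gs &, forall s s' : autC, s x = s' x -> s = s'}.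
Proof.
have [u _] := gsP; move=> s s' sgs s'gs.
elim: gs u sgs s'gs => //= a l IH /andP[nin /IH {}IH].
rewrite !inE => /predU1P[->|sl] /predU1P[->|s'l] // E; last exact: IH.
  by case/negP: nin; rewrite E; apply/mapP; exists s'.
by case/negP: nin; rewrite -E; apply/mapP; exists s.
Qed.

Lemma conj_reps_perm (h : autC -> autC) :
  (forall s s' : autC, h s x = h s' x -> s x = s' x) ->
  perm_eq [seq h s x | s <- gs] [seq (s : autC) x | s <- gs].
Proof.
move=> hinj; have [ugs mgs] := gsP.
have u2 : uniq [seq h s x | s <- gs].
  rewrite map_inj_in_uniq ?conj_reps_uniq // => s s' sg sg' /hinj.
  exact: conj_reps_inj.
have sub : {subset [seq h s x | s <- gs] <= [seq (s : autC) x | s <- gs]}.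
  by move=> y /mapP[s _ ->]; apply: mgs.
have [|_ E] := uniq_min_size u2 sub; first by rewrite !size_map.
exact: uniq_perm.
Qed.

Lemma conj_reps_big (R : Type) (idx : R) (op : Monoid.com_law idx)
    (F : autC -> R) (h : autC -> autC) :
  (forall s s' : autC, s x = s' x -> F s = F s') ->
  (forall s s' : autC, h s x = h s' x -> s x = s' x) ->
  \big[op/idx]_(s <- gs) F (h s) = \big[op/idx]_(s <- gs) F s.
Proof.
move=> FF hinj.
(* [F] factors through the value at [x], so it can be read as a function of the conjugate, and the
   reindexing becomes a permutation of the conjugates. *)
have pick (y : algC) : {F' : R | forall s : autC, s x = y -> F s = F'}.
  have [e|ne] := pselect (exists s : autC, s x = y); last first.
    by exists idx => s Ds; case: ne; exists s.
  by have [s Ds] := cid e; exists (F s) => s' Ds'; apply: FF; rewrite Ds.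
pose F' y := sval (pick y).
have F'E (s : autC) : F s = F' (s x) by rewrite /F'; case: (pick _) => z /= ->.
transitivity (\big[op/idx]_(y <- [seq h s x | s <- gs]) F' y).
  by rewrite big_map; apply: eq_bigr => s _; rewrite F'E.
rewrite (perm_big _ (conj_reps_perm hinj)) big_map.
by apply: eq_bigr => s _; rewrite F'E.
Qed.

Lemma conj_reps_bigl (R : Type) (idx : R) (op : Monoid.com_law idx)
    (F : autC -> R) (t : autC) :
  (forall s s' : autC, s x = s' x -> F s = F s') ->
  \big[op/idx]_(s <- gs) F (t \o s : autC) = \big[op/idx]_(s <- gs) F s.
Proof.
move=> FF; apply: (conj_reps_big _ (h := fun s => (t \o s : autC))) => // s s' /=.
exact: fmorph_inj.
Qed.

Lemma conj_reps_pos : (0 < size gs)%N.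
Proof. by have [s] := conj_repsP idfun; case: gs. Qed.

End ConjReindex.

(** * Places of the field of algebraic numbers *)

Definition subring_set (A : set algC) : Prop :=
  [/\ A 1, forall x y, A x -> A y -> A (x - y) & forall x y, A x -> A y -> A (x * y)].

Section SubringSet.
Variable A : set algC.
Hypothesis sA : subring_set A.
Let A1 : A 1. Proof. by case: sA. Qed.
Let AB x y : A x -> A y -> A (x - y). Proof. by case: sA => _ h _; apply: h. Qed.
Let AM x y : A x -> A y -> A (x * y). Proof. by case: sA => _ _ h; apply: h. Qed.
Lemma subring_set0 : A 0. Proof. by rewrite -(subrr 1); apply: AB. Qed.
Lemma subring_setN x : A x -> A (- x).
Proof. by move=> Ax; rewrite -sub0r; apply: AB => //; apply: subring_set0. Qed.
Lemma subring_setD x y : A x -> A y -> A (x + y).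
Proof. by move=> Ax Ay; rewrite -[y]opprK; apply: AB => //; apply: subring_setN. Qed.
Lemma subring_setX x n : A x -> A (x ^+ n).
Proof. by move=> Ax; elim: n => [|n IH]; rewrite ?expr0 ?exprS //; apply: AM. Qed.
Lemma subring_set_sum (I : Type) (r : seq I) (P : pred I) F :
  (forall i, P i -> A (F i)) -> A (\sum_(i <- r | P i) F i).
Proof. by move=> h; elim/big_ind: _ => //; [exact: subring_set0|exact: subring_setD]. Qed.
Lemma subring_set_prod (I : Type) (r : seq I) (P : pred I) F :
  (forall i, P i -> A (F i)) -> A (\prod_(i <- r | P i) F i).
Proof. by move=> h; elim/big_ind: _ => //. Qed.
Lemma subring_set_nat n : A n%:R.
Proof. by elim: n => [|n IH]; [exact: subring_set0|rewrite -natr1; exact: subring_setD]. Qed.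
Lemma subring_set_int (n : int) : A n%:~R.
Proof.
by case: n => n; rewrite ?NegzE ?rmorphN; [|apply: subring_setN]; exact: subring_set_nat.
Qed.
Lemma subring_set_horner (P : {poly algC}) x :
  (forall i, A P`_i) -> A x -> A P.[x].
Proof.
move=> AP Ax; rewrite horner_coef; apply: subring_set_sum => i _.
by apply: AM => //; apply: subring_setX.
Qed.
End SubringSet.

Section Chevalley.
Variable l : nat.
Local Notation lC := (l%:R : algC).
Hypothesis l_gt0 : (0 < l)%N.

(** Chevalley's method: a subring that is maximal among those without 1/l is a valuation ring, and
    its maximal ideal contains l. *)
Definition max_avoiding (O : set algC) : Prop :=
  [/\ subring_set O, ~ O lC^-1 &
    forall B, subring_set B -> ~ B lC^-1 -> (forall x, O x -> B x) -> forall x, B x -> O x].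

Lemma max_avoiding_exists (Z0 : set algC) :
  subring_set Z0 -> ~ Z0 lC^-1 -> exists O, max_avoiding O.
Proof.
move=> sZ nZ.
pose P := [set A : set algC | A = classical_sets.set0 \/ (subring_set A /\ ~ A lC^-1)]%classic.
have [F FP Ftot|O [OP Omax]] := @Zorn_bigcup _ P.
  have [[x0 [X0 FX0 X0x]]|ne] := pselect (exists x, (\bigcup_(X in F) X)%classic x); last first.
    left; rewrite predeqE => x; split=> // -[X FX Xx]; by case: ne; exists x, X.
  right.
  have sF X x : F X -> X x -> subring_set X /\ ~ X lC^-1.
    by move=> FX Xx; case: (FP X FX) => // E; rewrite E in Xx.
  have [sX0 _] := sF _ _ FX0 X0x.
  have op x y (f : algC -> algC -> algC) : 
     (forall X, subring_set X -> X x -> X y -> X (f x y)) ->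
     (\bigcup_(X in F) X)%classic x -> (\bigcup_(X in F) X)%classic y ->
     (\bigcup_(X in F) X)%classic (f x y).
    move=> cl [X FX Xx] [Y FY Yy]; have [sX _] := sF _ _ FX Xx; have [sY _] := sF _ _ FY Yy.
    by case: (Ftot X Y FX FY) => sub; [exists Y|exists X] => //; apply: cl => //; apply: sub.
  split; last by case=> X FX Xl; have [_] := sF _ _ FX Xl; apply.
  split; first by exists X0 => //; case: sX0.
    by move=> x y; apply: (op x y (fun x y => x - y)) => X [_ h _]; apply: h.
  by move=> x y; apply: (op x y (fun x y => x * y)) => X [_ _ h]; apply: h.
have On0 : O <> classical_sets.set0.
  move=> O0; apply: (Omax Z0); last by right.
  by rewrite O0; split=> // sub; case: sZ => /sub.
case: OP => // -[sO nO]; exists O; split=> // B sB nB OB x Bx.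
apply: contrapT => nOx; apply: (Omax B); last by right.
by split=> // BO; apply: nOx; apply: BO.
Qed.

Variable O : set algC.
Hypothesis Omax : max_avoiding O.
Let sO : subring_set O. Proof. by case: Omax. Qed.
Let nOl : ~ O lC^-1. Proof. by case: Omax. Qed.
Let O1 : O 1. Proof. by case: sO. Qed.
Let OB x y : O x -> O y -> O (x - y). Proof. by case: sO => _ h _; apply: h. Qed.
Let OM x y : O x -> O y -> O (x * y). Proof. by case: sO => _ _ h; apply: h. Qed.
Let OD x y : O x -> O y -> O (x + y). Proof. exact: subring_setD. Qed.
Let Ol : O lC. Proof. exact: subring_set_nat. Qed.
Let l_neq0 : lC != 0. Proof. by rewrite pnatr_eq0 -lt0n. Qed.

(** Adjoining the inverse of u = 1 - l b keeps 1/l out: every u^n has the form 1 - l c, so 1/l = a /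
    u^n would give 1/l = a + c. Maximality then puts 1/u in [O]. *)
Lemma avoiding_unit b : O b -> O (1 - lC * b)^-1.
Proof.
move=> Ob; set u := 1 - lC * b; have Ou : O u by apply/OB/OM.
have uX n : exists2 c, O c & u ^+ n = 1 - lC * c.
  elim: n => [|n [c Oc IH]]; first by exists 0; rewrite ?mulr0 ?subr0 //; apply: subring_set0.
  exists (c + b - lC * (b * c)); first by apply: OB; [apply: OD|do 2?apply: OM].
  by rewrite exprS IH /u; ring.
have u_neq0 : u != 0.
  apply/eqP => u0; apply: nOl; suff -> : lC^-1 = b by [].
  by apply: (mulfI l_neq0); rewrite divff //; apply/eqP; rewrite -subr_eq0; apply/eqP.
pose B := [set x : algC | exists n a, O a /\ x = a / u ^+ n]%classic.
have uXn0 n : u ^+ n != 0 by rewrite expf_neq0.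
case: Omax => _ _ /(_ B); apply; last by exists 1%N, 1; split; rewrite ?expr1 ?mul1r.
- split; first by exists 0%N, 1; split; rewrite ?expr0 ?divr1.
    move=> _ _ [n [a [Oa ->]]] [m [c [Oc ->]]]; exists (n + m)%N, (a * u ^+ m - c * u ^+ n).
    split; first by apply: OB; apply: OM => //; apply: subring_setX.
    by rewrite exprD; field; rewrite !uXn0.
  move=> _ _ [n [a [Oa ->]]] [m [c [Oc ->]]]; exists (n + m)%N, (a * c).
  by split; [apply: OM|rewrite exprD; field; rewrite !uXn0].
- move=> [n [a [Oa E]]]; have [c Oc Ec] := uX n; apply: nOl.
  suff -> : lC^-1 = a + c by apply: OD.
  have Ea : u ^+ n = lC * a.
    by rewrite -[a](divfK (uXn0 n)) -E mulrA divff // mul1r.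
  apply: (mulfI l_neq0); rewrite divff // mulrDr -Ea Ec; ring.
- by move=> x Ox; exists 0%N, x; rewrite expr0 divr1.
Qed.

(** A relation 1 = l P(x) over [O]. By maximality there is one as soon as x is outside [O], because
    [O][x] then contains 1/l. *)
Let rep (x : algC) n :=
  exists P : {poly algC}, [/\ forall i, O P`_i, (size P <= n)%N & lC * P.[x] = 1].

Let rep_of x : ~ O x -> exists n, rep x n.
Proof.
move=> nOx; pose B := [set y : algC | exists P : {poly algC}, (forall i, O P`_i) /\ y = P.[x]]%classic.
have [] := pselect (B lC^-1).
  by case=> P [OP E]; exists (size P), P; split=> //; rewrite -E divff.
move=> nB; case: nOx; case: Omax => _ _ /(_ B); apply => //.
- split.
  + exists 1; rewrite hornerC; split=> // i; rewrite coef1; exact: subring_set_nat.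
  + move=> _ _ [P [OP ->]] [Q [OQ ->]]; exists (P - Q); rewrite hornerD hornerN.
    by split=> // i; rewrite coefB; apply: OB.
  + move=> _ _ [P [OP ->]] [Q [OQ ->]]; exists (P * Q); rewrite hornerM.
    split=> // i; rewrite coefM; apply: subring_set_sum => // j _; exact: OM.
- move=> y Oy; exists y%:P; rewrite hornerC; split=> // i.
  by rewrite coefC; case: ifP => // _; apply: subring_set0.
- exists 'X; rewrite hornerX; split=> // i; rewrite coefX; exact: subring_set_nat.
Qed.

(** The relation for 1/x, divided by the unit 1 - l Q_0 and multiplied by a power of x, rewrites the
    top power of x as l times a polynomial of lower degree; substituting it shortens the relation
    for x. *)
Let rep_step x m n : x != 0 -> rep x m -> rep x^-1 n -> (n <= m)%N -> rep x m.-1.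
Proof.
move=> x_neq0 [P [OP szP EP]] [Q [OQ szQ EQ]] nm.
case: m => [|m] in szP nm *; first by exists P.
rewrite /=; pose y := x^-1.
pose u := 1 - lC * Q`_0.
have Oui : O u^-1 by apply: avoiding_unit.
have u_neq0 : u != 0.
  apply/eqP => u0; apply: nOl; suff -> : lC^-1 = Q`_0 by [].
  by apply: (mulfI l_neq0); rewrite divff //; apply/eqP; rewrite -subr_eq0; apply/eqP.
pose R := \poly_(j < m) (u^-1 * Q`_(m - j)).
have ER : x ^+ m = lC * R.[x].
  have E1 : u = lC * \sum_(i < m) Q`_i.+1 * y ^+ i.+1.
    rewrite /u -[X in X - _]EQ (horner_coef_wide _ (leq_trans szQ nm)) big_ord_recl expr0 mulr1.
    by rewrite mulrDr addrC addrA addNr add0r.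
  have -> : x ^+ m = x ^+ m * u^-1 * u by rewrite mulrAC -mulrA divff // mulr1.
  rewrite [in X in _ * X]E1 /R horner_poly !mulr_sumr [RHS](reindex_inj rev_ord_inj) /=.
  apply: eq_bigr => i _; have im := ltn_ord i.
  rewrite subKn // -{1}(subnK im) exprD /y exprVn.
  by field; rewrite u_neq0 ?expf_neq0.
exists (\poly_(j < m) P`_j + (lC * P`_m) *: R); split.
- move=> i; rewrite coefD coefZ !coef_poly; apply: OD.
    by case: ifP => // _; apply: subring_set0.
  by apply: OM; [apply: OM|case: ifP => _; [apply: OM|apply: subring_set0]].
- rewrite (leq_trans (size_polyD _ _)) // geq_max size_poly /=.
  by rewrite (leq_trans (size_scale_leq _ _)) // size_poly.
- rewrite hornerD hornerZ -mulrA (mulrCA lC P`_m) -ER -[RHS]EP.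
  by rewrite [P.[x]](horner_coef_wide _ szP) big_ord_recr /= horner_poly.
Qed.

(** If neither x nor 1/x were in [O], both would have relations of minimal length, and the longer of
    the two could be shortened. *)
Lemma max_avoiding_valuation x : O x \/ O x^-1.
Proof.
have [->|x_neq0] := eqVneq x 0; first by left; apply: subring_set0.
apply: contrapT => /not_orP[nx nxi].
have exm y : ~ O y -> exists m, `[< rep y m >] /\ forall n, `[< rep y n >] -> (m <= n)%N.
  move=> ny; have ex : exists m, `[< rep y m >] by have [m] := rep_of ny; exists m; apply/asboolP.
  by case: (ex_minnP ex) => m ? ?; exists m.
have [m [/asboolP rm minm]] := exm _ nx; have [n [/asboolP rn minn]] := exm _ nxi.
have pos y k : rep y k -> (0 < k)%N.
  by case: k => // -[P [_]]; rewrite leqn0 size_poly_eq0 => /eqP-> /eqP; rewrite horner0 mulr0 eq_sym oner_eq0.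
have [nm|mn] := leqP n m.
  have /asboolP/minm := rep_step x_neq0 rm rn nm; have := pos _ _ rm; lia.
have := @rep_step x^-1 n m; rewrite invr_eq0 invrK => /(_ x_neq0 rn rm (ltnW mn)).
move=> /asboolP/minn; have := pos _ _ rn; lia.
Qed.

End Chevalley.

Lemma expVB (R : fieldType) (x : R) n i : x != 0 -> (i <= n)%N ->
  x^-1 ^+ (n - i) * x ^+ n = x ^+ i.
Proof.
by move=> x0 le; rewrite exprVn -{2}(subnK le) exprD mulKf ?expf_neq0.
Qed.

(** A valuation ring of [algC] above l, given by its elements. No value group is introduced:
    divisibility is always expressed as membership of a quotient. *)
Record place (l : nat) := Place {
  pO : set algC;
  pOsub : subring_set pO;
  pOval : forall x, pO x \/ pO x^-1;
  pOl : ~ pO l%:R^-1 }.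

Section Residue.
Variables (l : nat) (v : place l).
Local Notation O := (pO v).
Lemma O1 : O 1. Proof. by case: (pOsub v). Qed.
Lemma OB x y : O x -> O y -> O (x - y). Proof. by case: (pOsub v) => _ h _; apply: h. Qed.
Lemma OM x y : O x -> O y -> O (x * y). Proof. by case: (pOsub v) => _ _ h; apply: h. Qed.
Lemma OD x y : O x -> O y -> O (x + y). Proof. exact: subring_setD (pOsub v) _ _. Qed.
Lemma ON x : O x -> O (- x). Proof. exact: subring_setN (pOsub v) _. Qed.
Lemma O0 : O 0. Proof. exact: subring_set0 (pOsub v). Qed.
Lemma OX x n : O x -> O (x ^+ n). Proof. exact: subring_setX (pOsub v) _ _. Qed.
Lemma Onat n : O n%:R. Proof. exact: subring_set_nat (pOsub v) _. Qed.
Lemma Oint (n : int) : O n%:~R. Proof. exact: subring_set_int (pOsub v) _. Qed.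
Hint Resolve O0 O1 : core.

(** The maximal ideal. The case x = 0 is separate because [0^-1 = 0] lies in the ring. *)
Definition pm : set algC := fun x => O x /\ (x = 0 \/ ~ O x^-1).
Lemma pm0 : pm 0. Proof. by split; [|left]. Qed.
Lemma pm1 : ~ pm 1.
Proof. by case=> _ [/eqP|]; [rewrite oner_eq0|rewrite invr1]. Qed.
Lemma pmM x y : O x -> pm y -> pm (x * y).
Proof.
move=> Ox [Oy [->|ny]]; first by rewrite mulr0; apply: pm0.
split; first exact: OM.
have [->|x0] := eqVneq x 0; first by left; rewrite mul0r.
right=> H; apply: ny; suff -> : y^-1 = x * (x * y)^-1 by apply: OM.
by rewrite invfM mulrA divff // mul1r.
Qed.
Lemma pmN x : pm x -> pm (- x).
Proof. by move=> h; rewrite -mulN1r; apply: pmM => //; apply: ON. Qed.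
Lemma pmD x y : pm x -> pm y -> pm (x + y).
Proof.
wlog D : x y / O (x / y).
  move=> W mx my; have [D|D] := pOval v (x / y); first exact: W.
  by rewrite addrC; apply: W => //; rewrite -invf_div.
move=> mx my; have [->|y0] := eqVneq y 0; first by rewrite addr0.
have -> : x + y = (x / y + 1) * y by rewrite mulrDl mul1r divfK.
by apply: pmM => //; apply: OD.
Qed.
Lemma pmB x y : pm x -> pm y -> pm (x - y).
Proof. by move=> mx my; apply: pmD => //; apply: pmN. Qed.
Lemma pmBC x y : pm (x - y) -> pm (y - x).
Proof. by move/pmN; rewrite opprB. Qed.

(** The residue field is carried by canonical representatives: choice selects one element in each
    class modulo the maximal ideal, and [resT] is the subtype of the selected elements. *)
Let rep x : algC := xget 0 [set y | O y /\ pm (x - y)]%classic.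
Let repP x : O x -> O (rep x) /\ pm (x - rep x).
Proof.
move=> Ox; apply: (@xgetPex _ 0 [set y | O y /\ pm (x - y)]%classic).
by exists x; split=> //; rewrite subrr; apply: pm0.
Qed.
Let rep_eq x y : pm (x - y) -> rep x = rep y.
Proof.
move=> m; rewrite /rep; congr (xget 0 _); rewrite predeqE => z /=.
split=> -[Oz mz]; split=> //.
  by have -> : y - z = (y - x) + (x - z) by [ring]; apply: pmD mz; apply: pmBC.
by have -> : x - z = (x - y) + (y - z) by [ring]; apply: pmD mz.
Qed.

Record resT := ResT { res_val : algC; res_prop : `[< O res_val /\ rep res_val = res_val >] }.
HB.instance Definition _ := [isSub for res_val].
HB.instance Definition _ := [Choice of resT by <:].

Let rep_idP x : O x -> `[< O (rep x) /\ rep (rep x) = rep x >].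
Proof.
move=> Ox; apply/asboolP; have [Or mr] := repP Ox; split=> //.
by apply/esym/rep_eq.
Qed.
(** Outside the ring the value defaults to the class of 0, so the compatibility lemmas below carry
    integrality hypotheses. *)
Definition pr (x : algC) : resT :=
  match pselect (O x) with
  | left Ox => ResT (rep_idP Ox)
  | right _ => ResT (rep_idP O0)
  end.
Lemma res_valO (x : resT) : O (res_val x).
Proof. by case: x => x /= /asboolP[]. Qed.
Hint Resolve res_valO : core.
Lemma pr_val (x : resT) : pr (res_val x) = x.
Proof.
rewrite /pr; case: pselect => [Ox|/(_ (res_valO x))//]; apply: val_inj => /=.
by case: x {Ox} => x /= /asboolP[].
Qed.
Lemma val_pr x : O x -> pm (x - res_val (pr x)).
Proof. by move=> Ox; rewrite /pr; case: pselect => // Ox' /=; case: (repP Ox'). Qed.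
Lemma pr_eq x y : O x -> O y -> pm (x - y) -> pr x = pr y.
Proof.
move=> Ox Oy m; rewrite /pr; case: pselect => // Ox'; case: pselect => // Oy'.
by apply: val_inj => /=; apply: rep_eq.
Qed.
Lemma pr_eqP x y : O x -> O y -> pr x = pr y -> pm (x - y).
Proof.
move=> Ox Oy E; have := val_pr Ox; have := val_pr Oy; rewrite E => my mx.
by have -> : x - y = (x - res_val (pr y)) - (y - res_val (pr y)) by [ring]; apply: pmB.
Qed.

Let addr (x y : resT) := pr (res_val x + res_val y).
Let mulr (x y : resT) := pr (res_val x * res_val y).
Let oppr (x : resT) := pr (- res_val x).
Let prD x y : O x -> O y -> pr (x + y) = addr (pr x) (pr y).
Proof.
move=> Ox Oy; apply: pr_eq; try exact: OD.
have -> : forall a b : algC, x + y - (a + b) = (x - a) + (y - b) by move=> *; ring.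
by apply: pmD; apply: val_pr.
Qed.
Let prM x y : O x -> O y -> pr (x * y) = mulr (pr x) (pr y).
Proof.
move=> Ox Oy; apply: pr_eq; try exact: OM.
have -> : forall a b : algC, x * y - (a * b) = x * (y - b) + b * (x - a) by move=> *; ring.
by apply: pmD; apply: pmM => //; apply: val_pr.
Qed.
Let addA : associative addr.
Proof.
move=> x y z; rewrite -(pr_val x) -(pr_val y) -(pr_val z).
by rewrite -!prD ?addrA //; apply: OD.
Qed.
Let addC : commutative addr.
Proof. by move=> x y; rewrite /addr addrC. Qed.
Let add0 : left_id (pr 0) addr.
Proof. by move=> x; rewrite -(pr_val x) -prD ?add0r. Qed.
Let addN : left_inverse (pr 0) oppr addr.
Proof. by move=> x; rewrite /oppr -{2}(pr_val x) -prD ?addNr //; apply: ON. Qed.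
HB.instance Definition _ := GRing.isZmodule.Build resT addA addC add0 addN.
Let mulA : associative mulr.
Proof.
move=> x y z; rewrite -(pr_val x) -(pr_val y) -(pr_val z).
by rewrite -!prM ?mulrA //; apply: OM.
Qed.
Let mulC : commutative mulr.
Proof. by move=> x y; rewrite /mulr mulrC. Qed.
Let mul1 : left_id (pr 1) mulr.
Proof. by move=> x; rewrite -(pr_val x) -prM ?mul1r. Qed.
Let mulD : left_distributive mulr (+%R : resT -> resT -> resT).
Proof.
move=> x y z; rewrite -[LHS]/(mulr (addr x y) z) -[RHS]/(addr (mulr x z) (mulr y z)).
rewrite -(pr_val x) -(pr_val y) -(pr_val z).
by rewrite -prD // -!prM // -?prD ?mulrDl //; (apply: OM || apply: OD).
Qed.
Let one0 : pr 1 != 0 :> resT.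
Proof. by apply/eqP => /(pr_eqP O1 O0); rewrite subr0; apply: pm1. Qed.
HB.instance Definition _ := GRing.Zmodule_isComNzRing.Build resT mulA mulC mul1 mulD one0.

Let inv (x : resT) : resT := if x == 0 then 0 else pr (res_val x)^-1.
Let mulV (x : resT) : x != 0 -> inv x * x = 1.
Proof.
move=> x0; rewrite /inv (negPf x0).
have [Oi'|nO] := pselect (O (res_val x)^-1).
  transitivity (mulr (pr (res_val x)^-1) (pr (res_val x))); first by rewrite pr_val.
  rewrite -prM // mulVf //.
  by apply: contraNneq x0 => E; rewrite -(pr_val x) E.
case/negP: x0; apply/eqP; rewrite -(pr_val x); apply: pr_eq => //.
by rewrite subr0; split=> //; right.
Qed.
Let inv0 : inv 0 = 0. Proof. by rewrite /inv eqxx. Qed.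
HB.instance Definition _ := GRing.ComNzRing_isField.Build resT mulV inv0.

Lemma prDE x y : O x -> O y -> pr (x + y) = pr x + pr y. Proof. exact: prD. Qed.
Lemma prME x y : O x -> O y -> pr (x * y) = pr x * pr y. Proof. exact: prM. Qed.
Lemma pr1 : pr 1 = 1. Proof. by []. Qed.
Lemma pr0 : pr 0 = 0. Proof. by []. Qed.
Lemma prNE x : O x -> pr (- x) = - pr x.
Proof.
move=> Ox; apply/eqP; rewrite -subr_eq0 opprK -prDE ?addNr ?pr0 //; exact: ON.
Qed.
Lemma prBE x y : O x -> O y -> pr (x - y) = pr x - pr y.
Proof. by move=> Ox Oy; rewrite prDE ?prNE //; apply: ON. Qed.
Lemma prXE x n : O x -> pr (x ^+ n) = pr x ^+ n.
Proof.
by move=> Ox; elim: n => [|n IH]; rewrite ?expr0 // !exprS prME ?IH //; apply: OX.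
Qed.
Lemma pr_eq0P x : O x -> (pr x = 0 <-> pm x).
Proof.
move=> Ox; split=> [/(pr_eqP Ox O0)|m]; first by rewrite subr0.
by apply: (pr_eq Ox O0); rewrite subr0.
Qed.
Lemma pr_sum (I : Type) (r : seq I) (P : pred I) F : (forall i, P i -> O (F i)) ->
  pr (\sum_(i <- r | P i) F i) = \sum_(i <- r | P i) pr (F i).
Proof.
move=> h; suff [] : O (\sum_(i <- r | P i) F i) /\
  pr (\sum_(i <- r | P i) F i) = \sum_(i <- r | P i) pr (F i) by [].
elim/big_rec2: _ => // i y x Pi [Ox <-]; split; first by apply: OD => //; apply: h.
by rewrite prDE //; apply: h.
Qed.
Lemma pr_prod (I : Type) (r : seq I) (P : pred I) F : (forall i, P i -> O (F i)) ->
  pr (\prod_(i <- r | P i) F i) = \prod_(i <- r | P i) pr (F i).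
Proof.
move=> h; suff [] : O (\prod_(i <- r | P i) F i) /\
  pr (\prod_(i <- r | P i) F i) = \prod_(i <- r | P i) pr (F i) by [].
elim/big_rec2: _ => // i y x Pi [Ox <-]; split; first by apply: OM => //; apply: h.
by rewrite prME //; apply: h.
Qed.
Lemma pr_nat n : pr n%:R = n%:R.
Proof. by elim: n => // n IH; rewrite -!natr1 prDE ?IH ?pr1 //; apply: Onat. Qed.
Lemma pr_int (n : int) : pr n%:~R = n%:~R.
Proof.
by case: n => n; rewrite ?NegzE ?rmorphN /= ?prNE ?pr_nat //; apply: Onat.
Qed.
Lemma pr_surj (y : resT) : exists2 x, O x & pr x = y.
Proof. by exists (res_val y); rewrite ?pr_val. Qed.
Lemma pr_neq0_unit x : O x -> pr x != 0 -> O x^-1.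
Proof.
move=> Ox nz; apply: contrapT => n; case/negP: nz; apply/eqP/pr_eq0P => //.
by split=> //; right.
Qed.
Lemma unit_pr_neq0 x : x != 0 -> O x -> O x^-1 -> pr x != 0.
Proof.
move=> x0 Ox Ox1; apply/eqP => /(pr_eq0P Ox) [_ [/eqP|//]].
by rewrite (negPf x0).
Qed.
Lemma prVE x : O x -> O x^-1 -> pr x^-1 = (pr x)^-1.
Proof.
move=> Ox Ox1; have [->|x0] := eqVneq x 0; first by rewrite invr0 pr0 invr0.
have nz := unit_pr_neq0 x0 Ox Ox1.
by apply: (mulfI nz); rewrite -prME // !divff.
Qed.
(** Make the polynomial monic and lift it to [algC]. A root of the monic lift is integral, since
    otherwise division by the top power of x would put 1 in the maximal ideal; its residue is the
    wanted root. *)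
Lemma res_closed (P : {poly resT}) : (1 < size P)%N -> exists x, root P x.
Proof.
move=> sP; have P0 : P != 0 by rewrite -size_poly_gt0 ltnW.
pose Q := 'X^((size P).-1) + \poly_(i < (size P).-1) res_val (P`_i / lead_coef P).
have szl : (size (\poly_(i < (size P).-1) res_val (P`_i / lead_coef P)) < size ('X^((size P).-1) : {poly algC}))%N.
  by rewrite size_polyXn ltnS size_poly.
have szQ : size Q = size P by rewrite size_polyDl // size_polyXn prednK ?size_poly_gt0.
have [x /eqP Qx] : exists x, root Q x by apply/closed_rootP; rewrite szQ; case: size sP => [|[]].
have QE y : Q.[y] = y ^+ (size P).-1 + \sum_(i < (size P).-1) res_val (P`_i / lead_coef P) * y ^+ i.
  by rewrite hornerD hornerXn horner_poly.
have Ox : O x.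
  have [//|Oxi] := pOval v x; apply: contrapT => nOx.
  have m : pm x^-1 by split=> //; right; rewrite invrK.
  have x0 : x != 0 by apply: contra_notN nOx => /eqP->.
  set n := (size P).-1 in QE; rewrite QE in Qx.
  apply: pm1; have -> : 1 = - (\sum_(i < n) (res_val (P`_i / lead_coef P) * x^-1 ^+ (n - i))).
    apply: (mulIf (expf_neq0 n x0)); rewrite mul1r mulNr mulr_suml.
    apply/eqP; rewrite -addr_eq0 -[X in _ == X]Qx; apply/eqP; congr (_ + _).
    apply: eq_bigr => i _; rewrite -mulrA; congr (_ * _).
    by rewrite expVB // ltnW.
  apply: pmN; elim/big_ind: _ => [||i _]; [exact: pm0|exact: pmD|].
  apply: pmM => //.
  have := ltn_ord i; rewrite -subn_gt0; case: (n - i)%N => // k _.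
  by rewrite exprSr; apply: pmM => //; apply: OX.
exists (pr x); rewrite /root; have := congr1 pr Qx; rewrite QE pr0.
have OS (i : 'I_(size P).-1) : O (res_val (P`_i / lead_coef P) * x ^+ i).
  by apply: OM => //; apply: OX.
rewrite prDE ?prXE //; [|exact: OX|by apply: (subring_set_sum (pOsub v)) => i _; apply: OS].
rewrite pr_sum => [E|i _]; last exact: OS.
have -> : P.[pr x] = lead_coef P * (pr x ^+ (size P).-1 +
     \sum_(i < (size P).-1) pr (res_val (P`_i / lead_coef P) * x ^+ i)).
  rewrite (horner_coef_wide _ (leqSpred _)) big_ord_recr /= addrC mulrDr; congr (_ + _).
  rewrite mulr_sumr; apply: eq_bigr => i _.
  rewrite prME //; last exact: OX.
  by rewrite pr_val prXE // mulrA mulrCA divff ?mulr1 // lead_coef_eq0.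
by rewrite E mulr0.
Qed.
End Residue.

Lemma place_exists (l : nat) : prime l -> exists v : place l, True.
Proof.
move=> pl; have l0 := prime_gt0 pl.
have [||O Omax] := @max_avoiding_exists l [set x : algC | x \in Num.int]%classic.
- split=> /=; [exact: rpred1|exact: rpredB|exact: rpredM].
- move=> /= /intrP[m E].
  have lC0 : (l%:R : algC) != 0 by rewrite pnatr_eq0 -lt0n.
  have : (1 : int)%:~R = (Posz l * m)%:~R :> algC by rewrite intrM -E -pmulrn divff.
  move/intr_inj => {}E; have l1 := prime_gt1 pl.
  have : (l %| `|(1 : int)|)%N by rewrite E abszM dvdn_mulr.
  by rewrite dvdn1 => /eqP El; rewrite El in l1.
by have [sO nO _] := Omax; exists (Place sO (max_avoiding_valuation l0 Omax) nO).
Qed.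

(** * Integrality at all places *)

Notation pZ := (map_poly (intr : int -> algC)).

(** Plays the role of the ring of algebraic integers, as an intersection of valuation rings. *)
Definition allO (x : algC) : Prop := forall l, prime l -> forall v : place l, pO v x.

(** An automorphism pulls a place back to a place. *)
Lemma allO_aut (s : autC) x : allO x -> allO (s x).
Proof.
move=> Ax l pl v.
have sub : subring_set (fun x => pO v (s x)).
  split; rewrite ?rmorph1; first exact: O1.
    by move=> y z Oy Oz; rewrite rmorphB; apply: OB.
  by move=> y z Oy Oz; rewrite rmorphM; apply: OM.
have val y : pO v (s y) \/ pO v (s y^-1) by rewrite fmorphV; apply: pOval.
have nl : ~ pO v (s (l%:R^-1)) by rewrite fmorphV rmorph_nat; apply: pOl.
exact: (Ax l pl (Place sub val nl)).
Qed.

Lemma allO_int (n : int) : allO n%:~R. Proof. by move=> l pl v; apply: Oint. Qed.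
Lemma allO_nat n : allO n%:R. Proof. by move=> l pl v; apply: Onat. Qed.
Lemma allO0 : allO 0. Proof. exact: allO_nat 0. Qed.
Lemma allO1 : allO 1. Proof. exact: allO_nat 1. Qed.
Lemma allOB x y : allO x -> allO y -> allO (x - y).
Proof. by move=> Ax Ay l pl v; apply: OB; [apply: Ax|apply: Ay]. Qed.
Lemma allON x : allO x -> allO (- x).
Proof. by move=> Ax l pl v; apply: ON; apply: Ax. Qed.
Lemma allOD x y : allO x -> allO y -> allO (x + y).
Proof. by move=> Ax Ay l pl v; apply: OD; [apply: Ax|apply: Ay]. Qed.
Lemma allOM x y : allO x -> allO y -> allO (x * y).
Proof. by move=> Ax Ay l pl v; apply: OM; [apply: Ax|apply: Ay]. Qed.
Lemma allOX x n : allO x -> allO (x ^+ n).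
Proof. by move=> Ax l pl v; apply: OX; apply: Ax. Qed.

Definition allOb : {pred algC} := fun x => `[< allO x >].
Lemma allOb_subring : subring_closed allOb.
Proof.
split; first exact/asboolP/allO1.
  by move=> x y /asboolP Ax /asboolP Ay; apply/asboolP/allOB.
by move=> x y /asboolP Ax /asboolP Ay; apply/asboolP/allOM.
Qed.
HB.instance Definition _ := GRing.isSubringClosed.Build algC allOb allOb_subring.

(** One place above each prime is enough: if l divides the denominator, Bezout with the numerator
    would put 1/l in the ring. *)
Lemma Crat_int_places x : x \in Crat ->
  (forall l, prime l -> exists v : place l, pO v x) -> x \in Num.int.
Proof.
case/CratP=> q -> Ax; rewrite Cint_rat -(divq_num_den q).
have [d1|d1] := eqVneq `|denq q|%N 1%N.
  have -> : denq q = 1 by have := denq_gt0 q; lia.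
  by rewrite divr1 intr_int.
pose l := pdiv `|denq q|.
have pl : prime l by apply: pdiv_prime; have := denq_gt0 q; lia.
have [v Oq] := Ax l pl; case: (@pOl _ v).
have ld : (l %| `|denq q|)%N by apply: pdiv_dvd.
have /coprimezP[[u w] /= E] : coprimez (numq q) l.
  rewrite coprimezE /= coprime_sym prime_coprime //; apply/negP => ln.
  have := coprime_num_den q; rewrite /coprime => /eqP g1.
  have : (l %| gcdn `|numq q| `|denq q|)%N by rewrite dvdn_gcd ln.
  by rewrite g1 dvdn1 => /eqP l1; rewrite l1 in pl.
have [b Db] : exists b : int, denq q = b * l.
  by apply/dvdzP; rewrite dvdzE.
have l0 : (l%:R : algC) != 0 by rewrite pnatr_eq0 -lt0n prime_gt0.
have -> : l%:R^-1 = u%:~R * (ratr q * b%:~R) + w%:~R :> algC.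
  apply: (mulIf l0); rewrite mulVf // mulrDl.
  have lE : l%:R = (Posz l)%:~R :> algC by [].
  rewrite lE -[w%:~R * _]intrM.
  have -> : u%:~R * (ratr q * b%:~R) * l%:~R = (u * numq q)%:~R :> algC.
    rewrite -mulrA -(mulrA (ratr q)) -[b%:~R * l%:~R]intrM -Db rmorphM; congr (_ * _).
    rewrite -[X in ratr X](divq_num_den q) rmorphM fmorphV /= !ratr_int divfK //.
    by rewrite intr_eq0 denq_neq0.
  by rewrite -rmorphD /= E.
by apply: OD; [apply: OM; [apply: Oint|apply: OM => //; apply: Oint]|apply: Oint].
Qed.

Lemma allO_Crat_int x : x \in Crat -> allO x -> x \in Num.int.
Proof.
move=> rx ax; apply: Crat_int_places => // l pl.
by have [v _] := place_exists pl; exists v; apply: ax.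
Qed.

Lemma pr_prime l (v : place l) : (0 < l)%N -> pr v l%:R = 0.
Proof.
move=> l0; apply/pr_eq0P; first exact: Onat.
by split; [exact: Onat|right; apply: pOl].
Qed.

Lemma res_char l (v : place l) : prime l -> l \in [pchar resT v].
Proof.
move=> pl; rewrite inE pl /=; apply/eqP; rewrite -(pr_nat v).
by apply: pr_prime; apply: prime_gt0.
Qed.

Lemma pr_int_eq0 l (v : place l) (n : int) : prime l ->
  (pr v n%:~R == 0) = (l %| n)%Z.
Proof.
move=> pl; rewrite pr_int.
have E (m : nat) : (m%:R == 0 :> resT v) = (l %| m)%N.
  by rewrite (dvdn_pcharf (res_char v pl)).
by case: n => n; rewrite ?NegzE ?rmorphN ?oppr_eq0 dvdzE /= ?abszN E.
Qed.

Definition primZ (P : {poly int}) : Prop :=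
  forall l, prime l -> exists i, ~~ (l %| P`_i)%Z.

Lemma rat_prim (q : {poly algC}) : (forall i, q`_i \in Crat) -> q != 0 ->
  exists P : {poly int}, primZ P /\ exists2 a, a != 0 & pZ P = a *: q.
Proof.
move=> rq q0.
have [q1 Dq] : exists q1 : {poly rat}, q = map_poly ratr q1.
  have g0 : getCrat 0 = 0.
    by have := ratCK 0; rewrite rmorph0.
  exists (map_poly getCrat q); apply/polyP=> i; rewrite coef_map /= coef_map_id0 //.
  by rewrite getCratK.
have [p [b b0 Dp]] := rat_poly_scale q1.
have p0 : p != 0.
  apply: contraNneq q0 => p0; by rewrite Dq Dp p0 map_poly0 scaler0 map_poly0.
exists (zprimitive p); split.
  move=> l pl; apply: contrapT => nex.
  have : (l %| zcontents (zprimitive p))%Z.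
    rewrite dvdz_contents; apply/polyOverP=> i; apply: contrapT => ni; apply: nex.
    by exists i; apply/negP.
  rewrite zcontents_primitive (negPf p0) /= dvdzE /= dvdn1 => /eqP E.
  by rewrite E in pl.
exists (b%:~R / (zcontents p)%:~R).
  by rewrite mulf_neq0 ?invr_eq0 ?intr_eq0 ?zcontents_eq0.
apply/polyP=> i; have E : p`_i = zcontents p * (zprimitive p)`_i.
  by rewrite {1}[p]zpolyEprim coefZ.
have z0 : ((zcontents p)%:~R : algC) != 0 by rewrite intr_eq0 zcontents_eq0.
have b0' : (b%:~R : algC) != 0 by rewrite intr_eq0.
rewrite Dq Dp coefZ !coef_map coefZ coef_map /= E.
move: (zcontents p) z0 => zc z0 {E}.
rewrite intrM !rmorphM fmorphV /= !ratr_int.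
by rewrite mulrACA divff // mul1r mulKf.
Qed.

Lemma prim_minpoly (x : algC) : exists P : {poly int}, primZ P /\ root (pZ P) x.
Proof.
have [q [Dq _] _] := minCpolyP x.
have [|| P [pP [a a0 E]]] := @rat_prim (minCpoly x).
- by move=> i; rewrite Dq coef_map Crat_rat.
- by rewrite minCpoly_eq0.
by exists P; split=> //; rewrite E rootZ // root_minCpoly.
Qed.

Lemma primZ_neq0 P : primZ P -> P != 0.
Proof.
by move=> /(_ 2 isT) [i]; apply: contraNneq => ->; rewrite coef0 dvdz0.
Qed.

Lemma aut_horner_pZ (s : autC) (P : {poly int}) x : s (pZ P).[x] = (pZ P).[s x].
Proof.
rewrite -horner_map -map_poly_comp; congr _.[_]; apply: eq_map_poly => a /=.
by rewrite rmorph_int.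
Qed.

Lemma horner_intr_wide (R : nzRingType) (P : {poly int}) (y : R) n : (size P <= n)%N ->
  (map_poly intr P).[y] = \sum_(i < n) (P`_i)%:~R * y ^+ i.
Proof.
move=> le; rewrite (@horner_coef_wide _ n) ?(leq_trans (size_poly _ _)) //.
by apply: eq_bigr => i _; rewrite coef_map.
Qed.

Lemma pr_horner l (v : place l) (P : {poly int}) x : pO v x ->
  pr v (pZ P).[x] = (map_poly intr P).[pr v x].
Proof.
move=> Ox; rewrite !(horner_intr_wide _ (leqnn _)).
rewrite pr_sum => [|i _]; last by apply: OM; [apply: Oint|apply: OX].
apply: eq_bigr => i _; rewrite prME ?pr_int ?prXE //; [exact: Oint|exact: OX].
Qed.

Lemma O_horner l (v : place l) (P : {poly int}) x : pO v x -> pO v (pZ P).[x].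
Proof.
move=> Ox; apply: (subring_set_horner (pOsub v)) => // i.
by rewrite coef_map; apply: Oint.
Qed.

Lemma prim_red_neq0 l (v : place l) P : prime l -> primZ P ->
  map_poly (intr : int -> resT v) P != 0.
Proof.
move=> pl /(_ l pl) [i]; apply: contraNneq => /polyP/(_ i).
by rewrite coef_map coef0 /= -(pr_int v) => /eqP; rewrite pr_int_eq0.
Qed.

(* The multipliers b_i = a_n x^i + ... + a_(n-i): together with the x b_i they
   generate, locally at every place, the unit ideal. *)
Lemma denominators (x : algC) : exists Bs : seq {poly int}, forall s : autC,
  (forall B, B \in Bs -> allO (pZ B).[s x] /\ allO (s x * (pZ B).[s x])) /\
  (forall l (v : place l), prime l -> exists2 B, B \in Bs &
     pr v (pZ B).[s x] != 0 \/ pr v (s x * (pZ B).[s x]) != 0).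
Proof.
have [P [pP rP]] := prim_minpoly x.
pose n := (size P).-1.
have szP : size P = n.+1 by rewrite prednK // size_poly_gt0 primZ_neq0.
pose B i := \poly_(j < i.+1) P`_(n - i + j).
exists [seq B i | i <- iota 0 n] => s.
set y := s x.
have Py : (pZ P).[y] = 0.
  by rewrite -aut_horner_pZ (eqP rP) rmorph0.
have BE i : (pZ (B i)).[y] = \sum_(j < i.+1) (P`_(n - i + j))%:~R * y ^+ j.
  rewrite (horner_intr_wide _ (size_poly _ _)).
  by apply: eq_bigr => j _; rewrite coef_poly ltn_ord.
have PE : \sum_(j < n.+1) (P`_j)%:~R * y ^+ j = 0.
  by rewrite -[RHS]Py (@horner_intr_wide _ _ _ n.+1) ?szP.
have BPE i : (i <= n)%N -> y ^+ (n - i) * (pZ (B i)).[y] =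
    - \sum_(j < n - i) (P`_j)%:~R * y ^+ j.
  move=> le; apply/eqP; rewrite -addr_eq0 addrC BE mulr_sumr -[X in _ == X]PE.
  rewrite -(big_mkord xpredT (fun j => (P`_j)%:~R * y ^+ j)) -(big_mkord xpredT (fun j => y ^+ (n - i) * ((P`_(n - i + j))%:~R * y ^+ j))) -[X in _ == X](big_mkord xpredT (fun j => (P`_j)%:~R * y ^+ j)).
  rewrite (@big_cat_nat _ _ _ (n - i) 0 n.+1) //=; last lia.
  apply/eqP; congr (_ + _); rewrite -[X in _ = \sum_(X <= _ < _) _]add0n big_addn.
  have -> : (n.+1 - (n - i) = i.+1)%N by lia.
  apply: eq_bigr => j _; rewrite [(j + _)%N]addnC exprD; ring.
have OBi i l (v : place l) : (i < n)%N -> pO v (pZ (B i)).[y] /\ pO v (y * (pZ (B i)).[y]).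
  move=> lt; have [Oy|Oyi] := pOval v y.
    by have OB := O_horner (B i) Oy; split=> //; apply: OM.
  have [y0|y0] := eqVneq y 0.
    by rewrite y0 mul0r; split; [apply: O_horner; apply: O0|apply: O0].
  have E : (pZ (B i)).[y] = - \sum_(j < n - i) (P`_j)%:~R * y^-1 ^+ (n - i - j).
    apply: (mulfI (expf_neq0 (n - i) y0)); rewrite BPE ?(ltnW lt) // mulrN mulr_sumr; congr (- _).
    apply: eq_bigr => j _; rewrite mulrCA; congr (_ * _); rewrite mulrC.
    by rewrite expVB // ltnW.
  split.
    rewrite E; apply: ON; apply: (subring_set_sum (pOsub v)) => j _.
    by apply: OM; [apply: Oint|apply: OX].
  rewrite E mulrN mulr_sumr; apply: ON; apply: (subring_set_sum (pOsub v)) => j _.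
  have : (0 < n - i - j)%N by have := ltn_ord j; lia.
  case: (n - i - j)%N => // k _; rewrite mulrCA exprS mulVKf //.
  by apply: OM; [apply: Oint|apply: OX].
split=> [B0 /mapP[i]|l v pl].
  rewrite mem_iota add0n /= => lt ->.
  by split=> l pl v; have [] := OBi i l v lt.
apply: contrapT => nex.
have z i : (i < n)%N -> pr v (pZ (B i)).[y] = 0 /\ pr v (y * (pZ (B i)).[y]) = 0.
  move=> lt; have inB : B i \in [seq B i | i <- iota 0 n].
    by apply/mapP; exists i; rewrite // mem_iota add0n.
  split; apply/eqP; apply: contrapT => ne; apply: nex; exists (B i) => //; [left|right]; exact/negP.
have [i] := pP l pl; apply/negP; rewrite negbK -(pr_int_eq0 v) //.
have [ltni|lein] := ltnP n i.
  by rewrite nth_default ?szP // pr0.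
have BS i0 : (i0 < n)%N -> (pZ (B i0.+1)).[y] = y * (pZ (B i0)).[y] + (P`_(n - i0.+1))%:~R.
  move=> lt; rewrite !BE big_ord_recl /= addn0 expr0 mulr1 addrC; congr (_ + _).
  rewrite mulr_sumr; apply: eq_bigr => j _; rewrite /bump /= add1n exprS mulrCA.
  by have -> : (n - i0.+1 + j.+1 = n - i0 + j)%N by lia.
have [->|i0] := eqVneq i n.
  have [n0|n0] := posnP n.
    by move: PE; rewrite n0 big_ord1 expr0 mulr1 => ->; rewrite pr0.
  have [] := z 0%N n0; rewrite BE big_ord1 expr0 mulr1 subn0 addn0 => -> _; exact: eqxx.
have li : (n - i.+1 < n)%N by lia.
have E := BS _ li.
have ni : (n - (n - i.+1).+1 = i)%N by lia.
have [_ z1] := z _ li; have [_ O1] := OBi _ _ v li.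
have -> : (P`_i)%:~R = (pZ (B (n - i.+1).+1)).[y] - y * (pZ (B (n - i.+1)%N)).[y].
  by rewrite E ni addrAC subrr add0r.
have [lt'|ge'] := ltnP (n - i.+1).+1 n.
  have [z2 _] := z _ lt'; have [O2 _] := OBi _ _ v lt'.
  by rewrite prBE // z1 z2 subr0.
have -> : ((n - i.+1).+1 = n)%N by lia.
have -> : (pZ (B n)).[y] = 0.
  have := BPE n (leqnn _); rewrite subnn expr0 mul1r big_ord0 oppr0; exact.
by rewrite sub0r prNE // z1 oppr0.
Qed.

(** At a place where x is not integral, 1/x lies in the maximal ideal and the primitive equation of
    x forces its leading coefficient there too, which is impossible once p exceeds that
    coefficient. *)
Lemma O_large (x : algC) :
  exists N : nat, forall p, prime p -> (N < p)%N -> forall v : place p, pO v x.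
Proof.
have [P [pP rP]] := prim_minpoly x.
pose n := (size P).-1.
have P0 := primZ_neq0 pP.
have szP : size P = n.+1 by rewrite prednK // size_poly_gt0.
exists `|lead_coef P|%N => p pp lt v; have [//|Oxi] := pOval v x.
apply: contrapT => nOx.
have x0 : x != 0 by apply: contra_notN nOx => /eqP->; apply: O0.
have m : pm v x^-1 by split=> //; right; rewrite invrK.
have E : (lead_coef P)%:~R = - \sum_(j < n) (P`_j)%:~R * x^-1 ^+ (n - j).
  apply: (mulIf (expf_neq0 n x0)); rewrite mulNr mulr_suml.
  apply/eqP; rewrite -addr_eq0 addrC.
  have : (pZ P).[x] == 0 by [].
  rewrite (@horner_intr_wide _ _ _ n.+1) ?szP // big_ord_recr /= lead_coefE szP /=.
  move=> /eqP E0; rewrite -[X in _ == X]E0; apply/eqP; congr (_ + _); apply: eq_bigr => j _.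
  by rewrite -mulrA expVB // ltnW.
have : pm v (lead_coef P)%:~R.
  rewrite E; apply: pmN; elim/big_ind: _ => [||j _]; [exact: pm0|exact: pmD|].
  apply: pmM; first exact: Oint.
  have := ltn_ord j; rewrite -subn_gt0; case: (n - j)%N => // k _.
  by rewrite exprSr; apply: pmM => //; apply: OX.
move/(pr_eq0P (Oint v _))/eqP; rewrite pr_int_eq0 // dvdzE /= => /dvdn_leq.
by rewrite absz_gt0 lead_coef_eq0 => /(_ P0); rewrite leqNgt lt.
Qed.

Lemma unit_large (x : algC) : x != 0 ->
  exists N : nat, forall p, prime p -> (N < p)%N -> forall v : place p, 
    pO v x /\ pr v x != 0.
Proof.
move=> x0; have [N1 H1] := O_large x; have [N2 H2] := O_large x^-1.
exists (maxn N1 N2) => p pp; rewrite gtn_max => /andP[l1 l2] v.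
have Ox := H1 p pp l1 v; have Oi := H2 p pp l2 v.
by split=> //; apply: unit_pr_neq0.
Qed.

(** Reduction modulo a place is only meaningful on integral elements, so statements about reduced
    polynomials go through relations that respect the ring operations and pass to coefficients. *)
Record ring_rel (A B : nzRingType) (r : A -> B -> Prop) := RingRel {
  rr0 : r 0 0; rr1 : r 1 1;
  rrD : forall a b a' b', r a b -> r a' b' -> r (a + a') (b + b');
  rrM : forall a b a' b', r a b -> r a' b' -> r (a * a') (b * b');
  rrN : forall a b, r a b -> r (- a) (- b) }.

Definition poly_rel (A B : nzRingType) (r : A -> B -> Prop) (P : {poly A}) (Q : {poly B}) :=
  forall i, r P`_i Q`_i.

Section RingRel.
Variables (A B : nzRingType) (r : A -> B -> Prop).
Hypothesis rr : ring_rel r.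
Lemma rrB a b a' b' : r a b -> r a' b' -> r (a - a') (b - b').
Proof. by move=> h h'; apply: (rrD rr) => //; apply: (rrN rr). Qed.
Lemma rr_sum I (s : seq I) (P : pred I) F G : (forall i, P i -> r (F i) (G i)) ->
  r (\sum_(i <- s | P i) F i) (\sum_(i <- s | P i) G i).
Proof. by move=> h; elim/big_ind2: _ => // [|a b c d]; [exact: rr0 rr|exact: rrD]. Qed.
Lemma rr_prod I (s : seq I) (P : pred I) F G : (forall i, P i -> r (F i) (G i)) ->
  r (\prod_(i <- s | P i) F i) (\prod_(i <- s | P i) G i).
Proof. by move=> h; elim/big_ind2: _ => // [|a b c d]; [exact: rr1 rr|exact: rrM]. Qed.
Lemma rrX a b n : r a b -> r (a ^+ n) (b ^+ n).
Proof. by move=> h; elim: n => [|n IH]; rewrite ?expr0 ?exprS; [exact: rr1 rr|exact: rrM]. Qed.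
Lemma poly_rel_ring : ring_rel (poly_rel r).
Proof.
split=> [i|i|a b a' b' h h' i|a b a' b' h h' i|a b h i].
- by rewrite !coef0; apply: rr0.
- by rewrite !coef1; case: (i == 0)%N; [exact: rr1|exact: rr0].
- by rewrite !coefD; apply: rrD.
- by rewrite !coefM; apply: rr_sum => j _; apply: rrM.
- by rewrite !coefN; apply: rrN.
Qed.
Lemma poly_relC a b : r a b -> poly_rel r a%:P b%:P.
Proof. by move=> h i; rewrite !coefC; case: ifP => // _; apply: rr0. Qed.
Lemma poly_relX : poly_rel r 'X 'X.
Proof. by move=> i; rewrite !coefX; case: (i == 1)%N; [exact: rr1|exact: rr0]. Qed.
Lemma poly_rel_XsubC a b : r a b -> poly_rel r ('X - a%:P) ('X - b%:P).
Proof.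
move=> h; have q := poly_rel_ring; apply: (rrD q); first exact: poly_relX.
by apply: (rrN q); apply: poly_relC.
Qed.
Lemma poly_rel_Poly s t : size s = size t -> (forall i, (i < size s)%N -> r s`_i t`_i) ->
  poly_rel r (Poly s) (Poly t).
Proof.
move=> sz h i; rewrite !coef_Poly; have [lt|ge] := ltnP i (size s); first exact: h.
by rewrite !nth_default -?sz //; apply: rr0.
Qed.
End RingRel.

Definition place_rel l (v : place l) (x : algC) (y : resT v) : Prop := pO v x /\ pr v x = y.
Arguments place_rel {l} v x y.
Lemma place_rel_ring l (v : place l) : ring_rel (place_rel v).
Proof.
split=> [||a b a' b' [h <-] [h' <-]|a b a' b' [h <-] [h' <-]|a b [h <-]].
- by split; [exact: O0|].
- by split; [exact: O1|].
- by split; [exact: OD|exact: prDE].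
- by split; [exact: OM|exact: prME].
- by split; [exact: ON|exact: prNE].
Qed.
Lemma place_relI l (v : place l) x : pO v x -> place_rel v x (pr v x). Proof. by []. Qed.

(** * Inertia and Frobenius in abelian extensions *)

(* [gen gam x] means that x lies in Q(gam). *)
Definition gen (gam x : algC) : Prop := forall u u' : autC, u gam = u' gam -> u x = u' x.
Definition abel (gam : algC) : Prop := forall s t : autC, s (t gam) = t (s gam).

Section Gen.
Variable gam : algC.
Lemma gen_refl : gen gam gam. Proof. by []. Qed.
Lemma genD x y : gen gam x -> gen gam y -> gen gam (x + y).
Proof. by move=> gx gy u u' E; rewrite !rmorphD (gx u u' E) (gy u u' E). Qed.
Lemma genM x y : gen gam x -> gen gam y -> gen gam (x * y).
Proof. by move=> gx gy u u' E; rewrite !rmorphM (gx u u' E) (gy u u' E). Qed.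
Lemma genN x : gen gam x -> gen gam (- x).
Proof. by move=> gx u u' E; rewrite !rmorphN (gx u u' E). Qed.
Lemma genB x y : gen gam x -> gen gam y -> gen gam (x - y).
Proof. by move=> gx gy; apply: genD => //; apply: genN. Qed.
Lemma genX x n : gen gam x -> gen gam (x ^+ n).
Proof. by move=> gx u u' E; rewrite !rmorphXn (gx u u' E). Qed.
Lemma gen_horner (P : {poly int}) x : gen gam x -> gen gam (pZ P).[x].
Proof. by move=> gx u u' E; rewrite !aut_horner_pZ (gx u u' E). Qed.
Hypothesis ab : abel gam.
Lemma gen_aut x (t : autC) : gen gam x -> gen gam (t x).
Proof. by move=> gx u u' E; apply: (gx (u \o t) (u' \o t)) => /=; rewrite (ab u) (ab u') E. Qed.
Lemma gen_abel x (s t : autC) : gen gam x -> s (t x) = t (s x).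
Proof. by move=> gx; apply: (gx (s \o t) (t \o s)) => /=; apply: ab. Qed.
End Gen.

Lemma gen_trans a b x : gen a b -> gen b x -> gen a x.
Proof. by move=> gb gx u u' E; apply: gx; apply: gb. Qed.

(** The inertia group of Q(gam) at [v] is trivial, phrased with pairs of automorphisms so that no
    decomposition group is needed. *)
Definition inertia_trivial l (v : place l) (gam : algC) : Prop :=
  forall s s' : autC,
    (forall x, allO x -> gen gam x -> pr v (s x) = pr v (s' x)) -> s gam = s' gam.

(** The second argument is a dummy: it turns the predicate [allO] into a ring relation, so that
    integrality of polynomial coefficients comes from the same lifting lemmas as reduction. *)
Definition allO_rel (x : algC) (_ : int) : Prop := allO x.
Lemma allO_rel_ring : ring_rel allO_rel.
Proof.
by split=> [||? ? ? ?|? ? ? ?|? ?]; [exact: allO0|exact: allO1|exact: allOD|exact: allOM|exact: allON].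
Qed.

Section Unramified.
Variables (p : nat) (v : place p) (gam : algC) (gs : seq autC).
Hypotheses (pp : prime p) (ab : abel gam) (gsP : conj_reps gam gs).
Let kp := place_rel_ring v.
Let kpp := poly_rel_ring kp.

Lemma separating_list : inertia_trivial v gam ->
  exists xs : seq algC, (forall x, x \in xs -> allO x /\ gen gam x) /\
   {in gs &, forall s s' : autC, s != s' -> exists2 x, x \in xs & pr v (s x) != pr v (s' x)}.
Proof.
move=> it.
suff H : forall ps : seq (autC * autC), (forall q, q \in ps -> q.1 gam != q.2 gam) ->
  exists xs : seq algC, (forall x, x \in xs -> allO x /\ gen gam x) /\
   forall q, q \in ps -> exists2 x, x \in xs & pr v (q.1 x) != pr v (q.2 x).
  have [|xs [h1 h2]] := H [seq q <- [seq (s, s') | s <- gs, s' <- gs] | q.1 != q.2].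
    move=> q; rewrite mem_filter => /andP[ne /allpairsP[[s s'] /= [sg s'g E]]].
    move: ne; rewrite E /=; apply: contraNN => /eqP h.
    by apply/eqP; apply: (conj_reps_inj gsP).
  exists xs; split=> // s s' sg s'g ne; apply: (h2 (s, s')).
  by rewrite mem_filter ne /=; apply/allpairsP; exists (s, s').
elim=> [|q ps IH] h; first by exists [::].
have [|xs [h1 h2]] := IH; first by move=> q' qin; apply: h; rewrite inE qin orbT.
have [x [ax gx nx]] : exists x, [/\ allO x, gen gam x & pr v (q.1 x) != pr v (q.2 x)].
  apply: contrapT => nex; have /eqP[] := h q (mem_head _ _).
  apply: it => x ax gx; apply: contrapT => ne; apply: nex; exists x; split=> //; exact/eqP.
exists (x :: xs); split=> [y|q']; rewrite inE => /predU1P[->|qin] //; first exact: h1.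
  by exists x; rewrite ?mem_head.
by have [y yin ny] := h2 _ qin; exists y; rewrite // inE yin orbT.
Qed.

Section Theta.
Variable xs : seq algC.
Hypothesis xsP : forall x, x \in xs -> allO x /\ gen gam x.
(** Kronecker's device: the elements of [xs] become the coefficients of one polynomial theta in an
    auxiliary variable. Its conjugates are distinct modulo [v] as soon as some element of [xs]
    separates them, so theta acts as a primitive element. *)
Let th (s : autC) : {poly algC} := Poly [seq s x | x <- xs].
Let thb (s : autC) : {poly resT v} := Poly [seq pr v (s x) | x <- xs].
Let th_rel s : poly_rel (place_rel v) (th s) (thb s).
Proof.
apply: (poly_rel_Poly kp); first by rewrite !size_map.
move=> i; rewrite size_map => lt; rewrite !(nth_map 0) //; apply: place_relI.
by have [ax _] := xsP (mem_nth 0 lt); apply: (allO_aut s ax).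
Qed.
Let th_aut s (t : autC) : map_poly t (th s) = th (t \o s).
Proof.
apply/polyP=> i; rewrite coef_map !coef_Poly; have [lt|ge] := ltnP i (size xs).
  by rewrite !(nth_map 0).
by rewrite !nth_default ?size_map //= rmorph0.
Qed.
Let th_gen (s s' : autC) : s gam = s' gam -> th s = th s'.
Proof.
move=> E; rewrite /th; congr Poly; apply/eq_in_map => x xin.
by have [_ gx] := xsP xin; apply: gx.
Qed.
Let th_all s i : allO (th s)`_i.
Proof.
rewrite coef_Poly; have [lt|ge] := ltnP i (size xs).
  by rewrite (nth_map 0) //; have [ax _] := xsP (mem_nth 0 lt); apply: allO_aut.
by rewrite nth_default ?size_map //; apply: allO0.
Qed.
Let thO s : poly_rel allO_rel (th s) 0.
Proof. by move=> i; apply: th_all. Qed.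
Let thXO s n i : allO (th s ^+ n)`_i.
Proof. exact: (rrX (poly_rel_ring allO_rel_ring) n (thO s) i). Qed.
Let prodO (P : pred autC) i j : allO (\prod_(s <- gs | P s) ('X - (th s)%:P))`_i`_j.
Proof.
have rr2 := poly_rel_ring allO_rel_ring.
have := @rr_prod _ _ _ (poly_rel_ring rr2) _ gs P (fun s => 'X - (th s)%:P) (fun=> 'X - 0%:P).
by apply=> s _; apply: (poly_rel_XsubC rr2).
Qed.

(** The coefficients of the trace of x theta^n are rational integers; they reduce to 0 at [v], so p
    divides them in Z. *)
Lemma trace_div x n i : allO x -> gen gam x -> (forall s : autC, pr v (s x) = 0) ->
  pO v ((\sum_(s <- gs) (s : autC) x *: th s ^+ n)`_i / p%:R).
Proof.
move=> ax gx z; set c := _`_i.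
have cE : c = \sum_(s <- gs) (s : autC) x * (th s ^+ n)`_i.
  by rewrite /c coef_sum; apply: eq_bigr => s _; rewrite coefZ.
have : c \in Num.int.
  apply: allO_Crat_int.
    apply: aut_fixed_Crat => t; rewrite cE rmorph_sum /=.
    rewrite -[RHS](conj_reps_bigl gsP _ t) => [|s s' E]; last by rewrite (th_gen E) (gx s s').
    by apply: eq_bigr => s _; rewrite rmorphM /= -th_aut -rmorphXn coef_map.
  rewrite cE; elim/big_ind: _ => [||s _]; [exact: allO0|exact: allOD|].
  apply: allOM; first exact: allO_aut.
  exact: thXO.
case/intrP=> m Dm; have : pr v m%:~R = 0.
  rewrite -Dm cE pr_sum => [|s _]; last first.
    apply: OM; first exact: allO_aut.
    by apply: thXO.
  apply: big1 => s _; rewrite prME ?z ?mul0r //; first exact: allO_aut.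
  by apply: thXO.
move/eqP; rewrite pr_int_eq0 // => /dvdzP[m' E]; rewrite Dm E intrM -pmulrn mulfK ?pnatr_eq0 -?lt0n ?prime_gt0 //.
exact: Oint.
Qed.

(** The product of the X - theta_s has coefficients in Z, so its reduction is fixed by the Frobenius
    of the residue field. The Frobenius image of the reduced theta is hence a root of it, that is,
    the reduction of some conjugate theta_s. *)
Lemma frobenius_theta : exists2 sg, sg \in gs & forall x, x \in xs -> pr v ((sg : autC) x) = pr v x ^+ p.
Proof.
pose P := \prod_(s <- gs) ('X - (th s)%:P).
pose Q := \prod_(s <- gs) ('X - (thb s)%:P).
have rPQ : poly_rel (poly_rel (place_rel v)) P Q.
  by apply: (rr_prod (poly_rel_ring kpp)) => s _; apply: (poly_rel_XsubC kpp).
have Pint i j : P`_i`_j \in Num.int.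
  apply: allO_Crat_int; last first.
    exact: prodO.
  apply: aut_fixed_Crat => t; rewrite -coef_map -(coef_map (map_poly t)) /=.
  suff -> : map_poly (map_poly t) P = P by [].
  rewrite /P rmorph_prod /=.
  rewrite -[RHS](conj_reps_bigl gsP _ t) => [|s s' E]; last by rewrite (th_gen E).
  by apply: eq_bigr => s _; rewrite map_polyXsubC /= th_aut.
pose Fr := map_poly (pFrobenius_aut (res_char v pp)).
have FrQ : map_poly Fr Q = Q.
  apply/polyP=> i; rewrite coef_map /=; apply/polyP=> j; rewrite coef_map /=.
  have [_ <-] := rPQ i j; have /intrP[m ->] := Pint i j.
  by rewrite pr_int rmorph_int.
have Q1 : root Q (thb idfun).
  have [s sg E] := conj_repsP gsP idfun.
  rewrite /root /Q horner_prod prodf_seq_eq0; apply/hasP; exists s => //=.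
  rewrite hornerXsubC subr_eq0 /thb; apply/eqP; congr Poly; apply/eq_in_map => x xin.
  by have [_ gx] := xsP xin; rewrite -(gx idfun s E).
have : root Q (Fr (thb idfun)) by rewrite -FrQ; apply: rmorph_root.
rewrite /root /Q horner_prod prodf_seq_eq0 => /hasP[s sg /=].
rewrite hornerXsubC subr_eq0 => /eqP E; exists s => // x xin.
have /(nthP 0) [i lt Dx] := xin.
have := congr1 (fun P : {poly resT v} => P`_i) E; rewrite coef_map /= !coef_Poly !(nth_map 0) // Dx.
by rewrite pFrobenius_autE => ->.
Qed.

(** Lagrange interpolation: [L] vanishes at all conjugates of theta but one, so x L(theta) is an
    integral combination of the traces of x theta^j, all divisible by p. Separation makes some
    coefficient of L(theta) a unit at [v], which can be divided out. *)
Lemma unramified_div_theta x :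
  {in gs &, forall s s' : autC, s != s' -> exists2 x, x \in xs & pr v (s x) != pr v (s' x)} ->
  allO x -> gen gam x -> (forall s : autC, pr v (s x) = 0) -> pO v (x / p%:R).
Proof.
move=> sep ax gx z; have [s0 s0g E0] := conj_repsP gsP idfun.
pose L := \prod_(s <- gs | s != s0) ('X - (th s)%:P).
have DL : \sum_(s <- gs) (s : autC) x *: L.[th s] = s0 x *: L.[th s0].
  rewrite (bigD1_seq s0) ?(conj_reps_uniq gsP) //= big1_seq ?addr0 // => s /andP[ne sg].
  rewrite /L horner_prod; have -> : \prod_(i <- gs | i != s0) ('X - (th i)%:P).[th s] = 0.
    apply/eqP; rewrite prodf_seq_eq0; apply/hasP; exists s => //=.
    by rewrite ne hornerXsubC subrr eqxx.
  by rewrite scaler0.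
have EL : s0 x *: L.[th s0] = \sum_(j < size L) L`_j * \sum_(s <- gs) (s : autC) x *: th s ^+ j.
  rewrite -DL.
  under eq_bigr do rewrite horner_coef scaler_sumr.
  rewrite exchange_big /=; apply: eq_bigr => j _; rewrite mulr_sumr.
  by apply: eq_bigr => s _; rewrite scalerAr.
have Lred : poly_rel (place_rel v) L.[th s0] (\prod_(s <- gs | s != s0) (thb s0 - thb s)).
  rewrite /L horner_prod; apply: (rr_prod kpp) => s _.
  by rewrite hornerXsubC; apply: (rrB kpp).
have nz : \prod_(s <- gs | s != s0) (thb s0 - thb s) != 0.
  rewrite prodf_seq_neq0; apply/allP => s sg; apply/implyP => ne.
  rewrite subr_eq0; apply/eqP => E; have [y yin /eqP[]] := sep _ _ sg s0g ne.
  have /(nthP 0) [i lt Dx] := yin.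
  have := congr1 (fun P : {poly resT v} => P`_i) E.
  by rewrite !coef_Poly !(nth_map 0) // Dx.
have [i ni] : exists i, pr v L.[th s0]`_i != 0.
  apply: contrapT => nex; case/eqP: nz; apply/polyP=> i; rewrite coef0.
  have [_ <-] := Lred i; apply/eqP; apply: contrapT => ne; apply: nex; exists i; exact/negP.
have [Oi _] := Lred i; have Oinv := pr_neq0_unit Oi ni.
have e0 : L.[th s0]`_i != 0 by apply: contraNneq ni => ->; rewrite pr0.
have -> : x = s0 x by rewrite -(gx idfun s0 E0).
have -> : s0 x / p%:R = (s0 x *: L.[th s0])`_i / p%:R * (L.[th s0]`_i)^-1.
  by rewrite coefZ mulrAC mulfK.
apply: OM => //; rewrite EL coef_sum mulr_suml; apply: (subring_set_sum (pOsub v)) => j _.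
rewrite coefM mulr_suml; apply: (subring_set_sum (pOsub v)) => m _.
rewrite -mulrA; apply: OM; last exact: trace_div.
exact: prodO.
Qed.
End Theta.

Lemma unramified_div x : inertia_trivial v gam ->
  allO x -> gen gam x -> (forall s : autC, pr v (s x) = 0) -> pO v (x / p%:R).
Proof.
by move=> it; have [xs [h1 h2]] := separating_list it; apply: (unramified_div_theta h1 h2).
Qed.

Lemma frobenius_exists (xs : seq algC) : (forall x, x \in xs -> allO x /\ gen gam x) ->
  exists sg : autC, forall x, x \in xs -> pr v (sg x) = pr v x ^+ p.
Proof. by move=> h; have [sg _ H] := frobenius_theta h; exists sg. Qed.
End Unramified.

(** * Heights along the tree of preimages *)

Definition unitv l (v : place l) (e : algC) : Prop := [/\ e != 0, pO v e & pO v e^-1].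

Section UnitV.
Variables (l : nat) (v : place l).
Lemma unitv1 : unitv v 1. Proof. by split; rewrite ?invr1 ?oner_eq0 //; apply: O1. Qed.
Lemma unitvM x y : unitv v x -> unitv v y -> unitv v (x * y).
Proof. by move=> [? ? ?] [? ? ?]; split; rewrite ?mulf_neq0 // ?invfM; apply: OM. Qed.
Lemma unitvV x : unitv v x -> unitv v x^-1.
Proof. by move=> [? ? ?]; split; rewrite ?invr_eq0 // invrK. Qed.
Lemma unitvX x n : unitv v x -> unitv v (x ^+ n).
Proof. by move=> ux; elim: n => [|n IH]; rewrite ?expr0 ?exprS; [exact: unitv1|exact: unitvM]. Qed.
Lemma unitvO x : unitv v x -> pO v x. Proof. by case. Qed.
Lemma unitv_pr x : pO v x -> pr v x != 0 -> unitv v x.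
Proof.
move=> Ox nx; split=> //; last exact: pr_neq0_unit.
by apply: contraNneq nx => ->; rewrite pr0.
Qed.
Lemma pr_unitv x : unitv v x -> pr v x != 0.
Proof. by case=> ? ? ?; apply: unit_pr_neq0. Qed.

(* [(nu x : nw x)] are projective coordinates of x that are integral and not both in the maximal ideal. *)
Definition nu (x : algC) : algC := if pselect (pO v x) then x else 1.
Definition nw (x : algC) : algC := if pselect (pO v x) then 1 else x^-1.

Variant nuw_spec x : algC -> algC -> Prop :=
  | NuwFin of pO v x : nuw_spec x x 1
  | NuwInf of ~ pO v x & x != 0 & pO v x^-1 & pr v x^-1 = 0 : nuw_spec x 1 x^-1.
Lemma nuwP x : nuw_spec x (nu x) (nw x).
Proof.
rewrite /nu /nw; case: pselect => [Ox|nOx]; first by apply: NuwFin.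
have x0 : x != 0 by apply: contra_notN nOx => /eqP->; apply: O0.
have Oi : pO v x^-1 by have [] := pOval v x.
apply: NuwInf => //; apply/pr_eq0P => //; split=> //; right; by rewrite invrK.
Qed.
Lemma nuO x : pO v (nu x). Proof. by case: nuwP => // *; apply: O1. Qed.
Lemma nwO x : pO v (nw x). Proof. by case: nuwP => // *; apply: O1. Qed.
Lemma nw_neq0 x : nw x != 0. Proof. by case: nuwP => // *; rewrite ?oner_eq0 ?invr_eq0. Qed.
Lemma nuE x : nu x = x * nw x.
Proof. by case: nuwP => [|_ x0]; rewrite ?mulr1 ?divff. Qed.
Lemma nuw_pr x : (pr v (nu x) != 0) || (pr v (nw x) != 0).
Proof. by case: nuwP => *; rewrite pr1 oner_eq0 ?orbT. Qed.
End UnitV.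

Section NormPoly.
Variables (gam : algC) (gs : seq autC).
Hypothesis gsP : conj_reps gam gs.

(** Up to sign [a] is the leading coefficient of the primitive integral multiple of the
    characteristic polynomial of x; it collects the finite part of the height. *)
Definition lcz (x a : algC) : Prop := a != 0 /\
  exists2 P : {poly int}, primZ P & pZ P = a *: \prod_(s <- gs) ('X - ((s : autC) x)%:P).

Lemma lcz_exists x : gen gam x -> exists a, lcz x a.
Proof.
move=> gx; have [i||P [pP [a a0 E]]] := @rat_prim (\prod_(s <- gs) ('X - ((s : autC) x)%:P)).
- apply: aut_fixed_Crat => t; rewrite -coef_map /=.
  suff -> : map_poly t (\prod_(s <- gs) ('X - ((s : autC) x)%:P)) = \prod_(s <- gs) ('X - ((s : autC) x)%:P) by [].
  rewrite rmorph_prod /= -[RHS](conj_reps_bigl gsP _ t) => [|s s' Es]; last by rewrite (gx s s').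
  by apply: eq_bigr => s _; rewrite map_polyXsubC.
- by rewrite prodf_seq_neq0; apply/allP=> s _; rewrite polyXsubC_eq0.
by exists a; split=> //; exists P.
Qed.

Lemma lcz_int x a : lcz x a -> a \in Num.int.
Proof.
case=> a0 [P _ E]; have := congr1 lead_coef E; rewrite lead_coefZ.
rewrite (monicP (monic_prod_XsubC _ _ _)) mulr1 => <-.
by rewrite lead_coefE coef_map intr_int.
Qed.

(** Gauss's lemma at one place: a product of linear forms in normalised coordinates is nonzero
    modulo [v], and so is a primitive polynomial; the factor between the two is a unit. *)
Lemma lcz_local x a l (v : place l) : prime l -> lcz x a ->
  unitv v (a / \prod_(s <- gs) nw v ((s : autC) x)).
Proof.
move=> pl [a0 [P pP E]].
have kp := place_rel_ring v; have kpp := poly_rel_ring kp.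
set e := a / _.
have W0 : \prod_(s <- gs) nw v ((s : autC) x) != 0.
  by rewrite prodf_seq_neq0; apply/allP=> s _; rewrite nw_neq0.
have e0 : e != 0 by rewrite mulf_neq0 // invr_eq0.
pose R := \prod_(s <- gs) ((nw v ((s : autC) x))%:P * 'X - (nu v ((s : autC) x))%:P).
pose Rb := \prod_(s <- gs) ((pr v (nw v ((s : autC) x)))%:P * 'X - (pr v (nu v ((s : autC) x)))%:P).
have rR : poly_rel (place_rel v) R Rb.
  apply: (rr_prod kpp) => s _; apply: (rrB kpp).
    apply: (rrM kpp); last exact: (poly_relX kp).
    by apply: (poly_relC kp); apply: place_relI; apply: nwO.
  by apply: (poly_relC kp); apply: place_relI; apply: nuO.
have Rb0 : Rb != 0.
  rewrite prodf_seq_neq0; apply/allP=> s _ /=; apply/eqP => /polyP H.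
  have := nuw_pr v ((s : autC) x).
  have := H 0%N; rewrite coefB coefCM coefX mulr0 coefC sub0r coef0 => /eqP; rewrite oppr_eq0 => ->.
  by have := H 1%N; rewrite coefB coefCM coefX mulr1 coefC subr0 coef0 => /eqP ->.
have ER : pZ P = e *: R.
  have -> : R = (\prod_(s <- gs) nw v ((s : autC) x)) *: \prod_(s <- gs) ('X - ((s : autC) x)%:P).
    rewrite -mul_polyC rmorph_prod -big_split /=; apply: eq_bigr => s _.
    by rewrite nuE mulrBr [(_ * nw _ _)%:P]rmorphM /= [X in _ = _ - X]mulrC.
  by rewrite scalerA divfK.
have Pb0 := prim_red_neq0 v pl pP.
have rP : poly_rel (place_rel v) (pZ P) (map_poly intr P).
  by move=> i; rewrite !coef_map /=; split; [exact: Oint|exact: pr_int].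
have [Oe|Oei] := pOval v e.
  apply: unitv_pr => //; apply: contraNneq Pb0 => e1; apply/eqP/polyP=> i.
  have [_ <-] := rP i; have [OR ERb] := rR i.
  by rewrite ER coefZ prME // e1 mul0r coef0.
rewrite -(invrK e); apply: unitvV; apply: unitv_pr => //.
apply: contraNneq Rb0 => e1; apply/eqP/polyP=> i; have [_ <-] := rR i.
have -> : R = e^-1 *: pZ P by rewrite ER scalerA mulVf // scale1r.
have [OP _] := rP i.
by rewrite coefZ prME // e1 mul0r coef0.
Qed.

Lemma prod_gs_Crat (F : autC -> algC) :
  (forall s s' : autC, s gam = s' gam -> F s = F s') ->
  (forall (t s : autC), t (F s) = F (t \o s)) -> \prod_(s <- gs) F s \in Crat.
Proof.
move=> FF tF; apply: aut_fixed_Crat => t; rewrite rmorph_prod /=.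
by rewrite -[RHS](conj_reps_bigl gsP _ t FF); apply: eq_bigr => s _.
Qed.
End NormPoly.

Definition mx (x : algC) : algC := if `|x| <= 1 then 1 else `|x|.
Lemma mxP x : (mx x = 1 /\ `|x| <= 1) \/ (mx x = `|x| /\ 1 <= `|x|).
Proof.
rewrite /mx; case: ifPn => h; [left|right]; split=> //.
by rewrite -real_ltNge ?real1 ?normr_real // in h; apply: ltW.
Qed.
Lemma mx_ge1 x : 1 <= mx x. Proof. by case: (mxP x) => -[-> //]. Qed.
Lemma mx_ge0 x : 0 <= mx x. Proof. exact: le_trans ler01 (mx_ge1 x). Qed.
Lemma mx_norm x : `|x| <= mx x. Proof. by case: (mxP x) => -[-> //]. Qed.
Hint Resolve mx_ge1 mx_ge0 mx_norm : core.

Definition l1 (P : {poly int}) : nat := \sum_(i < size P) absz (P`_i)%R.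
Lemma norm_absz (n : int) : `|n%:~R| <= (absz n)%:R :> algC.
Proof. by rewrite -intr_norm -abszE. Qed.
Lemma l1_bound P y : `|y| <= 1 -> `|(pZ P).[y]| <= (l1 P)%:R.
Proof.
move=> y1; rewrite (horner_intr_wide _ (leqnn _)) (le_trans (ler_norm_sum _ _ _)) //.
rewrite /l1 natr_sum ler_sum // => i _; rewrite normrM normrX.
rewrite -[X in _ <= X]mulr1 ler_pM ?exprn_ge0 ?exprn_ile1 //.
exact: norm_absz.
Qed.

Lemma l1_bound_mx (P : {poly int}) x n : (size P <= n.+1)%N -> `|(pZ P).[x]| <= (l1 P)%:R * mx x ^+ n.
Proof.
move=> sz; rewrite (horner_intr_wide _ (leqnn _)) (le_trans (ler_norm_sum _ _ _)) //.
rewrite /l1 natr_sum mulr_suml ler_sum // => i _; rewrite normrM normrX.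
apply: ler_pM; rewrite ?exprn_ge0 //; first exact: norm_absz.
apply: (@le_trans _ _ (mx x ^+ i)); first by rewrite lerXn2r ?nnegrE.
by rewrite ler_weXn2l // -ltnS (leq_trans (ltn_ord i)).
Qed.

Definition rvp (R : nzRingType) d (P : {poly R}) : {poly R} := \poly_(i < d.+1) P`_(d - i).

Lemma rvp_horner (P : {poly int}) d (x : algC) : (size P <= d.+1)%N -> x != 0 ->
  (pZ (rvp d P)).[x^-1] * x ^+ d = (pZ P).[x].
Proof.
move=> sz x0; rewrite (horner_intr_wide _ (size_poly _ _)) (horner_intr_wide _ sz) mulr_suml.
rewrite [RHS](reindex_inj rev_ord_inj) /=; apply: eq_bigr => i _.
have id : (i <= d)%N by rewrite -ltnS.
rewrite coef_poly ltn_ord subSS -mulrA; congr (_ * _).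
by rewrite -{1}(subKn id) expVB // leq_subr.
Qed.

(* Integer data of a rational map f/g of degree d: Bezout identities in the two
   charts of P^1 bound its bad reduction by the integer R. *)
Record ratmap (f g : {poly int}) (d R : nat) : Prop := RatMap {
  rm_f : (size f <= d.+1)%N; rm_g : (size g <= d.+1)%N;
  rm_d : (2 <= d)%N; rm_R : (0 < R)%N;
  rm_bez1 : exists u v, u * f + v * g = R%:R%:P;
  rm_bez2 : exists u v, u * rvp d f + v * rvp d g = R%:R%:P }.

Section Map.
Variables (f g : {poly int}) (d R : nat).
Hypothesis rm : ratmap f g d R.
Let szf := rm_f rm.
Let szg := rm_g rm.
Local Notation RC := (R%:R : algC).

Definition fC x : algC := (pZ f).[x].
Definition gC x : algC := (pZ g).[x].
Definition phi (x : algC) : algC := fC x / gC x.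

Lemma aut_phi (s : autC) x : s (phi x) = phi (s x).
Proof. by rewrite /phi rmorphM fmorphV /= !aut_horner_pZ. Qed.
Lemma aut_gC (s : autC) x : s (gC x) = gC (s x). Proof. exact: aut_horner_pZ. Qed.

Lemma bezC1 : exists u v : {poly int}, forall x, (pZ u).[x] * fC x + (pZ v).[x] * gC x = RC.
Proof.
have [u [v E]] := rm_bez1 rm; exists u, v => x; have := congr1 (fun P => (pZ P).[x]) E.
by rewrite rmorphD !rmorphM hornerD !hornerM map_polyC hornerC /= rmorph_nat.
Qed.
Lemma bezC2 : exists u v : {poly int}, forall x,
  (pZ u).[x] * (pZ (rvp d f)).[x] + (pZ v).[x] * (pZ (rvp d g)).[x] = RC.
Proof.
have [u [v E]] := rm_bez2 rm; exists u, v => x; have := congr1 (fun P => (pZ P).[x]) E.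
by rewrite rmorphD !rmorphM hornerD !hornerM map_polyC hornerC /= rmorph_nat.
Qed.

Section Local.
Variables (l : nat) (v : place l) (x : algC).
Hypothesis gx : gC x != 0.
Local Notation w := (nw v x).

Lemma hom_local : [/\ pO v (w ^+ d * fC x), pO v (w ^+ d * gC x) &
  exists U V, [/\ pO v U, pO v V & U * (w ^+ d * fC x) + V * (w ^+ d * gC x) = RC]].
Proof.
case: nuwP => [Ox|_ x0 Oi _].
  rewrite expr1n !mul1r; split; try exact: O_horner.
  have [u [v' E]] := bezC1; exists (pZ u).[x], (pZ v').[x].
  by split=> //; apply: O_horner.
have Ef : x^-1 ^+ d * fC x = (pZ (rvp d f)).[x^-1].
  by rewrite /fC -(rvp_horner szf x0) mulrCA exprVn mulVf ?mulr1 // expf_neq0.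
have Eg : x^-1 ^+ d * gC x = (pZ (rvp d g)).[x^-1].
  by rewrite /gC -(rvp_horner szg x0) mulrCA exprVn mulVf ?mulr1 // expf_neq0.
rewrite Ef Eg; split; try exact: O_horner.
have [u [v' E]] := bezC2; exists (pZ u).[x^-1], (pZ v').[x^-1].
by split=> //; apply: O_horner.
Qed.

(* eps compares the homogeneous image of normalised coordinates with
   normalised coordinates of the image. *)
Definition eps : algC := w ^+ d * gC x / nw v (phi x).
Lemma eps_g : w ^+ d * gC x = eps * nw v (phi x).
Proof. by rewrite divfK // nw_neq0. Qed.
Lemma eps_f : w ^+ d * fC x = eps * nu v (phi x).
Proof.
by rewrite /eps nuE /phi; field; rewrite gx nw_neq0.
Qed.
Lemma eps_neq0 : eps != 0.
Proof. by rewrite mulf_neq0 ?invr_eq0 ?nw_neq0 // mulf_neq0 // expf_neq0 // nw_neq0. Qed.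
Lemma epsO : pO v eps.
Proof.
have [Of Og _] := hom_local; have := eps_f; have := eps_g.
case: (nuwP v (phi x)) => [_ Eg _|_ _ _ _ _ Ef]; first by rewrite mulr1 in Eg; rewrite -Eg.
by rewrite mulr1 in Ef; rewrite -Ef.
Qed.
(** Numerator and denominator are both [eps] times integral elements, so the Bezout identity in
    normalised coordinates is a multiple of [eps]. *)
Lemma eps_div : pO v (RC / eps).
Proof.
have [Of Og [U [V [OU OV <-]]]] := hom_local.
have -> : (U * (w ^+ d * fC x) + V * (w ^+ d * gC x)) / eps = U * nu v (phi x) + V * nw v (phi x).
  by rewrite eps_f eps_g; field; apply: eps_neq0.
by apply: OD; apply: OM => //; [apply: nuO|apply: nwO].
Qed.
Lemma eps_unit : prime l -> ~~ (l %| R)%N -> unitv v eps.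
Proof.
move=> pl nR; apply: unitv_pr; first exact: epsO.
apply: contraNneq nR => e0.
have : pr v RC = 0.
  have -> : RC = RC / eps * eps by rewrite divfK // eps_neq0.
  by rewrite prME ?e0 ?mulr0 //; [exact: eps_div|exact: epsO].
by move=> /eqP; rewrite -[R%:R]/((Posz R)%:~R) pr_int_eq0.
Qed.
End Local.

(** The Bezout identities serve at the archimedean place too: their cofactors are bounded on the
    unit disc, which keeps |f| + |g| away from 0, in the chart at 0 or at infinity according to
    |x|. *)
Lemma arch_bound : exists2 C : nat, (0 < C)%N &
  forall x, mx x ^+ d <= C%:R * (`|fC x| + `|gC x|).
Proof.
have [u [v E1]] := bezC1; have [u2 [v2 E2]] := bezC2.
pose C := (l1 u + l1 v + l1 u2 + l1 v2).+1; exists C => // x.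
have R1 : 1 <= RC by rewrite ler1n (rm_R rm).
have key (A B a b : algC) (m n : nat) : (m + n <= C)%N -> `|A| <= m%:R -> `|B| <= n%:R ->
    A * a + B * b = RC -> 1 <= C%:R * (`|a| + `|b|).
  move=> le hA hB E; apply: le_trans R1 _; rewrite -E.
  have <- : `|A * a + B * b| = A * a + B * b by rewrite E normr_nat.
  rewrite (le_trans (ler_normD _ _)) // mulrDr !normrM lerD // ler_pM //.
    by rewrite (le_trans hA) // ler_nat; lia.
  by rewrite (le_trans hB) // ler_nat; lia.
case: (mxP x) => -[-> h].
  by rewrite expr1n; apply: (key _ _ _ _ (l1 u) (l1 v) _ (l1_bound u h) (l1_bound v h) (E1 x)); rewrite /C; lia.
have x0 : x != 0 by rewrite -normr_gt0 (lt_le_trans ltr01).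
have h' : `|x^-1| <= 1 by rewrite normfV invf_le1 // normr_gt0.
have := key _ _ _ _ (l1 u2) (l1 v2) _ (l1_bound u2 h') (l1_bound v2 h') (E2 x^-1).
move=> /(_ ltac:(rewrite /C; lia)) => K.
rewrite /fC /gC -(rvp_horner szf x0) -(rvp_horner szg x0) !normrM normrX -mulrDl mulrA.
by rewrite -[X in X <= _]mul1r ler_pM ?exprn_ge0.
Qed.

Lemma aut_gC_neq0 (s : autC) x : gC x != 0 -> gC (s x) != 0.
Proof. by rewrite -aut_gC fmorph_eq0. Qed.

Definition mahler (gs : seq autC) (x a : algC) : algC := `|a| * \prod_(s <- gs) mx ((s : autC) x).

Lemma mahler_ge0 gs x a : 0 <= mahler gs x a.
Proof. by rewrite mulr_ge0 // prodr_ge0. Qed.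

Lemma int_norm_ge1 (x : algC) : x \in Num.int -> x != 0 -> 1 <= `|x|.
Proof. by move=> xi x0; apply: norm_intr_ge1. Qed.

Lemma gen_phi del x : gen del x -> gen del (phi x).
Proof. by move=> gx u u' E; rewrite !aut_phi (gx u u' E). Qed.

(** This is d h(x) <= h(phi x) + O(1). At the finite places, R^n / q with n conjugates is rational
    and integral everywhere, hence a nonzero integer, so |q| <= R^n; [arch] handles the archimedean
    factors. *)
Lemma height_step (del : algC) gs x a b (C : nat) : conj_reps del gs -> gen del x -> gC x != 0 ->
  (forall x, mx x ^+ d <= C%:R * (`|fC x| + `|gC x|)) ->
  lcz gs x a -> lcz gs (phi x) b ->
  mahler gs x a ^+ d <= (2 * C * R)%:R ^+ size gs * mahler gs (phi x) b.
Proof.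
move=> gsP gx g0 arch la lb; have [a0 _] := la; have [b0 _] := lb.
have gs0 (s : autC) : gC (s x) != 0 by apply: aut_gC_neq0.
pose G := \prod_(s <- gs) gC ((s : autC) x).
have G0 : G != 0 by rewrite prodf_seq_neq0; apply/allP => s _; apply: gs0.
pose q := a ^+ d * G / b.
have q0 : q != 0 by rewrite mulf_neq0 ?invr_eq0 // mulf_neq0 ?expf_neq0.
have R0 : RC != 0 by rewrite pnatr_eq0 -lt0n (rm_R rm).
have ratZ : {subset Num.int <= Crat} by move=> y /intrP[m ->]; rewrite rpred_int.
have qi : RC ^+ size gs / q \in Num.int.
  apply: allO_Crat_int.
    have aQ := ratZ _ (lcz_int la); have bQ := ratZ _ (lcz_int lb).
    rewrite rpred_div ?rpredX ?rpred_nat // rpred_div // rpredM ?rpredX // /G.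
    apply: (@prod_gs_Crat del gs gsP (fun s => gC (s x))) => [s s' E|t s]; first by rewrite (gx s s').
    by rewrite aut_gC.
  move=> l pl v; have ua := lcz_local v pl la; have ub := lcz_local v pl lb.
  pose W := \prod_(s <- gs) nw v ((s : autC) x).
  pose W' := \prod_(s <- gs) nw v ((s : autC) (phi x)).
  rewrite -/W in ua; rewrite -/W' in ub.
  pose A := a / W; pose B := b / W'.
  have A0 : A != 0 by case: ua. have B0 : B != 0 by case: ub.
  have W0 : W != 0 by rewrite prodf_seq_neq0; apply/allP => s _; apply: nw_neq0.
  have W'0 : W' != 0 by rewrite prodf_seq_neq0; apply/allP => s _; apply: nw_neq0.
  have Eq : q = A ^+ d / B * \prod_(s <- gs) eps v ((s : autC) x).
    have -> : \prod_(s <- gs) eps v ((s : autC) x) = W ^+ d * G / W'.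
      rewrite -prodrXl -big_split /= -prodf_div; apply: eq_bigr => s _.
      by rewrite /eps aut_phi.
    by rewrite /q /A /B expr_div_n; field; rewrite ?b0 ?W0 ?W'0 ?expf_neq0.
  have E0 : \prod_(s <- gs) eps v ((s : autC) x) != 0.
    by rewrite prodf_seq_neq0; apply/allP => s _; apply: eps_neq0.
  have -> : RC ^+ size gs / q = B / A ^+ d * \prod_(s <- gs) (RC / eps v ((s : autC) x)).
    rewrite prodf_div big_const_seq count_predT iter_mulr_1 Eq.
    by field; rewrite ?B0 ?E0 ?expf_neq0.
  apply: OM; last by apply: (subring_set_prod (pOsub v)) => s _; apply: eps_div.
  by apply: unitvO; apply: unitvM => //; apply: unitvV; apply: unitvX.
have qle : `|q| <= RC ^+ size gs.
  have : 1 <= `|RC ^+ size gs / q| by rewrite int_norm_ge1 // mulf_neq0 ?invr_eq0 ?expf_neq0.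
  by rewrite normf_div normrX normr_nat ler_pdivlMr ?normr_gt0 // mul1r.
have step (s : autC) : mx (s x) ^+ d <= (2 * C)%:R * `|gC (s x)| * mx (s (phi x)).
  apply: le_trans (arch _) _.
  have -> : `|fC (s x)| = `|gC (s x)| * `|s (phi x)|.
    by rewrite aut_phi /phi normf_div mulrC divfK // normr_eq0.
  have -> : (2 * C)%:R * `|gC (s x)| * mx (s (phi x)) =
     C%:R * (`|gC (s x)| * mx (s (phi x)) + `|gC (s x)| * mx (s (phi x))).
    by rewrite natrM; ring.
  rewrite ler_wpM2l ?ler0n // lerD //; first by rewrite ler_wpM2l.
  by rewrite ler_peMr.
rewrite /mahler exprMn -prodrXl.
apply: (@le_trans _ _ (`|a| ^+ d * \prod_(s <- gs) ((2 * C)%:R * `|gC ((s : autC) x)| * mx ((s : autC) (phi x))))).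
  rewrite ler_wpM2l ?exprn_ge0 // ler_prod // => s _; by rewrite exprn_ge0 //=.
rewrite !big_split /= big_const_seq count_predT iter_mulr_1 -normr_prod -/G.
have -> : `|a| ^+ d * ((2 * C)%:R ^+ size gs * `|G| * \prod_(i <- gs) mx ((i : autC) (phi x))) =
  (2 * C)%:R ^+ size gs * `|q| * (`|b| * \prod_(i <- gs) mx ((i : autC) (phi x))).
  by rewrite /q normf_div normrM normrX; field; rewrite normr_eq0.
rewrite [(2 * C * R)%:R]natrM [(_ * RC) ^+ _]exprMn -!mulrA.
rewrite ler_wpM2l ?exprn_ge0 ?ler0n // ler_wpM2r // mulr_ge0 // prodr_ge0 //.
Qed.

Lemma height_base (x0 : algC) : exists2 K : nat, (0 < K)%N &
  forall del gs (t : autC) a, conj_reps del gs -> gen del (t x0) -> lcz gs (t x0) a ->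
    mahler gs (t x0) a <= K%:R ^+ size gs.
Proof.
have [P [pP rP]] := prim_minpoly x0.
pose n := (size P).-1; have P0 := primZ_neq0 pP.
have szP : size P = n.+1 by rewrite prednK // size_poly_gt0.
pose A := absz (lead_coef P).
have A0 : (0 < A)%N by rewrite absz_gt0 lead_coef_eq0.
have intA : allO (A%:R * x0).
  suff H : allO ((lead_coef P)%:~R * x0).
    have [E|E] : A = lead_coef P :> int \/ A = - lead_coef P :> int by rewrite /A; lia.
      by rewrite -[A%:R]/((A : int)%:~R) E.
    by rewrite -[A%:R]/((A : int)%:~R) E rmorphN mulNr; apply: allON.
  move=> l pl v; have [O|Oi] := pOval v x0; first by apply: OM => //; apply: Oint.
  have [->|nz] := eqVneq x0 0; first by rewrite mulr0; apply: O0.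
  have n0 : (0 < n)%N.
    rewrite lt0n; apply/eqP => n0; move: rP; rewrite /root (@horner_intr_wide _ _ _ 1) ?szP ?n0 //.
    rewrite big_ord1 expr0 mulr1 intr_eq0 => /eqP E.
    by case/eqP: P0; rewrite (@size1_polyC _ P) ?szP ?n0 // E.
  have E : (lead_coef P)%:~R * x0 = - \sum_(j < n) (P`_j)%:~R * x0^-1 ^+ (n.-1 - j).
    apply: (mulIf (expf_neq0 n.-1 nz)); rewrite -mulrA -exprS prednK // mulNr mulr_suml.
    apply/eqP; rewrite -addr_eq0 addrC; have : (pZ P).[x0] == 0 by [].
    rewrite (@horner_intr_wide _ _ _ n.+1) ?szP // big_ord_recr /= lead_coefE szP /=.
    move=> /eqP E0; rewrite -[X in _ == X]E0; apply/eqP; congr (_ + _); apply: eq_bigr => j _.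
    by rewrite -mulrA expVB // -ltnS prednK.
  rewrite E; apply: ON; apply: (subring_set_sum (pOsub v)) => j _.
  by apply: OM; [apply: Oint|apply: OX].
have [B0 HB] : exists B0 : nat, forall t : autC, `|t x0| <= B0%:R.
  have [gs0 gs0P] := conj_reps_exists x0.
  exists (\sum_(s <- gs0) Num.bound `|(s : autC) x0|) => t.
  have [s sg ->] := conj_repsP gs0P t; rewrite natr_sum (bigD1_seq s) ?(conj_reps_uniq gs0P) //=.
  apply: (@le_trans _ _ (Num.bound `|s x0|)%:R); first by rewrite ltW // archi_boundP.
  by rewrite lerDl sumr_ge0.
(* [A] is a common denominator of the conjugates of [x0] and [B0] bounds their absolute values;
   neither depends on [del]. *)
exists (A * B0.+1)%N; first by rewrite muln_gt0 A0.
move=> del gs t a gsP gx la; have [a0 _] := la.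
have ai : A%:R ^+ size gs / a \in Num.int.
  have ratZ : {subset Num.int <= Crat} by move=> y /intrP[m ->]; rewrite rpred_int.
  apply: allO_Crat_int.
    by rewrite rpred_div ?rpredX ?rpred_nat //; apply/ratZ/lcz_int/la.
  move=> l pl v; have ua := lcz_local v pl la.
  pose W := \prod_(s <- gs) nw v ((s : autC) (t x0)).
  rewrite -/W in ua.
  have W0 : W != 0 by rewrite prodf_seq_neq0; apply/allP => s _; apply: nw_neq0.
  have -> : A%:R ^+ size gs / a = (a / W)^-1 * \prod_(s <- gs) (A%:R / nw v ((s : autC) (t x0))).
    rewrite prodf_div big_const_seq count_predT iter_mulr_1 -/W.
    by field; rewrite a0 W0.
  apply: OM; first by case: (unitvV ua).
  apply: (subring_set_prod (pOsub v)) => s _.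
  case: nuwP => [_|*]; first by rewrite divr1; apply: Onat.
  rewrite invrK; have /(allO_aut (s \o t : autC))/(_ l pl v) := intA.
  by rewrite rmorphM rmorph_nat.
have ale : `|a| <= A%:R ^+ size gs.
  have : 1 <= `|A%:R ^+ size gs / a|.
    by rewrite int_norm_ge1 // mulf_neq0 ?invr_eq0 ?expf_neq0 // pnatr_eq0 -lt0n.
  by rewrite normf_div normrX normr_nat ler_pdivlMr ?normr_gt0 // mul1r.
rewrite /mahler natrM exprMn ler_pM // ?prodr_ge0 //.
have -> : B0.+1%:R ^+ size gs = \prod_(s <- gs) B0.+1%:R :> algC.
  by rewrite big_const_seq count_predT iter_mulr_1.
apply: ler_prod => s _; rewrite mx_ge0 /=.
case: (mxP (s (t x0))) => -[-> _]; first by rewrite ler1n.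
apply: le_trans (HB (s \o t : autC)) _; by rewrite ler_nat.
Qed.
End Map.

(** Level n of the tree of preimages of the conjugates of [x0], restricted to points whose first n
    images are finite. *)
Fixpoint inT (f g : {poly int}) (x0 : seq algC) (n : nat) (x : algC) : Prop :=
  if n is n'.+1 then gC g x != 0 /\ inT f g x0 n' (phi f g x)
  else exists2 b, b \in x0 & exists s : autC, x = s b.

Section Tree.
Variables (f g : {poly int}) (d R : nat) (x0 : seq algC).
Hypothesis rm : ratmap f g d R.

Lemma height_bases : exists2 K : nat, (0 < K)%N &
  forall b, b \in x0 -> forall del gs (t : autC) a, conj_reps del gs -> gen del (t b) -> lcz gs (t b) a ->
    mahler gs (t b) a <= K%:R ^+ size gs.
Proof.
elim: x0 => [|b s [K K0 H]]; first by exists 1%N.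
have [K1 K1pos H1] := height_base rm b.
exists (maxn K K1); first by rewrite leq_max K0.
move=> c; rewrite in_cons => /predU1P[->|cs] del gs t a gsP gx la.
  apply: le_trans (H1 _ _ _ _ gsP gx la) _; by rewrite lerXn2r ?nnegrE ?ler0n // ler_nat leq_maxr.
apply: le_trans (H _ cs _ _ _ _ gsP gx la) _; by rewrite lerXn2r ?nnegrE ?ler0n // ler_nat leq_maxl.
Qed.

(** A step loses a factor (2CR)^n, for n conjugates, but then extracts a d-th root. Since d >= 2, a
    constant K >= 2CR satisfies K * K <= K^d, so the same K serves at every level. *)
Lemma height_T : exists2 K : nat, (0 < K)%N & forall n x, inT f g x0 n x ->
  forall del gs a, conj_reps del gs -> gen del x -> lcz gs x a ->
    mahler gs x a <= K%:R ^+ size gs.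
Proof.
have [K0 K0pos HK0] := height_bases; have [C C0 arch] := arch_bound rm.
pose K := maxn K0 (2 * C * R); exists K; first by rewrite leq_max K0pos.
elim=> [|n IH] x.
  move=> [b bB [t ->]] del gs a gsP gx la; apply: le_trans (HK0 _ bB _ _ _ _ gsP gx la) _.
  by rewrite lerXn2r ?nnegrE ?ler0n // ler_nat leq_maxl.
move=> [g0 Tx] del gs a gsP gx la.
have [b lb] := lcz_exists gsP (gen_phi f g gx).
have := height_step rm gsP gx g0 arch la lb.
have := IH _ Tx _ _ _ gsP (gen_phi f g gx) lb; set n0 := size gs => hb ha.
have d0 : (0 < d)%N by have := rm_d rm; lia.
rewrite -(ler_pXn2r d0) ?nnegrE ?mahler_ge0 ?exprn_ge0 ?ler0n //.
apply: le_trans ha _; apply: (@le_trans _ _ (K%:R ^+ n0 * K%:R ^+ n0)).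
  apply: ler_pM; rewrite ?exprn_ge0 ?ler0n ?mahler_ge0 //.
  by rewrite lerXn2r ?nnegrE ?ler0n // ler_nat leq_maxr.
rewrite -exprD addnn -muln2 exprM -exprM -exprM ler_weXn2l ?ler1n ?leq_max ?K0pos //.
by rewrite leq_mul2l (rm_d rm) orbT.
Qed.

End Tree.

Lemma expr_split (A : nzRingType) (x : A) M i : (i <= M)%N -> x ^+ M = x ^+ (M - i) * x ^+ i.
Proof. by move=> le; rewrite -exprD subnK. Qed.

Lemma coprime_unitv l (v : place l) (p : nat) : prime l -> prime p -> l != p -> unitv v p%:R.
Proof.
move=> pl pp ne; apply: unitv_pr; first exact: Onat.
rewrite -[p%:R]/((Posz p)%:~R) pr_int_eq0 // dvdzE /= dvdn_prime2 //.
Qed.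

(** Product formula: the weighted norm divided by its power of p is a rational integer of absolute
    value below 1. One place above p suffices because this number is rational. *)
Lemma norm_vanish (gam : algC) gs (p j : nat) (y A : algC) :
  conj_reps gam gs -> prime p -> gen gam y -> A \in Crat -> A != 0 ->
  (forall l (v : place l), prime l -> l != p -> pO v (A * \prod_(s <- gs) (s : autC) y)) ->
  (exists v : place p, pO v (A * \prod_(s <- gs) (s : autC) y / p%:R ^+ (j * size gs))) ->
  `|A| * \prod_(s <- gs) `|(s : autC) y| < p%:R ^+ (j * size gs) -> y = 0.
Proof.
move=> gsP pp gy AQ A0 Hl [v Hv] lt.
have p0 : (p%:R : algC) != 0 by rewrite pnatr_eq0 -lt0n prime_gt0.
set z := A * _ in Hl Hv.
have zi : z / p%:R ^+ (j * size gs) \in Num.int.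
  apply: Crat_int_places.
    rewrite rpred_div ?rpredX ?rpred_nat // rpredM //.
    by apply: (@prod_gs_Crat _ _ gsP (fun s => s y)) => [s s' E|t s //]; apply: gy.
  move=> l pl; have [->|ne] := eqVneq l p; first by exists v.
  have [w _] := place_exists pl; exists w; apply: OM; first exact: Hl.
  by apply: unitvO; apply: unitvV; apply: unitvX; apply: coprime_unitv.
have : z / p%:R ^+ (j * size gs) = 0.
  apply/eqP; apply: contraTT lt => nz; rewrite -real_leNgt ?realX ?ger0_real ?ler0n //; last first.
    by rewrite mulr_ge0 // prodr_ge0.
  have := norm_intr_ge1 zi nz.
  rewrite normf_div normrX normr_nat /z normrM normr_prod ler_pdivlMr ?mul1r //.
  by rewrite exprn_gt0 // ltr0n prime_gt0.
move/eqP; rewrite mulf_eq0 invr_eq0 expf_eq0 (negPf p0) andbF orbF mulf_eq0 (negPf A0) /=.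
by rewrite prodf_seq_eq0 => /hasP[s _ /=]; rewrite fmorph_eq0 => /eqP.
Qed.

(** * Finiteness of ramification *)

Section DiffQuot.
Variables (R : comNzRingType) (P : {poly int}).
Local Notation PR := (map_poly (intr : int -> R) P).
(** The quotient (P(x) - P(y)) / (x - y), written without division so that it reduces modulo a place
    and gives P' on the diagonal. *)
Definition dq (x y : R) : R :=
  \sum_(i < size P) (P`_i)%:~R * \sum_(j < i) x ^+ (i.-1 - j) * y ^+ j.
Lemma dqE x y : PR.[x] - PR.[y] = (x - y) * dq x y.
Proof.
rewrite !(horner_intr_wide _ (leqnn _)) -sumrB /dq mulr_sumr; apply: eq_bigr => i _.
by rewrite -mulrBr subrXX mulrCA.
Qed.
Lemma dq_diag x : dq x x = PR^`().[x].
Proof.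
rewrite deriv_map (@horner_intr_wide _ _ _ (size P).-1) ?size_poly // /dq.
case: (size P) => [|m]; rewrite ?big_ord0 // big_ord_recl big_ord0 mulr0 add0r /=.
apply: eq_bigr => i _; rewrite coef_deriv rmorphMn /= mulrnAl -mulrnAr; congr (_ * _).
rewrite (eq_bigr (fun=> x ^+ i)) ?sumr_const ?card_ord // => j _.
by rewrite -exprD subnK // -ltnS.
Qed.
End DiffQuot.

Lemma dq_red l (v : place l) (P : {poly int}) x y : pO v x -> pO v y ->
  pr v (dq P x y) = dq P (pr v x) (pr v y).
Proof.
move=> Ox Oy; have kp := place_rel_ring v.
suff [] : place_rel v (dq P x y) (dq P (pr v x) (pr v y)) by [].
apply: (rr_sum kp) => i _; apply: (rrM kp); first by split; [exact: Oint|exact: pr_int].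
by apply: (rr_sum kp) => j _; apply: (rrM kp); apply: (rrX kp).
Qed.

Lemma list_large (L : seq algC) : exists N : nat, forall p, prime p -> (N < p)%N ->
  forall v : place p, forall x y, x \in L -> y \in L ->
    pO v x /\ (pr v x = pr v y -> x = y).
Proof.
have H1 : exists N : nat, forall p, prime p -> (N < p)%N -> forall v : place p,
    forall x, x \in L -> pO v x.
  elim: L => [|x L [N HN]]; first by exists 0%N.
  have [M HM] := O_large x; exists (maxn N M) => p pp; rewrite gtn_max => /andP[l1 l2] v y.
  by rewrite inE => /predU1P[->|]; [exact: HM|exact: HN].
have H2 : exists N : nat, forall p, prime p -> (N < p)%N -> forall v : place p,
    forall z, z \in [seq x - y | x <- L, y <- L] -> z != 0 -> pr v z != 0.
  elim: [seq x - y | x <- L, y <- L] => [|x l [N HN]]; first by exists 0%N.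
  have [->|x0] := eqVneq x 0.
    by exists N => p pp lt v z; rewrite inE => /predU1P[->/eqP//|]; apply: HN.
  have [M HM] := unit_large x0; exists (maxn N M) => p pp; rewrite gtn_max => /andP[l1 l2] v y.
  by rewrite inE => /predU1P[-> _|]; [case: (HM p pp l2 v)|exact: HN].
have [N1 h1] := H1; have [N2 h2] := H2; exists (maxn N1 N2) => p pp.
rewrite gtn_max => /andP[l1 l2] v x y xL yL.
have Ox := h1 p pp l1 v x xL; have Oy := h1 p pp l1 v y yL; split=> // E.
apply/eqP; rewrite -subr_eq0; apply: contrapT => /negP nz.
have /eqP[] := h2 p pp l2 v (x - y) (allpairs_f _ xL yL) nz.
by rewrite prBE // E subrr.
Qed.

Definition P1cong l (v : place l) (x y : algC) : Prop :=
  [/\ pO v x, pO v y & pr v x = pr v y] \/ (~ pO v x /\ ~ pO v y).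

(** The integers B(gam) and gam B(gam) are projective coordinates of gam, so their residues
    determine gam modulo [v] even when gam is not integral. *)
Lemma inertia_P1cong l (v : place l) gam (s s' : autC) : prime l ->
  (forall x, allO x -> gen gam x -> pr v (s x) = pr v (s' x)) ->
  P1cong v (s gam) (s' gam).
Proof.
move=> pl H; have [Bs HB] := denominators gam.
have [int_s ex_s] := HB s; have [int_s' _] := HB s'; have [int_1 _] := HB idfun.
have [B BB good] := ex_s l v pl.
have [a1 a2] := int_s B BB; have [a1' a2'] := int_s' B BB; have [b1 b2] := int_1 B BB.
have gB : gen gam (pZ B).[gam] by apply: gen_horner.
have E1 := H _ b1 gB; have E2 := H _ b2 (genM (@gen_refl gam) gB).
rewrite !aut_horner_pZ in E1; rewrite !rmorphM !aut_horner_pZ in E2.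
set x := s gam in E1 E2 good a1 a2 *; set y := s' gam in E1 E2 a1' a2' *.
have Ox1 := a1 l pl v; have Ox2 := a2 l pl v; have Oy1 := a1' l pl v; have Oy2 := a2' l pl v.
have fin z : pO v (pZ B).[z] -> pO v (z * (pZ B).[z]) -> pr v (pZ B).[z] != 0 ->
     pO v z /\ pr v z = pr v (z * (pZ B).[z]) / pr v (pZ B).[z].
  move=> O1 O2 nz; have [B0 _ Oi] := unitv_pr O1 nz.
  have E : z = z * (pZ B).[z] / (pZ B).[z] by rewrite mulfK.
  split; first by rewrite E; apply: OM.
  by rewrite {1}E prME ?prVE.
have [nz|/negPn/eqP z0] := boolP (pr v (pZ B).[x] != 0).
  left; have [Ox Ex] := fin x Ox1 Ox2 nz.
  have [|Oy Ey] := fin y Oy1 Oy2; first by rewrite -E1.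
  by split=> //; rewrite Ex Ey E1 E2.
case: good; first by rewrite z0 eqxx.
move=> nz; right; split=> O.
  by case/eqP: nz; rewrite prME // z0 mulr0.
by case/eqP: nz; rewrite E2 prME // -E1 z0 mulr0.
Qed.

Definition wronsk (R : nzRingType) (f g : {poly R}) : {poly R} := f^`() * g - f * g^`().

Lemma coef_rvp0 (R : nzRingType) d (P : {poly R}) : (rvp d P)`_0 = P`_d.
Proof. by rewrite coef_poly subn0. Qed.

Section FiniteRamification.
Variables (f g : {poly int}) (d R : nat).
Hypothesis rm : ratmap f g d R.
Let szf := rm_f rm.
Let szg := rm_g rm.
Local Notation RC := (R%:R : algC).
Local Notation fC := (fC f).
Local Notation gC := (gC g).
Local Notation phi := (phi f g).
Local Notation fd := ((f`_d)%:~R : algC).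
Local Notation gd := ((g`_d)%:~R : algC).

Lemma RC_neq0 : RC != 0.
Proof. by rewrite pnatr_eq0 -lt0n (rm_R rm). Qed.

Lemma fg_neq0 x : fC x = 0 -> gC x = 0 -> False.
Proof.
move=> f0 g0; have [u [v /(_ x)]] := bezC1 rm; rewrite f0 g0 !mulr0 addr0 => /esym/eqP.
by rewrite (negPf RC_neq0).
Qed.

Lemma fgd_neq0 : fd = 0 -> gd = 0 -> False.
Proof.
move=> f0 g0; have [u [v /(_ 0)]] := bezC2 rm.
rewrite !(horner_coef0 (pZ (rvp d _))) !coef_map !coef_rvp0 /= f0 g0 !mulr0 addr0 => /esym/eqP.
by rewrite (negPf RC_neq0).
Qed.

(** If the Wronskian vanishes, the Bezout identity makes f divide R f' and g divide R g'. By degrees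
    f' = g' = 0, so both coefficients of index d vanish, against the identity at infinity. *)
Lemma wronsk_neq0 : wronsk f g != 0.
Proof.
apply/eqP => W0; have [u [v E]] := rm_bez1 rm.
have W : f^`() * g = f * g^`() by apply/eqP; rewrite -subr_eq0; apply/eqP.
have Rp : (R%:R : {poly int}) != 0 by rewrite -polyC_natr polyC_eq0 pnatr_eq0 -lt0n (rm_R rm).
rewrite polyC_natr in E.
have Ef : R%:R * f^`() = f * (u * f^`() + v * g^`()).
  by rewrite -E mulrDl -(mulrA v) [g * _]mulrC W; ring.
have Eg : R%:R * g^`() = g * (u * f^`() + v * g^`()).
  by rewrite -E mulrDl -(mulrA u) -W; ring.
have const (h q : {poly int}) : R%:R * h^`() = h * q -> h^`() = 0.
  move=> Eh; apply/eqP; apply: contraTT isT => h0.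
  have := congr1 (size : {poly int} -> nat) Eh.
  have hn0 : h != 0 by apply: contraNneq h0 => ->; rewrite deriv0.
  have q0 : q != 0 by apply: contraNneq h0 => q0; move: Eh; rewrite q0 mulr0 => /eqP; rewrite mulf_eq0 (negPf Rp).
  rewrite -polyC_natr mul_polyC size_scale ?pnatr_eq0 -?lt0n ?(rm_R rm) // size_mul //.
  have := lt_size_deriv hn0; have : (0 < size q)%N by rewrite size_poly_gt0.
  set a := size h; set b := size q; set c := size h^`(); lia.
have cst (h : {poly int}) : h^`() = 0 -> h`_d = 0.
  move=> h0; have := congr1 (fun P : {poly int} => P`_(d.-1)) h0.
  rewrite coef_deriv coef0 prednK; last by have := rm_d rm; lia.
  by move/eqP; rewrite mulrn_eq0 => /orP[/eqP d0|/eqP//]; have := rm_d rm; rewrite d0.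
by apply: fgd_neq0; rewrite cst ?(const _ _ Ef) ?(const _ _ Eg).
Qed.

Section Crit.
Variables (cs : seq algC) (lw : algC).
Hypotheses (lw0 : lw != 0) (Ecs : pZ (wronsk f g) = lw *: \prod_(c <- cs) ('X - c%:P)).

(** Vanishes at the images of the critical points [cs]; the last factor adds phi(infinity), which
    accounts for points that become congruent at infinity. *)
Definition critV : {poly algC} :=
  \prod_(c <- cs) ((fC c)%:P - (gC c)%:P * 'X) * (fd%:P - gd%:P * 'X).

Lemma critV_neq0 : critV != 0.
Proof.
have H a b : (a = 0 -> b = 0 -> False) -> a%:P - b%:P * 'X != 0 :> {poly algC}.
  move=> h; apply/eqP => /polyP E; apply: h.
    by have := E 0%N; rewrite coefB coefCM coefX mulr0 subr0 coefC coef0.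
  have := E 1%N; rewrite coefB coefCM coefX mulr1 coefC sub0r coef0 => /eqP.
  by rewrite oppr_eq0 => /eqP.
rewrite mulf_neq0 //; last by apply: H; apply: fgd_neq0.
rewrite prodf_seq_neq0; apply/allP => c _ /=; apply: H; exact: fg_neq0.
Qed.

Lemma critV_Crat i : critV`_i \in Crat.
Proof.
apply: aut_fixed_Crat => t; rewrite -coef_map /=.
suff -> : map_poly t critV = critV by [].
have mapF (a b : algC) : map_poly t (a%:P - b%:P * 'X) = (t a)%:P - (t b)%:P * 'X.
  by rewrite rmorphB rmorphM /= !map_polyC map_polyX.
rewrite /critV rmorphM rmorph_prod /= mapF !rmorph_int; congr (_ * _).
have perm : perm_eq [seq t c | c <- cs] cs.
  apply: prod_XsubC_eq; rewrite big_map.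
  have := congr1 (map_poly t) Ecs; rewrite map_polyZ /= -map_poly_comp.
  rewrite (eq_map_poly (g := intr)) => [|a]; last by rewrite /= rmorph_int.
  have lwE : t lw = lw.
    have := congr1 lead_coef Ecs; rewrite lead_coefZ (monicP (monic_prod_XsubC _ _ _)) mulr1 => <-.
    by rewrite lead_coefE coef_map /= rmorph_int.
  rewrite Ecs lwE rmorph_prod /= => /(scalerI lw0) ->.
  by apply: eq_bigr => c _; rewrite map_polyXsubC.
rewrite -[RHS](perm_big _ perm) big_map; apply: eq_bigr => c _.
by rewrite mapF /fC /gC !aut_horner_pZ.
Qed.

Lemma critV_local l (v : place l) b : (nw v b) ^+ (size cs).+1 * critV.[b] =
  \prod_(c <- cs) (nw v b * fC c - nu v b * gC c) * (nw v b * fd - nu v b * gd).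
Proof.
rewrite /critV hornerM horner_prod exprSr mulrACA; congr (_ * _).
  have -> : nw v b ^+ size cs = \prod_(c <- cs) nw v b.
    by rewrite big_const_seq count_predT iter_mulr_1.
  rewrite -big_split /=; apply: eq_bigr => c _.
  by rewrite !hornerE nuE; ring.
by rewrite !hornerE nuE; ring.
Qed.

(** If x and y are distinct, congruent and have the same image b, then f - b g and its difference
    quotient both vanish. Modulo [v] the residue is a multiple point of its fibre, so a zero of the
    Wronskian, and b is congruent to a critical value. For points congruent at infinity, b is
    congruent to phi(infinity). *)
Lemma critV_cong l (v : place l) x y : prime l ->
  (forall c, c \in cs -> pO v c) -> unitv v lw ->
  x != y -> gC x != 0 -> gC y != 0 -> phi x = phi y -> P1cong v x y ->
  pO v ((nw v (phi x)) ^+ (size cs).+1 * critV.[phi x]) /\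
  pr v ((nw v (phi x)) ^+ (size cs).+1 * critV.[phi x]) = 0.
Proof.
move=> pl Oc ulw xy gx gy Exy cong.
set b := phi x; rewrite critV_local; set w := nw v b; set u := nu v b.
have Ow : pO v w by apply: nwO. have Ou : pO v u by apply: nuO.
have OF P z : pO v z -> pO v (pZ P).[z] by apply: O_horner.
have Of1 c : c \in cs -> pO v (w * fC c - u * gC c).
  by move=> /Oc h; apply: OB; apply: OM => //; apply: OF.
have Of2 : pO v (w * fd - u * gd) by apply: OB; apply: OM => //; apply: Oint.
have Oprod : pO v (\prod_(c <- cs) (w * fC c - u * gC c)).
  by rewrite big_seq; apply: (subring_set_prod (pOsub v)) => c; apply: Of1.
split; first exact: OM.
have Ex : w * fC x - u * gC x = 0.
  by rewrite /u nuE -/b -/w /b /phi; field.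
have Ey : w * fC y - u * gC y = 0.
  by rewrite /u nuE -/b -/w /b Exy /phi; field.
rewrite prME //; apply/eqP; rewrite mulf_eq0; apply/orP.
case: cong => [[Ox Oy Er]|[nOx _]]; last first.
  right; case: (nuwP v x) (nOx) => // _ x0 Oi ri _.
  have E : w * (pZ (rvp d f)).[x^-1] - u * (pZ (rvp d g)).[x^-1] = 0.
    apply: (mulIf (expf_neq0 d x0)); rewrite mul0r mulrBl -!mulrA.
    by rewrite !rvp_horner.
  have := congr1 (pr v) E; rewrite pr0 prBE ?prME //; try (by apply: OF); try (by apply: OM => //; apply: OF).
  rewrite !pr_horner // ri !(horner_coef0 (map_poly _ _)) !coef_map !coef_rvp0 /= => {}E.
  by rewrite prBE ?prME ?pr_int ?E //; (apply: Oint || (apply: OM => //; apply: Oint)).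
left; set rho := pr v x.
have D : w * dq f x y - u * dq g x y = 0.
  have xy0 : x - y != 0 by rewrite subr_eq0.
  apply: (mulfI xy0); rewrite mulr0 mulrBr !(mulrCA (x - y)) -!dqE -/(fC _) -/(gC _).
  rewrite !mulrBr; have -> : forall a b c d : algC, a - b - (c - d) = (a - c) - (b - d) by move=> *; ring.
  by rewrite Ex Ey subrr.
have Odq P : pO v (dq P x y).
  apply: (subring_set_sum (pOsub v)) => i _; apply: OM; first exact: Oint.
  by apply: (subring_set_sum (pOsub v)) => j _; apply: OM; apply: OX.
pose fb : {poly resT v} := map_poly intr f; pose gb : {poly resT v} := map_poly intr g.
have E1 : pr v w * fb.[rho] = pr v u * gb.[rho].
  have := congr1 (pr v) Ex; rewrite pr0 prBE ?prME //; try (by apply: OF); try (by apply: OM => //; apply: OF).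
  by rewrite !pr_horner // => /eqP; rewrite subr_eq0 => /eqP.
have E2 : pr v w * fb^`().[rho] = pr v u * gb^`().[rho].
  have := congr1 (pr v) D; rewrite pr0 prBE ?prME //; try (by apply: OM).
  by rewrite !dq_red // -Er !dq_diag => /eqP; rewrite subr_eq0 => /eqP.
have Wr : (map_poly intr (wronsk f g)).[rho] = 0 :> resT v.
  rewrite /wronsk rmorphB !rmorphM /= -!deriv_map -/fb -/gb !hornerE.
  have [nz|nz] := orP (nuw_pr v b).
    apply: (mulfI nz); rewrite mulr0 -/u.
    have -> : forall a b c d e : resT v, a * (b * c - d * e) = b * (a * c) - d * (a * e) by move=> *; ring.
    by rewrite -E1 -E2; ring.
  apply: (mulfI nz); rewrite mulr0 -/w.
  have -> : forall a b c d e : resT v, a * (b * c - d * e) = (a * b) * c - (a * d) * e by move=> *; ring.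
  by rewrite E1 E2; ring.
have Wr2 : pr v lw * \prod_(c <- cs) (rho - pr v c) = 0.
  rewrite -Wr -pr_horner // Ecs hornerZ horner_prod prME; last 2 first.
  - by case: ulw.
  - rewrite big_seq; apply: (subring_set_prod (pOsub v)) => c cin.
    by rewrite hornerXsubC; apply: OB => //; apply: Oc.
  congr (_ * _); rewrite big_seq [in RHS]big_seq pr_prod => [|c cin].
    by apply: eq_bigr => c cin; rewrite hornerXsubC prBE //; apply: Oc.
  by rewrite hornerXsubC; apply: OB => //; apply: Oc.
move/eqP: Wr2; rewrite mulf_eq0 (negPf (pr_unitv ulw)) /= prodf_seq_eq0 => /hasP[c cin /=].
rewrite subr_eq0 => /eqP Ec.
rewrite big_seq pr_prod // prodf_seq_eq0; apply/hasP; exists c => //=; rewrite cin /=.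
rewrite prBE ?prME ?pr_horner -?Ec ?E1 ?subrr //; try (by apply: Oc); try (by apply: OF; apply: Oc).
all: by apply: OM => //; apply: OF; apply: Oc.
Qed.

End Crit.

Lemma hom_eval_O l (v : place l) (P : {poly int}) M b : (size P <= M.+1)%N ->
  pO v (nw v b ^+ M * (pZ P).[b]).
Proof.
move=> sz; rewrite (horner_intr_wide _ sz) mulr_sumr; apply: (subring_set_sum (pOsub v)) => i _.
have le : (i <= M)%N by rewrite -ltnS.
have -> : nw v b ^+ M * ((P`_i)%:~R * b ^+ i) = (P`_i)%:~R * (nw v b ^+ (M - i) * nu v b ^+ i).
  by rewrite mulrCA nuE exprMn (expr_split _ le); ring.
apply: OM; first exact: Oint.
by apply: OM; apply: OX; [exact: nwO|exact: nuO].
Qed.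

Lemma denominator_nw l (v : place l) (B : algC) b : pO v B -> pO v (b * B) ->
  pO v (B / nw v b) /\ ((pr v B != 0 \/ pr v (b * B) != 0) -> unitv v (B / nw v b)).
Proof.
move=> OB ObB; case: nuwP => [Ob|nOb b0 Oi ri].
  rewrite divr1; split=> // -[|nz]; first exact: unitv_pr.
  by apply: unitv_pr => //; apply: contraNneq nz => E; rewrite prME // E mulr0.
rewrite invrK mulrC; split=> // -[nz|]; last exact: unitv_pr.
case/eqP: nz; have -> : B = b * B * b^-1 by rewrite mulrAC divff // mul1r.
by rewrite prME // ri mulr0.
Qed.

Lemma map_sub_neq0 b : pZ f - b *: pZ g != 0.
Proof.
apply/eqP => /eqP; rewrite subr_eq0 => /eqP E.
have : pZ (wronsk f g) != 0.
  have := wronsk_neq0; apply: contraNneq => /polyP H; apply/eqP/polyP=> i.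
  by have := H i; rewrite coef_map !coef0 => /eqP; rewrite intr_eq0 => /eqP.
by rewrite /wronsk rmorphB !rmorphM /= -!deriv_map E derivZ -!scalerAl [_^`() * _]mulrC subrr eqxx.
Qed.

Variable x0 : seq algC.
Hypothesis abT : forall n x, inT f g x0 n x -> abel x.

(** Induction on the level. If inertia fixes b = phi(x) but moves x, then PV(b) reduces to 0 at all
    conjugates and is divisible by p, b being unramified. The product formula gives PV(b) = 0, so x
    belongs to a finite list of preimages whose members stay distinct modulo large primes. *)
Lemma inertia_T : exists N : nat, forall p, prime p -> (N < p)%N -> forall v : place p,
  forall n x, inT f g x0 n x -> inertia_trivial v x.
Proof.
have [cs Ecs] := closed_field_poly_normal (pZ (wronsk f g)).
set lw := lead_coef _ in Ecs.
have lw0 : lw != 0.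
  rewrite lead_coef_eq0; have := wronsk_neq0; apply: contraNneq => /polyP H; apply/eqP/polyP=> i.
  by have := H i; rewrite coef_map !coef0 => /eqP; rewrite intr_eq0 => /eqP.
have [PV [pPV [e e0 EPV]]] := rat_prim (critV_Crat lw0 Ecs) (critV_neq0 cs).
have [bs Ebs] := closed_field_poly_normal (critV cs).
have pre (b : algC) : exists L : seq algC, forall x, gC x != 0 -> phi x = b -> x \in L.
  have [L EL] := closed_field_poly_normal (pZ f - b *: pZ g); exists L => x gx Ex.
  have rx : root (pZ f - b *: pZ g) x.
    by rewrite /root hornerD hornerN hornerZ -/(fC x) -/(gC x) -Ex divfK // subrr.
  by move: rx; rewrite EL rootZ ?lead_coef_eq0 ?map_sub_neq0 // root_prod_XsubC.
have [L1 HL1] : exists L : seq algC, forall x b, b \in bs -> gC x != 0 -> phi x = b -> x \in L.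
  elim: bs {Ebs} => [|b bs [L IH]]; first by exists [::].
  have [L' H'] := pre b; exists (L' ++ L) => x b'; rewrite inE mem_cat => /predU1P[-> gx Ex|bin gx Ex].
    by rewrite H'.
  by rewrite (IH x b' bin gx Ex) orbT.
have [N1 H1] := list_large L1.
have [gs0 gs0P] := boolp.choice conj_reps_exists.
have [N2 H2] := list_large [seq (s : autC) b | b <- x0, s <- gs0 b].
have [N3 H3] := list_large cs.
have [N4 H4] := unit_large lw0.
have [N5 H5] := unit_large e0.
have [K K0 HK] := height_T x0 rm.
pose M := (size PV + (size cs).+1)%N.
have szM : (size PV <= M.+1)%N by rewrite leqW // leq_addr.
(* With n conjugates the weighted norm of PV(b) is at most [N6]^n, to be compared with p^n. *)
pose N6 := (l1 PV * K ^ M)%N.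
exists (N1 + N2 + N3 + N4 + N5 + N6)%N => p pp lt v.
have {}H1 := H1 p pp ltac:(lia) v. have {}H2 := H2 p pp ltac:(lia) v.
have {}H3 := H3 p pp ltac:(lia) v. have [Olw rlw] := H4 p pp ltac:(lia) v.
have [Oe re] := H5 p pp ltac:(lia) v. have lt6 : (N6 < p)%N by lia.
have Ocs c : c \in cs -> pO v c by move=> cin; have [] := H3 c c cin cin.
elim=> [|n IH] x.
  move=> [b bB [t ->]] s s' H; have := inertia_P1cong pp H.
  have [s1 s1g E1] := conj_repsP (gs0P b) (s \o t); have [s2 s2g E2] := conj_repsP (gs0P b) (s' \o t).
  rewrite /= in E1 E2; rewrite E1 E2 => C.
  have m1 : s1 b \in [seq (s : autC) b | b <- x0, s <- gs0 b] by apply/allpairsPdep; exists b, s1.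
  have m2 : s2 b \in [seq (s : autC) b | b <- x0, s <- gs0 b] by apply/allpairsPdep; exists b, s2.
  have [O1 inj] := H2 _ _ m1 m2; case: C => [[_ _ E]|[]//]; exact: inj.
move=> [gx Tb] s s' H; set b := phi x in Tb.
have ab := abT (n := n.+1) (conj gx Tb : inT f g x0 n.+1 x).
have abb := abT Tb.
have gb : gen x b by apply: gen_phi.
have itb := IH _ Tb.
have Esb : s b = s' b by apply: itb => y ay gy; apply: H => //; apply: gen_trans gb gy.
apply: contrapT => /eqP ne.
(* Commutativity enters here: the pair (s, s') stays in the same inertia class after composition
   with any t. *)
have cong (t : autC) : P1cong v (t (s x)) (t (s' x)).
  apply: (inertia_P1cong (s := t \o s) (s' := t \o s')) => //= y ay gy.
  by rewrite !(gen_abel ab t _ gy); apply: H; [apply: allO_aut|apply: gen_aut].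
(* every conjugate of b is the image of two distinct congruent points *)
have conjb (t : autC) : pO v (nw v (t b) ^+ (size cs).+1 * (critV cs).[t b]) /\
    pr v (nw v (t b) ^+ (size cs).+1 * (critV cs).[t b]) = 0.
  pose t' := (t \o algC_invaut s : autC).
  have Et : t b = phi (t' (s x)) by rewrite /t' /= algC_autK -aut_phi.
  have Et' : t b = phi (t' (s' x)).
    by rewrite -!aut_phi /t' /= -/b -Esb algC_autK.
  have ulw : unitv v lw by apply: unitv_pr.
  have ne' : t' (s x) != t' (s' x) by apply: contraNneq ne => /fmorph_inj ->.
  have g1 : gC (t' (s x)) != 0 by do 2!apply: aut_gC_neq0.
  have g2 : gC (t' (s' x)) != 0 by do 2!apply: aut_gC_neq0.
  rewrite Et; apply: (critV_cong Ecs pp Ocs ulw ne' g1 g2); first by rewrite -Et.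
  exact: cong.
have conjPV (t : autC) : pr v (nw v (t b) ^+ M * (pZ PV).[t b]) = 0.
  have [O1 z1] := conjb t; rewrite EPV hornerZ /M exprD.
  have -> : nw v (t b) ^+ size PV * nw v (t b) ^+ (size cs).+1 * (e * (critV cs).[t b]) =
    nw v (t b) ^+ size PV * e * (nw v (t b) ^+ (size cs).+1 * (critV cs).[t b]) by ring.
  rewrite prME // ?z1 ?mulr0 //; apply: OM => //; apply: OX; exact: nwO.
have [Bs HB] := denominators b.
have divPV (t : autC) : pO v (nw v (t b) ^+ M * (pZ PV).[t b] / p%:R).
  have [intB exB] := HB t; have [B BB good] := exB _ v pp.
  have [a1 a2] := intB B BB; have [b1 b2] := (HB idfun).1 B BB.
  have [OT /(_ good) UT] := denominator_nw (a1 _ pp v) (a2 _ pp v).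
  pose y := (pZ B).[b] ^+ M * (pZ PV).[b].
  have yE (t' : autC) : t' y = ((pZ B).[t' b] / nw v (t' b)) ^+ M * (nw v (t' b) ^+ M * (pZ PV).[t' b]).
    by rewrite rmorphM rmorphXn /= !aut_horner_pZ mulrA -exprMn divfK // nw_neq0.
  have gy : gen b y.
    by apply: genM; [apply: genX|]; apply: gen_horner; apply: gen_refl.
  have ay : allO y.
    have -> : y = \sum_(i < M.+1) (PV`_i)%:~R * ((b * (pZ B).[b]) ^+ i * (pZ B).[b] ^+ (M - i)).
      rewrite /y (@horner_intr_wide _ PV _ M.+1) // mulr_sumr.
      apply: eq_bigr => i _; have le : (i <= M)%N by rewrite -ltnS.
      by rewrite mulrCA [(b * _) ^+ i]exprMn (expr_split _ le); congr (_ * _); rewrite mulrC mulrA [RHS]mulrAC.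
    elim/big_ind: _ => [||i _]; [exact: allO0|exact: allOD|].
    by apply: allOM; [exact: allO_int|apply: allOM; apply: allOX].
  have z (t' : autC) : pr v (t' y) = 0.
    have [intB' _] := HB t'; have [c1 c2] := intB' B BB.
    have [OT' _] := denominator_nw (c1 _ pp v) (c2 _ pp v).
    rewrite yE prME ?conjPV ?mulr0 //; first exact: OX.
    exact: hom_eval_O.
  have [gsb gsbP] := conj_reps_exists b.
  have := unramified_div pp gsbP itb (allO_aut t ay) (gen_aut abb t gy) _.
  move=> /(_ (fun s => z (s \o t : autC))); rewrite yE.
  set T := (pZ B).[t b] / _ in OT UT *; move=> h.
  have -> : nw v (t b) ^+ M * (pZ PV).[t b] / p%:R = (T ^+ M)^-1 * (T ^+ M * (nw v (t b) ^+ M * (pZ PV).[t b]) / p%:R).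
    by rewrite -[in RHS](mulrA (T ^+ M)) mulKf // expf_neq0 //; case: UT.
  by apply: OM => //; apply: unitvO; apply: unitvV; apply: unitvX.
have [gsb gsbP] := conj_reps_exists b.
have [a la] := lcz_exists gsbP (@gen_refl b).
have [a0 _] := la.
have loc l (w : place l) : prime l -> exists2 U, unitv w U &
   a ^+ M * \prod_(t <- gsb) (t : autC) (pZ PV).[b] = U * \prod_(t <- gsb) (nw w ((t : autC) b) ^+ M * (pZ PV).[(t : autC) b]).
  move=> pl; exists ((a / \prod_(t <- gsb) nw w ((t : autC) b)) ^+ M); first by apply: unitvX; apply: lcz_local.
  rewrite big_split /= prodrXl mulrA -exprMn divfK; last first.
    by rewrite prodf_seq_neq0; apply/allP => t _; apply: nw_neq0.
  by congr (_ * _); apply: eq_bigr => t _; rewrite aut_horner_pZ.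
have PVb : (pZ PV).[b] = 0.
  apply: (@norm_vanish b gsb p 1 _ (a ^+ M) gsbP pp).
  - by apply: gen_horner; apply: gen_refl.
  - have /intrP[m ->] := lcz_int la; by rewrite rpredX // rpred_int.
  - by rewrite expf_neq0.
  - move=> l w pl _; have [U uU ->] := loc l w pl; apply: OM; first by case: uU.
    by apply: (subring_set_prod (pOsub w)) => t _; apply: hom_eval_O.
  - exists v; have [U uU ->] := loc _ v pp; rewrite -mulrA mul1n; apply: OM; first by case: uU.
    have -> : p%:R ^+ size gsb = \prod_(t <- gsb) (p%:R : algC).
      by rewrite big_const_seq count_predT iter_mulr_1.
    by rewrite -prodf_div; apply: (subring_set_prod (pOsub v)) => t _; apply: divPV.
  - rewrite mul1n normrX.
    apply: (@le_lt_trans _ _ ((l1 PV)%:R ^+ size gsb * mahler gsb b a ^+ M)).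
      rewrite /mahler exprMn [X in _ <= X]mulrCA ler_wpM2l ?exprn_ge0 //.
      have -> : (l1 PV)%:R ^+ size gsb = \prod_(t <- gsb) (l1 PV)%:R :> algC.
        by rewrite big_const_seq count_predT iter_mulr_1.
      rewrite -prodrXl -big_split /=; apply: ler_prod => t _; rewrite normr_ge0 /= aut_horner_pZ.
      exact: l1_bound_mx.
    apply: (@le_lt_trans _ _ ((l1 PV)%:R ^+ size gsb * (K%:R ^+ size gsb) ^+ M)).
      rewrite ler_wpM2l ?exprn_ge0 ?ler0n // lerXn2r ?nnegrE ?exprn_ge0 ?mahler_ge0 ?ler0n //.
      exact: HK Tb _ _ _ gsbP (@gen_refl b) la.
    rewrite exprAC -exprMn -natrX -natrM -/N6.
    by rewrite ltr_pXn2r ?nnegrE ?ler0n ?(conj_reps_pos gsbP) // ltr_nat.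
have bbs (t : autC) : t b \in bs.
  have : root (critV cs) (t b).
    have := congr1 t PVb; rewrite rmorph0 aut_horner_pZ EPV hornerZ => /eqP.
    by rewrite mulf_eq0 (negPf e0).
  by rewrite Ebs rootZ ?lead_coef_eq0 ?critV_neq0 // root_prod_XsubC.
have m1 : s x \in L1 by apply: (HL1 _ (s b)); rewrite ?aut_gC_neq0 // -aut_phi.
have m2 : s' x \in L1 by apply: (HL1 _ (s b)); rewrite ?aut_gC_neq0 // Esb -aut_phi.
have [O1 inj] := H1 _ _ m1 m2.
case: (inertia_P1cong pp H) => [[_ _ E]|[]//].
by case/eqP: ne; apply: inj.
Qed.
End FiniteRamification.

(** A congruence modulo p itself, not only modulo the maximal ideal of [v], stated in each affine
    chart where the point is integral. *)
Definition frob_cong p (v : place p) (sg : autC) (x : algC) : Prop :=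
  (pO v x -> pO v ((sg x - x ^+ p) / p%:R)) /\
  (x != 0 -> pO v x^-1 -> pO v (((sg x)^-1 - x^-1 ^+ p) / p%:R)).

(** On Q(gam) there are only finitely many automorphisms. If each of them failed at some integer,
    these finitely many integers would contradict [frobenius_exists]. *)
Lemma frobenius_all p (v : place p) (gam : algC) : prime p ->
  exists sg : autC, forall y, allO y -> gen gam y -> pr v (sg y) = pr v y ^+ p.
Proof.
move=> pp; have [gs gsP] := conj_reps_exists gam.
apply: contrapT => nex.
have bad (s : autC) : exists y, [/\ allO y, gen gam y & pr v (s y) <> pr v y ^+ p].
  apply: contrapT => ny; apply: nex; exists s => y ay gy; apply: contrapT => ne.
  by apply: ny; exists y.
have [ys ysP] := boolp.choice bad.
have [sg Hsg] : exists sg : autC, forall y, y \in [seq ys s | s <- gs] -> pr v (sg y) = pr v y ^+ p.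
  apply: (frobenius_exists v pp gsP) => y /mapP[s _ ->]; by have [] := ysP s.
have [s sgs E] := conj_repsP gsP sg; have [_ gy []] := ysP s.
by rewrite -(gy _ _ E); apply: Hsg; apply: map_f.
Qed.

(** With integral coordinates (c : b) of x, the integer b^p sigma(c) - sigma(b) c^p reduces to 0
    under every automorphism, since sigma commutes with all of them on Q(gam). It is then divisible
    by p by [unramified_div], and a coordinate that is a unit is divided out. *)
Lemma frobenius_cong p (v : place p) (gam : algC) : prime p -> abel gam -> inertia_trivial v gam ->
  exists sg : autC, forall x, gen gam x -> forall s : autC, frob_cong v sg (s x).
Proof.
move=> pp ab it; have [gs gsP] := conj_reps_exists gam.
have [sg Hsg] := frobenius_all v gam pp; exists sg => x gx s.
have [Bs HB] := denominators x.
have gB B : gen gam (pZ B).[x] by apply: gen_horner.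
have gxB B : gen gam (x * (pZ B).[x]) by apply: genM.
have aB B : B \in Bs -> allO (pZ B).[x] by move=> BB; have [] := (HB idfun).1 B BB.
have axB B : B \in Bs -> allO (x * (pZ B).[x]) by move=> BB; have [] := (HB idfun).1 B BB.
have fB (t : autC) B : B \in Bs -> pr v (sg (t (pZ B).[x])) = pr v (t (pZ B).[x]) ^+ p.
  by move=> BB; apply: Hsg; [apply/allO_aut/aB|apply: gen_aut].
have fxB (t : autC) B : B \in Bs -> pr v (sg (t (x * (pZ B).[x]))) = pr v (t (x * (pZ B).[x])) ^+ p.
  by move=> BB; apply: Hsg; [apply/allO_aut/axB|apply: gen_aut].
have [_ /(_ p v pp) [B BB good]] := HB s.
pose b := (pZ B).[x]; pose c := x * b.
pose y := b ^+ p * sg c - sg b * c ^+ p.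
have ay : allO y.
  apply: allOB; apply: allOM; do ?[apply: allOX|apply: allO_aut]; by [apply: aB|apply: axB].
have gy : gen gam y.
  have g1 := gB B; have g2 := gxB B.
  by apply: genB; apply: genM; do ?[apply: genX|apply: gen_aut].
have Ob (t : autC) : pO v (t b) by apply: allO_aut (aB _ BB) _ pp _.
have Oc (t : autC) : pO v (t c) by apply: allO_aut (axB _ BB) _ pp _.
have Osb (t : autC) : pO v (sg (t b)) by apply: (Ob (sg \o t : autC)).
have Osc (t : autC) : pO v (sg (t c)) by apply: (Oc (sg \o t : autC)).
have yE (t : autC) : t y = t b ^+ p * sg (t c) - sg (t b) * t c ^+ p.
  have E1 : t (sg b) = sg (t b) by exact: (gen_abel ab t sg (gB B)).
  have E2 : t (sg c) = sg (t c) by exact: (gen_abel ab t sg (gxB B)).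
  by rewrite /y rmorphB [t (b ^+ p * _)]rmorphM [t (sg b * _)]rmorphM E1 E2 !(rmorphXn t).
have z (t : autC) : pr v (t y) = 0.
  rewrite yE prBE; try by apply: OM => //; apply: OX.
  rewrite !prME //; try exact: OX.
  by rewrite !prXE // fB // fxB // subrr.
have := unramified_div pp gsP it (allO_aut s ay) (gen_aut ab s gy) (fun t => z (t \o s : autC)).
rewrite yE => D.
have sc : s c = s x * s b by rewrite rmorphM.
have sgc : sg (s c) = sg (s x) * sg (s b) by rewrite sc rmorphM.
rewrite -!aut_horner_pZ -/b -sc in good.
split=> [Ox|x0 Oi].
  have ub : unitv v (s b).
    apply: unitv_pr => //; case: good => // nz.
    by apply: contraNneq nz => E; rewrite sc prME // E mulr0.
  have ub' : unitv v (sg (s b)).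
    by apply: unitv_pr => //; rewrite fB // expf_neq0 // pr_unitv.
  have [b0 _ _] := ub; have [b0' _ _] := ub'.
  have -> : (sg (s x) - s x ^+ p) / p%:R =
    (s b ^+ p * sg (s b))^-1 * ((s b ^+ p * sg (s c) - sg (s b) * s c ^+ p) / p%:R).
    rewrite sgc sc exprMn [RHS]mulrA; congr (_ / _).
    have sbp : s b ^+ p != 0 by rewrite expf_neq0.
    by field; rewrite sbp b0'.
  by apply: OM => //; apply: unitvO; apply: unitvV; apply: unitvM => //; apply: unitvX.
have ncz : pr v (s c) != 0.
  case: good => // nz; apply/eqP => E.
  have : pr v (s b) = 0.
    have -> : s b = s c * (s x)^-1 by rewrite sc mulrAC divff // mul1r.
    by rewrite prME // E mul0r.
  by move/eqP; rewrite (negPf nz).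
have uc : unitv v (s c) by apply: unitv_pr.
have uc' : unitv v (sg (s c)).
  by apply: unitv_pr => //; rewrite fxB // expf_neq0 // pr_unitv.
have [c0 _ _] := uc; have [c0' _ _] := uc'.
have b0 : s b != 0 by apply: contraNneq c0 => E; rewrite sc E mulr0.
have b0' : sg (s b) != 0 by rewrite fmorph_eq0.
have x0' : sg (s x) != 0 by rewrite fmorph_eq0.
have -> : ((sg (s x))^-1 - (s x)^-1 ^+ p) / p%:R =
  - ((s c ^+ p * sg (s c))^-1 * ((s b ^+ p * sg (s c) - sg (s b) * s c ^+ p) / p%:R)).
  rewrite sgc sc !exprMn exprVn [X in _ = - X]mulrA -[RHS]mulNr; congr (_ / _).
  have sbp : s b ^+ p != 0 by rewrite expf_neq0.
  have sxp : s x ^+ p != 0 by rewrite expf_neq0.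
  by field; rewrite ?sbp ?sxp ?b0' ?x0'.
by apply: ON; apply: OM => //; apply: unitvO; apply: unitvV; apply: unitvM => //; apply: unitvX.
Qed.

(** * The auxiliary polynomial *)

Definition hev d (A : comNzRingType) (P : {poly int}) (a b : A) : A :=
  \sum_(i < d.+1) (P`_i)%:~R * a ^+ i * b ^+ (d - i).

Lemma hev_scale d (A : comNzRingType) P (e a b : A) :
  hev d P (e * a) (e * b) = e ^+ d * hev d P a b.
Proof.
rewrite /hev mulr_sumr; apply: eq_bigr => i _.
have le : (i <= d)%N by rewrite -ltnS.
by rewrite !exprMn (expr_split e le); ring.
Qed.

Lemma hev_rmorph d (A B : comNzRingType) (h : {rmorphism A -> B}) P a b :
  h (hev d P a b) = hev d P (h a) (h b).
Proof.
rewrite /hev rmorph_sum; apply: eq_bigr => i _.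
by rewrite !rmorphM !rmorphXn /= rmorph_int.
Qed.

Lemma hev_nuw d l (v : place l) (P : {poly int}) x : (size P <= d.+1)%N ->
  hev d P (nu v x) (nw v x) = nw v x ^+ d * (pZ P).[x].
Proof.
move=> sz; rewrite (horner_intr_wide _ sz) mulr_sumr; apply: eq_bigr => i _.
have le : (i <= d)%N by rewrite -ltnS.
by rewrite nuE exprMn (expr_split (nw v x) le); ring.
Qed.

Section Digits.
Variable d : nat.
Definition dig (i k : nat) : nat := ((i %/ d ^ k) %% d)%N.
Lemma dig_lt i k : (0 < d)%N -> (dig i k <= d.-1)%N.
Proof. by move=> d0; rewrite -ltnS prednK // ltn_mod. Qed.
End Digits.

Section Basis.
Variables (f g : {poly int}) (d : nat).
Hypothesis d2 : (2 <= d)%N.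
Let d0 : (0 < d)%N. Proof. exact: ltnW. Qed.

Definition hstep (A : comNzRingType) (q : A * A) : A * A := (hev d f q.1 q.2, hev d g q.1 q.2).
Definition hiter (A : comNzRingType) k (q : A * A) : A * A := iter k (@hstep A) q.

Lemma hiterS (A : comNzRingType) k (q : A * A) : hiter k.+1 q = hstep (hiter k q).
Proof. by []. Qed.

(** A form of degree d^m - 1 attached to the base d digits of i. The exponent of each iterate stays
    below d, so the archimedean cost grows with m and not with i. *)
Definition Ebas (A : comNzRingType) (m i : nat) (q : A * A) : A :=
  \prod_(k < m) ((hiter k q).1 ^+ dig d i k * (hiter k q).2 ^+ (d.-1 - dig d i k)).

Lemma hiter_rmorph (A B : comNzRingType) (h : {rmorphism A -> B}) k a b :
  hiter k (h a, h b) = (h (hiter k (a, b)).1, h (hiter k (a, b)).2).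
Proof. by elim: k => //= k; rewrite /hiter => ->; rewrite /hstep /= !hev_rmorph. Qed.

Lemma Ebas_rmorph (A B : comNzRingType) (h : {rmorphism A -> B}) m i a b :
  Ebas m i (h a, h b) = h (Ebas m i (a, b)).
Proof.
by rewrite /Ebas rmorph_prod; apply: eq_bigr => k _; rewrite hiter_rmorph rmorphM !rmorphXn.
Qed.

Lemma size_hev P (a b : {poly int}) n : (size a <= n.+1)%N -> (size b <= n.+1)%N ->
  (size (hev d P a b) <= (d * n).+1)%N.
Proof.
move=> ha hb; apply: (leq_trans (size_sum _ _ _)); apply/bigmax_leqP => i _.
have le : (i <= d)%N by rewrite -ltnS.
have sX (q : {poly int}) k : (size q <= n.+1)%N -> (size (q ^+ k) <= (k * n).+1)%N.
  move=> hq; apply: (leq_trans (size_poly_exp_leq _ _)); rewrite ltnS mulnC leq_mul2l; lia.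
apply: (leq_trans (size_polyMleq _ _)).
have s1 : (size ((P`_i)%:~R * a ^+ i)%R <= (i * n).+1)%N.
  rewrite -[_%:~R](rmorph_int polyC) mul_polyC; apply: leq_trans (size_scale_leq _ _) _; exact: sX.
have s2 := sX b (d - i)%N hb.
have E : (i * n + (d - i) * n = d * n)%N by rewrite -mulnDl subnKC.
by rewrite -subn1 leq_subLR add1n (leq_trans (leq_add s1 s2)) // addSn addnS E.
Qed.

Lemma size_hiter k (q : {poly int} * {poly int}) : (size q.1 <= 2)%N -> (size q.2 <= 2)%N ->
  (size (hiter k q).1 <= (d ^ k).+1)%N /\ (size (hiter k q).2 <= (d ^ k).+1)%N.
Proof.
move=> h1 h2; elim: k => [|k [IH1 IH2]]; first by rewrite expn0.
by rewrite hiterS /hstep expnS; split; apply: size_hev.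
Qed.

Lemma size_Ebas m i (q : {poly int} * {poly int}) : (size q.1 <= 2)%N -> (size q.2 <= 2)%N ->
  (size (Ebas m i q) <= d ^ m)%N.
Proof.
move=> h1 h2; elim: m => [|m IH]; rewrite /Ebas; first by rewrite big_ord0 size_poly1 expn0.
rewrite big_ord_recr /=; apply: leq_trans (size_polyMleq _ _) _.
have [s1 s2] := size_hiter m h1 h2.
have sX (r : {poly int}) k : (size r <= (d ^ m).+1)%N -> (size (r ^+ k) <= (k * d ^ m).+1)%N.
  move=> hq; apply: (leq_trans (size_poly_exp_leq _ _)); rewrite ltnS mulnC leq_mul2l; lia.
have t1 := sX _ (dig d i m) s1; have t2 := sX _ (d.-1 - dig d i m)%N s2.
have E : (dig d i m * d ^ m + (d.-1 - dig d i m) * d ^ m = d.-1 * d ^ m)%N.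
  by rewrite -mulnDl subnKC // dig_lt.
have E2 : (d ^ m.+1 = d ^ m + d.-1 * d ^ m)%N by rewrite expnS -{1}(prednK d0) mulSn.
rewrite -subn1 leq_subLR add1n E2 -addnS leq_add //.
apply: leq_trans (size_polyMleq _ _) _.
by rewrite -subn1 leq_subLR add1n (leq_trans (leq_add t1 t2)) // addSn addnS E.
Qed.
End Basis.

(** Siegel's lemma: two vectors with entries in [0, B) have the same image modulo M, and their
    difference is small. *)
Lemma pigeonhole_lattice (I K : finType) (L : (I -> int) -> K -> int) (B M : nat) :
  (0 < M)%N -> (M ^ #|K| < B ^ #|I|)%N ->
  (forall a b k, L (fun i => a i - b i) k = L a k - L b k) ->
  exists c : I -> int, [/\ exists i, c i != 0, forall i, (absz (c i) < B)%N &
    forall k, (M %| L c k)%Z].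
Proof.
move=> M0 lt Lin.
pose toZ (a : {ffun I -> 'I_B}) (i : I) : int := a i.
have Mpos (z : int) : (absz (z %% M)%Z < M)%N.
  have Mz : (M : int) != 0 by rewrite eqz_nat -lt0n.
  have := ltz_mod z Mz; have := modz_ge0 z Mz; lia.
pose red (a : {ffun I -> 'I_B}) : {ffun K -> 'I_M} := [ffun k => Ordinal (Mpos (L (toZ a) k))].
have [inj|ninj] := pselect (injective red).
  by have := leq_card _ inj; rewrite !card_ffun !card_ord leqNgt lt.
have [a [b [E ne]]] : exists a b, red a = red b /\ a <> b.
  apply: contrapT => nex; apply: ninj => a b E; apply: contrapT => ne; apply: nex; by exists a, b.
exists (fun i => toZ a i - toZ b i); split.
- apply: contrapT => nex; apply: ne; apply/ffunP=> i; apply: val_inj => /=.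
  apply: contrapT => ni; apply: nex; exists i; apply/negP => /eqP; rewrite /toZ; lia.
- by move=> i; rewrite /toZ; have := ltn_ord (a i); have := ltn_ord (b i); lia.
- move=> k; rewrite Lin -eqz_mod_dvd.
  have := congr1 (fun h : {ffun K -> 'I_M} => (h k : nat)) E; rewrite !ffunE /= => Ek.
  have Mz : (M : int) != 0 by rewrite eqz_nat -lt0n.
  have := modz_ge0 (L (toZ a) k) Mz; have := modz_ge0 (L (toZ b) k) Mz.
  by move: Ek => /= Ek h1 h2; apply/eqP; lia.
Qed.

Section Auxiliary.
Variables (f g : {poly int}) (d R : nat).
Hypothesis rm : ratmap f g d R.
Let d2 := rm_d rm.
Let d0 : (0 < d)%N. Proof. exact: ltnW. Qed.
Local Notation fC := (fC f).
Local Notation gC := (gC g).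
Local Notation phi := (phi f g).

Definition ebas (m i : nat) (x : algC) : algC := \prod_(k < m) (iter k phi x) ^+ dig d i k.

Section AuxLocal.
Variables (l : nat) (v : place l) (m : nat) (x : algC).
Hypothesis orb : forall k, (k < m)%N -> gC (iter k phi x) != 0.
Local Notation u_ k := (nu v (iter k phi x)).
Local Notation w_ k := (nw v (iter k phi x)).

Lemma ebas_local i : \prod_(k < m) w_ k ^+ d.-1 * ebas m i x =
  \prod_(k < m) (u_ k ^+ dig d i k * w_ k ^+ (d.-1 - dig d i k)).
Proof.
rewrite /ebas -big_split /=; apply: eq_bigr => k _.
by rewrite nuE exprMn (expr_split _ (dig_lt i k d0)); ring.
Qed.

Fixpoint eta k : algC :=
  if k is k'.+1 then eta k' ^+ d * eps f g d v (iter k' phi x) else 1.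

Lemma eta_unit k : prime l -> ~~ (l %| R)%N -> (k <= m)%N -> unitv v (eta k).
Proof.
move=> pl nR; elim: k => [_|k IH lt]; first exact: unitv1.
apply: unitvM; first by apply/unitvX/IH/ltnW.
by apply: (eps_unit rm) => //; apply: orb.
Qed.

Lemma hiter_local k : (k <= m)%N -> hiter f g d k (u_ 0, w_ 0) = (eta k * u_ k, eta k * w_ k).
Proof.
elim: k => [_|k IH lt]; first by rewrite /= !mul1r.
rewrite hiterS IH ?(ltnW lt) // /hstep.
rewrite [(_, _).1]/= [(_, _).2]/= !hev_scale.
rewrite !hev_nuw ?(rm_f rm) ?(rm_g rm) //.
have g0 := orb lt.
rewrite -/(fC _) -/(gC _) (eps_f f d v g0) (eps_g f g d v) iterS /=.
by congr (_, _); rewrite mulrA.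
Qed.

Definition upsilon : algC := \prod_(k < m) eta k ^+ d.-1.

Lemma Ebas_local i : Ebas f g d m i (u_ 0, w_ 0) =
  upsilon * \prod_(k < m) (u_ k ^+ dig d i k * w_ k ^+ (d.-1 - dig d i k)).
Proof.
rewrite /Ebas /upsilon -big_split /=; apply: eq_bigr => k _.
rewrite hiter_local ?(ltnW (ltn_ord k)) //= !exprMn (expr_split _ (dig_lt i k d0)); ring.
Qed.
End AuxLocal.

Section AuxPoly.
Variables (p J m : nat).
Local Notation D := (d ^ m)%N.
Implicit Types (c : 'I_D * 'I_J -> int) (q : {poly int} * {poly int}).
Definition ev (xi : algC) : {rmorphism {poly int} -> algC} := horner_eval xi \o pZ.
Lemma evE xi P : ev xi P = (pZ P).[xi]. Proof. by []. Qed.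

Definition Spol c q (l : 'I_J) : {poly int} := \sum_(i < D) c (i, l) *: Ebas f g d m i q.
(** The coefficient of z^i after the substitution y = X^p + z in the polynomial in y with
    coefficients [Spol]. *)
Definition Cpol c q (i : nat) : {poly int} :=
  \sum_(l < J) (Spol c q l * 'X^(p * (l - i))) *+ 'C(l, i).
Definition Haux c (x y : algC) : algC :=
  \sum_(i < D) \sum_(l < J) (c (i, l))%:~R * ebas m i x * y ^+ l.

Lemma Cpol_expand c q (xi z : algC) :
  \sum_(l < J) ev xi (Spol c q l) * (xi ^+ p + z) ^+ l = \sum_(i < J) ev xi (Cpol c q i) * z ^+ i.
Proof.
pose F (l i : 'I_J) := ev xi (Spol c q l) * (xi ^+ p) ^+ (l - i) * z ^+ i *+ 'C(l, i).
transitivity (\sum_(l < J) \sum_(i < J) F l i).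
  apply: eq_bigr => l _; rewrite exprDn mulr_sumr.
  rewrite (big_ord_widen J (fun i => ev xi (Spol c q l) * ((xi ^+ p) ^+ (l - i) * z ^+ i *+ 'C(l, i)))) //.
  rewrite big_mkcond /=; apply: eq_bigr => i _; rewrite /F ltnS.
  by case: leqP => le; rewrite ?mulrnAr ?mulrA // bin_small // mulr0n.
rewrite exchange_big; apply: eq_bigr => i _; rewrite /Cpol (rmorph_sum (ev xi)) mulr_suml.
apply: eq_bigr => l _; rewrite /F (rmorphMn (ev xi)) (rmorphM (ev xi)) mulrnAl; congr (_ * _ * _ *+ _).
by rewrite evE map_polyXn hornerXn exprM.
Qed.

Lemma size_Cpol c q i : (size q.1 <= 2)%N -> (size q.2 <= 2)%N ->
  (size (Cpol c q i) <= D + p * J)%N.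
Proof.
move=> h1 h2; apply: (leq_trans (size_sum _ _ _)); apply/bigmax_leqP => l _.
rewrite -mulr_natr -polyC_natr mulrC mul_polyC; apply: leq_trans (size_scale_leq _ _) _.
have sS : (size (Spol c q l) <= D)%N.
  apply: (leq_trans (size_sum _ _ _)); apply/bigmax_leqP => k _.
  by apply: leq_trans (size_scale_leq _ _) _; apply: size_Ebas.
have [->|nz] := eqVneq (Spol c q l) 0; first by rewrite mul0r size_poly0.
rewrite size_mulXn // addnC leq_add // leq_mul2l; have := ltn_ord l; lia.
Qed.

Lemma Cpol_linear a b q i : Cpol (fun k => a k - b k) q i = Cpol a q i - Cpol b q i.
Proof.
rewrite /Cpol -sumrB; apply: eq_bigr => l _; rewrite -mulrnBl -mulrBl; congr (_ * _ *+ _).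
by rewrite /Spol -sumrB; apply: eq_bigr => k _; rewrite scalerBl.
Qed.

Definition q1 : {poly int} * {poly int} := ('X, 1).
Definition q2 : {poly int} * {poly int} := (1, 'X).
(** In the chart at infinity the exponent l of y becomes J - 1 - l, which reverses the second
    index. *)
Definition crev c : 'I_D * 'I_J -> int := fun k => c (k.1, rev_ord k.2).

(** When z is a multiple of p, the terms with i >= j are divisible by p^j anyway, so only the first
    j coefficients are constrained. Both charts appear because conjugates of a point may be
    non-integral at [v]. *)
Definition aux_div c (j : nat) : Prop := forall i, (i < j)%N ->
  (forall k, (Posz (expn p j) %| (Cpol c q1 i)`_k)%Z) /\
  (forall k, (Posz (expn p j) %| (Cpol (crev c) q2 i)`_k)%Z).

Section AuxHloc.
Variables (l : nat) (v : place l) (c : 'I_D * 'I_J -> int) (x y : algC).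
Hypothesis orb : forall k, (k < m)%N -> gC (iter k phi x) != 0.
Local Notation u_ k := (nu v (iter k phi x)).
Local Notation w_ k := (nw v (iter k phi x)).

Definition Hhom : algC := \prod_(k < m) w_ k ^+ d.-1 * nw v y ^+ J.-1 * Haux c x y.

Lemma Hhom_E : Hhom = \sum_(i < D) \sum_(l < J) (c (i, l))%:~R *
  \prod_(k < m) (u_ k ^+ dig d i k * w_ k ^+ (d.-1 - dig d i k)) * (nu v y ^+ l * nw v y ^+ (J.-1 - l)).
Proof.
rewrite /Hhom /Haux mulr_sumr; apply: eq_bigr => i _; rewrite mulr_sumr; apply: eq_bigr => l' _.
have le : (l' <= J.-1)%N by have := ltn_ord l'; lia.
by rewrite -ebas_local nuE exprMn (expr_split (nw v y) le); ring.
Qed.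

Lemma Hhom_O : pO v Hhom.
Proof.
rewrite Hhom_E; apply: (subring_set_sum (pOsub v)) => i _; apply: (subring_set_sum (pOsub v)) => l' _.
apply: OM; [apply: OM; first exact: Oint|apply: OM; apply: OX; [exact: nuO|exact: nwO]].
by apply: (subring_set_prod (pOsub v)) => k _; apply: OM; apply: OX; [exact: nuO|exact: nwO].
Qed.

Lemma Hhom_Ebas : prime l -> ~~ (l %| R)%N -> exists2 U, unitv v U &
  Hhom = U * \sum_(l < J) (\sum_(i < D) (c (i, l))%:~R * Ebas f g d m i (u_ 0, w_ 0)) *
    (nu v y ^+ l * nw v y ^+ (J.-1 - l)).
Proof.
move=> pl nR; have uU : unitv v (upsilon v m x).
  rewrite /upsilon; elim/big_ind: _ => [||k _]; [exact: unitv1|exact: unitvM|].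
  by apply: unitvX; exact: (eta_unit v orb pl nR (ltnW (ltn_ord k))).
have [U0 _ _] := uU; exists (upsilon v m x)^-1; first exact: unitvV.
rewrite Hhom_E exchange_big mulr_sumr; apply: eq_bigr => l' _ /=.
rewrite mulr_suml mulr_sumr; apply: eq_bigr => i _.
rewrite (Ebas_local v orb); move: (\prod_(k < m) _) (upsilon v m x) U0 => P U0 nz.
by move: (c (i, l'))%:~R (nu v y ^+ l' * _) => a b; field.
Qed.
End AuxHloc.
End AuxPoly.
End Auxiliary.

Lemma O_horner_div l (v : place l) (P : {poly int}) (N : nat) x : (0 < N)%N ->
  (forall k, (Posz N %| P`_k)%Z) -> pO v x -> pO v ((pZ P).[x] / N%:R).
Proof.
move=> N0 dv Ox; rewrite (horner_intr_wide _ (leqnn _)) mulr_suml.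
apply: (subring_set_sum (pOsub v)) => i _; have /dvdzP[m ->] := dv i.
rewrite intrM -pmulrn mulrAC mulrAC -!mulrA; apply: OM; first exact: Oint.
rewrite mulrCA divff ?mulr1; last by rewrite pnatr_eq0 -lt0n.
exact: OX.
Qed.

Section Orbits.
Variables (f g : {poly int}) (x0 : seq algC).
Local Notation gC := (gC g).
Local Notation phi := (phi f g).

Lemma inT_iter n x k : (k <= n)%N -> inT f g x0 n x -> inT f g x0 (n - k) (iter k phi x).
Proof.
elim: k => [|k IH] lt Tx; first by rewrite subn0.
have := IH (ltnW lt) Tx; have -> : (n - k = (n - k.+1).+1)%N by lia.
by case.
Qed.

Lemma inT_orb n x k : (k < n)%N -> inT f g x0 n x -> gC (iter k phi x) != 0.
Proof.
move=> lt Tx; have := inT_iter (ltnW lt) Tx; have -> : (n - k = (n - k.+1).+1)%N by lia.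
by case.
Qed.

Lemma gen_iter_phi del x k : gen del x -> gen del (iter k phi x).
Proof. by move=> gx; elim: k => //= k IH; apply: gen_phi. Qed.

End Orbits.

Section AuxVanish.
Variables (f g : {poly int}) (d R : nat).
Hypothesis rm : ratmap f g d R.
Let d2 := rm_d rm.
Let d0 : (0 < d)%N. Proof. exact: ltnW. Qed.
Local Notation fC := (fC f).
Local Notation gC := (gC g).
Local Notation phi := (phi f g).
Variables (p J m j : nat).
Hypotheses (pp : prime p) (pR : ~~ (p %| R)%N) (J0 : (0 < J)%N).
Local Notation D := (d ^ m)%N.
Variable c : 'I_D * 'I_J -> int.
Hypothesis cdiv : @aux_div f g d p J m c j.
Local Notation Haux := (@Haux f g d J m c).

Lemma Cpol_sum_div (v : place p) (c' : 'I_D * 'I_J -> int) q xi z : pO v xi -> pO v z ->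
  (forall i k, (i < j)%N -> (Posz (expn p j) %| (@Cpol f g d p J m c' q i)`_k)%Z) ->
  pO v ((\sum_(l < J) ev xi (@Spol f g d J m c' q l) * (xi ^+ p + p%:R * z) ^+ l) / p%:R ^+ j).
Proof.
move=> Ox Oz H; rewrite Cpol_expand mulr_suml; apply: (subring_set_sum (pOsub v)) => i _.
have [lt|ge] := ltnP i j.
  rewrite mulrAC; apply: OM; last by apply: OX; apply: OM => //; apply: Onat.
  rewrite -natrX evE; apply: O_horner_div => //; first by rewrite expn_gt0 prime_gt0.
  by move=> k; apply: H.
rewrite -mulrA; apply: OM; first by rewrite evE; apply: O_horner.
have p0 : (p%:R : algC) != 0 by rewrite pnatr_eq0 -lt0n prime_gt0.
rewrite exprMn mulrAC; apply: OM; last exact: OX.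
rewrite (expr_split _ ge) mulfK ?expf_neq0 //; apply: OX; exact: Onat.
Qed.

Lemma Hhom_div (v : place p) (sg : autC) x :
  (forall k, (k < m)%N -> gC (iter k phi x) != 0) -> frob_cong v sg x ->
  pO v (@Hhom f g d J m p v c x (sg x) / p%:R ^+ j).
Proof.
move=> orb [fc1 fc2]; have [U uU ->] := Hhom_Ebas rm v c (sg x) orb pp pR.
rewrite -mulrA; apply: OM; first by case: uU.
have p0 : (p%:R : algC) != 0 by rewrite pnatr_eq0 -lt0n prime_gt0.
rewrite /=; case: (nuwP v x) => [Ox|nOx x0 Oi ri].
  have Oz := fc1 Ox; set z := (sg x - _) / _ in Oz.
  have yE : sg x = x ^+ p + p%:R * z by rewrite /z mulrCA divff // mulr1 addrC subrK.
  have Oy : pO v (sg x) by rewrite yE; apply: OD; [apply: OX|apply: OM => //; apply: Onat].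
  have -> : \sum_(l < J) (\sum_(i < D) (c (i, l))%:~R * Ebas f g d m i (x, 1)) *
      (nu v (sg x) ^+ l * nw v (sg x) ^+ (J.-1 - l)) =
      \sum_(l < J) ev x (@Spol f g d J m c q1 l) * (x ^+ p + p%:R * z) ^+ l.
    apply: eq_bigr => l _; rewrite -yE; case: nuwP => // _; rewrite expr1n mulr1; congr (_ * _).
    rewrite /Spol (rmorph_sum (ev x)); apply: eq_bigr => i _.
    rewrite -mul_polyC (rmorphM (ev x)); congr (_ * _); first by rewrite evE map_polyC hornerC.
    by rewrite -Ebas_rmorph !evE map_polyX hornerX rmorph1 hornerC.
  by apply: Cpol_sum_div => // i k lt; have [] := cdiv lt.
have sx0 : sg x != 0 by rewrite fmorph_eq0.
have Oz := fc2 x0 Oi; set z := ((sg x)^-1 - _) / _ in Oz.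
have yE : (sg x)^-1 = x^-1 ^+ p + p%:R * z by rewrite /z mulrCA divff // mulr1 addrC subrK.
have Oyi : pO v (sg x)^-1 by rewrite yE; apply: OD; [apply: OX|apply: OM => //; apply: Onat].
clearbody z.
have ryi : pr v (sg x)^-1 = 0.
  rewrite yE prDE ?prXE ?prME ?(pr_prime v (prime_gt0 pp)) ?mul0r ?addr0 ?ri ?expr0n ?(gtn_eqF (prime_gt0 pp)) //;
    try exact: Onat; try exact: OX.
  by apply: OM => //; apply: Onat.
have nOy : ~ pO v (sg x).
  move=> Oy; have : pr v (sg x * (sg x)^-1) = 1 by rewrite divff // pr1.
  by rewrite prME // ryi mulr0 => /esym/eqP; rewrite oner_eq0.
have -> : \sum_(l < J) (\sum_(i < D) (c (i, l))%:~R * Ebas f g d m i (1, x^-1)) *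
    (nu v (sg x) ^+ l * nw v (sg x) ^+ (J.-1 - l)) =
    \sum_(l < J) ev x^-1 (@Spol f g d J m (crev c) q2 l) * (x^-1 ^+ p + p%:R * z) ^+ l.
  rewrite (reindex_inj rev_ord_inj) /=; apply: eq_bigr => l _; rewrite -yE.
  case: (nuwP v (sg x)) => // _ _ _ _; rewrite expr1n mul1r.
  have -> : (J.-1 - (J - l.+1) = l)%N by have := ltn_ord l; lia.
  congr (_ * _); rewrite -[RHS]/(ev x^-1 _) /Spol (rmorph_sum (ev x^-1)); apply: eq_bigr => i _.
  rewrite -mul_polyC (rmorphM (ev x^-1)); congr (_ * _); first by rewrite evE map_polyC hornerC.
  by rewrite -Ebas_rmorph !evE map_polyX hornerX rmorph1 hornerC.
by apply: Cpol_sum_div => // i k lt; have [] := cdiv lt.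
Qed.

Lemma Haux_aut (s : autC) x y : s (Haux x y) = Haux (s x) (s y).
Proof.
rewrite /Haux rmorph_sum; apply: eq_bigr => i _; rewrite rmorph_sum; apply: eq_bigr => l _.
rewrite !rmorphM rmorphXn rmorph_int /ebas rmorph_prod /=; congr (_ * _ * _).
apply: eq_bigr => k _; rewrite rmorphXn; congr (_ ^+ _).
by elim: (k : nat) => //= k' IH; rewrite aut_phi IH.
Qed.

Variables (Bc : nat).
Hypothesis cB : forall k, (absz (c k) <= Bc)%N.

Lemma Haux_arch x y : `|Haux x y| <=
  (D * J * Bc)%:R * (\prod_(k < m) mx (iter k phi x) ^+ d.-1 * mx y ^+ J.-1).
Proof.
set Q := \prod_(k < m) _ * _ ^+ J.-1; have Q0 : 0 <= Q.
  by rewrite mulr_ge0 ?exprn_ge0 // prodr_ge0 // => k _; rewrite exprn_ge0.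
have -> : (D * J * Bc)%:R * Q = \sum_(i < D) \sum_(l < J) Bc%:R * Q.
  rewrite !sumr_const !card_ord !mulr_natl -!mulrnA; congr (_ *+ _); lia.
apply: (le_trans (ler_norm_sum _ _ _)); apply: ler_sum => i _.
apply: (le_trans (ler_norm_sum _ _ _)); apply: ler_sum => l _.
rewrite !normrM -mulrA; apply: ler_pM => //; first by rewrite mulr_ge0.
  by apply: le_trans (norm_absz _) _; rewrite ler_nat.
rewrite /Q; apply: ler_pM => //; last first.
  rewrite normrX; apply: (@le_trans _ _ (mx y ^+ l)); first by rewrite lerXn2r ?nnegrE.
  by rewrite ler_weXn2l //; have := ltn_ord l; lia.
rewrite /ebas normr_prod; apply: ler_prod => k _; rewrite normr_ge0 /= normrX.
apply: (@le_trans _ _ (mx (iter k phi x) ^+ dig d i k)); first by rewrite lerXn2r ?nnegrE.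
by rewrite ler_weXn2l // dig_lt.
Qed.

Variables (x0 : seq algC) (K : nat).
Hypothesis HK : forall n x, inT f g x0 n x ->
  forall del gs a, conj_reps del gs -> gen del x -> lcz gs x a ->
    mahler gs x a <= K%:R ^+ size gs.
Hypothesis bound : (D * J * Bc * K ^ (d.-1 * m + J.-1) < p ^ j)%N.

Lemma Haux_zero (v : place p) (sg : autC) n x : (m <= n)%N -> inT f g x0 n x -> abel x ->
  (forall s : autC, frob_cong v sg (s x)) -> Haux x (sg x) = 0.
Proof.
move=> mn Tx ab fc; have [gs gsP] := conj_reps_exists x.
have gx := @gen_refl x.
have la k : exists a, lcz gs (iter k phi x) a by apply: (lcz_exists gsP); apply: gen_iter_phi.
have [a_ la_] := boolp.choice la.
have a0_ k : a_ k != 0 by case: (la_ k).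
have iterA (s : autC) k : s (iter k phi x) = iter k phi (s x).
  by elim: k => //= k IH; rewrite aut_phi IH.
(* Clears the denominators of the iterates to the power d - 1 and of sigma x to the power J - 1;
   sigma x has the same conjugates as x, hence the same leading coefficient [a_ 0]. *)
pose A := \prod_(k < m) a_ k ^+ d.-1 * a_ 0%N ^+ J.-1.
have sgp (T : comNzRingType) (F : algC -> T) :
   \prod_(s <- gs) F ((s : autC) (sg x)) = \prod_(s <- gs) F ((s : autC) x).
  apply: (conj_reps_big gsP _ (F := fun s : autC => F (s x)) (h := fun s : autC => (s \o sg : autC))) => [s s' -> //|s s' /=].
  by rewrite !(ab _ sg) => /fmorph_inj.
have orb (s : autC) k : (k < m)%N -> gC (iter k phi (s x)) != 0.
  by move=> lt; rewrite -iterA; apply: aut_gC_neq0; apply: (inT_orb (n := n) _ Tx); lia.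
have loc l (w : place l) : prime l -> exists2 U, unitv w U &
   A * \prod_(s <- gs) (s : autC) (Haux x (sg x)) =
   U * \prod_(s <- gs) Hhom f g w c ((s : autC) x) ((s : autC) (sg x)).
  move=> pl; pose u_ k := a_ k / \prod_(s <- gs) nw w ((s : autC) (iter k phi x)).
  have uu k : unitv w (u_ k) by apply: lcz_local.
  exists (\prod_(k < m) u_ k ^+ d.-1 * u_ 0%N ^+ J.-1).
    apply: unitvM; last by apply: unitvX.
    by elim/big_ind: _ => [||k _]; [exact: unitv1|exact: unitvM|apply: unitvX].
  have aE k : a_ k = u_ k * \prod_(s <- gs) nw w ((s : autC) (iter k phi x)).
    by rewrite /u_ divfK // prodf_seq_neq0; apply/allP => s _; apply: nw_neq0.
  have -> : A = (\prod_(k < m) u_ k ^+ d.-1 * u_ 0%N ^+ J.-1) *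
     ((\prod_(s <- gs) \prod_(k < m) nw w (iter k phi ((s : autC) x)) ^+ d.-1) *
      \prod_(s <- gs) nw w ((s : autC) (sg x)) ^+ J.-1).
    rewrite /A (sgp _ (fun y => nw w y ^+ J.-1)) mulrACA; congr (_ * _); last first.
      by rewrite {1}aE exprMn prodrXl.
    rewrite exchange_big /= -big_split /=; apply: eq_bigr => k _.
    by rewrite {1}aE exprMn prodrXl; congr (_ * _ ^+ _); apply: eq_bigr => s _; rewrite iterA.
  rewrite -!mulrA; do 2!congr (_ * _); rewrite !mulrA -!big_split /=.
  by apply: eq_bigr => s _; rewrite Haux_aut.
apply: (@norm_vanish x gs p j _ A gsP pp).
- move=> u u' E; rewrite !Haux_aut E; congr (Haux _ _).
  by rewrite !(ab _ sg) E.
- have aQ k : a_ k \in Crat by have /intrP[i ->] := lcz_int (la_ k); rewrite rpred_int.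
  by rewrite rpredM ?rpredX // rpred_prod // => k _; rewrite rpredX.
- by rewrite mulf_neq0 ?expf_neq0 //; apply/prodf_neq0 => k _; rewrite expf_neq0.
- move=> l w pl _; have [U uU ->] := loc l w pl; apply: OM; first by case: uU.
  by apply: (subring_set_prod (pOsub w)) => s _; apply: (Hhom_O rm).
- exists v; have [U uU ->] := loc _ v pp; rewrite -mulrA; apply: OM; first by case: uU.
  have -> : p%:R ^+ (j * size gs) = \prod_(t <- gs) (p%:R ^+ j : algC).
    by rewrite big_const_seq count_predT iter_mulr_1 exprM.
  rewrite -prodf_div; apply: (subring_set_prod (pOsub v)) => s _; rewrite ab.
  by apply: Hhom_div => //; apply: orb.
- apply: (@le_lt_trans _ _ ((D * J * Bc)%:R ^+ size gs * (\prod_(k < m) mahler gs (iter k phi x) (a_ k) ^+ d.-1 * mahler gs x (a_ 0%N) ^+ J.-1))).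
    have -> : \prod_(k < m) mahler gs (iter k phi x) (a_ k) ^+ d.-1 * mahler gs x (a_ 0%N) ^+ J.-1 =
       `|A| * \prod_(s <- gs) (\prod_(k < m) mx (iter k phi ((s : autC) x)) ^+ d.-1 * mx ((s : autC) (sg x)) ^+ J.-1).
      rewrite big_split /= (sgp _ (fun y => mx y ^+ J.-1)) /A normrM normr_prod normrX mulrACA; congr (_ * _); last first.
        by rewrite /mahler exprMn prodrXl.
      rewrite exchange_big /= -big_split /=; apply: eq_bigr => k _; rewrite /mahler exprMn normrX; congr (_ * _).
      by rewrite -prodrXl; apply: eq_bigr => s _; rewrite iterA.
    have -> : (D * J * Bc)%:R ^+ size gs = \prod_(s <- gs) (D * J * Bc)%:R :> algC.
      by rewrite big_const_seq count_predT iter_mulr_1.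
    rewrite mulrCA ler_wpM2l // -big_split /=; apply: ler_prod => s _; rewrite normr_ge0 /= Haux_aut.
    exact: Haux_arch.
  apply: (@le_lt_trans _ _ ((D * J * Bc)%:R ^+ size gs * (K%:R ^+ size gs) ^+ (d.-1 * m + J.-1))).
    rewrite ler_wpM2l ?exprn_ge0 ?ler0n // exprD.
    have KT k : (k < m.+1)%N -> mahler gs (iter k phi x) (a_ k) <= K%:R ^+ size gs.
      move=> lt; have le : (k <= n)%N by apply: leq_trans mn.
      exact: (HK (inT_iter le Tx) gsP (gen_iter_phi f g k gx) (la_ k)).
    apply: ler_pM; rewrite ?exprn_ge0 ?mahler_ge0 //.
    - by apply: prodr_ge0 => k _; rewrite exprn_ge0 // mahler_ge0.
    - rewrite exprM; have -> : ((K%:R ^+ size gs) ^+ d.-1) ^+ m = \prod_(k < m) (K%:R ^+ size gs) ^+ d.-1 :> algC.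
        by rewrite prodr_const card_ord.
      apply: ler_prod => k _; rewrite exprn_ge0 ?mahler_ge0 //=.
      by rewrite lerXn2r ?nnegrE ?mahler_ge0 ?exprn_ge0 ?ler0n // KT // ltnW // ltnS.
    - by rewrite lerXn2r ?nnegrE ?mahler_ge0 ?exprn_ge0 ?ler0n // (KT 0%N).
  rewrite exprAC -exprMn mulnC mulrC exprM -natrX -natrM -natrX.
  rewrite ltr_pXn2r ?nnegrE ?ler0n ?(conj_reps_pos gsP) // ltr_nat.
  by rewrite mulnC [(Bc * _)%N]mulnC.
Qed.
End AuxVanish.

Lemma sum_ord_divmod (V : nmodType) (n d : nat) (F : nat -> V) :
  \sum_(i < n * d) F i = \sum_(j < n) \sum_(r < d) F (j * d + r)%N.
Proof.
elim: n => [|n IH]; first by rewrite !big_ord0.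
rewrite big_ord_recr /= -IH -!(big_mkord xpredT F) -(big_mkord xpredT (fun r => F (n * d + r)%N)).
rewrite (@big_cat_nat _ _ _ (n * d)) //=; last by rewrite mulSn leq_addl.
congr (_ + _); rewrite -{1}[(n * d)%N]add0n big_addn mulSn addnK.
by apply: eq_bigr => r _; rewrite addnC.
Qed.

(** * Independence of the digit basis *)

Section Independence.
Variables (f g : {poly int}) (d R : nat).
Hypothesis rm : ratmap f g d R.
Let d2 := rm_d rm.
Let d0 : (0 < d)%N. Proof. exact: ltnW. Qed.
Local Notation fC := (fC f).
Local Notation gC := (gC g).
Local Notation phi := (phi f g).

Lemma pZ_W : pZ (wronsk f g) = (pZ f)^`() * pZ g - pZ f * (pZ g)^`().
Proof. by rewrite /wronsk rmorphB !rmorphM /= !deriv_map. Qed.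

(** A multiple root of f - b g is a zero of the Wronskian, so all but finitely many b have d
    distinct finite preimages; these avoid [bad] if b avoids its image. *)
Lemma generic_fiber (bad : seq algC) : exists bad' : seq algC, forall b, b \notin bad' ->
  exists rs : seq algC, [/\ uniq rs, size rs = d &
    forall x, x \in rs -> [/\ gC x != 0, phi x = b & x \notin bad]].
Proof.
have [cs Ecs] := closed_field_poly_normal (pZ (wronsk f g)).
have W0 : pZ (wronsk f g) != 0.
  by rewrite map_poly_eq0_id0 ?intr_eq0 ?lead_coef_eq0 ?(wronsk_neq0 rm).
exists ((f`_d)%:~R / (g`_d)%:~R :: [seq phi x | x <- cs] ++ [seq phi x | x <- bad]) => b.
rewrite in_cons mem_cat !negb_or => /and3P[b3 b1 b2].
pose h := pZ f - b *: pZ g.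
have hd : h`_d != 0.
  rewrite coefB coefZ !coef_map /= subr_eq0; apply/eqP => E.
  have gd0 : (g`_d)%:~R != 0 :> algC.
    by apply/eqP => g0; apply: (fgd_neq0 rm _ g0); rewrite E g0 mulr0.
  by move/negP: b3; apply; rewrite E mulfK.
have sh : size h = d.+1.
  apply/eqP; rewrite eqn_leq; apply/andP; split.
    apply: leq_trans (size_polyD _ _) _; rewrite size_polyN geq_max.
    rewrite (leq_trans (size_poly _ _) (rm_f rm)) //=.
    by apply: leq_trans (size_scale_leq _ _) _; apply: leq_trans (size_poly _ _) (rm_g rm).
  by rewrite ltnNge; apply: contra hd => le; rewrite nth_default.
have rh x : root h x -> gC x != 0 /\ phi x = b.
  rewrite /root !hornerE subr_eq0 => /eqP E.
  have g0 : gC x != 0.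
    by apply/eqP => g0; apply: (fg_neq0 rm _ g0); rewrite /fC E -/(gC x) g0 mulr0.
  by split=> //; rewrite /phi /fC E mulfK.
have [rs Ers] := closed_field_poly_normal h.
have l0 : lead_coef h != 0 by rewrite lead_coef_eq0 -size_poly_eq0 sh.
have rrs x : (x \in rs) = root h x by rewrite Ers rootZ // root_prod_XsubC.
exists rs; split.
- rewrite -separable_prod_XsubC.
  have -> : \prod_(x <- rs) ('X - x%:P) = (lead_coef h)^-1 *: h.
    by rewrite {2}Ers scalerA mulVf // scale1r.
  rewrite unlock derivZ coprimepZl ?invr_eq0 // coprimepZr ?invr_eq0 //.
  apply/Pdiv.ClosedField.coprimepP => x rx; apply/negP => rx'.
  have [g0 px] := rh _ rx; move/negP: b1; apply; apply/mapP; exists x => //.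
  rewrite -root_prod_XsubC; move: W0; rewrite -lead_coef_eq0 => lw.
  rewrite -(rootZ _ _ lw) -Ecs pZ_W /root !hornerE.
  move: rx rx'; rewrite /root /h derivB derivZ !hornerE !subr_eq0 => /eqP -> /eqP ->.
  by apply/eqP; ring.
- by have := congr1 (fun q : {poly algC} => size q) Ers; rewrite size_scale // size_prod_XsubC sh => -[].
- move=> x; rewrite rrs => /rh[g0 px]; split=> //; apply: contra b2 => xb.
  by apply/mapP; exists x.
Qed.

Lemma fresh_nat (bad : seq algC) : exists n : nat, n%:R \notin bad.
Proof.
apply: contrapT => H; have inb n : n%:R \in bad.
  by apply/negPn/negP => h; apply: H; exists n.
have : (size [seq (i%:R : algC) | i <- iota 0 (size bad).+1] <= size bad)%N.
  apply: uniq_leq_size; last by move=> x /mapP[i _ ->].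
  rewrite map_inj_uniq ?iota_uniq // => i j /eqP; rewrite eqr_nat; exact/eqP.
by rewrite size_map size_iota ltnn.
Qed.

Lemma ebasS m i x : ebas f g d m.+1 i x = x ^+ (i %% d) * ebas f g d m (i %/ d) (phi x).
Proof.
rewrite /ebas big_ord_recl /= /dig expn0 divn1; congr (_ * _).
apply: eq_bigr => k _; rewrite /bump add1n -iterS iterSr; congr (_ ^+ _).
by rewrite expnS divnMA.
Qed.

(** The function of index j d + r is x^r times the function of index j at phi(x). On a fibre with d
    points this gives a polynomial of degree below d in x with d roots; its coefficients vanish, and
    they are relations of the same kind one level down. *)
Lemma ebas_indep m (c : nat -> algC) (bad : seq algC) :
  (forall b, b \notin bad -> \sum_(i < d ^ m) c i * ebas f g d m i b = 0) ->
  forall i, (i < d ^ m)%N -> c i = 0.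
Proof.
elim: m c bad => [|m IH] c bad H.
  have [n nb] := fresh_nat bad; have := H _ nb.
  by rewrite expn0 big_ord1 /ebas big_ord0 mulr1 => E [].
have [bad' Hb] := generic_fiber bad.
have key r : (r < d)%N -> forall j, (j < d ^ m)%N -> c (j * d + r)%N = 0.
  move=> rd; apply: (IH (fun j => c (j * d + r)%N) bad') => b nb.
  have [rs [u sz Hrs]] := Hb b nb.
  pose P : {poly algC} := \poly_(r < d) (\sum_(j < d ^ m) c (j * d + r)%N * ebas f g d m j b).
  suff P0 : P = 0 by have := congr1 (fun q : {poly algC} => q`_r) P0; rewrite coef_poly rd coef0.
  apply: (roots_geq_poly_eq0 _ u); last by rewrite sz size_poly.
  apply/allP => x xr; have [g0 px nx] := Hrs x xr; rewrite /root horner_poly; apply/eqP.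
  have := H x nx; rewrite expnSr (sum_ord_divmod _ _ (fun i => c i * ebas f g d m.+1 i x)).
  rewrite exchange_big /= => E; rewrite -[X in _ = X]E; apply: eq_bigr => r' _.
  rewrite mulr_suml; apply: eq_bigr => j _.
  have -> : ebas f g d m.+1 (j * d + r') x = x ^+ r' * ebas f g d m j b.
    by rewrite ebasS px modnMDl modn_small // divnMDl // divn_small // addn0.
  by ring.
move=> i lt; rewrite (divn_eq i d); apply: key; first by rewrite ltn_mod.
by rewrite ltn_divLR // -expnSr.
Qed.

Lemma hiter_affine k x : (forall i, (i < k)%N -> gC (iter i phi x) != 0) ->
  exists2 w : algC, w != 0 & hiter f g d k (x, 1) = (w * iter k phi x, w).
Proof.
elim: k => [|k IH] H; first by exists 1; rewrite ?oner_neq0 ?mul1r.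
have [w w0 E] := IH (fun i lt => H i (ltnW lt)).
have g0 := H k (ltnSn k).
have hv (P : {poly int}) (a : algC) : (size P <= d.+1)%N -> hev d P (w * a) w = w ^+ d * (pZ P).[a].
  move=> sz; rewrite -{2}[w]mulr1 hev_scale (horner_intr_wide _ sz); congr (_ * _).
  by apply: eq_bigr => i _; rewrite expr1n mulr1.
exists (w ^+ d * gC (iter k phi x)); first by rewrite mulf_neq0 ?expf_neq0.
rewrite hiterS E /hstep [(_, _).1]/= [(_, _).2]/= !hv ?(rm_f rm) ?(rm_g rm) //.
by rewrite /= /phi -/(fC _) -/(gC _); congr (_, _); field.
Qed.

Lemma Ebas_affine m x : (forall i, (i < m)%N -> gC (iter i phi x) != 0) ->
  exists2 w : algC, w != 0 & forall i, Ebas f g d m i (x, 1) = w * ebas f g d m i x.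
Proof.
move=> H; exists (\prod_(k < m) (hiter f g d k (x, 1)).2 ^+ d.-1).
  apply/prodf_neq0 => k _; rewrite expf_neq0 //.
  by have [|w w0 ->] := @hiter_affine k x => // i ik; apply: H; apply: ltn_trans (ltn_ord k).
move=> i; rewrite /Ebas /ebas -big_split /=; apply: eq_bigr => k _.
have [|w w0 ->] := @hiter_affine k x; first by move=> j jk; apply: H; apply: ltn_trans (ltn_ord k).
by rewrite /= exprMn (expr_split w (dig_lt i k d0)); ring.
Qed.

Lemma ev_Spol m J (c : 'I_(d ^ m) * 'I_J -> int) x y :
  (forall i, (i < m)%N -> gC (iter i phi x) != 0) ->
  exists2 w : algC, w != 0 &
  \sum_(l < J) ev x (@Spol f g d J m c q1 l) * y ^+ l = w * @Haux f g d J m c x y.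
Proof.
move=> H; have [w w0 E] := Ebas_affine H; exists w => //.
rewrite /Haux exchange_big mulr_sumr; apply: eq_bigr => l _; rewrite mulr_sumr.
rewrite /Spol (rmorph_sum (ev x)) mulr_suml; apply: eq_bigr => i _.
rewrite -mul_polyC (rmorphM (ev x)) -Ebas_rmorph !evE map_polyX hornerX rmorph1 hornerC.
by rewrite map_polyC hornerC E /=; ring.
Qed.

Lemma orbit_bad m : exists bad : seq algC, forall b, b \notin bad ->
  forall i, (i < m)%N -> gC (iter i phi b) != 0.
Proof.
elim: m => [|m [bad H]]; first by exists [::].
have gne : pZ g != 0.
  apply/eqP => g0; have W0 := wronsk_neq0 rm; move: W0; rewrite /wronsk.
  have -> : g = 0 by apply/polyP => i; have := congr1 (fun q : {poly algC} => q`_i) g0; rewrite coef_map !coef0 /= => /eqP; rewrite intr_eq0 => /eqP.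
  by rewrite deriv0 !mulr0 subrr eqxx.
have [rs Ers] := closed_field_poly_normal (pZ g).
have rrs x : gC x = 0 -> x \in rs.
  move=> gx; rewrite -root_prod_XsubC -(@rootZ _ x (lead_coef (pZ g))) ?lead_coef_eq0 //.
  by rewrite -Ers; apply/eqP.
have fibs b : exists s : seq algC, forall x, gC x != 0 -> phi x = b -> x \in s.
  have h0 := map_sub_neq0 rm b; have [s Es] := closed_field_poly_normal (pZ f - b *: pZ g).
  exists s => x g0 px; rewrite -root_prod_XsubC -(@rootZ _ x (lead_coef (pZ f - b *: pZ g))) ?lead_coef_eq0 //.
  by rewrite -Es /root !hornerE -px /phi /fC /gC divfK // subrr.
have [fb fbP] := boolp.choice fibs.
exists (rs ++ flatten [seq fb b | b <- bad]) => b; rewrite mem_cat negb_or => /andP[nr nb].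
have g0 : gC b != 0 by apply: contra nr => /eqP/rrs.
case=> [|i] //= lt; rewrite -iterS iterSr; apply: H => //.
apply: contra nb => hb; apply/flattenP; exists (fb (phi b)); first exact: map_f.
exact: fbP.
Qed.

(** The substitution y = x^p + z is invertible, so if all coefficients vanished every [Spol] would
    vanish, against [ebas_indep]. *)
Lemma Cpol_nonzero p m J (c : 'I_(d ^ m) * 'I_J -> int) : (exists k, c k != 0) ->
  exists2 i, (i < J)%N & @Cpol f g d p J m c q1 i != 0.
Proof.
move=> [[i0 l0] cn]; apply: contrapT => nex.
have C0 i : (i < J)%N -> @Cpol f g d p J m c q1 i = 0.
  by move=> lt; apply/eqP/negPn/negP => h; apply: nex; exists i.
move/negP: cn; apply; apply/eqP.
have [bad Hb] := orbit_bad m.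
pose cc i : algC := if insub i is Some i' then (c (i', l0))%:~R else 0.
have ccE (i : 'I_(d ^ m)) : cc i = (c (i, l0))%:~R by rewrite /cc valK.
suff : cc i0 = 0 by rewrite ccE => /eqP; rewrite intr_eq0 => /eqP.
apply: (@ebas_indep m cc bad) => // b nb; have H := Hb b nb.
pose S (l : 'I_J) := ev b (@Spol f g d J m c q1 l).
pose Q : {poly algC} := \sum_(l < J) S l *: 'X^l.
have Qz y : Q.[y] = 0.
  rewrite /Q horner_sum.
  transitivity (\sum_(l < J) ev b (@Spol f g d J m c q1 l) * (b ^+ p + (y - b ^+ p)) ^+ l).
    by apply: eq_bigr => l _; rewrite hornerZ hornerXn addrC subrK.
  rewrite (Cpol_expand f g p c q1 b (y - b ^+ p)); apply: big1 => i _.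
  by rewrite C0 // rmorph0 mul0r.
have Q0 : Q = 0.
  apply: (@roots_geq_poly_eq0 _ Q [seq i%:R | i <- iota 0 (size Q)]); last by rewrite size_map size_iota.
    by apply/allP => x _; rewrite /root Qz.
  rewrite map_inj_uniq ?iota_uniq // => i j /eqP; rewrite eqr_nat; exact/eqP.
have S0 : S l0 = 0.
  have := congr1 (fun q : {poly algC} => q`_l0) Q0; rewrite coef0 coef_sum (bigD1 l0) //= coefZ coefXn eqxx mulr1.
  rewrite big1 ?addr0 // => l nl; rewrite coefZ coefXn; case: eqP => [E|]; last by rewrite mulr0.
  by case/eqP: nl; apply: val_inj.
have [w w0 E] := Ebas_affine H.
apply: (mulfI w0); rewrite mulr0 -[X in _ = X]S0 /S /Spol (rmorph_sum (ev b)) mulr_sumr.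
apply: eq_bigr => i _; rewrite -mul_polyC (rmorphM (ev b)) -Ebas_rmorph !evE map_polyX hornerX rmorph1 hornerC.
by rewrite map_polyC hornerC E ccE /=; ring.
Qed.
End Independence.

Lemma content_split p (G : {poly {poly int}}) : prime p -> G != 0 ->
  exists t G', [/\ G = G' *+ (p ^ t)%N, (size G' <= size G)%N & exists i k, ~~ (Posz p %| G'`_i`_k)%Z].
Proof.
move=> pp G0; have [i [k nz]] : exists i k, G`_i`_k != 0.
  exists (size G).-1, (size (lead_coef G)).-1; rewrite -[G`_ _]lead_coefE -lead_coefE.
  by rewrite !lead_coef_eq0.
elim: {G0}(absz G`_i`_k) {-2}G (leqnn (absz G`_i`_k)) nz => [|n IH] {}G le nz.
  by move: le; rewrite leqn0 absz_eq0 (negPf nz).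
have [H|[i' [k' nd]]] : (forall i k, (Posz p %| G`_i`_k)%Z) \/ exists i k, ~~ (Posz p %| G`_i`_k)%Z.
- have [|nex] := pselect (exists i k, ~~ (Posz p %| G`_i`_k)%Z); [by right|left=> a b].
  by apply/negPn/negP => h; apply: nex; exists a, b.
- pose G1 : {poly {poly int}} := \poly_(a < size G) \poly_(b < size G`_a) (G`_a`_b %/ p)%Z.
  have cG1 a b : G`_a`_b = G1`_a`_b *+ p.
    rewrite coef_poly; case: ltnP => la; last by rewrite [G`_a]nth_default ?coef0 ?mul0rn.
    rewrite coef_poly; case: ltnP => lb; last by rewrite [_`_b]nth_default ?mul0rn.
    by rewrite -mulr_natr natz divzK.
  have EG : G = G1 *+ p by apply/polyP => a; apply/polyP => b; rewrite !coefMn cG1.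
  have [||t [G' [E sz bad]]] := IH G1.
  + move: le nz; rewrite cG1 -mulr_natr natz abszM mulf_eq0 negb_or => le /andP[c0 _].
    have := prime_gt1 pp; move: le; rewrite absz_nat; move: c0; rewrite -absz_gt0; nia.
  + by move: nz; rewrite cG1; apply: contraNneq => ->; rewrite mul0rn.
  exists t.+1, G'; split=> //; first by rewrite EG E -mulrnA expnSr.
  by apply: leq_trans sz _; apply: size_poly.
- by exists 0%N, G; rewrite mulr1n; split=> //; exists i', k'.
Qed.

Definition ev2 (A : comNzRingType) (G : {poly {poly int}}) (x z : A) : A :=
  (map_poly (map_poly (intr : int -> A)) G).[z%:P].[x].

Lemma ev2E (A : comNzRingType) (G : {poly {poly int}}) (x z : A) n : (size G <= n)%N ->
  ev2 G x z = \sum_(i < n) (map_poly intr G`_i).[x] * z ^+ i.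
Proof.
move=> sz; rewrite /ev2 (horner_coef_wide _ (leq_trans (size_poly _ _) sz)) horner_sum.
by apply: eq_bigr => i _; rewrite hornerM coef_map /= -rmorphXn hornerC.
Qed.

Lemma ev2Mn (A : comNzRingType) (G : {poly {poly int}}) (x z : A) n : ev2 (G *+ n) x z = ev2 G x z *+ n.
Proof. by rewrite /ev2 rmorphMn hornerMn hornerMn. Qed.

Lemma pr_ev2 l (v : place l) (G : {poly {poly int}}) x z : pO v x -> pO v z ->
  pr v (ev2 G x z) = ev2 G (pr v x) (pr v z).
Proof.
move=> Ox Oz; rewrite !(@ev2E _ _ _ _ (size G)) //.
rewrite pr_sum; last by move=> i _; apply: OM; [apply: O_horner|apply: OX].
by apply: eq_bigr => i _; rewrite prME ?prXE ?pr_horner //; [apply: O_horner|apply: OX].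
Qed.

(** Quantified over the whole field Q(x), so that it passes from x to phi(x). *)
Definition good_frob p (v : place p) (sg : autC) (x : algC) : Prop :=
  forall y, gen x y -> forall s : autC, frob_cong v sg (s y).

Section AuxRelation.
Variables (f g : {poly int}) (d R : nat) (x0 : seq algC).
Hypothesis rm : ratmap f g d R.
Hypothesis abT : forall n x, inT f g x0 n x -> abel x.
Let d2 := rm_d rm.
Let d0 : (0 < d)%N. Proof. exact: ltnW. Qed.

(** In the variable z = (sigma x - x^p)/p the auxiliary polynomial vanishes at all points of high
    level. Dividing it by its largest power of p before reducing keeps it nonzero modulo p, and its
    degree in z is below J < p. *)
Theorem aux_relation : exists N : nat, forall p, prime p -> (N < p)%N -> forall v : place p,
  exists (A : {poly {poly resT v}}) (M : nat), [/\ A != 0, (size A < p)%N &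
    forall n x sg, (M <= n)%N -> inT f g x0 n x -> pO v x -> good_frob v sg x ->
      A.[(pr v ((sg x - x ^+ p) / p%:R))%:P].[pr v x] = 0].
Proof.
have [K K0 HK] := height_T x0 rm.
(* Let D = d^m, with p J <= D <= d p J. There are at most 4 j D conditions modulo p^j for D J
   unknowns below p^t + 1, and 4 j^2 = 64 t^2 = t J. At the archimedean places D K^((d-1)m) <= D^t
   is at most a constant times p^t, the unknowns cost another p^t, and 2t + 1 <= j. *)
pose t := (1 + K * d.-1)%N; pose J := (64 * t)%N; pose j := (4 * t)%N.
exists (R + J + (d * J) ^ t * J * K ^ J)%N => p pp ltp v.
have p1 := prime_gt1 pp; have p0 := prime_gt0 pp.
pose m := up_log d (p * J); pose D := (d ^ m)%N.
have J0 : (0 < J)%N by rewrite muln_gt0.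
have [mlo mhi] : (d ^ m.-1 < p * J)%N /\ (p * J <= D)%N.
  by apply/andP; apply: up_log_bounds => //; nia.
have m0 : (0 < m)%N by rewrite lt0n; apply/eqP => m0; move: mhi; rewrite /D m0 expn0; nia.
have Dhi : (D <= d * (p * J))%N by rewrite /D -(prednK m0) expnS leq_mul2l ltnW ?orbT.
have pig : ((p ^ j) ^ #|{: bool * ('I_j * 'I_(D + p * J))}| < (p ^ t).+1 ^ #|{: 'I_D * 'I_J}|)%N.
  rewrite !card_prod card_bool !card_ord -expnM.
  apply: (@leq_ltn_trans ((p ^ t) ^ (D * J))); last by rewrite ltn_exp2r // muln_gt0 J0 expn_gt0 d0.
  rewrite -expnM leq_exp2l // /j /J; nia.
have [c [cn cB cd]] : exists c : 'I_D * 'I_J -> int, [/\ exists i, c i != 0, forall i, (absz (c i) < (p ^ t).+1)%N &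
    forall k : bool * ('I_j * 'I_(D + p * J)), (Posz (p ^ j)%N %|
      (if k.1 then @Cpol f g d p J m c q1 k.2.1 else @Cpol f g d p J m (crev c) q2 k.2.1)`_k.2.2)%Z].
  pose L (c : 'I_D * 'I_J -> int) (k : bool * ('I_j * 'I_(D + p * J))) : int :=
      (if k.1 then @Cpol f g d p J m c q1 k.2.1 else @Cpol f g d p J m (crev c) q2 k.2.1)`_k.2.2.
  have pj0 : (0 < p ^ j)%N by rewrite expn_gt0 p0.
  apply: (@pigeonhole_lattice _ _ L _ _ pj0 pig) => a b [[] [i k]] /=; rewrite /L /= -coefB -?Cpol_linear //.
have sq1 : (size q1.1 <= 2)%N /\ (size q1.2 <= 2)%N by rewrite /q1 size_polyX size_poly1.
have sq2 : (size q2.1 <= 2)%N /\ (size q2.2 <= 2)%N by rewrite /q2 size_polyX size_poly1.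
have cdiv : @aux_div f g d p J m c j.
  move=> i ij; split=> k; (case: (ltnP k (D + p * J)) => lk;
    [|rewrite nth_default ?dvdz0 //; apply: leq_trans lk]).
  - exact: (cd (true, (Ordinal ij, Ordinal lk))).
  - by case: sq1 => ? ?; apply: (size_Cpol rm).
  - exact: (cd (false, (Ordinal ij, Ordinal lk))).
  - by case: sq2 => ? ?; apply: (size_Cpol rm).
have [i0 i0J Cn] := Cpol_nonzero rm p cn.
(* The substitution sigma x = x^p + p z scales the i-th coefficient by p^i. *)
pose G : {poly {poly int}} := \poly_(i < J) (@Cpol f g d p J m c q1 i *+ (p ^ i)%N).
have Gn : G != 0.
  apply: contraNneq Cn => G0; have := congr1 (fun q : {poly {poly int}} => q`_i0) G0.
  rewrite coef_poly i0J coef0 => /eqP; rewrite -mulr_natr mulf_eq0 -polyC_natr polyC_eq0.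
  by rewrite pnatr_eq0 expn_eq0 -leqn0 leqNgt p0 orbF.
have [tt [G' [GE szG' [i1 [k1 nd]]]]] := content_split pp Gn.
have szG : (size G <= J)%N by apply: size_poly.
have ltJ : (J < p)%N by lia.
exists (map_poly (map_poly intr) G'), m; split.
- apply: contraNneq nd => A0.
  have := congr1 (fun q : {poly {poly resT v}} => q`_i1`_k1) A0.
  by rewrite !coef_map !coef0 /= -(pr_int_eq0 v) // pr_int => ->.
- exact: leq_ltn_trans (size_poly _ _) (leq_ltn_trans szG' (leq_ltn_trans szG ltJ)).
move=> n x sg mn Tx Ox gf; set z := (sg x - _) / _.
have pC : (p%:R : algC) != 0 by rewrite pnatr_eq0 -lt0n.
have gx := @gen_refl x.
have [Oz _] := gf x gx idfun; have {}Oz := Oz Ox; rewrite /= -/z in Oz.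
rewrite -/(ev2 G' (pr v x) (pr v z)) -pr_ev2 //.
suff -> : ev2 G' x z = 0 by rewrite pr0.
have : ev2 G x z = 0.
  rewrite (ev2E _ _ szG).
  transitivity (\sum_(i < J) ev x (@Cpol f g d p J m c q1 i) * (p%:R * z) ^+ i).
    apply: eq_bigr => i _; rewrite coef_poly ltn_ord rmorphMn hornerMn evE; move: (z) => zz.
    by rewrite exprMn -natrX -mulr_natr mulrA.
  rewrite -Cpol_expand.
  have -> : x ^+ p + p%:R * z = sg x by rewrite /z mulrCA divff // mulr1 addrC subrK.
  have [|w w0 ->] := ev_Spol rm c (sg x) (x := x).
    by move=> i im; apply: (inT_orb (n := n)) Tx; apply: leq_trans mn.
  rewrite (@Haux_zero f g d R rm p J m j pp _ J0 c cdiv (p ^ t)%N _ x0 K _ _ v sg n x) ?mulr0 //.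
  - by apply/negP => /dvdn_leq; have := rm_R rm; lia.
  - have KD : (K ^ (d.-1 * m) <= D ^ (K * d.-1))%N.
      rewrite /D -expnM (_ : (m * (K * d.-1) = K * (d.-1 * m))%N); last by lia.
      rewrite (expnM d K) leq_exp2r ?muln_gt0 ?m0 ?andbT -?subn1 ?subn_gt0 //.
      exact/ltnW/ltn_expl.
    have KJ : (K ^ J.-1 <= K ^ J)%N by rewrite leq_pexp2l // leq_pred.
    have Dt : (D ^ t <= (d * J) ^ t * p ^ t)%N.
      by rewrite -expnMn leq_exp2r //; apply: leq_trans Dhi _; lia.
    rewrite -/D expnD.
    apply: (@leq_ltn_trans ((d * J) ^ t * J * K ^ J * (p ^ t * p ^ t))).
      have -> : (D * J * p ^ t * (K ^ (d.-1 * m) * K ^ J.-1) =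
                D * K ^ (d.-1 * m) * (J * p ^ t * K ^ J.-1))%N by lia.
      apply: (@leq_trans (((d * J) ^ t * p ^ t) * (J * p ^ t * K ^ J))); last by lia.
      apply: leq_mul; last by rewrite leq_mul2l KJ orbT.
      by apply: leq_trans Dt; rewrite /t expnD expn1 leq_mul2l KD orbT.
    apply: (@leq_trans (p * (p ^ t * p ^ t))).
      rewrite ltn_mul2r muln_gt0 expn_gt0 p0 /=; apply: leq_ltn_trans ltp; exact: leq_addl.
    by rewrite -!expnD -expnS leq_exp2l // /j /t; lia.
  - exact: abT Tx.
  - by move=> s; apply: gf.
rewrite GE ev2Mn -mulr_natr => /eqP; rewrite mulf_eq0 pnatr_eq0 expn_eq0 -leqn0 leqNgt p0 orbF.
by move/eqP.
Qed.
End AuxRelation.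

(** * The invariant form in characteristic p *)

Lemma freshman_lift (A : comNzRingType) (p : nat) (a b : A) : prime p ->
  exists r, (a + b) ^+ p = a ^+ p + b ^+ p + r *+ p.
Proof.
move=> pp; have p0 := prime_gt0 pp; rewrite exprDn.
pose q := p.-1; have Ep : p = q.+1 by rewrite prednK.
rewrite Ep big_ord_recl big_ord_recr /= bin0 subn0 expr0 mulr1 mulr1n -/q.
rewrite /bump /= add1n binn subnn expr0 mul1r mulr1n -Ep.
exists (\sum_(i < q) a ^+ (p - bump 0 i) * b ^+ bump 0 i *+ ('C(p, bump 0 i) %/ p)).
rewrite addrA [RHS]addrAC; congr (_ + _ + _); rewrite -sumrMnl; apply: eq_bigr => i _.
rewrite -mulrnA divnK // /bump /= add1n prime_dvd_bin //=; have := ltn_ord i; lia.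
Qed.

Lemma fermat_lift (p : nat) (c : int) : prime p -> exists r : int, c ^+ p = c + r *+ p.
Proof.
move=> pp; have pos (n : nat) : exists r : int, (n%:Z) ^+ p = n%:Z + r *+ p.
  elim: n => [|n [r IH]]; first by exists 0; rewrite expr0n mul0rn addr0 gtn_eqF ?prime_gt0.
  have [s Hs] := freshman_lift (n%:Z) 1 pp; exists (r + s).
  by rewrite -addn1 PoszD Hs IH expr1n mulrnDl; ring.
case: c => n; first exact: pos.
have [r Hr] := pos n.+1; rewrite NegzE exprNn Hr.
have [p2|odd_p] := even_prime pp.
  by exists (n.+1%:Z + r); rewrite p2 expr2 mulrNN mulr1 mul1r; ring.
by exists (- r); rewrite -signr_odd odd_p expr1; ring.
Qed.

(** [P1] is the p-derivative of P. It is defined over Z before reduction, and it supplies the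
    additive term of the skew product. *)
Lemma frobenius_lift (p : nat) (P : {poly int}) : prime p ->
  exists P1, P ^+ p = P \Po 'X^p + P1 *+ p.
Proof.
move=> pp; elim/poly_ind: P => [|P c [P1 IH]].
  by exists 0; rewrite comp_poly0 expr0n mul0rn addr0 gtn_eqF ?prime_gt0.
have [r Hr] := freshman_lift (P * 'X) c%:P pp.
have [s Hs] := fermat_lift c pp.
exists (P1 * 'X^p + s%:P + r).
rewrite Hr exprMn IH -rmorphXn Hs rmorphD rmorphMn /= comp_polyD comp_polyM comp_polyX comp_polyC.
by rewrite !mulrnDl mulrDl -mulrnAl; ring.
Qed.

Section CharP.
Variables (k : fieldType) (p : nat).
Hypothesis chp : p \in [pchar k].
Let pp : prime p := pcharf_prime chp.
Let p0 : (0 < p)%N := prime_gt0 pp.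

Lemma polyMnp (P : {poly k}) : P *+ p = 0.
Proof. by rewrite -mulr_natr -polyC_natr (pcharf0 chp) mulr0. Qed.

Lemma deriv_Xp (P : {poly k}) : (P ^+ p)^`() = 0.
Proof. by rewrite deriv_exp polyMnp. Qed.
End CharP.

(** Differentiating the lifted identity over Z produces a factor p on both sides, which is cancelled
    before reducing modulo p. *)
Lemma deriv_frobenius_lift (k : fieldType) (p : nat) (P P1 : {poly int}) : p \in [pchar k] ->
  P ^+ p = P \Po 'X^p + P1 *+ p ->
  let F := map_poly (intr : int -> k) P in
  (map_poly (intr : int -> k) P1)^`() = F ^+ p.-1 * F^`() - 'X^(p.-1) * F^`() ^+ p.
Proof.
move=> chp E F; have pp := pcharf_prime chp; have p0 := prime_gt0 pp.
have [Q1 EQ] := frobenius_lift P^`() pp.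
have D : P1^`() = P ^+ p.-1 * P^`() - 'X^(p.-1) * (P^`() \Po 'X^p).
  have := congr1 (fun q : {poly int} => q^`()) E.
  rewrite deriv_exp derivD derivMn deriv_comp derivXn.
  rewrite mulrnAr -mulrnDl => /eqP; rewrite -subr_eq0 -mulrnBl -mulr_natr mulf_eq0.
  rewrite -polyC_natr polyC_eq0 pnatr_eq0 (gtn_eqF p0) orbF subr_eq0 => /eqP H.
  by rewrite [P ^+ _ * _]mulrC H; ring.
rewrite deriv_map D rmorphB !rmorphM /= !rmorphXn /= map_polyX -deriv_map; congr (_ - _ * _).
have := congr1 (map_poly (intr : int -> k)) EQ; rewrite rmorphXn rmorphD rmorphMn /= (polyMnp chp) addr0 => <-.
by rewrite deriv_map.
Qed.

Lemma frob_comp (k : fieldType) (p : nat) (P : {poly int}) : p \in [pchar k] ->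
  map_poly (intr : int -> k) P \Po 'X^p = (map_poly intr P) ^+ p.
Proof.
move=> chp; have [Q1 EQ] := frobenius_lift P (pcharf_prime chp).
have := congr1 (map_poly (intr : int -> k)) EQ; rewrite rmorphXn rmorphD rmorphMn /= (polyMnp chp) addr0 => ->.
by rewrite map_comp_poly rmorphXn /= map_polyX.
Qed.

Section Homp.
Variables (k : fieldType).
Hypothesis kinf : forall s : seq k, exists x, x \notin s.

Lemma poly_ext (P Q : {poly k}) : (forall x, P.[x] = Q.[x]) -> P = Q.
Proof.
move=> H; apply/eqP; rewrite -subr_eq0; apply/eqP.
have [n] := ubnP (size (P - Q)).
have ex m : exists2 s : seq k, uniq s & size s = m.
  elim: m => [|m [s us sz]]; first by exists [::].
  by have [x nx] := kinf s; exists (x :: s); rewrite /= ?nx ?us ?sz.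
move=> _; have [s us sz] := ex (size (P - Q)).
apply: (roots_geq_poly_eq0 _ us); last by rewrite sz.
by apply/allP => x _; rewrite /root !hornerE H subrr.
Qed.

Variables F G : {poly k}.
Hypothesis G0 : G != 0.
Implicit Types P Q : {poly k}.

Lemma poly_ext_off (P Q : {poly k}) : (forall x, G.[x] != 0 -> P.[x] = Q.[x]) -> P = Q.
Proof.
move=> H; apply: (mulIf G0); apply: poly_ext => x; rewrite !hornerM.
by have [->|/H ->] := eqVneq G.[x] 0; rewrite ?mulr0.
Qed.

(** The pull-back along F/G of P viewed as a binary form of degree n, that is G^n P(F/G). *)
Definition homp n (P : {poly k}) : {poly k} := \sum_(i < n.+1) P`_i *: (F ^+ i * G ^+ (n - i)).

Lemma homp_horner n P x : G.[x] != 0 -> (size P <= n.+1)%N ->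
  (homp n P).[x] = G.[x] ^+ n * P.[F.[x] / G.[x]].
Proof.
move=> g0 sz; rewrite horner_sum (horner_coef_wide _ sz) mulr_sumr; apply: eq_bigr => i _.
have le : (i <= n)%N by rewrite -ltnS.
rewrite hornerZ hornerM !horner_exp expr_div_n (expr_split G.[x] le).
by have := expf_neq0 i g0; move: (G.[x] ^+ i) => y y0; field.
Qed.

Lemma hompM n m P Q : (size P <= n.+1)%N -> (size Q <= m.+1)%N ->
  homp (n + m) (P * Q) = homp n P * homp m Q.
Proof.
move=> sP sQ; have sz : (size (P * Q)%R <= (n + m).+1)%N.
  by apply: leq_trans (size_polyMleq _ _) _; lia.
apply: poly_ext_off => x g0; rewrite hornerM !homp_horner // hornerM exprD; ring.
Qed.

Lemma hompX n P j : (size P <= n.+1)%N -> homp (j * n) (P ^+ j) = homp n P ^+ j.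
Proof.
move=> sP; elim: j => [|j IH]; last first.
  rewrite !exprS mulSn hompM ?IH //; apply: leq_trans (size_poly_exp_leq _ _) _; nia.
by rewrite !expr0 mul0n /homp big_ord1 coef1 scale1r !expr0 mulr1.
Qed.

(** For a form of degree divisible by p, Euler's identity ties the two partial derivatives together,
    so F' and G' enter only through the Wronskian. *)
Lemma homp_deriv p n P : p \in [pchar k] -> (p %| n.+2)%N ->
  (homp n.+2 P)^`() = (F^`() * G - F * G^`()) * homp n P^`().
Proof.
move=> chp dM; rewrite /homp raddf_sum /=; pose M := n.+2; rewrite -/M; rewrite -/M in dM.
have M0 : M%:R = 0 :> {poly k}.
  by rewrite -polyC_natr -(divnK dM) natrM (pcharf0 chp) mulr0.
have M1 (P' : {poly k}) : P' *+ M = 0 by rewrite -mulr_natr M0 mulr0.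
have M1k (c : k) : c *+ M = 0 by apply: polyC_inj; rewrite polyCMn M1.
set W := _ - F * _.
transitivity (\sum_(i < M.+1) (P`_i *+ i) *: (F ^+ i.-1 * G ^+ (M - i).-1 * W)).
  apply: eq_bigr => i _; rewrite derivZ derivM !deriv_exp -scalerMnl scalerMnr; congr (P`_i *: _).
  have le : (i <= M)%N by rewrite -ltnS.
  have EM (Q : {poly k}) : Q *+ (M - i) = - (Q *+ i).
    by apply/eqP; rewrite -addr_eq0 -mulrnDr subnK // M1.
  case: (posnP i) => [->|i0]; first by rewrite mulr0n mul0r add0r subn0 mulr0n mulrnAr M1.
  have [iM|ltM] := eqVneq (i : nat) M.
    by rewrite iM subnn mulr0n mulr0 addr0 !M1 mul0r.
  have {}ltM : (i < M)%N by rewrite ltn_neqAle ltM.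
  rewrite EM /W; have -> : F ^+ i = F * F ^+ i.-1 by rewrite -exprS prednK.
  have -> : G ^+ (M - i) = G * G ^+ (M - i).-1 by rewrite -exprS prednK // subn_gt0.
  move: (F^`()) (G^`()) (F ^+ i.-1) (G ^+ (M - i).-1) => a b c e.
  rewrite !mulrnAl mulrN mulrnAr -mulrnBl; congr (_ *+ _).
  by rewrite mulrBr; congr (_ - _); [rewrite mulrCA mulrC mulrA mulrC|]; ring.
have El : nat_of_ord (lift ord0 (ord_max : 'I_n.+2)) = M by [].
rewrite big_ord_recl big_ord_recr El M1k mulr0n !scale0r /= addr0 add0r.
rewrite mulr_sumr; apply: eq_bigr => i _.
rewrite /bump /= add1n coef_deriv [X in _ *: X]mulrC scalerAr; congr (_ * (_ *: (_ * _ ^+ _))); rewrite /M; lia.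
Qed.
End Homp.

Section InvariantForm.
Variables (k : fieldType) (p : nat).
Hypothesis kinf : forall s : seq k, exists x, x \notin s.
Hypothesis chp : p \in [pchar k].
Variables (f g f1 g1 : {poly int}).
Hypothesis Ef : f ^+ p = f \Po 'X^p + f1 *+ p.
Hypothesis Eg : g ^+ p = g \Po 'X^p + g1 *+ p.
Local Notation mk := (map_poly (intr : int -> k)).
Local Notation F := (mk f).
Local Notation G := (mk g).
Let W := F^`() * G - F * G^`().
Let E := mk f1 * G ^+ p - mk g1 * F ^+ p.
Hypothesis G0 : G != 0.
Hypothesis W0 : W != 0.
Local Notation homp := (homp F G).
Let pp : prime p := pcharf_prime chp.
Let p0 : (0 < p)%N := prime_gt0 pp.

Lemma exprB_charp (a b : {poly k}) : (a - b) ^+ p = a ^+ p - b ^+ p.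
Proof.
have [r Hr] := freshman_lift (a - b) b pp.
by rewrite subrK (polyMnp chp) addr0 in Hr; rewrite Hr addrK.
Qed.

(** Divided by G^(2p), this says that the additive term of the skew product has differential
    phi^*(x^(p-1) dx) - (phi')^p x^(p-1) dx, so x^(p-1) can be added to the derivative of an
    invariant section. *)
Lemma derivE_skew : E^`() = F ^+ p.-1 * G ^+ p.-1 * W - 'X^(p.-1) * W ^+ p.
Proof.
have sp (Q : {poly k}) : Q ^+ p = Q * Q ^+ p.-1 by rewrite -exprS prednK.
rewrite /E derivB !derivM !(deriv_Xp chp) !mulr0 !addr0.
rewrite (deriv_frobenius_lift chp Ef) (deriv_frobenius_lift chp Eg).
rewrite {2}/W exprB_charp !exprMn [G ^+ p]sp [F ^+ p]sp /W.
move: (F^`()) (G^`()) (F ^+ p.-1) (G ^+ p.-1) ('X^(p.-1)) => a b c e x.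
by move: (a ^+ p) (b ^+ p) => a' b'; ring.
Qed.

Lemma homp1 n : homp n 1 = G ^+ n.
Proof.
rewrite /homp big_ord_recl coef1 scale1r expr0 mul1r subn0 big1 ?addr0 // => i _.
by rewrite coef1 /= scale0r.
Qed.

Lemma hompXn n i : (i <= n)%N -> homp n 'X^i = F ^+ i * G ^+ (n - i).
Proof.
move=> le; have lt : (i < n.+1)%N by [].
rewrite /homp (bigD1 (Ordinal lt)) //= coefXn eqxx scale1r big1 ?addr0 // => j nj.
by rewrite coefXn; case: eqP => [E'|]; rewrite ?scale0r //; case/eqP: nj; apply: val_inj.
Qed.

Lemma hompD n P Q : homp n (P + Q) = homp n P + homp n Q.
Proof. by rewrite /homp -big_split; apply: eq_bigr => i _; rewrite coefD scalerDl. Qed.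

Lemma hompZ n c P : homp n (c *: P) = c *: homp n P.
Proof. by rewrite /homp scaler_sumr; apply: eq_bigr => i _; rewrite coefZ scalerA. Qed.

(** Divided by a h, the hypothesis says that beta = - a'/(k0 a) is an invariant section of z |->
    (W^p z - E)/G^(2p). Its derivative, with [derivE_skew], shows that omega = beta' + x^(p-1) = U /
    a^p satisfies omega(phi) = (phi')^(p-1) omega. *)
Lemma invariant_form (a a' : {poly k}) (k0 n' : nat) : a != 0 -> k0%:R != 0 :> k ->
  (size a <= n'.+2)%N -> (size a' <= n'.+2)%N ->
  a * (homp n'.+1 a' * G ^+ (2 * p) - (homp n'.+1 a * E) *+ k0) = homp n'.+1 a * W ^+ p * a' ->
  exists U : {poly k}, let N := (p * n'.+1 + 2 * p.-1)%N in
   [/\ U != 0, (size U <= N.+1)%N & homp N U * a ^+ p = W ^+ p.-1 * U * homp n'.+1 a ^+ p].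
Proof.
move=> a0 k00 sa sa' Estar; set h := homp n'.+1 a in Estar *; set h' := homp n'.+1 a' in Estar.
(* [B] / a^p is beta: its denominator, a p-th power, has derivative 0. *)
pose B := - (k0%:R)^-1 *: (a' * a ^+ p.-1).
pose U := B^`() + 'X^(p.-1) * a ^+ p.
have sap j : (size (a ^+ j) <= (j * n'.+1).+1)%N by apply: leq_trans (size_poly_exp_leq _ _) _; nia.
have sp (Q : {poly k}) : Q ^+ p = Q * Q ^+ p.-1 by rewrite -exprS prednK.
have EM : (p * n'.+1 = n'.+1 + p.-1 * n'.+1)%N by rewrite -{1}(prednK p0) mulSn.
have sB : (size B <= (p * n'.+1).+1)%N.
  apply: leq_trans (size_scale_leq _ _) _; apply: leq_trans (size_polyMleq _ _) _.
  rewrite -subn1 leq_subLR; apply: leq_trans (leq_add sa' (sap p.-1)) _; rewrite EM; move: (p.-1 * n'.+1)%N => q; lia.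
have Bh : homp (p * n'.+1) B = - (k0%:R)^-1 *: (h' * h ^+ p.-1).
  by rewrite /B hompZ EM hompM // hompX.
have E2 : a ^+ p * (homp (p * n'.+1) B * G ^+ (2 * p) + h ^+ p * E) = h ^+ p * W ^+ p * B.
  have := congr1 (fun Q => - (k0%:R)^-1 *: (Q * (h ^+ p.-1 * a ^+ p.-1))) Estar.
  have En (Q : {poly k}) : Q *+ k0 = k0%:R%:P * Q by rewrite mul_polyC scaler_nat.
  rewrite En Bh /B !sp -!mul_polyC polyCN.
  have : (k0%:R^-1)%:P * (k0%:R)%:P = 1 :> {poly k} by rewrite -polyCM mulVf.
  move: (_%:P) (k0%:R%:P) (h ^+ p.-1) (a ^+ p.-1) (W ^+ p.-1) (G ^+ (2 * p)) => ki kk hp ap wp g2 Hk.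
  move=> H; transitivity (- ki * (a * (h' * g2 - kk * (h * E)) * (hp * ap)) + (1 - ki * kk) * (a * h * E * hp * ap)).
    by ring.
  by rewrite H Hk; ring.
have G2p : (G ^+ (2 * p))^`() = 0 by rewrite exprM (deriv_Xp chp).
have [n En] : exists n, (p * n'.+1 = n.+2)%N by exists (p * n'.+1 - 2)%N; have := prime_gt1 pp; nia.
have dv : (p %| n.+2)%N by rewrite -En dvdn_mulr.
have Bd : (homp (p * n'.+1) B)^`() = W * homp n B^`() by rewrite En (homp_deriv _ _ _ chp).
have E3 : a ^+ p * (homp n B^`() * G ^+ (2 * p) + h ^+ p * (F ^+ p.-1 * G ^+ p.-1)) =
          h ^+ p * W ^+ p.-1 * U.
  apply: (mulfI W0); have := congr1 (fun Q : {poly k} => Q^`()) E2.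
  rewrite derivM (deriv_Xp chp) mul0r add0r derivD !derivM !(deriv_Xp chp) G2p Bd derivE_skew.
  rewrite !(mul0r, mulr0, add0r, addr0) [W ^+ p]sp /U.
  set b := homp n _; move: (b) (a ^+ p) (G ^+ (2 * p)) (h ^+ p) (F ^+ p.-1) (G ^+ p.-1) (W ^+ p.-1).
  move: ('X^(p.-1)) (B^`()) => x b' {}b ap g2 hp fp gp wp H.
  transitivity (ap * (W * b * g2 + hp * (fp * gp * W - x * (W * wp))) + ap * hp * x * W * wp); first by ring.
  by rewrite H; ring.
have sU : (size U <= (p * n'.+1 + 2 * p.-1).+1)%N.
  apply: leq_trans (size_polyD _ _) _; rewrite geq_max; apply/andP; split.
    apply: leq_trans (size_poly _ _) _; move: sB; lia.
  apply: leq_trans (size_polyMleq _ _) _; rewrite size_polyXn addSn /= addnC.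
  apply: leq_trans (leq_add (sap p) (leqnn _)) _; move: (p * n'.+1)%N => q; lia.
exists U; split=> //.
(* A derivative has no monomial of exponent -1 modulo p, so the top term of X^(p-1) a^p survives in
   [U]. *)
- have ap0 : a ^+ p != 0 by rewrite expf_neq0.
  have Sa : (size (a ^+ p)).-1 = (p * (size a).-1)%N by rewrite size_exp mulnC.
  apply: contraTneq isT => U0; have := congr1 (fun Q : {poly k} => Q`_(p * (size a).-1 + p.-1)) U0.
  rewrite coefD coef_deriv coefXnM coef0 -addnS prednK // -{2}[p in (_ + p)%N]muln1 -mulnDr.
  have -> : (p * (size a).-1 + p <= p.-1)%N = false by move: (p * _)%N => q; lia.
  rewrite addnK -mulr_natr natrM (pcharf0 chp) mul0r mulr0 add0r.
  have -> : (p * (size a).-1)%N = (size (a ^+ p)).-1 by rewrite Sa.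
  by move/eqP; rewrite -lead_coefE lead_coef_eq0 (negPf ap0).
- have -> : homp (p * n'.+1 + 2 * p.-1) U = homp n B^`() * G ^+ (2 * p) + h ^+ p * (F ^+ p.-1 * G ^+ p.-1).
    rewrite /U hompD; congr (_ + _).
      have -> : (p * n'.+1 + 2 * p.-1 = n + 2 * p)%N by lia.
      rewrite -{1}[B^`()]mulr1 hompM ?homp1 // ?size_poly1 //.
      apply/leq_sizeP => j lj; rewrite coef_deriv; have [->|nj] := eqVneq j n.+1.
        by rewrite -mulr_natr -(divnK dv) natrM (pcharf0 chp) !mulr0.
      rewrite nth_default ?mul0rn //; apply: leq_trans sB _; rewrite En ltnS ltn_neqAle eq_sym nj.
      by rewrite lj.
    rewrite mulrC [X in homp X]addnC -[in RHS]hompX // [in RHS]mulrC.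
    have Eh : F ^+ p.-1 * G ^+ p.-1 = homp (2 * p.-1) 'X^(p.-1).
      by rewrite hompXn; [congr (_ * _ ^+ _); lia|lia].
    by rewrite Eh [a ^+ p * _]mulrC -hompM // size_polyXn; lia.
  by rewrite mulrC E3; ring.
Qed.
End InvariantForm.

Section LinearPowers.
Variables (A : comNzRingType) (u e : A).
Let L : {poly A} := u%:P * 'X - e%:P.

Lemma coef_linM (Q : {poly A}) i : (L * Q)`_i.+1 = u * Q`_i - e * Q`_i.+1.
Proof. by rewrite mulrBl coefB -mulrA !coefCM coefXM. Qed.

Lemma linX_coef i j : (i < j)%N -> (L ^+ i)`_j = 0.
Proof.
elim: i j => [|i IH] [|j] // lt; first by rewrite expr0 coef1.
by rewrite exprS coef_linM !IH ?mulr0 ?subr0 //; apply: ltnW.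
Qed.

Lemma linX_lead i : (L ^+ i)`_i = u ^+ i.
Proof.
elim: i => [|i IH]; first by rewrite !expr0 coef1.
by rewrite exprS coef_linM IH linX_coef // mulr0 subr0 exprS.
Qed.

Lemma linX_sub i : (L ^+ i.+1)`_i = - (u ^+ i * e) *+ i.+1.
Proof.
elim: i => [|i IH]; first by rewrite expr1 expr0 mul1r mulr1n coefB coefCM coefX coefC mulr0 sub0r.
rewrite exprS coef_linM IH linX_lead -mulr_natr -[RHS]mulr_natr mulrSr exprS; ring.
Qed.

Lemma linX_horner z i : (L ^+ i).[z] = (u * z - e) ^+ i.
Proof. by rewrite horner_exp /L !hornerE. Qed.
End LinearPowers.

Section Minimal.
Variables (k : fieldType) (p : nat).
Hypothesis kinf : forall s : seq k, exists x, x \notin s.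
Hypothesis chp : p \in [pchar k].
Variables (F G W E : {poly k}).
Hypothesis G0 : G != 0.
Hypothesis W0 : W != 0.
Local Notation homp := (homp F G).
Let pp : prime p := pcharf_prime chp.
Let p0 : (0 < p)%N := prime_gt0 pp.
Variable S : nat -> k -> k -> Prop.
Hypothesis hS : forall n x z, S n.+1 x z -> G.[x] != 0 ->
  S n (F.[x] / G.[x]) ((W.[x] ^+ p * z - E.[x]) / G.[x] ^+ (2 * p)).
Hypothesis hinf : forall M (P : {poly k}),
  (forall n x z, (M <= n)%N -> S n x z -> P.[x] = 0) -> P = 0.
Variable A0 : {poly {poly k}}.
Hypothesis A00 : A0 != 0.
Hypothesis sA0 : (size A0 < p)%N.
Let van (A : {poly {poly k}}) := exists M, forall n x z, (M <= n)%N -> S n x z -> A.[z%:P].[x] = 0.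
Hypothesis vA0 : van A0.

(** Take a relation of least degree k0 in z among those holding at all residue points of high level.
    Its pull-back has the same degree, so the combination that cancels the leading coefficients is
    0; its coefficient of z^(k0-1) is the asserted identity. *)
Lemma minimal_relation : exists (a a' : {poly k}) (k0 n' : nat), [/\ a != 0, k0%:R != 0 :> k,
  (size a <= n'.+2)%N, (size a' <= n'.+2)%N &
  a * (homp n'.+1 a' * G ^+ (2 * p) - (homp n'.+1 a * E) *+ k0) = homp n'.+1 a * W ^+ p * a'].
Proof.
have exA : exists n, `[< exists A : {poly {poly k}}, [/\ A != 0, van A & size A = n] >].
  by exists (size A0); apply/asboolP; exists A0.
have [n0 /asboolP [A [An vA sA]] nmin] := ex_minnP exA.
have minA (B : {poly {poly k}}) : van B -> (size B < size A)%N -> B = 0.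
  move=> vB lt; apply/eqP/negPn/negP => Bn; move: lt; rewrite sA ltnNge; apply/negP/negPn.
  by apply: nmin; apply/asboolP; exists B.
have sAp : (size A < p)%N.
  by rewrite sA; apply: leq_ltn_trans sA0; apply: nmin; apply/asboolP; exists A0.
have [k1 sk] : exists k1, size A = k1.+2.
  case E1: (size A) => [|[|k1]]; last by exists k1.
    by move/eqP: E1; rewrite size_poly_eq0 (negPf An).
  have Ea : A = (A`_0)%:P by apply: size1_polyC; rewrite E1.
  set a := A`_0 in Ea.
  have [M HM] := vA; have a0 : a = 0.
    by apply: (hinf (M := M)) => n x z Mn Sx; have := HM n x z Mn Sx; rewrite Ea hornerC.
  by move: An; rewrite Ea a0 eqxx.
pose k0 := k1.+1; pose a := A`_k0; pose a' := A`_k1.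
have an : a != 0 by have := lead_coef_eq0 A; rewrite lead_coefE sk (negPf An) => /negbT.
pose n' := (\max_(i < size A) size (A`_i)%R)%N.
have sn i : (size (A`_i)%R <= n')%N.
  have [lt|ge] := ltnP i (size A); last by rewrite nth_default ?size_poly0.
  exact: (@leq_bigmax _ (fun i : 'I_(size A) => size (A`_i)%R) (Ordinal lt)).
have sn2 i : (size (A`_i)%R <= n'.+2)%N by apply: leq_trans (sn i) _; apply: leqW.
exists a, a', k0, n'; split=> //; try exact: sn2.
  have lt : (k0 < p)%N by move: sAp; rewrite sk; apply: ltn_trans.
  apply/negP => /eqP/eqP; rewrite -(dvdn_pcharf chp) => /dvdn_leq; rewrite /k0; move: lt; rewrite /k0; lia.
pose L : {poly {poly k}} := (W ^+ p)%:P * 'X - E%:P.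
(* Larger than all degrees of the coefficients, so that their pull-backs vanish at the zeros of G,
   where the skew product is undefined. *)
pose N := n'.+1.
pose P2 : {poly {poly k}} := \sum_(i < k0.+1) (homp N A`_i * G ^+ (2 * p * (k0 - i)))%:P * L ^+ i.
have P2h x z : P2.[z%:P].[x] = \sum_(i < k0.+1) (homp N A`_i).[x] * G.[x] ^+ (2 * p * (k0 - i)) *
    (W.[x] ^+ p * z - E.[x]) ^+ i.
  rewrite /P2 horner_sum horner_sum; apply: eq_bigr => i _.
  by rewrite hornerM hornerC linX_horner !hornerM !horner_exp hornerD hornerN hornerM hornerC horner_exp.
have vP2 : van P2.
  have [M HM] := vA; exists M.+1 => n x z; case: n => // n Mn Sx; rewrite P2h.
  have [g0|g0] := eqVneq G.[x] 0.
    apply: big1 => i _; rewrite g0; have [lt|ge] := ltnP i k0.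
      by rewrite expr0n muln_eq0 muln_eq0 /= (gtn_eqF p0) subn_eq0 leqNgt lt /= mulr0 mul0r.
    rewrite /homp horner_sum big1 ?mul0r // => j _; rewrite hornerZ hornerM !horner_exp g0.
    have [jN|ltN] := leqP N j; first by rewrite nth_default ?mul0r //; apply: leq_trans (sn i) _; apply: ltnW.
    by rewrite expr0n subn_eq0 leqNgt ltN /= !mulr0.
  have := HM n _ _ Mn (hS Sx g0); rewrite (@horner_coef_wide _ k0.+1 A) ?sk // horner_sum => H.
  have -> : \sum_(i < k0.+1) (homp N A`_i).[x] * G.[x] ^+ (2 * p * (k0 - i)) * (W.[x] ^+ p * z - E.[x]) ^+ i =
     G.[x] ^+ N * G.[x] ^+ (2 * p * k0) * \sum_(i < k0.+1)
       (A`_i * ((W.[x] ^+ p * z - E.[x]) / G.[x] ^+ (2 * p))%:P ^+ i).[F.[x] / G.[x]].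
    rewrite mulr_sumr; apply: eq_bigr => i _; rewrite homp_horner ?sn2 // hornerM -rmorphXn hornerC.
    have le : (i <= k0)%N by rewrite -ltnS.
    have -> : G.[x] ^+ (2 * p * k0) = G.[x] ^+ (2 * p * (k0 - i)) * (G.[x] ^+ (2 * p)) ^+ i.
      by rewrite -exprM -exprD -mulnDr subnK.
    rewrite expr_div_n; have := expf_neq0 i (expf_neq0 (2 * p) g0); move: ((G.[x] ^+ (2 * p)) ^+ i) => y y0.
    by field.
  by rewrite H mulr0.
pose h := homp N a.
(* Both terms have the same coefficient of z^k0. *)
pose Q := a%:P * P2 - (h * W ^+ (p * k0))%:P * A.
have vQ : van Q.
  have [M HM] := vA; have [M' HM'] := vP2; exists (M + M')%N => n x z le Sx.
  rewrite /Q hornerD hornerN !hornerM !hornerC hornerD hornerN !hornerM.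
  by rewrite (HM n x z) ?(HM' n x z) ?mulr0 ?subr0 //; apply: leq_trans le; rewrite ?leq_addr ?leq_addl.
have P2top j : (k0 < j)%N -> P2`_j = 0.
  move=> lt; rewrite coef_sum big1 // => i _; rewrite coefCM linX_coef ?mulr0 //.
  by apply: leq_ltn_trans lt; rewrite -ltnS.
have P2k0 : P2`_k0 = h * W ^+ (p * k0).
  rewrite coef_sum (bigD1 ord_max) //= big1 ?addr0 => [|i ni].
    by rewrite coefCM linX_lead subnn muln0 expr0 mulr1 exprM.
  rewrite coefCM linX_coef ?mulr0 // ltn_neqAle -ltnS ltn_ord andbT.
  by apply: contra ni => /eqP Ei; apply/eqP/val_inj.
have Q0 : Q = 0.
  apply: minA => //; rewrite sk ltnS; apply/leq_sizeP => j le; rewrite coefB !coefCM.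
  have [ltj|] := ltnP k0 j; first by rewrite P2top // nth_default ?sk // !mulr0 subr0.
  move=> le'; have -> : j = k0 by apply/eqP; rewrite eqn_leq le'.
  by rewrite P2k0 -/a mulrC subrr.
have P2k1 : P2`_k1 = W ^+ (p * k1) * (homp N a' * G ^+ (2 * p) - (h * E) *+ k0).
  rewrite coef_sum big_ord_recr big_ord_recr /= big1 ?add0r => [|i _]; last first.
    by rewrite coefCM linX_coef ?mulr0.
  rewrite !coefCM linX_lead linX_sub subnn muln0 expr0 mulr1 /k0 subSnn muln1 -exprM.
  by rewrite -/h -/a' -!scaler_nat -!mul_polyC; ring.
have := congr1 (fun q : {poly {poly k}} => q`_k1) Q0.
rewrite coefB !coefCM coef0 P2k1 -/a' => /eqP; rewrite subr_eq0 => /eqP H.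
apply: (mulfI (expf_neq0 (p * k1) W0)).
rewrite mulrCA -/N -/h H /k0 mulnS exprD; move: (W ^+ p) (W ^+ (p * k1)) => w1 w2; ring.
Qed.
End Minimal.

(** * Divisors and ramification on the projective line *)

Definition alg_closed (K : fieldType) := forall P : {poly K}, (1 < size P)%N -> exists x, root P x.

Section Orders.
Variable K : fieldType.
Hypothesis Kc : alg_closed K.
Implicit Types H : {poly K}.

Lemma closed_inf (s : seq K) : exists x, x \notin s.
Proof.
have [|x rx] := Kc (P := 'X * \prod_(y <- s) ('X - y%:P) + 1).
  rewrite size_polyDl size_mul ?polyX_eq0 ?monic_neq0 ?monic_prod_XsubC // size_polyX size_prod_XsubC //.
  by rewrite size_poly1.
exists x; apply: contraL rx => xs; rewrite /root !hornerE.
have -> : (\prod_(y <- s) ('X - y%:P)).[x] = 0 by apply/eqP; rewrite -/(root _ _) root_prod_XsubC.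
by rewrite mulr0 add0r oner_eq0.
Qed.

Lemma closed_split (H : {poly K}) : H != 0 ->
  exists rs, H = lead_coef H *: \prod_(r <- rs) ('X - r%:P).
Proof.
have [n] := ubnP (size H); elim: n H => // n IH H lt H0.
have [le1|gt1] := leqP (size H) 1.
  have s1 : size H = 1%N by apply/eqP; rewrite eqn_leq le1 size_poly_gt0.
  by exists [::]; rewrite big_nil alg_polyC lead_coefE s1 -size1_polyC ?s1.
have [x /factor_theorem[Q EQ]] := Kc gt1.
have Q0 : Q != 0 by apply: contraNneq H0 => Q0; rewrite EQ Q0 mul0r.
have sQ : (size Q < n)%N.
  by move: lt; rewrite EQ size_mul ?polyXsubC_eq0 // size_XsubC addn2 /=.
have [rs E] := IH _ sQ Q0; exists (x :: rs).
by rewrite big_cons {1}EQ {1}E EQ lead_coefM lead_coefXsubC mulr1 -scalerAl mulrC.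
Qed.

(** The order of vanishing at Q of H viewed as a binary form of degree n; the missing degree counts
    as zeros at infinity. *)
Definition ord (n : nat) (H : {poly K}) (Q : option K) : nat :=
  if Q is Some x then mup x H else (n - (size H).-1)%N.

Lemma ordM n m H1 H2 Q : H1 != 0 -> H2 != 0 -> (size H1 <= n.+1)%N -> (size H2 <= m.+1)%N ->
  ord (n + m) (H1 * H2) Q = (ord n H1 Q + ord m H2 Q)%N.
Proof.
move=> h1 h2 s1 s2; case: Q => [x|] /=; first by rewrite mupM.
rewrite size_mul //; have := size_poly_gt0 H1; have := size_poly_gt0 H2; rewrite h1 h2.
move: (size _) (size _) s1 s2 => a b; lia.
Qed.

Lemma ordX n j H Q : H != 0 -> (size H <= n.+1)%N -> ord (j * n) (H ^+ j) Q = (j * ord n H Q)%N.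
Proof.
move=> h1 s1; elim: j => [|j IH].
  by rewrite expr0 /ord; case: Q => [x|]; rewrite ?size_poly1 // mupNroot // root1.
rewrite exprS !mulSn ordM ?expf_neq0 ?IH //.
by apply: leq_trans (size_poly_exp_leq _ _) _; rewrite ltnS mulnC leq_mul2l; lia.
Qed.

Lemma ordZ n c H Q : c != 0 -> ord n (c *: H) Q = ord n H Q.
Proof.
move=> c0; case: Q => [x|] /=; last by rewrite size_scale.
by rewrite -mul_polyC mupMr // rootC.
Qed.

Lemma ord_prod (I : eqType) n (rs : seq I) (h : I -> {poly K}) Q :
  (forall i, i \in rs -> h i != 0 /\ (size (h i) <= n.+1)%N) ->
  ord (size rs * n) (\prod_(i <- rs) h i) Q = (\sum_(i <- rs) ord n (h i) Q)%N /\
  \prod_(i <- rs) h i != 0 /\ (size (\prod_(i <- rs) h i)%R <= (size rs * n).+1)%N.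
Proof.
elim: rs => [_|i rs IH Hh].
  rewrite !big_nil size_poly1 oner_neq0 /=; split=> //.
  by case: Q => [x|] /=; rewrite ?size_poly1 // mupNroot // root1.
have [j jr|E [n0 sz]] := IH; first by apply: Hh; rewrite in_cons jr orbT.
have [h0 s0] := Hh i (mem_head _ _).
rewrite !big_cons /= mulSn ordM // E mulf_neq0 //; split=> //; split=> //.
by apply: leq_trans (size_polyMleq _ _) _; move: (size _) (size _) s0 sz => a b; lia.
Qed.

Definition lin (P : option K) : {poly K} := if P is Some y then 'X - y%:P else 1.

Lemma lin_neq0 P : lin P != 0.
Proof. by case: P => [y|] /=; rewrite ?polyXsubC_eq0 ?oner_neq0. Qed.
Lemma size_lin P : (size (lin P) <= 2)%N.
Proof. by case: P => [y|] /=; rewrite ?size_XsubC ?size_poly1. Qed.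
Lemma ord_lin P Q : ord 1 (lin P) Q = (P == Q).
Proof.
case: P Q => [y|] [x|] /=; rewrite ?size_XsubC ?size_poly1 //.
  by rewrite -[_ - _]expr1 mup_XsubCX.
by rewrite mupNroot // root1.
Qed.

Lemma form_split n H : H != 0 -> (size H <= n.+1)%N ->
  exists rs : seq (option K), size rs = n /\ H = lead_coef H *: \prod_(P <- rs) lin P.
Proof.
move=> H0 sz; have [rs E] := closed_split H0.
have srs : (size rs <= n)%N.
  move: sz; rewrite {1}E size_scale ?lead_coef_eq0 // size_prod_XsubC; lia.
exists (map Some rs ++ nseq (n - size rs) None); split.
  by rewrite size_cat size_map size_nseq subnKC.
by rewrite big_cat big_map big_nseq /= iter_mulr_1 expr1n mulr1.
Qed.

Lemma ord_count n (c : K) (rs : seq (option K)) Q : c != 0 -> size rs = n ->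
  ord n (c *: \prod_(P <- rs) lin P) Q = count_mem Q rs.
Proof.
move=> c0 <-; rewrite ordZ //; rewrite -{1}[size rs]muln1.
have [|-> _] := @ord_prod _ 1 rs lin Q; first by move=> P _; rewrite lin_neq0 size_lin.
by rewrite -sum1_count [RHS]big_mkcond; apply: eq_bigr => P _; rewrite ord_lin /=; case: eqP.
Qed.

Lemma ord_list n H : H != 0 -> (size H <= n.+1)%N ->
  exists rs : seq (option K), size rs = n /\ forall Q, ord n H Q = count_mem Q rs.
Proof.
move=> H0 sz; have [rs [s E]] := form_split H0 sz; exists rs; split=> // Q.
by rewrite E ord_count ?lead_coef_eq0.
Qed.

Lemma sum_ord_le n H (L : seq (option K)) : H != 0 -> (size H <= n.+1)%N -> uniq L ->
  (\sum_(Q <- L) ord n H Q <= n)%N.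
Proof.
move=> H0 sz u; have [rs [<- E]] := ord_list H0 sz.
under eq_bigr => Q _ do rewrite E.
elim: rs {E} => [|P rs IH] /=; first by rewrite big1.
rewrite big_split /= -add1n leq_add //.
have -> : (\sum_(Q <- L) (P == Q) = count_mem P L)%N.
  by rewrite -sum1_count [RHS]big_mkcond; apply: eq_bigr => Q _; rewrite /= eq_sym; case: eqP.
by rewrite count_uniq_mem //; case: (_ \in _).
Qed.

Lemma prop_of_ord (H1 H2 : {poly K}) : H1 != 0 -> H2 != 0 ->
  (forall x, mup x H1 = mup x H2) -> exists2 c, c != 0 & H1 = c *: H2.
Proof.
move=> h1 h2 E; have [r1 E1] := closed_split h1; have [r2 E2] := closed_split h2.
have cnt (H : {poly K}) rs x : H != 0 -> H = lead_coef H *: \prod_(r <- rs) ('X - r%:P) -> mup x H = count_mem x rs.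
  move=> H0 EH; have := @ord_count (size rs) (lead_coef H) (map Some rs) (Some x) _ _.
  rewrite lead_coef_eq0 big_map /= -EH size_map count_map => -> //.
have pe : perm_eq r1 r2 by apply/allP => x _ /=; rewrite -(cnt H1 r1) // -(cnt H2 r2) // E.
exists (lead_coef H1 / lead_coef H2); first by rewrite mulf_neq0 ?invr_eq0 ?lead_coef_eq0.
rewrite {1}E1 {2}E2 scalerA divfK ?lead_coef_eq0 //; congr (_ *: _); exact: perm_big.
Qed.
End Orders.

Lemma top_coefM (A : comNzRingType) (P Q : {poly A}) a b : (size P <= a.+1)%N -> (size Q <= b.+1)%N ->
  (P * Q)`_(a + b) = P`_a * Q`_b.
Proof.
move=> sP sQ; have lt : (a < (a + b).+1)%N by rewrite ltnS leq_addr.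
rewrite coefM (bigD1 (Ordinal lt)) //= addKn big1 ?addr0 // => i ni.
have [lia_|gia] := ltnP i a.
  by rewrite [Q`_ _]nth_default ?mulr0 //; apply: leq_trans sQ _; move: lia_; lia.
rewrite nth_default ?mul0r //; apply: leq_trans sP _; rewrite ltn_neqAle gia andbT.
by apply: contra ni => /eqP E; apply/eqP/val_inj.
Qed.

Lemma wronsk_local (K : fieldType) (H1 H2 : {poly K}) x : H1 != 0 -> H2.[x] != 0 ->
  (0 < mup x H1)%N -> (mup x H1)%:R != 0 :> K ->
  H1^`() * H2 - H1 * H2^`() != 0 /\ mup x (H1^`() * H2 - H1 * H2^`()) = (mup x H1).-1.
Proof.
move=> h1 h2 e0 eK; have [e [H nr E]] := multiplicity_XsubC H1 x; rewrite h1 /= in nr.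
have me : mup x H1 = e by rewrite E mupMr // -[e]/(e) mup_XsubCX eqxx.
rewrite me in e0 eK *; case: e e0 eK E {me} => // e _ eK E.
pose R := (H^`() * ('X - x%:P) + H *+ e.+1) * H2 - H * ('X - x%:P) * H2^`().
have EW : H1^`() * H2 - H1 * H2^`() = R * ('X - x%:P) ^+ e.
  rewrite E derivM deriv_exp derivXsubC mul1r /R /= exprS -!scaler_nat -!mul_polyC; ring.
have Rx : ~~ root R x.
  rewrite /root /R hornerD hornerN !hornerM hornerD hornerMn hornerM hornerXsubC subrr !(mulr0, mul0r) add0r subr0.
  by rewrite -mulr_natr !mulf_neq0.
have R0 : R != 0 by apply: contraNneq Rx => ->; rewrite root0.
by rewrite EW; split; [rewrite mulf_neq0 // expf_neq0 // polyXsubC_eq0|rewrite mupMr // mup_XsubCX eqxx].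
Qed.

Section RatMap.
Variable K : fieldType.
Hypothesis Kc : alg_closed K.
Variables (F G : {poly K}) (d : nat).
Hypotheses (sF : (size F <= d.+1)%N) (sG : (size G <= d.+1)%N) (d2 : (2 <= d)%N).
Hypothesis cop : forall x, F.[x] = 0 -> G.[x] = 0 -> False.
Hypothesis top : F`_d = 0 -> G`_d = 0 -> False.

(** Unlike [reval], the value at infinity uses the coefficients of the prescribed index d, which
    stays correct after a reduction that kills a leading coefficient. *)
Definition rphi (Q : option K) : option K :=
  match Q with
  | Some x => if G.[x] != 0 then Some (F.[x] / G.[x]) else None
  | None => if G`_d != 0 then Some (F`_d / G`_d) else None
  end.
Definition hP (P : option K) : {poly K} := if P is Some y then F - y *: G else G.
Definition ram (Q : option K) : nat := ord d (hP (rphi Q)) Q.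

Lemma size_hP P : (size (hP P) <= d.+1)%N.
Proof.
case: P => [y|] //=; apply: leq_trans (size_polyD _ _) _; rewrite size_polyN geq_max sF /=.
exact: leq_trans (size_scale_leq _ _) sG.
Qed.

Lemma hP_neq0 P : hP P != 0.
Proof.
have cst (H : {poly K}) : (forall x, ~ root H x) -> H`_d = 0.
  move=> nr; rewrite nth_default // leqNgt; apply/negP => lt.
  have [|x rx] := Kc (P := H); first exact: leq_trans d2 (ltnW lt).
  exact: nr rx.
apply/eqP; case: P => [y|] /= H0.
  have E : F = y *: G by apply/eqP; rewrite -subr_eq0; apply/eqP.
  have gd : G`_d = 0.
    by apply: cst => x rx; apply: (cop (x := x)); rewrite ?E ?hornerZ (eqP rx) ?mulr0.
  by apply: top => //; rewrite E coefZ gd mulr0.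
have fd : F`_d = 0 by apply: cst => x /eqP rx; apply: (cop rx); rewrite H0 horner0.
by apply: top => //; rewrite H0 coef0.
Qed.

Let G0 : G != 0 := hP_neq0 None.

Lemma ord_hP_gt0 P Q : (0 < ord d (hP P) Q)%N = (rphi Q == P).
Proof.
have rt (H : {poly K}) x : H != 0 -> (0 < mup x H)%N = root H x.
  by move=> H0; rewrite -XsubC_dvd // dvdp_XsubCl.
have dg (H : {poly K}) : (size H <= d.+1)%N -> (0 < d - (size H).-1)%N = (H`_d == 0).
  move=> sz; apply/idP/eqP => [lt|Hd].
    rewrite nth_default //; move: lt sz; move: (size H) => s; lia.
  suff : (size H <= d)%N by move: (size H) (d2) => s; lia.
  apply/leq_sizeP => j; rewrite leq_eqVlt => /predU1P[<- //|lt].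
  by rewrite nth_default //; apply: leq_trans sz _.
case: Q => [x|]; rewrite /ord.
  rewrite rt ?hP_neq0 //; case: P => [y|] /=.
    rewrite /root !hornerE subr_eq0; have [g0|g0] := eqVneq G.[x] 0.
      by rewrite g0 mulr0; apply/eqP => /cop; apply.
    by rewrite /=; apply/eqP/eqP => [->|[<-]]; rewrite ?mulfK ?divfK.
  by rewrite /root; have [g0|g0] := eqVneq G.[x] 0.
rewrite dg ?size_hP //; case: P => [y|] /=.
  rewrite coefB coefZ subr_eq0; have [g0|g0] := eqVneq G`_d 0.
    by rewrite g0 mulr0; apply/eqP => /top; apply.
  by rewrite /=; apply/eqP/eqP => [->|[<-]]; rewrite ?mulfK ?divfK.
by have [g0|g0] := eqVneq G`_d 0.
Qed.

Lemma ram_gt0 Q : (0 < ram Q)%N.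
Proof. by rewrite /ram ord_hP_gt0. Qed.

Lemma ord_hP P Q : ord d (hP P) Q = if rphi Q == P then ram Q else 0%N.
Proof.
case: eqP => [<- //|/eqP ne]; apply/eqP; rewrite -leqn0 leqNgt ord_hP_gt0.
exact: ne.
Qed.

Lemma ram_le Q : (ram Q <= d)%N.
Proof.
have [rs [s E]] := ord_list Kc (hP_neq0 (rphi Q)) (size_hP _).
by rewrite /ram E -s; apply: count_size.
Qed.

Lemma fiber P : exists rs : seq (option K), size rs = d /\
  forall Q, count_mem Q rs = if rphi Q == P then ram Q else 0%N.
Proof.
have [rs [s E]] := ord_list Kc (hP_neq0 P) (size_hP P).
by exists rs; split=> // Q; rewrite -E ord_hP.
Qed.

Lemma rphi_surj P : exists Q, rphi Q = P.
Proof.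
have [[|Q rs] [s E]] := fiber P; first by move: s d2 => <-.
by exists Q; have := E Q; rewrite /= eqxx; case: eqP.
Qed.

Lemma hP_horner P x : G.[x] != 0 -> (hP P).[x] = G.[x] * (lin P).[F.[x] / G.[x]].
Proof.
move=> g0; case: P => [y|] /=; last by rewrite hornerC mulr1.
by rewrite !hornerE; field.
Qed.

Lemma homp_factor N (c : K) (rs : seq (option K)) : size rs = N ->
  (size (c *: \prod_(P <- rs) lin P)%R <= N.+1)%N ->
  homp F G N (c *: \prod_(P <- rs) lin P) = c *: \prod_(P <- rs) hP P.
Proof.
move=> sN sz; apply: (poly_ext_off (closed_inf Kc) G0) => x g0; rewrite homp_horner // !hornerZ.
rewrite mulrCA; congr (_ * _); rewrite !horner_prod -{}sN {sz}.
elim: rs => [|P rs IH]; first by rewrite !big_nil mulr1.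
by rewrite !big_cons /= hP_horner // -IH exprS; ring.
Qed.

(** Split U into linear forms: each pulls back to the form of the fibre over its zero. *)
Lemma ord_homp N (U : {poly K}) Q : U != 0 -> (size U <= N.+1)%N ->
  [/\ ord (N * d) (homp F G N U) Q = (ord N U (rphi Q) * ram Q)%N, homp F G N U != 0 &
      (size (homp F G N U) <= (N * d).+1)%N].
Proof.
move=> U0 sU; have [rs [s E]] := form_split Kc U0 sU.
have c0 : lead_coef U != 0 by rewrite lead_coef_eq0.
have sE := sU; rewrite E in sE.
have [|O1 [n1 s1]] := @ord_prod _ _ d rs hP Q; first by move=> P _; rewrite hP_neq0 size_hP.
have HE : homp F G N U = lead_coef U *: \prod_(P <- rs) hP P by rewrite {1}E homp_factor.
rewrite HE ordZ // size_scale // scaler_eq0 negb_or c0 n1 -s; split=> //.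
rewrite O1 {1}E s ord_count //.
rewrite (eq_bigr (fun P => if rphi Q == P then ram Q else 0%N)) => [|P _]; last by rewrite ord_hP.
rewrite -big_mkcond big_const_seq iter_addn_0 mulnC.
by congr (_ * _)%N; apply: eq_count => P; rewrite /= eq_sym.
Qed.

Definition wron := F^`() * G - F * G^`().
Hypothesis chd : forall e, (0 < e)%N -> (e <= d)%N -> e%:R != 0 :> K.

(** Tame Riemann-Hurwitz: ramification indices are at most d, hence nonzero in K, and a zero of
    order e of a fibre form leaves order e - 1 in the Wronskian. *)
Lemma wron_ord Q : [/\ wron != 0, (size wron <= (2 * d - 2).+1)%N & ord (2 * d - 2) wron Q = (ram Q).-1].
Proof.
have eK R : (ram R)%:R != 0 :> K by apply: chd; [apply: ram_gt0|apply: ram_le].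
have loc x : wron != 0 /\ mup x wron = (ram (Some x)).-1.
  have r0 := ram_gt0 (Some x); have rK := eK (Some x); move: r0 rK; rewrite /ram.
  case Ex: (rphi (Some x)) => [y|] /= r0 rK.
    have g0 : G.[x] != 0 by move: Ex => /=; case: (G.[x] != 0).
    have [] := wronsk_local (hP_neq0 (Some y)) g0 r0 rK.
    suff -> : (F - y *: G)^`() * G - (F - y *: G) * G^`() = wron by [].
    by rewrite /wron derivB derivZ -!mul_polyC; ring.
  have g0 : G.[x] = 0 by move: Ex => /=; case: eqP.
  have f0 : F.[x] != 0 by apply/eqP => f0; apply: cop g0.
  have [] := wronsk_local (hP_neq0 None) f0 r0 rK.
  have -> : G^`() * F - G * F^`() = (-1) *: wron by rewrite scaleN1r /wron; ring.
  by rewrite scaler_eq0 negb_or => /andP[_ ->]; rewrite -mul_polyC mupMr // rootC oppr_eq0 oner_eq0.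
have infty : (size wron <= (2 * d - 2).+1)%N /\ (2 * d - 2 - (size wron).-1 = (ram None).-1)%N.
  (* Multiplication by X makes derivation diagonal on coefficients. The top coefficient of X w is
     then -e times the product of the two leading ones, and the degree can be read off. *)
  have main (H1 H2 w : {poly K}) e : H1 != 0 -> (0 < e <= d)%N -> size H1 = (d - e).+1 -> (size H2 <= d.+1)%N ->
      H2`_d != 0 -> e%:R != 0 :> K -> w = H1^`() * H2 - H1 * H2^`() -> size w = (2 * d - e)%N.
    move=> h1 /andP[e0 ed] s1 s2 h2 ek Ew.
    have cX (H : {poly K}) j : ('X * H^`())`_j = H`_j *+ j.
      by rewrite coefXM; case: j => [|j] /=; rewrite ?mulr0n // coef_deriv.
    have sX (H : {poly K}) a : (size H <= a)%N -> (size ('X * H^`())%R <= a)%N.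
      by move=> sz; apply/leq_sizeP => j le; rewrite cX nth_default ?mul0rn // (leq_trans sz).
    have EX : 'X * w = ('X * H1^`()) * H2 - H1 * ('X * H2^`()) by rewrite Ew; ring.
    have cw : ('X * w)`_(d - e + d) != 0.
      rewrite EX coefB !top_coefM ?sX ?s1 // !cX mulrnAl mulrnAr -opprB -mulrnBr ?leq_subr // oppr_eq0.
      rewrite subKn // -mulr_natr !mulf_neq0 //.
      by rewrite -[X in H1`_X]/(d - e).+1.-1 -s1 -lead_coefE lead_coef_eq0.
    have w0 : w != 0 by apply: contraNneq cw => ->; rewrite mulr0 coef0.
    have le1 : (2 * d - e <= size w)%N.
      rewrite leqNgt; apply: contra cw => lt; rewrite coefXM.
      have -> : (d - e + d == 0)%N = false by lia.
      by rewrite nth_default ?eqxx //; move: lt; move: (size w) => s; lia.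
    have le2 : (size ('X * w)%R <= (d - e + d).+1)%N.
      have pM (A B : {poly K}) : (size A <= (d - e).+1)%N -> (size B <= d.+1)%N -> (size (A * B)%R <= (d - e + d).+1)%N.
        by move=> hp hq; apply: leq_trans (size_polyMleq _ _) _; move: (size A) (size B) hp hq => a b; lia.
      rewrite EX; apply: leq_trans (size_polyD _ _) _; rewrite size_polyN geq_max.
      by apply/andP; split; apply: pM; rewrite ?sX ?s1.
    move: le1 le2; rewrite mulrC size_mulX //; move: (size w) => s; lia.
  have r0 := ram_gt0 None; have rd := ram_le None; have rK := eK None.
  suff sw : size wron = (2 * d - ram None)%N by rewrite sw; move: r0 rd; move: (ram None) => e; lia.
  have sH : size (hP (rphi None)) = (d - ram None).+1.
    have := size_hP (rphi None); have := hP_neq0 (rphi None); rewrite -size_poly_gt0.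
    rewrite /ram /ord; move: (size _) => s; lia.
  have := hP_neq0 (rphi None); move: sH; case Ex: (rphi None) => [y|] /= sH H0.
    apply: (main _ G _ (ram None) H0 _ sH) => //; first by rewrite r0 rd.
      by move: Ex => /=; case: (G`_d != 0).
    by rewrite /wron derivB derivZ -!mul_polyC; ring.
  have gd : G`_d = 0 by move: Ex => /=; case: eqP.
  have -> : size wron = size (- wron) by rewrite size_polyN.
  apply: (main _ F _ (ram None) H0 _ sH) => //; first by rewrite r0 rd.
    by apply/eqP => fd; apply: top.
  by rewrite /wron; ring.
case: infty => i1 i2; have [w0 _] := loc 0; split=> //; case: Q => [x|] //=.
by have [] := loc x.
Qed.

(** The fibres over [S] would consist of d |S| distinct points, all in [S]. *)
Lemma no_unramified_cycle (S : seq (option K)) : uniq S -> (0 < size S)%N ->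
  (forall Q, rphi Q \in S -> Q \in S /\ ram Q = 1%N) -> False.
Proof.
move=> uS s0 H; have [fb Hfb] := boolp.choice fiber.
pose T := flatten [seq fb P | P <- S].
have cT Q : count_mem Q T = if rphi Q \in S then ram Q else 0%N.
  rewrite /T count_flatten -map_comp sumnE big_map.
  rewrite (eq_bigr (fun P => if rphi Q == P then ram Q else 0%N)) => [|P _]; last by rewrite /= (Hfb P).2.
  case: ifP => inS.
    rewrite (bigD1_seq (rphi Q)) //= eqxx big1 ?addn0 // => P nP; rewrite eq_sym (negPf nP) //.
  rewrite big1_seq // => P /andP[_ PS]; case: eqP => // E; by rewrite E PS in inS.
have sT : size T = (d * size S)%N.
  rewrite /T size_flatten /shape -map_comp sumnE big_map (eq_bigr (fun=> d)) => [|P _]; last by rewrite /= (Hfb P).1.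
  by rewrite big_const_seq count_predT iter_addn_0.
have uT : uniq T.
  apply: count_mem_uniq => Q; rewrite cT.
  case: (boolP (rphi Q \in S)) => inS.
    have [_ ->] := H Q inS; suff -> : Q \in T by [].
    by rewrite -has_pred1 has_count cT inS ram_gt0.
  suff /negPf -> : Q \notin T by [].
  by rewrite -has_pred1 has_count cT (negPf inS).
have : (size T <= size S)%N.
  apply: uniq_leq_size => // Q; rewrite -has_pred1 has_count cT; case: ifP => // inS _.
  by have [] := H Q inS.
rewrite sT; nia.
Qed.

(** Ramification absorbs at most 2d - 2 points, and d n - (2d - 2) >= n + 2 when n >= 4. The gain of
    two leaves one point even if infinity has to be discarded. *)
Lemma fiber_growth (Y : seq (option K)) : uniq Y -> (4 <= size Y)%N ->
  exists Y', [/\ uniq Y', ((size Y).+1 < size Y')%N & forall Q, Q \in Y' -> rphi Q \in Y].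
Proof.
move=> uS s0; have [fb Hfb] := boolp.choice fiber.
pose T := flatten [seq fb P | P <- Y].
have cT Q : count_mem Q T = if rphi Q \in Y then ram Q else 0%N.
  rewrite /T count_flatten -map_comp sumnE big_map.
  rewrite (eq_bigr (fun P => if rphi Q == P then ram Q else 0%N)) => [|P _]; last by rewrite /= (Hfb P).2.
  case: ifP => inS.
    rewrite (bigD1_seq (rphi Q)) //= eqxx big1 ?addn0 // => P nP; rewrite eq_sym (negPf nP) //.
  rewrite big1_seq // => P /andP[_ PS]; case: eqP => // E; by rewrite E PS in inS.
have sT : size T = (d * size Y)%N.
  rewrite /T size_flatten /shape -map_comp sumnE big_map (eq_bigr (fun=> d)) => [|P _]; last by rewrite /= (Hfb P).1.
  by rewrite big_const_seq count_predT iter_addn_0.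
have inT Q : Q \in T -> rphi Q \in Y.
  by rewrite -has_pred1 has_count cT; case: ifP.
exists (undup T); split; [exact: undup_uniq| |by move=> Q; rewrite mem_undup; apply: inT].
have [w0 sw _] := wron_ord None.
have le := sum_ord_le Kc w0 sw (undup_uniq T).
have szT : size T = (\sum_(Q <- undup T) count_mem Q T)%N by rewrite -sum1_size -big_undup_iterop_count; apply: eq_bigr => Q _; rewrite Monoid.iteropE iter_addn_0 mul1n.
have E : (\sum_(Q <- undup T) count_mem Q T = size (undup T) + \sum_(Q <- undup T) ord (2 * d - 2) wron Q)%N.
  rewrite -sum1_size -big_split /=; apply: eq_big_seq => Q; rewrite mem_undup => QT.
  have [_ _ ->] := wron_ord Q; by rewrite cT inT // add1n prednK // ram_gt0.
have : (d * size Y <= size (undup T) + (2 * d - 2))%N by rewrite -sT szT E leq_add2l.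
nia.
Qed.
End RatMap.

Section Divisor.
Variable K : fieldType.
Hypothesis Kc : alg_closed K.
Variables (F G : {poly K}) (d p : nat).
Hypotheses (sF : (size F <= d.+1)%N) (sG : (size G <= d.+1)%N) (d2 : (2 <= d)%N).
Hypothesis cop : forall x, F.[x] = 0 -> G.[x] = 0 -> False.
Hypothesis top : F`_d = 0 -> G`_d = 0 -> False.
Hypothesis chd : forall e, (0 < e)%N -> (e <= d)%N -> e%:R != 0 :> K.
Hypothesis p1 : (1 < p)%N.
Variables (U a : {poly K}) (N' : nat).
Let N := (p * N' + 2 * p.-1)%N.
Hypotheses (U0 : U != 0) (a0 : a != 0) (sU : (size U <= N.+1)%N) (sa : (size a <= N'.+1)%N).
Hypothesis inv : homp F G N U * a ^+ p = wron F G ^+ p.-1 * U * homp F G N' a ^+ p.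
Local Notation rphi := (rphi F G d).
Local Notation ram := (ram F G d).

(** omega = U / a^p is a section of degree 2(p - 1), and its order at Q is p - 1 - m(Q). *)
Definition mdiv (Q : option K) : int := (p.-1)%:Z - (ord N U Q)%:Z + (p * ord N' a Q)%:Z.

(** Take orders in [inv]: the Wronskian contributes (p - 1)(e - 1), which the constant p - 1 in m
    absorbs. *)
Lemma mdiv_pull Q : mdiv Q = (ram Q)%:Z * mdiv (rphi Q).
Proof.
have [o1 n1 s1] := ord_homp Kc sF sG d2 cop top Q U0 sU.
have [o2 n2 s2] := ord_homp Kc sF sG d2 cop top Q a0 sa.
have [w0 sw ow] := wron_ord Kc sF sG d2 cop top chd Q.
have r0 := ram_gt0 Kc sF sG d2 cop top Q.
have sX n j (H : {poly K}) : (size H <= n.+1)%N -> (size (H ^+ j) <= (j * n).+1)%N.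
  by move=> s; apply: leq_trans (size_poly_exp_leq _ _) _; rewrite ltnS mulnC leq_mul2l; lia.
have := congr1 (fun H => ord (N * d + p * N') H Q) inv.
rewrite ordM ?expf_neq0 ?sX // ordX // o1.
have -> : (N * d + p * N' = (p.-1 * (2 * d - 2) + N) + p * (N' * d))%N by rewrite /N; nia.
have sWU : (size (wron F G ^+ p.-1 * U)%R <= (p.-1 * (2 * d - 2) + N).+1)%N.
  apply: leq_trans (size_polyMleq _ _) _; have := sX _ p.-1 _ sw; move: sU; move: (size _) (size _) => x y; lia.
rewrite ordM ?mulf_neq0 ?expf_neq0 ?sX // ordM ?expf_neq0 ?sX // !ordX // ow o2 /mdiv.
move: (ord N U Q) (ord N U (rphi Q)) (ord N' a Q) (ord N' a (rphi Q)) (ram Q) r0 => x x' y y' e e0 H.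
have {}H : (x' * e + p * y = p.-1 * e.-1 + x + p * (y' * e))%N by exact: H.
have -> : x%:Z = (x' * e)%:Z + (p * y)%:Z - (p.-1 * e.-1)%:Z - (p * (y' * e))%:Z by lia.
have -> : (p.-1 * e.-1)%:Z = p.-1%:Z * (e%:Z - 1) by rewrite PoszM; congr (_ * _); lia.
by rewrite !PoszM; ring.
Qed.

Lemma mdiv_finite : exists L : seq (option K), [/\ uniq L, forall Q, Q \notin L -> mdiv Q = p.-1%:Z &
  \sum_(Q <- L) (p.-1%:Z - mdiv Q) = (2 * p.-1)%:Z].
Proof.
have [ru [su Eu]] := ord_list Kc U0 sU; have [ra [sa' Ea]] := ord_list Kc a0 sa.
exists (undup (ru ++ ra)); split; first exact: undup_uniq.
  move=> Q; rewrite mem_undup mem_cat negb_or => /andP[/count_memPn h1 /count_memPn h2].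
  by rewrite /mdiv Eu Ea h1 h2 muln0 subr0 addr0.
have cs (rs : seq (option K)) : {subset rs <= ru ++ ra} -> (\sum_(Q <- undup (ru ++ ra)) count_mem Q rs = size rs)%N.
  move=> sub; rewrite -[RHS]sum1_size -[RHS]big_undup_iterop_count.
  rewrite [RHS](eq_bigr (fun Q => count_mem Q rs)) => [|Q _]; last by rewrite Monoid.iteropE iter_addn_0 mul1n.
  rewrite [LHS](bigID (fun Q => Q \in rs)) /= [X in (_ + X)%N]big1 ?addn0 => [|Q /count_memPn //].
  rewrite -big_filter; apply: perm_big; apply: uniq_perm; rewrite ?filter_uniq ?undup_uniq // => Q.
  rewrite mem_filter !mem_undup; case: (boolP (Q \in rs)) => // /sub ->; by [].
have h1 : {subset ru <= ru ++ ra} by move=> Q; rewrite mem_cat => ->.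
have h2 : {subset ra <= ru ++ ra} by move=> Q; rewrite mem_cat => ->; rewrite orbT.
transitivity ((\sum_(Q <- undup (ru ++ ra)) count_mem Q ru)%:Z - (p * \sum_(Q <- undup (ru ++ ra)) count_mem Q ra)%:Z).
  rewrite PoszM.
  have sP (h : option K -> nat) : (\sum_(Q <- undup (ru ++ ra)) h Q)%:Z = \sum_(Q <- undup (ru ++ ra)) (h Q)%:Z.
    by elim/big_rec2: _ => // Q y1 y2 _ <-; rewrite PoszD.
  rewrite !sP mulr_sumr -sumrB; apply: eq_bigr => Q _; rewrite /mdiv Eu Ea PoszM; ring.
rewrite !cs // su sa' /N; lia.
Qed.

(** Consider the points of the set where m is maximal. Going back multiplies m by e >= 1 and stays
    in the set, so e = 1 and m is again maximal, against [no_unramified_cycle]. *)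
Lemma backward_pos (m : option K -> int) (Pd : option K -> Prop) (L : seq (option K)) :
  (forall Q, m Q = (ram Q)%:Z * m (rphi Q)) ->
  (forall Q, Pd Q -> Q \in L) -> (forall Q, Pd (rphi Q) -> Pd Q) -> (forall Q, Pd Q -> 0 < m Q) ->
  forall Q, ~ Pd Q.
Proof.
move=> mE PL' Pb Pm Q0 P0.
pose L' := [seq Q <- undup L | `[< Pd Q >]].
have inL Q : (Q \in L') = `[< Pd Q >].
  rewrite mem_filter mem_undup; case: (boolP `[< Pd Q >]) => //= /asboolP /PL' ->; by [].
have [Q1 P1 mx] : exists2 Q1, Pd Q1 & forall Q, Pd Q -> m Q <= m Q1.
  have : (0 < size L')%N by rewrite -has_predT; apply/hasP; exists Q0; rewrite // inL; apply/asboolP.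
  move=> s0; have [n] := ubnP (size L').
  suff H (s : seq (option K)) : (0 < size s)%N -> exists2 Q1, Q1 \in s & forall Q, Q \in s -> m Q <= m Q1.
    have [Q1 h1 h2] := H L' s0; move=> _; exists Q1; first by apply/asboolP; rewrite -inL.
    by move=> Q PQ; apply: h2; rewrite inL; apply/asboolP.
  elim: s {s0} => // Q s IH _; case: s IH => [|R s] IH; first by exists Q; rewrite ?mem_head // => R; rewrite mem_seq1 => /eqP ->.
  have [//|Q1 h1 h2] := IH; have [le|lt] := lerP (m Q) (m Q1).
    by exists Q1; [rewrite in_cons h1 orbT|move=> T; rewrite in_cons => /predU1P[->|/h2]].
  exists Q; first exact: mem_head.
  by move=> T; rewrite in_cons => /predU1P[->|/h2 h]; rewrite // (le_trans h) // ltW.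
have m1 := Pm _ P1.
apply: (no_unramified_cycle Kc sF sG d2 cop top (S := [seq Q <- L' | m Q == m Q1])).
- by rewrite !filter_uniq // undup_uniq.
- rewrite -has_predT; apply/hasP; exists Q1 => //; rewrite mem_filter eqxx inL; exact/asboolP.
move=> Q; rewrite mem_filter inL => /andP[/eqP E /asboolP /Pb PQ].
have r0 := ram_gt0 Kc sF sG d2 cop top Q.
have := mx _ PQ; rewrite mE E => le.
have e1 : ram Q = 1%N by move: le r0 m1; move: (ram Q) (m Q1) => e x; nia.
by rewrite mem_filter inL mE e1 mul1r E eqxx; split=> //; apply/asboolP.
Qed.

(** Three uses of [backward_pos]: with -m where m < 0, with m where m > p - 1, and with m where m >
    0 does not divide p - 1. These sets are finite because m = p - 1 almost everywhere. *)
Theorem mdiv_bounds Q : 0 <= mdiv Q <= p.-1%:Z /\ (mdiv Q = 0 \/ (mdiv Q %| p.-1%:Z)%Z).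
Proof.
have [L [uL offL _]] := mdiv_finite.
have inL R : mdiv R <> p.-1%:Z -> R \in L by move=> ne; apply/negPn/negP => /offL.
have r0 R : (0 < ram R)%N := ram_gt0 Kc sF sG d2 cop top R.
have pq : 0 < p.-1%:Z by lia.
have neg R : ~ (mdiv R < 0).
  apply: (@backward_pos (fun Q => - mdiv Q) (fun Q => mdiv Q < 0) L _ _ _ _ R) => [T|T|T|T].
  - by rewrite mdiv_pull mulrN.
  - by move=> lt; apply: inL => E; move: lt; rewrite E; lia.
  - by rewrite [mdiv T]mdiv_pull; have := r0 T; move: (ram T) (mdiv _) => e x; nia.
  - by rewrite oppr_gt0.
have big R : ~ (p.-1%:Z < mdiv R).
  apply: (@backward_pos mdiv (fun Q => p.-1%:Z < mdiv Q) L _ _ _ _ R) => [T|T|T|T].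
  - exact: mdiv_pull.
  - by move=> lt; apply: inL => E; move: lt; rewrite E; lia.
  - by rewrite [mdiv T]mdiv_pull; have := r0 T; move: (ram T) (mdiv _) => e x; nia.
  - by move=> lt; apply: lt_trans lt.
have dv R : ~ (0 < mdiv R /\ ~ (mdiv R %| p.-1%:Z)%Z).
  apply: (@backward_pos mdiv (fun Q => 0 < mdiv Q /\ ~ (mdiv Q %| p.-1%:Z)%Z) L _ _ _ _ R) => [T|T|T|T].
  - exact: mdiv_pull.
  - by move=> [_ nd]; apply: inL => E; apply: nd; rewrite E dvdzz.
  - move=> [h1 h2]; split; first by rewrite mdiv_pull; have := r0 T; move: h1; move: (ram T) (mdiv _) => e x; nia.
    by move=> h3; apply: h2; apply: dvdz_trans h3; rewrite [mdiv T]mdiv_pull dvdz_mull.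
  - by case.
split; first by apply/andP; split; rewrite leNgt; apply/negP => /=; [apply: neg|apply: big].
have [->|ne] := eqVneq (mdiv Q) 0; [by left|right].
apply/negPn/negP => nd; apply: (dv Q); split; last exact/negP.
by rewrite lt_neqAle eq_sym ne leNgt; apply/negP/neg.
Qed.

Lemma mdiv_sum_le (L : seq (option K)) : uniq L -> \sum_(Q <- L) (p.-1%:Z - mdiv Q) <= (2 * p.-1)%:Z.
Proof.
move=> uL; have [L0 [u0 off <-]] := mdiv_finite.
have t0 Q : 0 <= p.-1%:Z - mdiv Q by rewrite subr_ge0; have [/andP[]] := mdiv_bounds Q.
rewrite [X in X <= _](bigID (fun Q => Q \in L0)) /= [X in _ + X]big1 ?addr0 => [|Q /off ->]; last by rewrite subrr.
have -> : \sum_(Q <- L | Q \in L0) (p.-1%:Z - mdiv Q) = \sum_(Q <- L0 | Q \in L) (p.-1%:Z - mdiv Q).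
  rewrite -[LHS]big_filter -[RHS]big_filter; apply: perm_big.
  by apply: uniq_perm; rewrite ?filter_uniq // => Q; rewrite !mem_filter andbC.
rewrite [X in _ <= X](bigID (fun Q => Q \in L)) /= lerDl; apply: sumr_ge0 => Q _; exact: t0.
Qed.
End Divisor.

(** * Reduction of a rational map *)

Section Reduction.
Variables (f g : {poly int}) (d R : nat).
Hypothesis rm : ratmap f g d R.
Variables (p : nat) (v : place p).
Hypotheses (pp : prime p) (pR : ~~ (p %| R)%N) (dp : (d < p)%N).
Local Notation k := (resT v).
Local Notation mk := (map_poly (intr : int -> k)).
Local Notation F := (mk f).
Local Notation G := (mk g).
Let chp : p \in [pchar k] := res_char v pp.

Lemma res_alg_closed : alg_closed k.
Proof. exact: (@res_closed _ v). Qed.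
Lemma red_natr n : (n%:R == 0 :> k) = (p %| n)%N.
Proof. by rewrite -(dvdn_pcharf chp). Qed.
Lemma red_sF : (size F <= d.+1)%N.
Proof. exact: leq_trans (size_poly _ _) (rm_f rm). Qed.
Lemma red_sG : (size G <= d.+1)%N.
Proof. exact: leq_trans (size_poly _ _) (rm_g rm). Qed.
Lemma red_cop x : F.[x] = 0 -> G.[x] = 0 -> False.
Proof.
move=> f0 g0; have [u [w E]] := rm_bez1 rm.
have := congr1 (fun P => (mk P).[x]) E.
rewrite rmorphD !rmorphM /= hornerD !hornerM f0 g0 !mulr0 addr0 map_polyC hornerC /= => /esym/eqP.
by rewrite rmorph_nat red_natr (negPf pR).
Qed.
Lemma red_top : F`_d = 0 -> G`_d = 0 -> False.
Proof.
rewrite !coef_map /= => f0 g0; have [u [w E]] := rm_bez2 rm.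
have := congr1 (fun P : {poly int} => (mk P).[0]) E.
rewrite rmorphD !rmorphM /= hornerD !hornerM ![(mk (rvp d _)).[0]]horner_coef0 !coef_map /= !coef_rvp0 f0 g0.
rewrite !mulr0 addr0 map_polyC hornerC /= => /esym/eqP.
by rewrite rmorph_nat red_natr (negPf pR).
Qed.
Lemma red_chd e : (0 < e)%N -> (e <= d)%N -> e%:R != 0 :> k.
Proof. by move=> e0 ed; rewrite red_natr; apply/negP => /dvdn_leq; lia. Qed.
Lemma red_G0 : G != 0.
Proof. exact: (hP_neq0 res_alg_closed (rm_d rm) red_cop red_top None). Qed.
Lemma red_W0 : wron F G != 0.
Proof.
by have [] := wron_ord res_alg_closed red_sF red_sG (rm_d rm) red_cop red_top red_chd None.
Qed.

Lemma unitv_factor r t : pO v t -> (pO v r -> pr v r != pr v t) -> unitv v (nw v r * t - nu v r).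
Proof.
move=> Ot H; apply: unitv_pr; case: nuwP => [Or|nO r0 Oi ri].
- by rewrite mul1r; apply: OB.
- by apply: OB; [apply: OM|apply: O1].
- by rewrite mul1r prBE // subr_eq0 eq_sym H.
- by rewrite prBE ?prME ?ri ?mul0r ?sub0r ?pr1 ?oppr_eq0 ?oner_eq0 //; [apply: OM|apply: O1].
Qed.

(** If no root of f - b g reduced to xi, every normalised linear factor would be a unit at a lift of
    xi, whereas their product reduces to 0. Multiple roots are allowed, which a Hensel argument
    would exclude. *)
Lemma lift_preimage b (xi : k) : pO v b -> G.[xi] != 0 -> F.[xi] / G.[xi] = pr v b ->
  exists r, [/\ gC g r != 0, phi f g r = b, pO v r & pr v r = xi].
Proof.
move=> Ob g0 E.
have h0 := map_sub_neq0 rm b; have [rs Ers] := closed_field_poly_normal (pZ f - b *: pZ g).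
set H := _ - _ in h0 Ers; pose Hb := hP F G (Some (pr v b)).
have Hb0 : Hb != 0 := hP_neq0 res_alg_closed (rm_d rm) red_cop red_top (Some (pr v b)).
have prH t : pO v t -> pO v H.[t] /\ pr v H.[t] = Hb.[pr v t].
  move=> Ot; have Of : pO v (pZ f).[t] by apply: O_horner.
  have Og : pO v (pZ g).[t] by apply: O_horner.
  rewrite /H /Hb /= !hornerE; split; first by apply: OB => //; apply: OM.
  by rewrite prBE ?prME ?pr_horner //; apply: OM.
have [hr Ehr] := closed_split res_alg_closed Hb0.
(* A residue off the fibre and off the reduced roots: evaluation there shows that the constant [c]
   is a unit. *)
have [tb ntb] := closed_inf res_alg_closed (hr ++ [seq pr v r | r <- rs]).
have [t0 Ot0 Et0] := pr_surj tb.
move: ntb; rewrite mem_cat negb_or => /andP[n1 n2].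
have HT t : H.[t] = lead_coef H / (\prod_(r <- rs) nw v r) * \prod_(r <- rs) (nw v r * t - nu v r).
  rewrite {1}Ers hornerZ horner_prod -mulrA; congr (_ * _).
  rewrite mulrC -prodf_div; apply: eq_bigr => r _; rewrite hornerXsubC nuE.
  by have := nw_neq0 v r; move: (nw v r) => w w0; field.
set c := _ / _ in HT.
have uF : unitv v (\prod_(r <- rs) (nw v r * t0 - nu v r)).
  rewrite big_seq; elim/big_ind: _ => [||r rr]; [exact: unitv1|exact: unitvM|].
  apply: unitv_factor => // _; rewrite Et0; apply: contraNneq n2 => <-; exact: map_f.
have [O1 E1] := prH t0 Ot0.
have uH : unitv v H.[t0].
  apply: unitv_pr => //; rewrite E1 Et0; apply: contraNneq n1 => z.
  rewrite -root_prod_XsubC -(@rootZ _ tb (lead_coef Hb)) ?lead_coef_eq0 // -Ehr; exact/eqP.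
have uc : unitv v c.
  have -> : c = H.[t0] / \prod_(r <- rs) (nw v r * t0 - nu v r).
    by rewrite HT mulfK //; case: uF.
  by apply: unitvM => //; apply: unitvV.
have [t Ot Et] := pr_surj xi.
have [Ht Pt] := prH t Ot.
have Hz : Hb.[pr v t] = 0 by rewrite Et /Hb /= !hornerE -E divfK // subrr.
have OF r : pO v (nw v r * t - nu v r) by apply: OB; [apply: OM => //; apply: nwO|apply: nuO].
have : \prod_(r <- rs) pr v (nw v r * t - nu v r) = 0.
  rewrite -pr_prod => [|r _]; last exact: OF.
  have -> : \prod_(r <- rs) (nw v r * t - nu v r) = c^-1 * H.[t].
    by rewrite HT mulKf //; case: uc.
  by rewrite prME ?Pt ?Hz ?mulr0 //; case: uc.
move/eqP; rewrite prodf_seq_eq0 => /hasP[r rr /= z].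
have [Or Er] : pO v r /\ pr v r = pr v t.
  apply: contrapT => nc; have /pr_unitv : unitv v (nw v r * t - nu v r).
    apply: unitv_factor => // Or; apply/eqP => Er; apply: nc; by split.
  by rewrite z.
have rH : root H r by rewrite Ers rootZ ?lead_coef_eq0 // root_prod_XsubC.
move: rH; rewrite /root /H !hornerE subr_eq0 => /eqP EH.
have g1 : gC g r != 0.
  by apply/eqP => gz; apply: (fg_neq0 rm _ gz); rewrite /fC EH -/(gC g r) gz mulr0.
by exists r; split; rewrite ?Er //; rewrite /phi /fC EH mulfK.
Qed.

(** Expand f(sigma x) around x^p by the difference quotient and f(x)^p by the lift [f1], likewise
    for g. In sigma(phi x) - phi(x)^p the terms without p cancel, and the quotient by p reduces to
    an affine function of z. *)
Lemma skew_step (f1 g1 : {poly int}) (sg : autC) x :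
  f ^+ p = f \Po 'X^p + f1 *+ p -> g ^+ p = g \Po 'X^p + g1 *+ p ->
  pO v x -> pO v ((sg x - x ^+ p) / p%:R) -> G.[pr v x] != 0 ->
  [/\ pO v (phi f g x), pr v (phi f g x) = F.[pr v x] / G.[pr v x] &
   pr v ((sg (phi f g x) - phi f g x ^+ p) / p%:R) =
   ((wron F G).[pr v x] ^+ p * pr v ((sg x - x ^+ p) / p%:R) -
     (mk f1 * G ^+ p - mk g1 * F ^+ p).[pr v x]) / G.[pr v x] ^+ (2 * p)].
Proof.
move=> Ef Eg Ox Oz g0; set z := (_ - _) / _ in Oz *.
have p0 : (p%:R : algC) != 0 by rewrite pnatr_eq0 -lt0n prime_gt0.
have sx : sg x = x ^+ p + p%:R * z by rewrite /z mulrCA divff // mulr1 addrC subrK.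
clearbody z.
have Op : pO v (p%:R : algC) by apply: Onat.
have Osx : pO v (sg x) by rewrite sx; apply: OD; [apply: OX|apply: OM].
have Oxp : pO v (x ^+ p) by apply: OX.
have psx : pr v (sg x) = pr v x ^+ p.
  by rewrite sx prDE ?prXE ?prME ?pr_prime ?mul0r ?addr0 ?prime_gt0 //; apply: OM.
have OH P y : pO v y -> pO v (pZ P).[y] by apply: O_horner.
have xip P : (mk P).[pr v x ^+ p] = (mk P).[pr v x] ^+ p.
  by have := congr1 (fun q : {poly k} => q.[pr v x]) (frob_comp P chp); rewrite horner_comp hornerXn horner_exp.
have ug : unitv v (gC g x) by apply: unitv_pr; rewrite ?pr_horner //; apply: OH.
have ugs : unitv v (gC g (sg x)).
  by apply: unitv_pr; rewrite ?pr_horner ?psx ?xip ?expf_neq0 //; apply: OH.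
have [gx0 _ Ogi] := ug; have [gs0 _ Ogsi] := ugs.
have Ophi : pO v (phi f g x) by apply: OM => //; apply: OH.
split=> //; first by rewrite /phi prME ?prVE ?pr_horner //; apply: OH.
have lift P P1 : P ^+ p = P \Po 'X^p + P1 *+ p -> (pZ P).[x] ^+ p = (pZ P).[x ^+ p] + p%:R * (pZ P1).[x].
  move=> E; have := congr1 (fun q => (pZ q).[x]) E.
  rewrite rmorphXn rmorphD rmorphMn /= map_comp_poly rmorphXn /= map_polyX horner_exp hornerD horner_comp hornerXn hornerMn.
  by rewrite mulr_natl.
pose Q P := dq P (sg x) (x ^+ p).
have QE P : (pZ P).[sg x] = (pZ P).[x ^+ p] + p%:R * (z * Q P).
  by apply/eqP; rewrite addrC -subr_eq dqE {1}sx -/(Q P); apply/eqP; ring.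
have OQ P : pO v (Q P).
  apply: (subring_set_sum (pOsub v)) => i _; apply: OM; first exact: Oint.
  by apply: (subring_set_sum (pOsub v)) => j _; apply: OM; apply: OX.
have PQ P : pr v (Q P) = (mk P)^`().[pr v x] ^+ p.
  by rewrite /Q dq_red // psx prXE // dq_diag deriv_map xip.
rewrite aut_phi /phi /fC /gC expr_div_n (lift _ _ Ef) (lift _ _ Eg) !QE.
set a := (pZ f).[x ^+ p]; set b := (pZ g).[x ^+ p]; set f1x := (pZ f1).[x]; set g1x := (pZ g1).[x].
have gsE : gC g (sg x) = b + p%:R * (z * Q g) by rewrite /gC QE.
have gxE : gC g x ^+ p = b + p%:R * g1x by rewrite /gC (lift _ _ Eg).
have n1 : b + p%:R * (z * Q g) != 0 by rewrite -gsE.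
have n2 : b + p%:R * g1x != 0 by rewrite -gxE expf_neq0.
have [Oa Ob Of1 Og1] : [/\ pO v a, pO v b, pO v f1x & pO v g1x] by split; apply: OH.
pose num := a * g1x + z * Q f * b - f1x * b - a * (z * Q g) + p%:R * (z * Q f * g1x - f1x * (z * Q g)).
have -> : ((a + p%:R * (z * Q f)) / (b + p%:R * (z * Q g)) - (a + p%:R * f1x) / (b + p%:R * g1x)) / p%:R =
   num * ((gC g (sg x))^-1 * (gC g x ^+ p)^-1).
  rewrite gsE gxE /num; move: (Q f) (Q g) n1 n2 => qf qg n1 n2; field.
  by rewrite p0 n1 n2.
have Oqf : pO v (z * Q f) by apply: OM.
have Oqg : pO v (z * Q g) by apply: OM.
have [pa pb] : pr v a = F.[pr v x] ^+ p /\ pr v b = G.[pr v x] ^+ p.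
  by rewrite /a /b !pr_horner ?prXE // !xip.
have [Onum pnum] : place_rel v num (F.[pr v x] ^+ p * (mk g1).[pr v x] +
     pr v z * F^`().[pr v x] ^+ p * G.[pr v x] ^+ p - (mk f1).[pr v x] * G.[pr v x] ^+ p -
     F.[pr v x] ^+ p * (pr v z * G^`().[pr v x] ^+ p)).
  have kp := place_rel_ring v.
  have -> : F.[pr v x] ^+ p * (mk g1).[pr v x] +
     pr v z * F^`().[pr v x] ^+ p * G.[pr v x] ^+ p - (mk f1).[pr v x] * G.[pr v x] ^+ p -
     F.[pr v x] ^+ p * (pr v z * G^`().[pr v x] ^+ p) =
     pr v a * pr v g1x + pr v z * pr v (Q f) * pr v b - pr v f1x * pr v b
      - pr v a * (pr v z * pr v (Q g)) + 0 * (pr v z * pr v (Q f) * pr v g1x - pr v f1x * (pr v z * pr v (Q g))).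
    by rewrite pa pb !PQ mul0r addr0 /f1x /g1x !pr_horner.
  have pz0 : place_rel v p%:R 0 by split=> //; rewrite pr_prime ?prime_gt0.
  have I1 y : pO v y -> place_rel v y (pr v y) by [].
  rewrite /num; repeat first [exact: pz0|apply: I1; exact: OQ|by apply: I1|apply: (rrD kp)|apply: (rrM kp)|apply: (rrN kp)].
rewrite prME ?prME ?prVE ?prXE //; try (by apply: OH); try (by rewrite -exprVn; apply: OX); last first.
- by apply: OM => //; rewrite -exprVn; apply: OX.
- by apply: OX; apply: OH.
rewrite pnum !pr_horner // psx xip -invfM -exprD addnn -mul2n; congr (_ / _).
rewrite /wron !hornerD !hornerN !hornerM !horner_exp.
have Wp : (F^`().[pr v x] * G.[pr v x] - F.[pr v x] * G^`().[pr v x]) ^+ p =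
   F^`().[pr v x] ^+ p * G.[pr v x] ^+ p - F.[pr v x] ^+ p * G^`().[pr v x] ^+ p.
  by rewrite -(pFrobenius_autE chp) rmorphB !rmorphM /= !pFrobenius_autE.
rewrite Wp; move: (F^`().[_] ^+ p) (G^`().[_] ^+ p) (F.[_] ^+ p) (G.[_] ^+ p) => a1 a2 a3 a4; ring.
Qed.
End Reduction.

(** * The invariant form at large primes *)

Section ModP.
Variables (f g : {poly int}) (d R : nat) (B : seq algC).
Hypothesis rm : ratmap f g d R.
Hypothesis abT : forall n x, inT f g B n x -> abel x.
Hypotheses (uB : uniq B) (sB : (4 <= size B)%N).

(** Residue fibres grow by [fiber_growth] and lift to the tree by [lift_preimage]. The resulting
    abundance of residues turns relations at tree points into polynomial identities. *)
Lemma tree_infinite : exists N : nat, forall p, prime p -> (N < p)%N -> forall v : place p,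
  forall n, exists Y : seq (resT v), [/\ uniq Y, (4 + n <= size Y)%N &
    forall xi, xi \in Y -> exists x, [/\ inT f g B n x, pO v x & pr v x = xi]].
Proof.
have [N1 H1] := list_large B; exists (N1 + R + d)%N => p pp lt v.
have pR : ~~ (p %| R)%N by apply/negP => /dvdn_leq; have := rm_R rm; lia.
have dp : (d < p)%N by lia.
have {}H1 := H1 p pp ltac:(lia) v.
elim=> [|n [Y [uY sY HY]]].
  exists [seq pr v b | b <- B]; split.
  - rewrite map_inj_in_uniq // => x y xB yB E; by have [_] := H1 x y xB yB; apply.
  - by rewrite size_map addn0.
  - move=> xi /mapP[b bB ->]; exists b; split=> //; last by have [] := H1 b b bB bB.
    by exists b => //; exists idfun.
have sG := red_sG rm v; have sF := red_sF rm v.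
have cl := @res_alg_closed _ v.
have sY4 : (4 <= size [seq Some y | y <- Y])%N by rewrite size_map; lia.
have uY4 : uniq [seq Some y | y <- Y] by rewrite map_inj_uniq // => x y [].
have [Y' [uY' sY' HY']] := fiber_growth cl sF sG (rm_d rm) (red_cop rm pp pR) (red_top rm pp pR) (red_chd v pp pR dp) uY4 sY4.
exists (pmap id Y'); split.
- by apply: (pmap_uniq (g := Some)) => // -[].
- have cN : (count_mem None Y' <= 1)%N by rewrite count_uniq_mem //; case: (_ \in _).
  have : (size (pmap id Y') + count_mem None Y' = size Y')%N.
    by rewrite size_pmap -(count_predC isSome Y'); congr (_ + _)%N; apply: eq_count => -[].
  move=> E; rewrite size_map -{}E in sY'; move: (size (pmap id Y')) (count_mem _ Y') (size Y) sY' sY cN => a b c; lia.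
move=> xi; rewrite mem_pmap map_id => /HY' /mapP[b bY].
rewrite /=; case: eqP => // /eqP g0 [E].
have [x [Tx Ox Ex]] := HY b bY.
have [r [gr pr_ Or Er]] := lift_preimage rm pp pR Ox g0 (etrans E (esym Ex)).
by exists r; split=> //=; rewrite pr_.
Qed.

Theorem invariant_form_mod_p : exists N : nat, forall p, prime p -> (N < p)%N -> forall v : place p,
  let F := map_poly (intr : int -> resT v) f in let G := map_poly (intr : int -> resT v) g in
  exists (U a : {poly resT v}) (N' : nat), let N0 := (p * N' + 2 * p.-1)%N in
  [/\ U != 0, a != 0, (size U <= N0.+1)%N, (size a <= N'.+1)%N &
      homp F G N0 U * a ^+ p = wron F G ^+ p.-1 * U * homp F G N' a ^+ p].
Proof.
have [N1 H1] := tree_infinite; have [N2 H2] := aux_relation rm abT.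
have [N3 H3] := inertia_T rm abT.
exists (N1 + N2 + N3 + R + d)%N => p pp lt v F G.
have pR : ~~ (p %| R)%N by apply/negP => /dvdn_leq; have := rm_R rm; lia.
have dp : (d < p)%N by lia.
have {}H1 := H1 p pp ltac:(lia) v.
have [A [M [A0 sA vA]]] := H2 p pp ltac:(lia) v.
have {}H3 := H3 p pp ltac:(lia) v.
have chp := res_char v pp.
have [f1 Ef] := frobenius_lift f pp; have [g1 Eg] := frobenius_lift g pp.
have cl := @res_alg_closed _ v.
have G0 : G != 0 := red_G0 rm v pp pR.
have W0 : wron F G != 0 := red_W0 rm v pp pR dp.
pose E := map_poly intr f1 * G ^+ p - map_poly intr g1 * F ^+ p.
(* The automorphism belongs to the data of the point: it may vary with x, and it is kept when
   passing to phi(x). *)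
pose S n (xi z : resT v) := exists x sg, [/\ inT f g B n x, pO v x, good_frob v sg x, pr v x = xi &
  pr v ((sg x - x ^+ p) / p%:R) = z].
have hS n xi z : S n.+1 xi z -> G.[xi] != 0 ->
    S n (F.[xi] / G.[xi]) (((wron F G).[xi] ^+ p * z - E.[xi]) / G.[xi] ^+ (2 * p)).
  move=> [x [sg [Tx Ox gf <- <-]]] g0; exists (phi f g x), sg.
  have Oz : pO v ((sg x - x ^+ p) / p%:R) by have [H _] := gf x (@gen_refl x) idfun; apply: H.
  have [O1 e1 e2] := skew_step pp Ef Eg Ox Oz g0.
  split=> //; first by case: Tx.
  move=> y gy; apply: gf => u u' Eu; apply: gy; rewrite !aut_phi Eu //.
have hinf M' (P : {poly resT v}) : (forall n xi z, (M' <= n)%N -> S n xi z -> P.[xi] = 0) -> P = 0.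
  move=> H; have [Y [uY sY HY]] := H1 (M' + size P)%N.
  apply: (roots_geq_poly_eq0 _ uY); last by apply: leq_trans sY; rewrite addnA leq_addl.
  apply/allP => xi /HY[x [Tx Ox Ex]].
  have [sg Hsg] := frobenius_cong pp (abT Tx) (H3 _ _ Tx).
  apply/eqP; apply: (H _ xi (pr v ((sg x - x ^+ p) / p%:R)) (leq_addr (size P) _)).
  by exists x, sg.
have van : exists M, forall n x z, (M <= n)%N -> S n x z -> A.[z%:P].[x] = 0.
  by exists M => n xi z le [x [sg [Tx Ox gf <- <-]]]; apply: vA le Tx Ox gf.
have [a [a' [k0 [n' [a0 k00 sa sa' Est]]]]] := minimal_relation chp G0 W0 hS hinf A0 sA van.
have [U [U0 sU EU]] := invariant_form (closed_inf cl) chp Ef Eg G0 W0 a0 k00 sa sa' Est.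
by exists U, a, n'.+1.
Qed.
End ModP.

(** * Binary forms, Moebius maps and integral models *)

Section Forms.
Variable K : fieldType.
Implicit Types (F G : {poly K}) (u w : K).

Definition hv n (P : {poly K}) u w : K := \sum_(i < n.+1) P`_i * u ^+ i * w ^+ (n - i).
Definition pt u w : option K := if w != 0 then Some (u / w) else None.

Lemma pt1 x : pt x 1 = Some x. Proof. by rewrite /pt oner_neq0 divr1. Qed.
Lemma pt_inf u : pt u 0 = None. Proof. by rewrite /pt eqxx. Qed.

Lemma pt_scale s u w : s != 0 -> pt (s * u) (s * w) = pt u w.
Proof.
move=> s0; rewrite /pt mulf_eq0 (negPf s0) /=; case: eqP => //= /eqP w0.
by congr Some; field; rewrite w0 s0.
Qed.

Lemma hv_affine n (P : {poly K}) u w : w != 0 -> (size P <= n.+1)%N -> hv n P u w = w ^+ n * P.[u / w].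
Proof.
move=> w0 sz; rewrite (horner_coef_wide _ sz) mulr_sumr; apply: eq_bigr => i _.
have le : (i <= n)%N by rewrite -ltnS.
rewrite expr_div_n (expr_split w le); have := expf_neq0 i w0; move: (w ^+ i) => y y0; by field.
Qed.

Lemma hv_inf n (P : {poly K}) u : hv n P u 0 = P`_n * u ^+ n.
Proof.
rewrite /hv big_ord_recr /= subnn expr0 mulr1 big1 ?add0r // => i _.
by rewrite expr0n subn_eq0 leqNgt ltn_ord mulr0.
Qed.

Lemma ptP (Q : option K) : exists u w, ((u != 0) || (w != 0)) /\ Q = pt u w.
Proof.
case: Q => [x|]; first by exists x, 1; rewrite oner_neq0 orbT pt1.
by exists 1, 0; rewrite oner_neq0 pt_inf.
Qed.

Lemma rphi_pt F G d u w : (size F <= d.+1)%N -> (size G <= d.+1)%N -> (u != 0) || (w != 0) ->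
  rphi F G d (pt u w) = pt (hv d F u w) (hv d G u w).
Proof.
move=> sF sG nz; have [w0|w0] := eqVneq w 0.
  rewrite w0 eqxx orbF in nz; rewrite w0 pt_inf !hv_inf ![_ * u ^+ d]mulrC pt_scale ?expf_neq0 //.
by rewrite !hv_affine // pt_scale ?expf_neq0 // /pt w0.
Qed.

Definition nocz n F G := forall u w, (u != 0) || (w != 0) -> hv n F u w = 0 -> hv n G u w = 0 -> False.

Lemma hv1 (P : {poly K}) u w : hv 1 P u w = P`_0 * w + P`_1 * u.
Proof. by rewrite /hv !big_ord_recl big_ord0 /= expr0 expr1 !mulr1 addr0. Qed.

Definition mobN (a b : K) : {poly K} := a *: 'X + b%:P.
Lemma size_mobN a b : (size (mobN a b) <= 2)%N.
Proof.
apply: leq_trans (size_polyD _ _) _; rewrite geq_max (leq_trans (size_scale_leq _ _)) ?size_polyX //=.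
by rewrite (leq_trans (size_polyC_leq1 _)).
Qed.
Lemma hv_mobN a b u w : hv 1 (mobN a b) u w = a * u + b * w.
Proof. by rewrite hv1 /mobN !coefD !coefZ !coefX !coefC /= mulr0 mulr1 add0r addr0 addrC. Qed.

Definition mob (a b c e : K) (P : option K) := rphi (mobN a b) (mobN c e) 1 P.
Lemma mob_pt a b c e u w : (u != 0) || (w != 0) -> mob a b c e (pt u w) = pt (a * u + b * w) (c * u + e * w).
Proof. by move=> nz; rewrite /mob rphi_pt ?size_mobN // !hv_mobN. Qed.

Lemma det_nz a b c e u w : a * e - b * c != 0 -> (u != 0) || (w != 0) ->
  (a * u + b * w != 0) || (c * u + e * w != 0).
Proof.
move=> D; apply: contraTT; rewrite !negb_or !negbK => /andP[/eqP h1 /eqP h2]; apply/andP.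
have Eu : (a * e - b * c) * u = e * (a * u + b * w) - b * (c * u + e * w) by ring.
have Ew : (a * e - b * c) * w = a * (c * u + e * w) - c * (a * u + b * w) by ring.
move/eqP: Eu; move/eqP: Ew; rewrite h1 h2 !mulr0 subr0 !mulf_eq0 (negPf D) /=; by split.
Qed.

Lemma mobM a b c e a' b' c' e' P : a' * e' - b' * c' != 0 ->
  mob a b c e (mob a' b' c' e' P) =
  mob (a * a' + b * c') (a * b' + b * e') (c * a' + e * c') (c * b' + e * e') P.
Proof.
move=> D; have [u [w [nz ->]]] := ptP P; rewrite !mob_pt ?det_nz //.
by congr pt; ring.
Qed.

Lemma mob_id s P : s != 0 -> mob s 0 0 s P = P.
Proof.
move=> s0; have [u [w [nz ->]]] := ptP P; rewrite mob_pt // !mul0r addr0 add0r.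
exact: pt_scale.
Qed.

Lemma mobK a b c e P : a * e - b * c != 0 -> mob e (- b) (- c) a (mob a b c e P) = P.
Proof.
move=> D; rewrite mobM //; have -> : e * a + - b * c = a * e - b * c by ring.
have -> : e * b + - b * e = 0 by ring. have -> : - c * a + a * c = 0 by ring.
have -> : - c * b + a * e = a * e - b * c by ring.
exact: mob_id.
Qed.

Lemma mobK' a b c e P : a * e - b * c != 0 -> mob a b c e (mob e (- b) (- c) a P) = P.
Proof.
move=> D; have D' : e * a - - b * - c != 0 by rewrite mulrNN mulrC [b * c]mulrC [c * b]mulrC.
by have := mobK P D'; rewrite !opprK.
Qed.

(* pull-back of the binary form [P] by the linear substitution *)
Definition subst n a b c e (P : {poly K}) := homp (mobN a b) (mobN c e) n P.
Hypothesis kinf : forall s : seq K, exists x, x \notin s.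

Lemma size_subst n a b c e (P : {poly K}) : (size (subst n a b c e P) <= n.+1)%N.
Proof.
apply: leq_trans (size_sum _ _ _) _; apply/bigmax_leqP => i _.
apply: leq_trans (size_scale_leq _ _) _; apply: leq_trans (size_polyMleq _ _) _.
have sX j a' b' : (size (mobN a' b' ^+ j) <= j.+1)%N.
  apply: leq_trans (size_poly_exp_leq _ _) _; have := size_mobN a' b'; move: (size _) => s; nia.
have le : (i <= n)%N by rewrite -ltnS.
have := sX i a b; have := sX (n - i)%N c e; move: (size _) (size _) => x y; lia.
Qed.

Lemma hv_subst n a b c e (P : {poly K}) u w : (size P <= n.+1)%N -> hv n (subst n a b c e P) u w = hv n P (a * u + b * w) (c * u + e * w).
Proof.
move=> sP; have lin_top (Q : {poly K}) j : (size Q <= 2)%N -> (Q ^+ j)`_j = Q`_1 ^+ j.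
  move=> sQ; elim: j => [|j IH]; first by rewrite !expr0 coef1.
  rewrite !exprS -{1}[j.+1]add1n top_coefM ?IH //; apply: leq_trans (size_poly_exp_leq _ _) _.
  by move: (size Q) sQ => s; nia.
have sX j a' b' : (size (mobN a' b' ^+ j) <= j.+1)%N.
  apply: leq_trans (size_poly_exp_leq _ _) _; have := size_mobN a' b'; move: (size _) => s; nia.
have c1 a' b' : (mobN a' b')`_1 = a' by rewrite coefD coefZ coefX coefC /= mulr1 addr0.
have [->|w0] := eqVneq w 0.
  rewrite hv_inf !mulr0 !addr0 /subst /homp coef_sum mulr_suml; apply: eq_bigr => i _.
  have le : (i <= n)%N by rewrite -ltnS.
  have Et : (mobN a b ^+ i * mobN c e ^+ (n - i))`_n = a ^+ i * c ^+ (n - i).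
    by have := top_coefM (sX i a b) (sX (n - i)%N c e); rewrite subnKC // !lin_top ?size_mobN // !c1.
  by rewrite coefZ Et !exprMn (expr_split u le); ring.
rewrite hv_affine ?size_subst // horner_sum mulr_sumr; apply: eq_bigr => i _.
have le : (i <= n)%N by rewrite -ltnS.
rewrite hornerZ hornerM !horner_exp !hornerD !hornerZ !hornerX !hornerC (expr_split w le).
have E a' b' : a' * (u / w) + b' = (a' * u + b' * w) / w by field.
rewrite !E !expr_div_n; have := expf_neq0 i w0; have := expf_neq0 (n - i) w0.
move: (w ^+ i) (w ^+ (n - i)) => y z z0 y0; field; by rewrite y0 z0.
Qed.
End Forms.

Lemma hvD (K : fieldType) n (P Q : {poly K}) u w : hv n (P + Q) u w = hv n P u w + hv n Q u w.
Proof. by rewrite /hv -big_split; apply: eq_bigr => i _; rewrite coefD !mulrDl. Qed.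
Lemma hvZ (K : fieldType) n c (P : {poly K}) u w : hv n (c *: P) u w = c * hv n P u w.
Proof. by rewrite /hv mulr_sumr; apply: eq_bigr => i _; rewrite coefZ !mulrA. Qed.

Lemma algC_closed : alg_closed algC.
Proof.
by move=> P sP; have /closed_rootP : size P != 1%N by rewrite gtn_eqF.
Qed.

Lemma reval_rphi (f g : {poly algC}) P : (1 < maxn (size f) (size g))%N ->
  reval f g P = rphi f g (rdeg f g) P.
Proof.
case: P => [x|] // h; rewrite /reval /rphi /rdeg.
have [lt|ge] := ltnP (size g) (size f).
  by rewrite nth_default ?eqxx //; move: lt h; move: (size f) (size g) => a b; lia.
have g0 : g != 0 by rewrite -size_poly_gt0; move: ge h; move: (size f) (size g) => a b; lia.
have dE : (maxn (size f) (size g)).-1 = (size g).-1 by rewrite (maxn_idPr ge).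
rewrite ?dE -[g`_ _]lead_coefE lead_coef_eq0 g0 /=; case: eqP => [E|ne]; first by rewrite -E -lead_coefE.
rewrite [f`_ _]nth_default ?mul0r //; move: ge ne g0; rewrite -size_poly_gt0; move: (size f) (size g) => a b; lia.
Qed.

Lemma ramif_ram (f g : {poly algC}) P : (1 < maxn (size f) (size g))%N ->
  ramif f g P = ram f g (rdeg f g) P.
Proof. by move=> h; case: P => [x|]; rewrite /ramif /ram -reval_rphi //; case: reval. Qed.

Lemma mob_reval a b c e P : a * e - b * c != 0 ->
  reval (a *: 'X + b%:P) (c *: 'X + e%:P) P = mob a b c e P.
Proof.
move=> D; have sz a' b' : a' != 0 -> size (mobN a' b' : {poly algC}) = 2%N.
  by move=> a0; rewrite size_polyDl size_scale ?size_polyX // (leq_ltn_trans (size_polyC_leq1 _)).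
have d1 : maxn (size (mobN a b : {poly algC})) (size (mobN c e : {poly algC})) = 2%N.
  have := size_mobN a b; have := size_mobN c e.
  have [a0|a0] := eqVneq a 0; last by rewrite (sz a) // => h _; apply/maxn_idPl.
  have c0 : c != 0 by apply: contraNneq D => ->; rewrite a0 mul0r mulr0 subr0.
  by rewrite (sz c) // => _ h; apply/maxn_idPr.
by rewrite reval_rphi /rdeg -/(mobN a b) -/(mobN c e) d1.
Qed.

Lemma coprimep_nocz (f g : {poly rat}) : coprimep f g -> (1 < rdeg f g)%N ->
  nocz (rdeg f g) (polyQ f) (polyQ g).
Proof.
move=> cop d2 u w nz; set d := rdeg f g.
have szm (P : {poly rat}) : size (polyQ P) = size P by apply: size_map_poly.
have sf : (size (polyQ f) <= d.+1)%N by rewrite szm /d /rdeg; move: (size f) (size g) => a b; lia.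
have sg : (size (polyQ g) <= d.+1)%N by rewrite szm /d /rdeg; move: (size f) (size g) => a b; lia.
have [w0|w0] := eqVneq w 0.
  rewrite w0 eqxx orbF in nz; rewrite w0 !hv_inf => /eqP; rewrite mulf_eq0 expf_eq0 (negPf nz) andbF orbF => /eqP f0.
  move/eqP; rewrite mulf_eq0 expf_eq0 (negPf nz) andbF orbF => /eqP g0.
  have lt (P : {poly algC}) : (size P <= d.+1)%N -> P`_d = 0 -> (size P <= d)%N.
    move=> s P0; apply/leq_sizeP => j; rewrite leq_eqVlt => /predU1P[<- //|l].
    by rewrite nth_default // (leq_trans s).
  have := lt _ sf f0; have := lt _ sg g0; rewrite !szm; move: d2; rewrite /d /rdeg.
  by move: (size f) (size g) => a b; lia.
rewrite !hv_affine // => /eqP; rewrite mulf_eq0 expf_eq0 (negPf w0) andbF /= => f0.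
move=> /eqP; rewrite mulf_eq0 expf_eq0 (negPf w0) andbF /= => g0.
have : coprimep (polyQ f) (polyQ g) by rewrite coprimep_map.
by move/coprimep_root => /(_ (u / w) f0); rewrite g0.
Qed.

Lemma norm_root_coprimep (f g : {poly rat}) :
  (forall x, root (polyQ f) x -> root (polyQ g) x -> False) -> coprimep f g.
Proof.
move=> H; rewrite -(coprimep_map (@ratr algC)) -/(polyQ f) -/(polyQ g).
apply/Pdiv.ClosedField.coprimepP => x r1; apply/negP => r2; exact: H r1 r2.
Qed.

Lemma nocz_coprimep d (f g : {poly rat}) : (size f <= d.+1)%N -> (size g <= d.+1)%N ->
  nocz d (polyQ f) (polyQ g) -> coprimep f g /\ rdeg f g = d.
Proof.
move=> sf sg nc; have szm (P : {poly rat}) : size (polyQ P) = size P by apply: size_map_poly.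
split.
  apply: norm_root_coprimep => x r1 r2; apply: (nc x 1); rewrite ?oner_neq0 ?orbT //.
    by rewrite hv_affine ?szm ?oner_neq0 // divr1 (eqP r1) mulr0.
  by rewrite hv_affine ?szm ?oner_neq0 // divr1 (eqP r2) mulr0.
have h := nc 1 0; rewrite !hv_inf !expr1n !mulr1 oner_neq0 in h.
rewrite /rdeg; suff : (d < maxn (size f) (size g))%N by move: (size f) (size g) sf sg => a b; lia.
rewrite ltnNge; apply/negP; rewrite geq_max => /andP[h1 h2].
by apply: h => //; rewrite nth_default ?szm.
Qed.

Lemma polyQ_pZ (P : {poly int}) : polyQ (map_poly intr P) = pZ P.
Proof. by rewrite /polyQ -map_poly_comp; apply: eq_map_poly => x /=; rewrite ratr_int. Qed.

Lemma polyQ_Z c (P : {poly rat}) : polyQ (c *: P) = ratr c *: polyQ P.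
Proof. by rewrite /polyQ map_polyZ. Qed.

Lemma bezout_int (F G : {poly int}) : coprimep (map_poly (intr : int -> rat) F) (map_poly intr G) ->
  exists R u v, (0 < R)%N /\ u * F + v * G = R%:R%:P.
Proof.
move=> /Bezout_coprimepP[[u v] /= /eqpP [[c1 c2] /= /andP[n1 n2] E]].
have [u0 [a a0 Eu]] := rat_poly_scale (c1 *: u).
have [v0 [b b0 Ev]] := rat_poly_scale (c1 *: v).
have [e [q q0 Eq]] := rat_poly_scale c2%:P.
have EE : ((b * q) *: u0) * F + ((a * q) *: v0) * G = (a * b) *: e.
  apply: (map_inj_poly (f := intr : int -> rat)); [exact: intr_inj|by []|].
  rewrite rmorphD !rmorphM /= !map_polyZ /= !intrM.
  have aE : a%:~R != 0 :> rat by rewrite intr_eq0.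
  have bE : b%:~R != 0 :> rat by rewrite intr_eq0.
  have qE : q%:~R != 0 :> rat by rewrite intr_eq0.
  have -> : map_poly intr u0 = a%:~R *: (c1 *: u) by rewrite Eu scalerA divff // scale1r.
  have -> : map_poly intr v0 = b%:~R *: (c1 *: v) by rewrite Ev scalerA divff // scale1r.
  have -> : map_poly intr e = q%:~R *: c2%:P by rewrite Eq scalerA divff // scale1r.
  rewrite alg_polyC in E; rewrite -E !scalerDr -!scalerAl !scalerA -?scalerAl ?scalerA; congr (_ + _).
    by rewrite -!mul_polyC; ring.
  by rewrite -!mul_polyC; ring.
have e0 : e`_0 != 0.
  have := congr1 (fun P : {poly rat} => P`_0) Eq; rewrite coefC coefZ coef_map /= => Ec.
  by apply: contraNneq n2 => z; rewrite Ec z mulr0.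
have sze : e = (e`_0)%:P.
  apply: size1_polyC; have := congr1 (fun P : {poly rat} => size P) Eq.
  rewrite size_scale ?invr_eq0 ?intr_eq0 // size_map_inj_poly ?intr_eq0 //; last exact: intr_inj.
  by move=> <-; rewrite size_polyC; case: (_ == _).
pose r := a * b * e`_0; have r0 : r != 0 by rewrite !mulf_neq0.
exists (absz r), (sgz r *: ((b * q) *: u0)), (sgz r *: ((a * q) *: v0)); split; first by rewrite absz_gt0.
rewrite -[sgz r *: _ * F]scalerAl -[sgz r *: _ * G]scalerAl -scalerDr EE sze -!mul_polyC -!polyCM; congr (_%:P).
by rewrite natz abszEsg.
Qed.

Lemma rvp_hv d (P : {poly int}) x : (pZ (rvp d P)).[x] = hv d (pZ P) 1 x.
Proof.
rewrite (horner_intr_wide _ (size_poly _ _)) /hv (reindex_inj rev_ord_inj) /=.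
apply: eq_bigr => i _; rewrite coef_poly subSS ltnS leq_subr coef_map /= expr1n mulr1.
by rewrite subKn // -ltnS.
Qed.

Lemma rat_ratmap (f g : {poly rat}) : coprimep f g -> (2 <= rdeg f g)%N ->
  exists f0 g0 R (s : rat), [/\ s != 0, polyQ f = ratr s *: pZ f0, polyQ g = ratr s *: pZ g0 & ratmap f0 g0 (rdeg f g) R].
Proof.
move=> cop d2; set d := rdeg f g in d2 *.
have [f1 [a a0 Ef]] := rat_poly_scale f; have [g1 [b b0 Eg]] := rat_poly_scale g.
pose f0 := b *: f1; pose g0 := a *: g1; pose s : rat := ((a * b)%:~R)^-1.
have s0 : s != 0 by rewrite invr_eq0 intr_eq0 mulf_neq0.
have ab : a%:~R != 0 :> rat /\ b%:~R != 0 :> rat by rewrite !intr_eq0.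
have Ef0 : f = s *: map_poly intr f0.
  by rewrite Ef map_polyZ scalerA /s intrM; congr (_ *: _); case: ab => h1 h2; field; rewrite h1 h2.
have Eg0 : g = s *: map_poly intr g0.
  by rewrite Eg map_polyZ scalerA /s intrM; congr (_ *: _); case: ab => h1 h2; field; rewrite h1 h2.
have Qf : polyQ f = ratr s *: pZ f0 by rewrite Ef0 polyQ_Z polyQ_pZ.
have Qg : polyQ g = ratr s *: pZ g0 by rewrite Eg0 polyQ_Z polyQ_pZ.
have szf (P0 : {poly int}) (P : {poly rat}) : P = s *: map_poly intr P0 -> size P0 = size P.
  by move=> ->; rewrite size_scale // size_map_inj_poly //; exact: intr_inj.
have nc := coprimep_nocz cop d2.
have nc0 u w : (u != 0) || (w != 0) -> hv d (pZ f0) u w = 0 -> hv d (pZ g0) u w = 0 -> False.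
  by move=> nz h1 h2; apply: (nc u w nz); rewrite ?Qf ?Qg hvZ ?h1 ?h2 mulr0.
have [|R1 [u1 [v1 [R1p B1]]]] := @bezout_int f0 g0.
  by move: cop; rewrite {1}Ef0 {1}Eg0 coprimepZl // coprimepZr.
have [R2 [u2 [v2 [R2p B2]]]] : exists R u v, (0 < R)%N /\ u * rvp d f0 + v * rvp d g0 = R%:R%:P.
  apply: bezout_int; apply: norm_root_coprimep => x; rewrite !polyQ_pZ /root !rvp_hv => /eqP h1 /eqP h2.
  by apply: (nc0 1 x); rewrite ?oner_neq0.
exists f0, g0, (R1 * R2)%N, s; split=> //; split=> //.
- by rewrite (szf _ _ Ef0) /d /rdeg; move: (size f) (size g) => x y; lia.
- by rewrite (szf _ _ Eg0) /d /rdeg; move: (size f) (size g) => x y; lia.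
- by rewrite muln_gt0 R1p.
- exists (R2%:R%:P * u1), (R2%:R%:P * v1); rewrite -!mulrA -mulrDr B1 -polyCM natrM mulrC //.
- exists (R1%:R%:P * u2), (R1%:R%:P * v2); by rewrite -!mulrA -mulrDr B2 -polyCM natrM.
Qed.

Lemma reval_pt (f g : {poly rat}) u w : coprimep f g -> (2 <= rdeg f g)%N -> (u != 0) || (w != 0) ->
  reval (polyQ f) (polyQ g) (pt u w) = pt (hv (rdeg f g) (polyQ f) u w) (hv (rdeg f g) (polyQ g) u w).
Proof.
move=> cop d2 nz; have szm (P : {poly rat}) : size (polyQ P) = size P by apply: size_map_poly.
have dE : rdeg (polyQ f) (polyQ g) = rdeg f g by rewrite /rdeg !szm.
rewrite reval_rphi ?szm; last by move: d2; rewrite /rdeg; move: (size f) (size g) => x y; lia.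
by rewrite dE rphi_pt // szm /rdeg; move: (size f) (size g) => x y; lia.
Qed.

Lemma conj_transport (f g : {poly rat}) (a b c e : rat) : coprimep f g -> (2 <= rdeg f g)%N ->
  a * e - b * c != 0 -> exists f' g' : {poly rat}, [/\ coprimep f' g', rdeg f' g' = rdeg f g &
   conj_by (ratr a) (ratr b) (ratr c) (ratr e) (polyQ f) (polyQ g) (polyQ f') (polyQ g')].
Proof.
move=> cop d2 D; set d := rdeg f g.
pose fh := subst d a b c e f; pose gh := subst d a b c e g.
(* The adjugate matrix replaces the inverse, which changes nothing projectively. *)
pose f' := e *: fh - b *: gh; pose g' := a *: gh - c *: fh.
have sz (x y : rat) (P Q : {poly rat}) : (size P <= d.+1)%N -> (size Q <= d.+1)%N -> (size (x *: P - y *: Q)%R <= d.+1)%N.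
  move=> h1 h2; apply: leq_trans (size_polyD _ _) _; rewrite size_polyN geq_max.
  by rewrite !(leq_trans (size_scale_leq _ _)).
have sf : (size f' <= d.+1)%N by apply: sz; apply: size_subst.
have sg : (size g' <= d.+1)%N by apply: sz; apply: size_subst.
have szm (P : {poly rat}) : size (polyQ P) = size P by apply: size_map_poly.
pose A := ratr a : algC; pose B := ratr b : algC; pose C := ratr c : algC; pose E := ratr e : algC.
have D' : A * E - B * C != 0 by rewrite -!rmorphM -rmorphB fmorph_eq0.
have Qsub (P : {poly rat}) : polyQ (subst d a b c e P) = subst d A B C E (polyQ P).
  rewrite /polyQ /subst /homp rmorph_sum; apply: eq_bigr => i _.
  by rewrite /= map_polyZ coef_map rmorphM !rmorphXn /= /mobN !rmorphD /= !map_polyZ /= !map_polyX !map_polyC.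
have hs (P : {poly rat}) u w : (size P <= d.+1)%N -> hv d (polyQ (subst d a b c e P)) u w = hv d (polyQ P) (A * u + B * w) (C * u + E * w).
  by move=> h; rewrite Qsub hv_subst ?szm.
have sd : (size f <= d.+1)%N /\ (size g <= d.+1)%N by rewrite /d /rdeg; move: (size f) (size g) => x y; lia.
have [sdf sdg] := sd.
have hv2 (x y : rat) (P Q : {poly rat}) u w : hv d (polyQ (x *: P - y *: Q)) u w = ratr x * hv d (polyQ P) u w - ratr y * hv d (polyQ Q) u w.
  have -> : polyQ (x *: P - y *: Q) = ratr x *: polyQ P + (- ratr y) *: polyQ Q.
    by rewrite /polyQ rmorphB /= !map_polyZ scaleNr.
  by rewrite hvD !hvZ mulNr.
have hf u w : hv d (polyQ f') u w = E * hv d (polyQ f) (A * u + B * w) (C * u + E * w) - B * hv d (polyQ g) (A * u + B * w) (C * u + E * w).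
  by rewrite hv2 !hs.
have hg u w : hv d (polyQ g') u w = A * hv d (polyQ g) (A * u + B * w) (C * u + E * w) - C * hv d (polyQ f) (A * u + B * w) (C * u + E * w).
  by rewrite hv2 !hs.
have nc := coprimep_nocz cop d2.
have nc' : nocz d (polyQ f') (polyQ g').
  move=> u w nz; rewrite hf hg; move: (det_nz D' nz) => nz'.
  move=> h1 h2; apply: (nc _ _ nz'); move: h1 h2;
    move: (hv _ (polyQ f) _ _) (hv _ (polyQ g) _ _) => x y h1 h2; apply: (mulfI D'); rewrite mulr0.
    by transitivity (A * (E * x - B * y) + B * (A * y - C * x)); [ring|rewrite h1 h2 !mulr0 addr0].
  by transitivity (C * (E * x - B * y) + E * (A * y - C * x)); [ring|rewrite h1 h2 !mulr0 addr0].
have [cop' dE] := nocz_coprimep sf sg nc'.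
exists f', g'; split=> //; split=> // P; rewrite !mob_reval //.
have [u [w [nz ->]]] := ptP P; have nz' := det_nz D' nz.
rewrite mob_pt // (reval_pt cop d2 nz') (reval_pt cop' _ nz) dE // mob_pt; last first.
  apply/negPn/negP; rewrite negb_or !negbK => /andP[/eqP h1 /eqP h2]; exact: (nc' _ _ nz h1 h2).
rewrite -/d hf hg; move: (hv _ (polyQ f) _ _) (hv _ (polyQ g) _ _) => x y.
rewrite -[LHS](pt_scale _ _ D'); congr pt; rewrite -/A -/B -/C -/E; ring.
Qed.

(** * Critical orbits *)

(** Finitely many such statements hold together, and a single place where all of them hold is enough
    for a conclusion in characteristic 0. *)
Definition ultimately (A : forall p, place p -> Prop) : Prop :=
  exists N : nat, forall p, prime p -> (N < p)%N -> forall v : place p, A p v.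

Lemma ultimately_and A B : ultimately A -> ultimately B -> ultimately (fun p v => A p v /\ B p v).
Proof.
move=> [N H] [M H']; exists (N + M)%N => p pp lt v.
by split; [apply: H => //; lia|apply: H' => //; lia].
Qed.

Lemma ultimately_seq (I : eqType) (s : seq I) (A : I -> forall p, place p -> Prop) :
  (forall i, i \in s -> ultimately (A i)) -> ultimately (fun p v => forall i, i \in s -> A i p v).
Proof.
elim: s => [|i s IH] H; first by exists 0%N.
have [||N HN] := @ultimately_and (A i) (fun p v => forall i, i \in s -> A i p v).
- by apply: H; rewrite mem_head.
- by apply: IH => j js; apply: H; rewrite in_cons js orbT.
by exists N => p pp lt v j; have [h1 h2] := HN p pp lt v; rewrite in_cons => /predU1P[->|/h2].
Qed.

Lemma ultimately_ex A : ultimately A -> exists p (v : place p), prime p /\ A p v.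
Proof.
move=> [N H]; have [p lt pp] := prime_above N; have [v _] := place_exists pp.
by exists p, v; split=> //; apply: H.
Qed.

Definition red p (v : place p) (Q : option algC) : option (resT v) :=
  if Q is Some x then (if pselect (pO v x) then Some (pr v x) else None) else None.

Lemma red_O p (v : place p) x : pO v x -> red v (Some x) = Some (pr v x).
Proof. by rewrite /red; case: pselect. Qed.

(** With weight (p-1)/m(Q) at Q, infinite when m = 0, this is a parabolic orbifold covered by
    itself: the first clause is the covering condition, the last says that the sum of 1 - 1/weight
    is 2. *)
Definition orbi (K : fieldType) (F G : {poly K}) (d p : nat) (m : option K -> int) : Prop :=
  [/\ forall Q, m Q = (ram F G d Q)%:Z * m (rphi F G d Q),
      forall Q, 0 <= m Q <= p.-1%:Z, forall Q, m Q = 0 \/ (m Q %| p.-1%:Z)%Z,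
      forall L, uniq L -> \sum_(Q <- L) (p.-1%:Z - m Q) <= (2 * p.-1)%:Z &
      exists L, [/\ uniq L, forall Q, Q \notin L -> m Q = p.-1%:Z &
         \sum_(Q <- L) (p.-1%:Z - m Q) = (2 * p.-1)%:Z]].

Section Transfer.
Variables (f g : {poly int}) (d R : nat).
Hypothesis rm : ratmap f g d R.
Local Notation FC := (pZ f).
Local Notation GC := (pZ g).
Local Notation phC := (rphi FC GC d).
Local Notation ramC := (ram FC GC d).
Local Notation Fk v := (map_poly (intr : int -> resT v) f).
Local Notation Gk v := (map_poly (intr : int -> resT v) g).

Lemma C_sF : (size FC <= d.+1)%N. Proof. exact: leq_trans (size_poly _ _) (rm_f rm). Qed.
Lemma C_sG : (size GC <= d.+1)%N. Proof. exact: leq_trans (size_poly _ _) (rm_g rm). Qed.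
Lemma C_cop x : FC.[x] = 0 -> GC.[x] = 0 -> False. Proof. exact: (fg_neq0 rm). Qed.
Lemma C_top : FC`_d = 0 -> GC`_d = 0 -> False.
Proof. by rewrite !coef_map; apply: (fgd_neq0 rm). Qed.
Lemma C_chd e : (0 < e)%N -> (e <= d)%N -> e%:R != 0 :> algC.
Proof. by move=> e0 _; rewrite pnatr_eq0 -lt0n. Qed.

Lemma good_prime : ultimately (fun p _ => ~~ (p %| R)%N /\ (d < p)%N).
Proof.
exists (R + d)%N => p pp lt v; split; last by lia.
by apply/negP => /dvdn_leq; have := rm_R rm; lia.
Qed.

Lemma red_comm Q : ultimately (fun p v => rphi (Fk v) (Gk v) d (red v Q) = red v (phC Q)).
Proof.
case: Q => [x|].
  have [N1 H1] := O_large x; have [g0|g0] := eqVneq (gC g x) 0.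
    exists N1 => p pp lt v; have Ox := H1 p pp lt v; rewrite red_O //= -pr_horner //.
    by rewrite [GC.[x]]g0 pr0 !eqxx.
  have [N2 H2] := unit_large g0; exists (N1 + N2)%N => p pp lt v.
  have Ox := H1 p pp ltac:(lia) v; have [Og rg] := H2 p pp ltac:(lia) v.
  have ug : unitv v (gC g x) by apply: unitv_pr.
  have [_ _ Oi] := ug; have Of : pO v FC.[x] by apply: O_horner.
  rewrite red_O // [phC _]/= g0 red_O; last by apply: OM.
  by rewrite /= -!pr_horner // rg prME // prVE.
have [g0|g0] := eqVneq (g`_d) 0.
  by exists 0%N => p pp lt v; rewrite /= !coef_map g0 /= !eqxx.
exists (absz g`_d) => p pp lt v; rewrite /= !coef_map /= intr_eq0 g0 /= -!(pr_int v) pr_int_eq0 //.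
have nd : ~~ (p %| g`_d)%Z.
  by rewrite dvdzE /=; apply/negP => /dvdn_leq; rewrite absz_gt0 g0 => /(_ isT); rewrite leqNgt lt.
have u : unitv v (g`_d)%:~R by apply: unitv_pr; [apply: Oint|rewrite pr_int_eq0].
have [_ _ Oi] := u; rewrite nd; case: pselect => [O|[]]; last by apply: OM => //; apply: Oint.
by rewrite prME ?prVE // ; apply: Oint.
Qed.

(** Read on the Wronskian, whose zeros reduce to zeros, at infinity through its coefficient of index
    2d - 2. *)
Lemma red_ram Q : (2 <= ramC Q)%N -> ultimately (fun p v => (2 <= ram (Fk v) (Gk v) d (red v Q))%N).
Proof.
move=> r2; have [W0 sW oW] := wron_ord algC_closed C_sF C_sG (rm_d rm) C_cop C_top C_chd Q.
have key : ultimately (fun p v => ~~ (p %| R)%N -> (d < p)%N ->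
     (0 < ord (2 * d - 2) (wron (Fk v) (Gk v)) (red v Q))%N).
  have EW : wron FC GC = pZ (wronsk f g) by rewrite /wron pZ_W.
  have EWk p (v : place p) : wron (Fk v) (Gk v) = map_poly intr (wronsk f g).
    by rewrite /wron /wronsk rmorphB !rmorphM /= !deriv_map.
  have o1 : (0 < ord (2 * d - 2) (wron FC GC) Q)%N by rewrite oW -ltnS prednK // ltnW.
  have rt (K : fieldType) (H : {poly K}) x : H != 0 -> (0 < mup x H)%N = root H x.
    by move=> H0; rewrite -XsubC_dvd // dvdp_XsubCl.
  case: Q {r2 oW} o1 => [x|] o1.
    have [N1 H1] := O_large x; exists N1 => p pp lt v nR dp; have Ox := H1 p pp lt v.
    rewrite red_O //= rt ?(red_W0 rm v pp nR dp) // EWk /root -pr_horner //.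
    by move: o1; rewrite /= rt // EW /root => /eqP ->; rewrite pr0.
  exists 0%N => p pp lt v nR dp /=.
  have Wd : (wronsk f g)`_(2 * d - 2) = 0.
    have : (wron FC GC)`_(2 * d - 2) = 0.
      by rewrite nth_default //; move: o1; rewrite /=; move: (size _) => s; lia.
    by rewrite EW coef_map /= => /eqP; rewrite intr_eq0 => /eqP.
  have [_ sk _] := wron_ord (@res_alg_closed _ v) (red_sF rm v) (red_sG rm v) (rm_d rm) (red_cop rm pp nR) (red_top rm pp nR) (red_chd v pp nR dp) None.
  have d2 := rm_d rm.
  suff : (size (wron (Fk v) (Gk v)) <= 2 * d - 2)%N by move: (size _) => s; lia.
  apply/leq_sizeP => j; rewrite leq_eqVlt => /predU1P[<-|l]; first by rewrite EWk coef_map Wd.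
  by rewrite nth_default //; apply: leq_trans sk _.
have [N1 H1] := good_prime; have [N2 H2] := key.
exists (N1 + N2)%N => p pp lt v; have [nR dp] := H1 p pp ltac:(lia) v.
have := H2 p pp ltac:(lia) v nR dp.
have [_ _ ->] := wron_ord (@res_alg_closed _ v) (red_sF rm v) (red_sG rm v) (rm_d rm) (red_cop rm pp nR) (red_top rm pp nR) (red_chd v pp nR dp) (red v Q).
by move: (ram _ _ _ _) => e; lia.
Qed.

Lemma red_neq (Q Q' : option algC) : Q != Q' -> ultimately (fun p v => red v Q != red v Q').
Proof.
case: Q Q' => [x|] [y|] // ne.
- have [N H] := list_large [:: x; y]; exists N => p pp lt v.
  have [Ox inj] := H p pp lt v x y (mem_head _ _) ltac:(by rewrite in_cons mem_head orbT).
  have [Oy _] := H p pp lt v y x ltac:(by rewrite in_cons mem_head orbT) (mem_head _ _).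
  by rewrite !red_O //; apply: contra ne => /eqP[/inj ->].
- by have [N1 H1] := O_large x; exists N1 => p pp lt v; rewrite red_O //; apply: H1.
- by have [N1 H1] := O_large y; exists N1 => p pp lt v; rewrite red_O //; apply: H1.
Qed.

Hypothesis mdata : ultimately (fun p v => exists m, orbi (Fk v) (Gk v) d p m).

Lemma iter_red Q n : ultimately (fun p v => forall i, (i < n)%N ->
  rphi (Fk v) (Gk v) d (red v (iter i phC Q)) = red v (iter i.+1 phC Q)).
Proof.
have [|N H] := @ultimately_seq _ (iota 0 n) (fun i p v => rphi (Fk v) (Gk v) d (red v (iter i phC Q)) = red v (iter i.+1 phC Q)).
  by move=> i _; apply: red_comm.
by exists N => p pp lt v i lti; apply: H => //; rewrite mem_iota.
Qed.

Lemma orbi_step (K : fieldType) (F G : {poly K}) p m Q : orbi F G d p m -> (0 < ram F G d Q)%N ->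
  m (rphi F G d Q) <= m Q /\ ((2 <= ram F G d Q)%N -> m (rphi F G d Q) * 2 <= m Q).
Proof.
move=> [pull bd _ _ _] r0; have := pull Q; have /andP[h _] := bd (rphi F G d Q).
move: (m (rphi F G d Q)) (m Q) (ram F G d Q) r0 h => x y e; split; nia.
Qed.

(** Otherwise the first five images stay distinct at some large place. As m is at least halved at
    the critical point and does not increase afterwards, each of them has m <= (p-1)/2, and five
    halves exceed 2. *)
Lemma crit_preperiodic Q : (2 <= ramC Q)%N -> exists m n, (m < n)%N /\ iter m phC Q = iter n phC Q.
Proof.
move=> r2; apply: contrapT => nex.
have ne i j : (i < j)%N -> iter i phC Q != iter j phC Q.
  by move=> lt; apply/eqP => E; apply: nex; exists i, j.
have [|N0 H0] := @ultimately_seq _ [seq ij <- allpairs pair (iota 0 6) (iota 0 6) | (ij.1 < ij.2)%N]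
    (fun ij p v => red v (iter ij.1 phC Q) != red v (iter ij.2 phC Q)).
  by move=> [i j]; rewrite mem_filter => /andP[lt _]; apply: red_neq; apply: ne.
have U1 := ultimately_and (ultimately_and mdata good_prime) (ultimately_and (iter_red Q 5) (red_ram r2)).
have [p [v [pp [h0 [[[m om] [nR dp]] [hi hr]]]]]] := ultimately_ex (ultimately_and (ex_intro _ N0 H0) U1).
have [pull bd _ sumL _] := om.
pose x i := red v (iter i phC Q).
have r0 T : (0 < ram (Fk v) (Gk v) d T)%N := ram_gt0 (@res_alg_closed _ v) (red_sF rm v) (red_sG rm v) (rm_d rm) (red_cop rm pp nR) (red_top rm pp nR) T.
have st i : (i < 5)%N -> m (x i.+1) <= m (x i).
  by move=> lt; rewrite /x -hi //; have [] := orbi_step om (r0 (x i)).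
have s0 : m (x 1%N) * 2 <= m (x 0%N).
  by rewrite /x -(hi 0%N) //; have [_] := orbi_step om (r0 (x 0%N)); apply.
have nx i j : (i < j < 6)%N -> x i != x j.
  move=> /andP[lt l6]; apply: (h0 (i, j)); rewrite mem_filter; apply/andP; split=> //.
  by apply: (allpairs_f pair); rewrite mem_iota; lia.
have uL : uniq [:: x 1%N; x 2%N; x 3%N; x 4%N; x 5%N].
  by rewrite /= !in_cons !in_nil !orbF !negb_or !nx.
have := sumL _ uL; rewrite !big_cons big_nil.
have /andP[_ h1] := bd (x 0%N).
have := (st 1%N isT, st 2%N isT, st 3%N isT, st 4%N isT).
have p1 := prime_gt1 pp; move=> [[[t1 t2] t3] t4]; lia.
Qed.

(** Around a cycle through a critical point m would be at least halved, so m = 0 on the cycle and on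
    everything that maps to it. Each such point takes p - 1 from a total of 2(p - 1). *)
Lemma periodic_fibers Q : (2 <= ramC Q)%N -> (exists n, (0 < n)%N /\ iter n phC Q = Q) ->
  forall T1 T2 T3, (exists j, iter j phC T1 = Q) -> (exists j, iter j phC T2 = Q) -> (exists j, iter j phC T3 = Q) ->
  ~~ uniq [:: T1; T2; T3].
Proof.
move=> r2 [n [n0 En]] T1 T2 T3 [j1 E1] [j2 E2] [j3 E3]; apply/negP => uT.
have ne : [/\ T1 != T2, T1 != T3 & T2 != T3].
  by move: uT; rewrite /= !in_cons !in_nil !orbF negb_or => /and3P[/andP[-> ->] -> _].
case: ne => n12 n13 n23.
have U1 := ultimately_and (ultimately_and mdata good_prime) (ultimately_and (iter_red Q n) (red_ram r2)).
have U2 := ultimately_and (iter_red T1 j1) (ultimately_and (iter_red T2 j2) (iter_red T3 j3)).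
have U3 := ultimately_and (red_neq n12) (ultimately_and (red_neq n13) (red_neq n23)).
have [p [v [pp [[[[m om] [nR dp]] [hi hr]] [[i1 [i2 i3]] [d12 [d13 d23]]]]]]] :=
  ultimately_ex (ultimately_and U1 (ultimately_and U2 U3)).
have [pull bd _ sumL _] := om.
have r0 T : (0 < ram (Fk v) (Gk v) d T)%N := ram_gt0 (@res_alg_closed _ v) (red_sF rm v) (red_sG rm v) (rm_d rm) (red_cop rm pp nR) (red_top rm pp nR) T.
have mQ : m (red v Q) = 0.
  pose x i := red v (iter i phC Q).
  have st i : (i < n)%N -> m (x i.+1) <= m (x i).
    by move=> lt; rewrite /x -hi //; have [] := orbi_step om (r0 (x i)).
  have s0 : m (x 1%N) * 2 <= m (x 0%N).
    by rewrite /x -(hi 0%N) //; have [_] := orbi_step om (r0 (x 0%N)); apply.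
  have ch i : (0 < i <= n)%N -> m (x i) <= m (x 1%N).
    elim: i => // -[|i] IH // lt; apply: le_trans (IH _); last by lia.
    by apply: st; lia.
  have := ch n; rewrite n0 leqnn => /(_ isT); rewrite {1}/x En -/(x 0%N).
  by have /andP[h _] := bd (x 0%N); lia.
have mT T j : iter j phC T = Q -> (forall i, (i < j)%N -> rphi (Fk v) (Gk v) d (red v (iter i phC T)) = red v (iter i.+1 phC T)) ->
    m (red v T) = 0.
  move=> E H; have {}E i : (i <= j)%N -> m (red v (iter (j - i) phC T)) = 0.
    elim: i => [_|i IH lt]; first by rewrite subn0 E.
    have Ej : (j - i = (j - i.+1).+1)%N by lia.
    rewrite pull H; last by lia.
    by rewrite -Ej IH ?mulr0 // ltnW.
  by have := E j (leqnn _); rewrite subnn.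
have := sumL [:: red v T1; red v T2; red v T3].
rewrite /= !in_cons !in_nil !orbF negb_or d12 d13 d23 => /(_ isT).
rewrite !big_cons big_nil (mT _ _ E1 i1) (mT _ _ E2 i2) (mT _ _ E3 i3).
have := prime_gt1 pp; lia.
Qed.

(** The backward orbit has at most two points, and surjectivity leaves only a fixed point or a
    swapped pair. *)
Lemma periodic_structure Q : (2 <= ramC Q)%N -> (exists n, (0 < n)%N /\ iter n phC Q = Q) ->
  (forall T, phC T = Q <-> T = Q) \/
  (exists2 Q', Q' != Q & (forall T, phC T = Q <-> T = Q') /\ (forall T, phC T = Q' <-> T = Q)).
Proof.
move=> r2 per; have F3 := periodic_fibers r2 per.
have surj := rphi_surj algC_closed C_sF C_sG (rm_d rm) C_cop C_top.
have [all|[Q' [ne E]]] : (forall T, phC T = Q -> T = Q) \/ exists Q', Q' <> Q /\ phC Q' = Q.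
  have [|nex] := pselect (exists Q', Q' <> Q /\ phC Q' = Q); [by right|left=> T ET].
  by apply: contrapT => ne; apply: nex; exists T.
  left=> T; split=> [/all //|->]; have [S ES] := surj Q; by rewrite -{1}(all S ES).
right; exists Q'; first exact/eqP.
have j0 : exists j, iter j phC Q = Q by exists 0%N.
have j1 T : phC T = Q -> exists j, iter j phC T = Q by exists 1%N.
have j2 T : phC T = Q' -> exists j, iter j phC T = Q by move=> ET; exists 2%N; rewrite /= ET.
have in2 T : (exists j, iter j phC T = Q) -> T = Q \/ T = Q'.
  move=> jT; have := F3 _ _ _ j0 (j1 _ E) jT; rewrite /= !in_cons !in_nil !orbF.
  have /eqP/negPf := ne; rewrite eq_sym => -> /=; rewrite andbT negb_and !negbK => /orP[/eqP ->|/eqP ->]; [by left|by right].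
have [S ES] := surj Q'; have SQ : S = Q.
  case: (in2 S (j2 _ ES)) => // SQ'; case: ne; by rewrite -ES SQ' E.
rewrite SQ in ES; split=> T; split=> [ET|->] //.
  by case: (in2 T (j1 _ ET)) => // TQ; case: ne; rewrite -ES -[RHS]ET TQ.
by case: (in2 T (j2 _ ET)) => // TQ; case: ne; rewrite TQ E in ET.
Qed.
End Transfer.

(** * The hypotheses on the integral model *)

Definition hyps (f g : {poly rat}) (al : rat) : Prop :=
  [/\ coprimep f g, (2 <= rdeg f g)%N, ~ exceptional (polyQ f) (polyQ g) (ratr al) &
      Ginf_abelian (polyQ f) (polyQ g) (ratr al)].

Section Setup.
Variables (f g : {poly rat}) (al : rat).
Hypothesis H : hyps f g al.
Variables (f0 g0 : {poly int}) (R : nat) (s : rat).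
Hypotheses (s0 : s != 0) (Ef : polyQ f = ratr s *: pZ f0) (Eg : polyQ g = ratr s *: pZ g0).
Let d := rdeg f g.
Hypothesis rm : ratmap f0 g0 d R.
Let sC : (ratr s : algC) != 0. Proof. by rewrite fmorph_eq0. Qed.

Lemma setup_deg : rdeg (polyQ f) (polyQ g) = d /\ (1 < maxn (size (polyQ f)) (size (polyQ g)))%N.
Proof.
have szm (P : {poly rat}) : size (polyQ P) = size P by apply: size_map_poly.
have [_ d2 _ _] := H; rewrite /rdeg !szm; split=> //.
by move: d2; rewrite /rdeg; move: (size f) (size g) => x y; lia.
Qed.

Lemma setup_reval P : reval (polyQ f) (polyQ g) P = rphi (pZ f0) (pZ g0) d P.
Proof.
have [dE sz] := setup_deg; rewrite reval_rphi // dE Ef Eg.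
case: P => [x|] /=; rewrite ?hornerZ ?coefZ mulf_eq0 (negPf sC) /=; case: eqP => //= /eqP n0; congr Some;
  by field; rewrite n0 sC.
Qed.

Lemma setup_ramif P : ramif (polyQ f) (polyQ g) P = ram (pZ f0) (pZ g0) d P.
Proof.
have [dE sz] := setup_deg; rewrite ramif_ram // dE /ram.
have -> : rphi (polyQ f) (polyQ g) d P = rphi (pZ f0) (pZ g0) d P by rewrite -setup_reval reval_rphi // dE.
suff -> T : hP (polyQ f) (polyQ g) T = ratr s *: hP (pZ f0) (pZ g0) T by rewrite ordZ.
by case: T => [y|]; rewrite /hP ?Ef Eg // scalerBr !scalerA mulrC.
Qed.

Lemma setup_iter n P : iter n (reval (polyQ f) (polyQ g)) P = iter n (rphi (pZ f0) (pZ g0) d) P.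
Proof. by elim: n => //= n ->; rewrite setup_reval. Qed.

Lemma back_aut (t : autC) x : backward_orbit (polyQ f) (polyQ g) (ratr al) x ->
  backward_orbit (polyQ f) (polyQ g) (ratr al) (t x).
Proof.
move=> [n E]; exists n; rewrite !setup_iter in E *.
have ph P : rphi (pZ f0) (pZ g0) d (omap t P) = omap t (rphi (pZ f0) (pZ g0) d P).
  have hz (Q : {poly int}) y : (pZ Q).[t y] = t (pZ Q).[y] by rewrite aut_horner_pZ.
  case: P => [y|] /=; first by rewrite !hz fmorph_eq0; case: eqP => //= _; rewrite fmorph_div.
  by rewrite !coef_map /=; case: eqP => //= _; rewrite fmorph_div !rmorph_int.
have -> : Some (t x) = omap t (Some x) by [].
have -> : iter n (rphi (pZ f0) (pZ g0) d) (omap t (Some x)) = omap t (iter n (rphi (pZ f0) (pZ g0) d) (Some x)).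
  by elim: n {E} => //= n ->; rewrite ph.
by rewrite E /= fmorph_rat.
Qed.

Lemma setup_tree : exists B : seq algC, [/\ uniq B, (4 <= size B)%N &
  forall n x, inT f0 g0 B n x -> abel x].
Proof.
have [cop d2 nex ab] := H.
have more (l : seq algC) : exists x, backward_orbit (polyQ f) (polyQ g) (ratr al) x /\ x \notin l.
  apply: contrapT => nx; apply: nex; exists l => x bx; apply/negPn/negP => nl; apply: nx; by exists x.
have build n : exists B : seq algC, [/\ uniq B, size B = n & forall x, x \in B -> backward_orbit (polyQ f) (polyQ g) (ratr al) x].
  elim: n => [|n [B [u sz HB]]]; first by exists [::].
  have [x [bx nx]] := more B; exists (x :: B); rewrite /= nx u sz; split=> // y.
  by rewrite in_cons => /predU1P[->|/HB].
(* Four points are what [fiber_growth] asks for. The tree also contains their conjugates, which stay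
   in the backward orbit because alpha is rational. *)
have [B [u sz HB]] := build 4%N; exists B; rewrite sz; split=> // n x Tx s1 t1.
apply: ab; elim: n x Tx => [|n IH] x; first by move=> [b bB [t ->]]; apply: back_aut; apply: HB.
move=> [gx /IH [m Em]]; exists m.+1; rewrite iterSr setup_reval /=.
by rewrite -/(gC g0 x) gx -/(fC f0 x).
Qed.

Lemma setup_forms : ultimately (fun p v =>
  let F := map_poly (intr : int -> resT v) f0 in let G := map_poly (intr : int -> resT v) g0 in
  exists (U a : {poly resT v}) (N' : nat), let N0 := (p * N' + 2 * p.-1)%N in
  [/\ U != 0, a != 0, (size U <= N0.+1)%N, (size a <= N'.+1)%N &
      homp F G N0 U * a ^+ p = wron F G ^+ p.-1 * U * homp F G N' a ^+ p]).
Proof. by have [B [u sz abT]] := setup_tree; apply: (invariant_form_mod_p rm abT u sz). Qed.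

Lemma setup_mdata : ultimately (fun p v => exists m,
  orbi (map_poly (intr : int -> resT v) f0) (map_poly (intr : int -> resT v) g0) d p m).
Proof.
have [N1 H1] := setup_forms; have [N2 H2] := good_prime rm.
exists (N1 + N2)%N => p pp lt v; have [nR dp] := H2 p pp ltac:(lia) v.
have [U [a [N' [U0 a0 sU sa inv]]]] := H1 p pp ltac:(lia) v.
have cl := @res_alg_closed _ v; have p1 := prime_gt1 pp.
exists (mdiv p U a N'); split.
- exact: (mdiv_pull cl (red_sF rm v) (red_sG rm v) (rm_d rm) (red_cop rm pp nR) (red_top rm pp nR) (red_chd v pp nR dp) p1 U0 a0 sU sa inv).
- move=> Q; by have [] := mdiv_bounds cl (red_sF rm v) (red_sG rm v) (rm_d rm) (red_cop rm pp nR) (red_top rm pp nR) (red_chd v pp nR dp) p1 U0 a0 sU sa inv Q.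
- move=> Q; by have [] := mdiv_bounds cl (red_sF rm v) (red_sG rm v) (rm_d rm) (red_cop rm pp nR) (red_top rm pp nR) (red_chd v pp nR dp) p1 U0 a0 sU sa inv Q.
- exact: (mdiv_sum_le cl (red_sF rm v) (red_sG rm v) (rm_d rm) (red_cop rm pp nR) (red_top rm pp nR) (red_chd v pp nR dp) p1 U0 a0 sU sa inv).
- exact: (mdiv_finite cl (red_sF rm v) (red_sG rm v) (rm_d rm) p1 U0 a0 sU sa).
Qed.
End Setup.

Lemma iter_conj (f g f' g' : {poly algC}) a b c e n P : conj_by a b c e f g f' g' ->
  iter n (reval f g) (mob a b c e P) = mob a b c e (iter n (reval f' g') P).
Proof. by move=> [D C]; elim: n => //= n ->; have := C (iter n (reval f' g') P); rewrite !mob_reval. Qed.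

Lemma mob_act (t : autC) (a b c e : rat) P :
  mob (ratr a) (ratr b) (ratr c) (ratr e) (omap t P) = omap t (mob (ratr a) (ratr b) (ratr c) (ratr e) P).
Proof.
have hz (x y : rat) z : (mobN (ratr x) (ratr y)).[t z] = t (mobN (ratr x) (ratr y)).[z].
  by rewrite /mobN !hornerE rmorphD rmorphM !fmorph_rat.
have cz (x y : rat) : t (mobN (ratr x) (ratr y))`_1 = (mobN (ratr x) (ratr y))`_1.
  by rewrite /mobN coefD coefZ coefX coefC /= mulr1 addr0 fmorph_rat.
case: P => [x|] /=; first by rewrite !hz fmorph_eq0; case: eqP => //= _; rewrite fmorph_div.
by case: eqP => //= _; rewrite fmorph_div !cz.
Qed.

Lemma hyps_conj (f g f' g' : {poly rat}) (al al' : rat) (a b c e : rat) : hyps f g al ->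
  coprimep f' g' -> rdeg f' g' = rdeg f g ->
  conj_by (ratr a) (ratr b) (ratr c) (ratr e) (polyQ f) (polyQ g) (polyQ f') (polyQ g') ->
  mob (ratr a : algC) (ratr b) (ratr c) (ratr e) (Some (ratr al')) = Some (ratr al) -> hyps f' g' al'.
Proof.
move=> [cop d2 nex ab] cop' dE C Eal; have [D _] := C.
pose M := mob (ratr a : algC) (ratr b) (ratr c) (ratr e).
pose M' := mob (ratr e : algC) (- ratr b) (- ratr c) (ratr a).
have MK P : M' (M P) = P by apply: mobK.
have MK' P : M (M' P) = P by apply: mobK'.
split=> //; first by rewrite dE.
  move=> [l Hl]; apply: nex; exists (pmap id (M None :: [seq M (Some x) | x <- l])) => x [n En].
  rewrite mem_pmap map_id; rewrite -(MK' (Some x)) /M (iter_conj _ _ C) -Eal in En.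
  have {}En : iter n (reval (polyQ f') (polyQ g')) (M' (Some x)) = Some (ratr al').
    by rewrite -[LHS]MK /M En MK.
  rewrite -(MK' (Some x)); case E: (M' (Some x)) => [y|]; last by rewrite mem_head.
  by rewrite in_cons; apply/orP; right; apply: map_f; apply: Hl; exists n; rewrite -E.
move=> s t x [n En].
have E1 : iter n (reval (polyQ f) (polyQ g)) (M (Some x)) = Some (ratr al) by rewrite /M (iter_conj _ _ C) En Eal.
have act (u : autC) P : M (omap u P) = omap u (M P) by apply: mob_act.
case E: (M (Some x)) => [y|].
  have [h] : Some (s (t x)) = Some (t (s x)); last by [].
  rewrite -[LHS]MK -[RHS]MK; congr M'.
  have -> : Some (s (t x)) = omap s (omap t (Some x)) by [].
  have -> : Some (t (s x)) = omap t (omap s (Some x)) by [].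
  rewrite !act E /=; congr Some; apply: ab; by exists n; rewrite -E.
(* [M] has rational coefficients and sends x to infinity, so x is rational. *)
have fx (u : autC) : u x = x.
  by have [h] : Some (u x) = Some x; [rewrite -[LHS]MK -[RHS]MK -[Some (u x)]/(omap u (Some x)) act E|].
by rewrite !fx.
Qed.

(** * The cyclotomic closure *)

Lemma C_in_Qc_common (z z' : algC) n n' : z ^+ n.+1 = 1 -> z' ^+ n'.+1 = 1 ->
  exists w N i j, [/\ w ^+ N.+1 = 1, z = w ^+ i & z' = w ^+ j].
Proof.
move=> h h'; have [w pw] := C_prim_root_exists (ltn0Sn ((n.+1 * n'.+1).-1)).
have EN : (n.+1 * n'.+1).-1.+1 = (n.+1 * n'.+1)%N by rewrite prednK.
have z1 : z ^+ (n.+1 * n'.+1).-1.+1 = 1 by rewrite EN exprM h expr1n.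
have z2 : z' ^+ (n.+1 * n'.+1).-1.+1 = 1 by rewrite EN mulnC exprM h' expr1n.
have [i Ei] := prim_rootP pw z1; have [j Ej] := prim_rootP pw z2.
exists w, (n.+1 * n'.+1).-1, i, j; split=> //; exact: prim_expr_order pw.
Qed.

Lemma Qc_op (op : {poly rat} -> {poly rat} -> {poly rat}) (opC : algC -> algC -> algC) x y :
  (forall p q w, (polyQ (op p q)).[w] = opC (polyQ p).[w] (polyQ q).[w]) ->
  in_Qc x -> in_Qc y -> in_Qc (opC x y).
Proof.
move=> H [n [z [p [hz ->]]]] [n' [z' [p' [hz' ->]]]].
have [w [N [i [j [hw -> ->]]]]] := C_in_Qc_common hz hz'.
exists N, w, (op (p \Po 'X^i) (p' \Po 'X^j)); split=> //; rewrite H.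
by rewrite /polyQ !map_comp_poly !rmorphXn /= !map_polyX !horner_comp !hornerXn.
Qed.

Lemma Qc_add x y : in_Qc x -> in_Qc y -> in_Qc (x + y).
Proof. by apply: (Qc_op (op := +%R)) => p q w; rewrite /polyQ rmorphD hornerD. Qed.
Lemma Qc_mul x y : in_Qc x -> in_Qc y -> in_Qc (x * y).
Proof. by apply: (Qc_op (op := *%R)) => p q w; rewrite /polyQ rmorphM hornerM. Qed.
Lemma Qc_rat (q : rat) : in_Qc (ratr q).
Proof. by exists 0%N, 1, q%:P; rewrite expr1 /polyQ map_polyC hornerC. Qed.
Lemma Qc_root n (z : algC) : z ^+ n.+1 = 1 -> in_Qc z.
Proof. by move=> h; exists n, z, 'X; rewrite /polyQ map_polyX hornerX. Qed.
Lemma Qc_opp x : in_Qc x -> in_Qc (- x).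
Proof.
by move=> h; rewrite -mulN1r -[- 1](rmorphN1 (@ratr algC)); apply: Qc_mul => //; apply: Qc_rat.
Qed.

Lemma Qc_conj_trans (f g f' g' F G : {poly algC}) (a b c e : rat) :
  conj_by (ratr a) (ratr b) (ratr c) (ratr e) f g f' g' -> Qc_conjugate f' g' F G -> Qc_conjugate f g F G.
Proof.
move=> [D C] [a' [b' [c' [e' [ha hb hc he [D' C']]]]]].
pose A := ratr a * a' + ratr b * c'; pose B := ratr a * b' + ratr b * e'.
pose Cc := ratr c * a' + ratr e * c'; pose E := ratr c * b' + ratr e * e'.
have q := Qc_rat.
exists A, B, Cc, E; split; do ?[apply: Qc_add; apply: Qc_mul => //].
have DE : A * E - B * Cc = (ratr a * ratr e - ratr b * ratr c) * (a' * e' - b' * c') by rewrite /A /B /Cc /E; ring.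
have D2 : A * E - B * Cc != 0 by rewrite DE mulf_neq0.
split=> // P; rewrite !mob_reval // -!mobM //.
have := C (mob a' b' c' e' P); rewrite !mob_reval // => ->.
by have := C' P; rewrite !mob_reval // => ->.
Qed.

Lemma special_conj (f g f' g' : {poly rat}) (a b c e : rat) : rdeg f' g' = rdeg f g ->
  conj_by (ratr a) (ratr b) (ratr c) (ratr e) (polyQ f) (polyQ g) (polyQ f') (polyQ g') ->
  special (polyQ f') (polyQ g') -> special (polyQ f) (polyQ g).
Proof.
move=> dE C; have szm (P : {poly rat}) : size (polyQ P) = size P by apply: size_map_poly.
rewrite /special; have -> : rdeg (polyQ f') (polyQ g') = rdeg (polyQ f) (polyQ g) by rewrite /rdeg !szm -/(rdeg f' g') dE.
by case=> h; [apply: Or41|apply: Or42|apply: Or43|apply: Or44]; apply: Qc_conj_trans C h.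
Qed.

(** * Polynomials and Chebyshev maps *)

Lemma root_of_unity_sqrt (z : algC) n : z ^+ n.+1 = 1 -> exists2 y, in_Qc y & y ^+ 2 = z.
Proof.
move=> h; exists (sqrtC z); last by rewrite sqrtCK.
apply: (@Qc_root (n.+1 * 2).-1); rewrite prednK // mulnC exprM sqrtCK.
exact: h.
Qed.

Lemma Qc_prod (I : Type) (r : seq I) (P : pred I) (F : I -> algC) :
  (forall i, in_Qc (F i)) -> in_Qc (\prod_(i <- r | P i) F i).
Proof.
move=> H; elim/big_ind: _ => //; last exact: Qc_mul.
by rewrite -(rmorph1 (@ratr algC)); apply: Qc_rat.
Qed.
Lemma Qc_1 : in_Qc 1. Proof. by rewrite -(rmorph1 (@ratr algC)); apply: Qc_rat. Qed.
Lemma Qc_0 : in_Qc 0. Proof. by rewrite -(rmorph0 (@ratr algC)); apply: Qc_rat. Qed.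
Lemma Qc_X x n : in_Qc x -> in_Qc (x ^+ n).
Proof. by move=> h; elim: n => [|n IH]; rewrite ?expr0 ?exprS; [exact: Qc_1|exact: Qc_mul]. Qed.

(* the product of [1 - z^k] over a half system is, up to a root of unity, a square root of [p] *)
Lemma sqrt_prime_Qc p : prime p -> exists2 y, in_Qc y & y ^+ 2 = p%:R.
Proof.
move=> pp; have [->|odd_p] := even_prime pp.
  have i4 : 'i ^+ 4 = 1 :> algC by rewrite -[4%N]/(2 * 2)%N exprM sqrCi sqrrN expr1n.
  have mi4 : (- 'i) ^+ 4 = 1 :> algC by rewrite exprNn i4 mulr1 -signr_odd expr0.
  have [y hy Ey] := root_of_unity_sqrt mi4.
  exists ((1 + 'i) * y); first by apply: Qc_mul => //; apply: Qc_add; [exact: Qc_1|apply: Qc_root i4].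
  rewrite exprMn Ey sqrrD sqrCi expr1n mul1r; have := sqrCi algC; move: ('i : algC) => j Ej.
  by transitivity (- (j ^+ 2) *+ 2 : algC); [ring|rewrite Ej; ring].
have [w pw] := C_prim_root_exists (prime_gt0 pp).
pose h := p./2; have Ep : p = h.*2.+1 by rewrite -[LHS]odd_double_half odd_p.
have w0 : w != 0 by rewrite (prim_root_natf_neq0 pw) || (apply/eqP => z; have := prim_expr_order pw; rewrite z expr0n gtn_eqF ?prime_gt0 // => /eqP; rewrite eq_sym oner_eq0).
have P1 : \prod_(1 <= k < p) (1 - w ^+ k) = p%:R.
  have E := factor_Xn_sub_1 pw; have Q : 'X^p - 1 = ('X - 1) * \sum_(i < p) 'X^i :> {poly algC}.
    by rewrite -subrX1.
  have p0 := prime_gt0 pp; rewrite Q (big_ltn p0) expr0 in E.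
  have X1 : 'X - 1%:P != 0 :> {poly algC} by rewrite polyXsubC_eq0.
  have := mulfI X1 E => /(congr1 (fun q : {poly algC} => q.[1])).
  rewrite horner_prod horner_sum => E'; rewrite (eq_bigr (fun k => ('X - (w ^+ k)%:P).[1])) => [|k _]; last by rewrite hornerXsubC.
  by rewrite E' (eq_bigr (fun=> 1)) => [|k _]; rewrite ?hornerXn ?expr1n // sumr_const card_ord.
pose A := \prod_(k < h) (1 - w ^+ k.+1).
pose z := \prod_(k < h) (- (w ^+ (p - k.+1))).
have PE : p%:R = z * A ^+ 2.
  rewrite -P1 Ep big_add1 /= -addnn big_mkord big_split_ord /= expr2 mulrA mulrC; congr (_ * _).
  rewrite /z /A (reindex_inj rev_ord_inj) /= -big_split /=; apply: eq_bigr => k _.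
  have wp := prim_expr_order pw; have ltk := ltn_ord k.
  have -> : (h + (h - k.+1)).+1 = (p - k.+1)%N by rewrite Ep -addnn; lia.
  have e1 : w ^+ (p - k.+1) * w ^+ k.+1 = 1 by rewrite -exprD subnK // Ep -addnn; lia.
  by rewrite mulrBr mulr1 mulNr e1 opprK addrC.
have zr : z ^+ (2 * p).-1.+1 = 1.
  rewrite prednK ?muln_gt0 ?prime_gt0 // /z -prodrXl big1 // => k _.
  by rewrite exprM sqrrN exprAC [X in X ^+ 2]exprAC (prim_expr_order pw) !expr1n.
have [y hy Ey] := root_of_unity_sqrt zr.
exists (y * A); last by rewrite exprMn Ey PE.
apply: Qc_mul => //; apply: Qc_prod => k; apply: Qc_add; first exact: Qc_1.
apply: Qc_opp; apply: Qc_X; apply: (@Qc_root p.-1); by rewrite prednK ?prime_gt0 // (prim_expr_order pw).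
Qed.

Lemma sqrt_nat_Qc n : (0 < n)%N -> exists2 y, in_Qc y & y ^+ 2 = n%:R.
Proof.
have [m] := ubnP n; elim: m n => // m IH n lt n0.
have [->|n1] := eqVneq n 1%N; first by exists 1; [exact: Qc_1|rewrite expr1n].
have n2 : (1 < n)%N by move: n0 n1; lia.
have pp := pdiv_prime n2; have dv := pdiv_dvd n.
have [y hy Ey] := sqrt_prime_Qc pp.
have q0 : (0 < n %/ pdiv n)%N by rewrite divn_gt0 ?pdiv_gt0 // pdiv_leq.
have [|y' hy' Ey'] := IH (n %/ pdiv n)%N _ q0.
  by apply: leq_trans (_ : n <= m)%N; [apply: ltn_Pdiv => //; apply: prime_gt1|rewrite -ltnS].
by exists (y' * y); [apply: Qc_mul|rewrite exprMn Ey Ey' -natrM divnK].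
Qed.

(** |q| differs from |numerator times denominator| by a rational square, and the square root of -1
    takes care of the sign. *)
Lemma sqrt_rat_Qc (q : rat) x : x ^+ 2 = ratr q -> in_Qc x.
Proof.
move=> Ex; have [q0|q0] := eqVneq q 0.
  by move: Ex; rewrite q0 rmorph0 => /eqP; rewrite sqrf_eq0 => /eqP ->; apply: Qc_0.
pose n := absz (numq q * denq q); have n0 : (0 < n)%N by rewrite absz_gt0 mulf_neq0 ?numq_eq0 ?denq_neq0.
have [y hy Ey] := sqrt_nat_Qc n0.
have dn : ratr (denq q)%:~R != 0 :> algC by rewrite fmorph_eq0 intr_eq0 denq_neq0.
pose y1 := y / ratr (denq q)%:~R.
have hy1 : in_Qc y1 by apply: Qc_mul => //; rewrite -fmorphV; apply: Qc_rat.
have key : y1 ^+ 2 = ratr `|q|.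
  rewrite /y1 expr_div_n Ey /n abszM natrM !natr_absz.
  have -> : `|q| = `|numq q|%:~R / (denq q)%:~R :> rat.
    by rewrite -{1}(divq_num_den q) normf_div -intr_norm [`|(denq q)%:~R|]gtr0_norm ?ltr0z.
  rewrite fmorph_div !ratr_int [`|denq q|]gtr0_norm // expr2.
  have dz : (denq q)%:~R != 0 :> algC by rewrite intr_eq0 denq_neq0.
  by field.
have [qp|qn] := ltrP 0 q.
  rewrite gtr0_norm // in key; have : x ^+ 2 == y1 ^+ 2 by rewrite Ex key.
  by rewrite eqf_sqr => /orP[/eqP ->|/eqP ->] //; apply: Qc_opp.
have i4 : 'i ^+ 4 = 1 :> algC by rewrite -[4%N]/(2 * 2)%N exprM sqrCi sqrrN expr1n.
rewrite ler0_norm // in key; have : x ^+ 2 == ('i * y1) ^+ 2 by rewrite exprMn sqrCi key Ex rmorphN mulN1r opprK.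
have hi : in_Qc ('i * y1) by apply: Qc_mul => //; apply: Qc_root i4.
by rewrite eqf_sqr => /orP[/eqP ->|/eqP ->] //; apply: Qc_opp.
Qed.

(** At x = u + 1/u the pair is u^n + u^(-n) and (u^n - u^(-n)) / (u - 1/u), computed by the addition
    formulas; n times the second component is the derivative of the first. *)
Fixpoint TS (n : nat) : {poly algC} * {poly algC} :=
  if n is m.+1 then let q := TS m in
    ((2^-1)%:P * ('X * q.1 + ('X^2 - 4%:P) * q.2), (2^-1)%:P * ('X * q.2 + q.1))
  else (2%:P, 0).

Lemma TS_props n : [/\ (TS n).1 ^+ 2 - ('X^2 - 4%:P) * (TS n).2 ^+ 2 = 4%:P,
  (TS n).1^`() = (TS n).2 *+ n & ('X^2 - 4%:P) * (TS n).2^`() = (TS n).1 *+ n - 'X * (TS n).2].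
Proof.
have h2 : (2^-1)%:P * 2%:P = 1 :> {poly algC} by rewrite -polyCM mulVf // pnatr_eq0.
have c4 : 4%:P = 2%:P * 2%:P :> {poly algC} by rewrite -polyCM -natrM.
have c2 : 2%:P = 1 + 1 :> {poly algC} by rewrite -polyCD.
elim: n => [|n [E1 E2 E3]]; first by split; rewrite /= ?derivC ?deriv0 ?mulr0n ?mulr0 ?subr0 // expr0n mulr0 subr0 c4 expr2.
rewrite /=; move: (TS n) E1 E2 E3 => [T S] /= E1 E2 E3; set hf := (2^-1)%:P in h2 *.
have hC : hf^`() = 0 by rewrite derivC.
have dq : ('X^2 - 4%:P)^`() = 'X * 2%:P :> {poly algC}.
  by rewrite derivB derivC subr0 derivXn /= expr1 -mulr_natr -polyC_natr.
have nP (Q : {poly algC}) j : Q *+ j = j%:R%:P * Q by rewrite mul_polyC scaler_nat.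
rewrite !nP in E2 E3 *; have -> : (n.+1%:R)%:P = n%:R%:P + 1 :> {poly algC} by rewrite -natr1 polyCD polyC1.
set k := n%:R%:P in E2 E3 *; set D := 'X^2 - 4%:P in E1 E3 dq *.
split.
- transitivity (hf * hf * (('X * 'X - D) * (T ^+ 2 - D * S ^+ 2))); first by ring.
  rewrite E1 /D; transitivity ((hf * 2%:P) * (hf * 2%:P) * 4%:P : {poly algC}); last by rewrite h2 !mul1r.
  by rewrite c4; ring.
- rewrite !derivM hC mul0r add0r derivD !derivM derivX dq E2 mul1r.
  transitivity (hf * (T + 'X * (k * S) + 'X * 2%:P * S + D * S^`())); first by ring.
  rewrite E3; transitivity ((hf * 2%:P) * ((k + 1) * (hf * ('X * S + T))) + (1 - hf * 2%:P) * (hf * ((k + 1) * ('X * S + T)))).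
    by rewrite c2; ring.
  by rewrite h2 subrr mul0r addr0 mul1r.
- rewrite !derivM hC mul0r add0r derivD !derivM derivX E2 mul1r.
  transitivity (hf * (D * S + 'X * (D * S^`()) + D * (k * S))); first by ring.
  rewrite E3 /D c4; have -> : 'X^2 = 'X * 'X :> {poly algC} by rewrite expr2.
  by ring.
Qed.

Lemma cheb_TS n : cheb_pair n = ((TS n).1, (TS n.+1).1).
Proof.
have h2 : (2^-1)%:P * 2%:P = 1 :> {poly algC} by rewrite -polyCM mulVf // pnatr_eq0.
elim: n => [|n IH]; first by rewrite /= mulr0 addr0 mulrCA h2 mulr1.
rewrite /= IH /=; congr (_, _).
move: (TS n) => [T S] /=; set hf := (2^-1)%:P in h2 *.
have c4 : 4%:P = 2%:P * 2%:P :> {poly algC} by rewrite -polyCM -natrM.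
have c2 : 2%:P = 1 + 1 :> {poly algC} by rewrite -polyCD.
transitivity ((hf * 2%:P) * ('X * (hf * ('X * T + ('X^2 - 4%:P) * S))) - (hf * 2%:P) * (hf * 2%:P) * T); first by rewrite h2 !mul1r.
by rewrite c4 c2; ring.
Qed.

Lemma cheb_ode n : ('X^2 - 4%:P) * (cheb n)^`() ^+ 2 = (cheb n ^+ 2 - 4%:P) *+ (n ^ 2).
Proof.
rewrite /cheb cheb_TS /=; have [E1 E2 _] := TS_props n; rewrite E2.
have -> : (TS n).1 ^+ 2 - 4%:P = ('X^2 - 4%:P) * (TS n).2 ^+ 2 by rewrite -{1}E1; ring.
by rewrite exprMn_n mulrnAr.
Qed.

Lemma size_cheb n : (size (cheb n) <= n.+1)%N /\ (cheb n)`_n != 0.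
Proof.
suff H m : [/\ (size (cheb m) <= m.+1)%N, (size (cheb m.+1) <= m.+2)%N, (cheb m)`_m != 0 & (cheb m.+1)`_m.+1 != 0] by have [] := H n.
elim: m => [|m [s1 s2 c1 c2]].
  by split; rewrite /cheb /= ?size_polyC ?size_polyX ?coefC ?coefX /= ?pnatr_eq0 ?oner_neq0 ?leq_b1.
have E : cheb m.+2 = 'X * cheb m.+1 - cheb m by rewrite /cheb /=.
split=> //; rewrite E.
  apply: leq_trans (size_polyD _ _) _; rewrite size_polyN geq_max; apply/andP; split.
    apply: leq_trans (size_polyMleq _ _) _; rewrite size_polyX; move: s2; move: (size _) => s; lia.
  by apply: leq_trans s1 _; lia.
by rewrite coefB coefXM /= [(cheb m)`_ _]nth_default ?subr0 //; apply: leq_trans s1 _; lia.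
Qed.

(** Differentiating gives a linear equation of order two. Its coefficient recursion, run downwards
    from degree d, leaves one free scalar, because i^2 - d^2 does not vanish for i < d; the
    first-order equation forces the scalar to be 1 or -1. *)
Lemma cheb_unique d (y : {poly algC}) : (0 < d)%N -> (size y <= d.+1)%N -> y^`() != 0 ->
  ('X^2 - 4%:P) * y^`() ^+ 2 = (y ^+ 2 - 4%:P) *+ (d ^ 2) -> y = cheb d \/ y = - cheb d.
Proof.
move=> d0 sy y'0 ode; have [sT cT] := size_cheb d.
have lin_ode (h : {poly algC}) : h^`() != 0 -> ('X^2 - 4%:P) * h^`() ^+ 2 = (h ^+ 2 - 4%:P) *+ (d ^ 2) ->
    ('X^2 - 4%:P) * h^`()^`() + 'X * h^`() = h *+ (d ^ 2).
  move=> h'0 E; have := congr1 (fun q : {poly algC} => q^`()) E.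
  rewrite derivM derivB derivC subr0 derivXn /= expr1 derivMn derivB derivC subr0 !deriv_exp /= !expr1.
  move=> E2; have h20 : h^`() *+ 2 != 0 by rewrite -mulr_natr mulf_neq0 // -polyC_natr polyC_eq0 pnatr_eq0.
  apply: (mulfI h20); move: E2; move: (h^`()^`()) => h2; move: (h^`()) => h1 E2.
  transitivity ('X *+ 2 * h1 ^+ 2 + ('X^2 - 4%:P) * (h2 * h1 *+ 2)); first by ring.
  by rewrite E2; ring.
have cX (h : {poly algC}) j : ('X * h^`())`_j = h`_j *+ j.
  by rewrite coefXM; case: j => [|j] /=; rewrite ?mulr0n // coef_deriv.
have rec (h : {poly algC}) : ('X^2 - 4%:P) * h^`()^`() + 'X * h^`() = h *+ (d ^ 2) ->
    forall i, h`_i * ((i ^ 2)%:R - (d ^ 2)%:R) = h`_i.+2 * (4 * i.+1 * i.+2)%:R.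
  move=> E i; have E' : 'X * ('X * h^`())^`() - 4%:P * h^`()^`() = h *+ (d ^ 2).
    by rewrite -E derivM derivX mul1r; ring.
  have := congr1 (fun q : {poly algC} => q`_i) E'.
  rewrite coefB coefCM !cX !coef_deriv coefMn => E1.
  have {}E1 : h`_i * i%:R * i%:R - 4 * (h`_i.+2 * i.+2%:R * i.+1%:R) = h`_i * (d ^ 2)%:R by rewrite !mulr_natr.
  by rewrite mulrBr -E1 !natrM; ring.
have T'0 : (cheb d)^`() != 0.
  apply: contraNneq cT => T0; have := congr1 (fun q : {poly algC} => q`_d.-1) T0.
  rewrite coef_deriv prednK // coef0 -mulr_natr => /eqP; rewrite mulf_eq0 pnatr_eq0 (gtn_eqF d0) orbF.
  by [].
have rT := rec _ (lin_ode _ T'0 (cheb_ode d)); have ry := rec _ (lin_ode _ y'0 ode).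
pose mu := y`_d / (cheb d)`_d; pose z := y - mu *: cheb d.
have rz i : z`_i * ((i ^ 2)%:R - (d ^ 2)%:R) = z`_i.+2 * (4 * i.+1 * i.+2)%:R.
  by rewrite !coefB !coefZ !mulrBl -!mulrA ry rT.
have ztop i : (d <= i)%N -> z`_i = 0.
  rewrite leq_eqVlt => /predU1P[<-|lt]; first by rewrite coefB coefZ /mu divfK // subrr.
  by rewrite coefB coefZ !nth_default ?mulr0 ?subr0 //; apply: leq_trans lt.
have z0 k i : (d <= i + k)%N -> z`_i = 0.
  elim: k i => [|k IH] i le; first by apply: ztop; rewrite addn0 in le.
  have [ge|lt] := leqP d i; first exact: ztop.
  have E2 : z`_i.+2 = 0 by apply: IH; rewrite addSnnS addSn in le *; apply: leq_trans le _; rewrite addnS.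
  have := rz i; rewrite E2 mul0r.
  move=> /eqP; rewrite mulf_eq0 subr_eq0 eqr_nat eqn_exp2r // (ltn_eqF lt) orbF; exact/eqP.
have Ey : y = mu *: cheb d.
  by apply/eqP; rewrite -subr_eq0; apply/eqP/polyP => i; rewrite (z0 d) ?coef0 // leq_addl.
have mu2 : mu ^+ 2 = 1.
  have := ode; rewrite Ey derivZ !exprZn -scalerAr cheb_ode => E.
  have : ((mu ^+ 2 - 1) * 4 * (d ^ 2)%:R)%:P = 0 :> {poly algC}.
    transitivity ((mu ^+ 2 *: cheb d ^+ 2 - 4%:P) *+ d ^ 2 - mu ^+ 2 *: ((cheb d ^+ 2 - 4%:P) *+ d ^ 2)).
      rewrite -[X in _ = X - _]mulr_natr -[X in _ = _ - _ *: X]mulr_natr -[(d ^ 2)%:R : {poly algC}]polyC_natr.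
      move: (mu ^+ 2) ((d ^ 2)%:R : algC) (4 : algC) => mm dd ff.
      by rewrite -!mul_polyC !polyCM polyCB polyC1; ring.
    by rewrite E subrr.
  move/eqP; rewrite polyC_eq0 !mulf_eq0 !pnatr_eq0 expn_eq0 (gtn_eqF d0) /= !orbF subr_eq0.
  by move/eqP.
have : mu ^+ 2 == 1 ^+ 2 by rewrite mu2 expr1n.
by rewrite eqf_sqr => /orP[] /eqP E; rewrite Ey E ?scale1r ?scaleN1r; [left|right].
Qed.

Lemma top3M (A : comNzRingType) (P Q : {poly A}) m n : (size P <= m.+3)%N -> (size Q <= n.+3)%N ->
  [/\ (P * Q)`_(m + n).+4 = P`_m.+2 * Q`_n.+2,
      (P * Q)`_(m + n).+3 = P`_m.+2 * Q`_n.+1 + P`_m.+1 * Q`_n.+2 &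
      (P * Q)`_(m + n).+2 = P`_m.+2 * Q`_n + P`_m.+1 * Q`_n.+1 + P`_m * Q`_n.+2].
Proof.
move=> sP sQ; pose P3 := \poly_(i < m) P`_i.
have EP : P = P`_m.+2 *: 'X^(m.+2) + P`_m.+1 *: 'X^(m.+1) + P`_m *: 'X^m + P3.
  apply/polyP => i; rewrite !coefD !coefZ !coefXn coef_poly.
  case: (ltngtP i m) => [lt|gt|->].
  - by rewrite !(ltn_eqF (leq_trans lt _)) ?leqnSn // ?(ltn_eqF lt) ?mulr0 ?add0r //; lia.
  - case: (ltngtP i m.+1) => [|gt1|->]; first by lia.
      case: (ltngtP i m.+2) => [|gt2|->]; first by lia.
        by rewrite nth_default ?mulr0 ?addr0 //; apply: leq_trans sP _.
      by rewrite mulr1 !mulr0 !addr0.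
    by rewrite (ltn_eqF (ltnSn _)) mulr1 !mulr0 !addr0 add0r.
  - by rewrite !(ltn_eqF (_ : (m < _)%N)) //; rewrite mulr1 !mulr0 !add0r addr0.
have z j : ((m + n).+2 <= j)%N -> (P3 * Q)`_j = 0.
  move=> le; rewrite nth_default //; apply: leq_trans (size_polyMleq _ _) _.
  have := size_poly m (fun i => P`_i); rewrite -/P3; move: sQ le; move: (size P3) (size Q) => s t; lia.
have q j : (n.+3 <= j)%N -> Q`_j = 0 by move=> le; rewrite nth_default // (leq_trans sQ).
have cX c i j : ((c *: 'X^i) * Q)`_(i + j) = c * Q`_j.
  by rewrite -scalerAl coefZ coefXnM ltnNge leq_addr /= addKn.
have cX' c i j : (i <= j)%N -> ((c *: 'X^i) * Q)`_j = c * Q`_(j - i).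
  by move=> le; rewrite -scalerAl coefZ coefXnM ltnNge le.
have e (a b : nat) : a = b -> Q`_a = Q`_b by move=> ->.
have E j : (m.+2 <= j)%N -> ((m + n).+2 <= j)%N -> (P * Q)`_j = P`_m.+2 * Q`_(j - m.+2) + P`_m.+1 * Q`_(j - m.+1) + P`_m * Q`_(j - m).
  by move=> l1 l2; rewrite {1}EP !mulrDl !coefD z // addr0 !cX' //; lia.
split; rewrite E; try lia.
- rewrite (e _ n.+2) ?(q ((m + n).+4 - m.+1)%N) ?(q ((m + n).+4 - m)%N) ?mulr0 ?addr0 //; lia.
- rewrite (e _ n.+1) ?(e ((m + n).+3 - m.+1)%N n.+2) ?(q ((m + n).+3 - m)%N) ?mulr0 ?addr0 //; lia.
- by rewrite (e ((m + n).+2 - m.+2)%N n) ?(e ((m + n).+2 - m.+1)%N n.+1) ?(e ((m + n).+2 - m)%N n.+2) //; lia.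
Qed.

Section PolyModP.
Variable K : fieldType.
Hypothesis Kc : alg_closed K.
Variables (F G : {poly K}) (d p : nat) (m : option K -> int) (c0 : K).
Hypotheses (sF : (size F <= d.+1)%N) (sG : (size G <= d.+1)%N) (d2 : (2 <= d)%N).
Hypothesis cop : forall x, F.[x] = 0 -> G.[x] = 0 -> False.
Hypothesis top : F`_d = 0 -> G`_d = 0 -> False.
Hypothesis chd : forall e, (0 < e)%N -> (e <= d)%N -> e%:R != 0 :> K.
Hypothesis p1 : (1 < p)%N.
Hypothesis om : orbi F G d p m.
Hypotheses (EG : G = c0%:P) (c00 : c0 != 0) (F1 : F`_d.-1 = 0).

(** Infinity is fixed and totally ramified, so m = 0 there, which uses half of the total. A finite
    point with m < p - 1 has m <= (p-1)/2 by divisibility, so there are at most two; they become the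
    roots of q, a double root when m = 0. *)
Lemma poly_quadratic : exists q : {poly K}, [/\ size q = 3, q`_2 = 1 &
  forall x : K, 2 * (p.-1%:Z - m (Some x)) = (p.-1 * mup x q)%:Z].
Proof.
have [pull bd dv sumL [L [uL offL SL]]] := om.
have Gd : G`_d = 0 by rewrite EG coefC; case: d d2.
have fib0 Q : rphi F G d Q = None -> Q = None.
  by case: Q => [x|] //=; rewrite EG hornerC c00.
have rN : rphi F G d None = None by rewrite /= Gd eqxx.
have ramN : ram F G d None = d.
  have [rs [srs E]] := fiber Kc sF sG d2 cop top None.
  have : all (pred1 None) rs.
    by apply/allP => Q Qrs; apply/eqP/fib0; have := E Q; case: eqP => // _ /eqP; rewrite -leqn0 leqNgt -has_count has_pred1 Qrs.
  by rewrite all_count srs => /eqP cE; rewrite -[RHS]cE E rN eqxx.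
have mN : m None = 0.
  by have := pull None; rewrite rN ramN; move: d2; move: (m None) => z; case: (d) => [|[|e]] // _; nia.
have inL Q : m Q <> p.-1%:Z -> Q \in L by move=> ne; apply/negPn/negP => /offL.
pose L' := [seq Q <- L | (Q != None) && (m Q != p.-1%:Z)].
have SL' : \sum_(Q <- L') (p.-1%:Z - m Q) = p.-1%:Z.
  have NL : None \in L by apply: inL; rewrite mN; lia.
  move: SL; rewrite (bigD1_seq None) //= mN subr0 => SL.
  have -> : \sum_(Q <- L') (p.-1%:Z - m Q) = \sum_(Q <- L | Q != None) (p.-1%:Z - m Q); last first.
    by apply: (addrI p.-1%:Z); rewrite SL mulSn mul1n PoszD.
  rewrite big_filter; rewrite [RHS](bigID (fun Q => m Q != p.-1%:Z)) /= [X in _ + X]big1 ?addr0 // => Q /andP[_].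
  by rewrite negbK => /eqP ->; rewrite subrr.
have half Q : Q \in L' -> p.-1%:Z <= 2 * (p.-1%:Z - m Q).
  rewrite mem_filter => /andP[/andP[_ ne] _]; have /andP[b0 b1] := bd Q.
  case: (dv Q) => [->|/dvdzP[k Ek]]; first by lia.
  have : m Q < p.-1%:Z by rewrite lt_neqAle ne.
  move: b0 Ek; move: (m Q) (p.-1%:Z) => z t b0 Ek lt.
  have k2 : 2 <= k.
    rewrite leNgt; apply/negP => k1.
    by have : k * z <= 1 * z; [apply: ler_wpM2r => //; lia|lia].
  by have : 2 * z <= k * z; [apply: ler_wpM2r|lia].
have inL' x : m (Some x) <> p.-1%:Z -> Some x \in L'.
  by move=> ne; rewrite mem_filter inL // andbT /=; apply/eqP.
have uL' : uniq L' by apply: filter_uniq.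
have fin Q : Q \in L' -> exists y, Q = Some y by rewrite mem_filter; case: Q => // y _; exists y.
have qsz a b : size (('X - a%:P) * ('X - b%:P) : {poly K}) = 3 by rewrite size_mul ?polyXsubC_eq0 // !size_XsubC.
have q2 a b : (('X - a%:P) * ('X - b%:P) : {poly K})`_2 = 1.
  by have := lead_coefM ('X - a%:P) ('X - b%:P : {poly K}); rewrite /lead_coef qsz -!lead_coefE !lead_coefXsubC mulr1.
have mq x a b : mup x (('X - a%:P) * ('X - b%:P)) = ((x == a) + (x == b))%N.
  rewrite mupM ?mulf_neq0 ?polyXsubC_eq0 // -[X in mup x X]expr1 mup_XsubCX -['X - b%:P]expr1 mup_XsubCX.
  by rewrite eq_sym [b == x]eq_sym; do 2!case: eqP.
case EL: L' uL' SL' half inL' fin => [|Q1 [|Q2 [|Q3 l]]] uL' SL' half inL' fin.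
- by move: SL'; rewrite big_nil; lia.
- have [y1 E1] := fin Q1 (mem_head _ _); exists (('X - y1%:P) * ('X - y1%:P)); split=> // x.
  rewrite mq; move: SL'; rewrite big_seq1 E1 => S1; case: (eqVneq x y1) => [->|ne]; first by rewrite S1 /= PoszM mulrC.
  have -> : m (Some x) = p.-1%:Z; last by rewrite subrr mulr0 muln0.
  by apply: contrapT => /inL'; rewrite mem_seq1 E1 => /eqP[] /eqP; apply/negP.
- have [y1 E1] := fin Q1 (mem_head _ _).
  have [y2 E2] := fin Q2 ltac:(by rewrite in_cons mem_head orbT).
  have h1 := half Q1 (mem_head _ _).
  have h2 := half Q2 ltac:(by rewrite in_cons mem_head orbT).
  exists (('X - y1%:P) * ('X - y2%:P)); split=> // x.
  move: SL'; rewrite !big_cons big_nil; move: uL'; rewrite /= mem_seq1 andbT E1 E2 => n12.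
  rewrite E1 E2 in h1 h2 * => S1; rewrite mq.
  have n12' : y1 != y2 by apply: contra n12 => /eqP ->.
  case: (eqVneq x y1) => [->|ne1]; first by rewrite (negPf n12') /= addn0 muln1; move: h1 h2 S1; move: (m (Some y1)) (m (Some y2)) (p.-1) => z1 z2 t; lia.
  case: (eqVneq x y2) => [->|ne2]; first by rewrite /= add0n muln1; move: h1 h2 S1; move: (m (Some y1)) (m (Some y2)) (p.-1) => z1 z2 t; lia.
  have -> : m (Some x) = p.-1%:Z; last by rewrite subrr mulr0 muln0.
  apply: contrapT => /inL'; rewrite !in_cons E1 E2 orbF => /orP[] /eqP[] /eqP; exact/negP.
- have h1 := half Q1 (mem_head _ _).
  have h2 := half Q2 ltac:(by rewrite !in_cons eqxx orbT).
  have h3 := half Q3 ltac:(by rewrite !in_cons eqxx !orbT).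
  move: SL'; rewrite !big_cons.
  have : 0 <= \sum_(j <- l) (p.-1%:Z - m j) by apply: sumr_ge0 => j _; rewrite subr_ge0; case/andP: (bd j).
  by move: (\sum_(j <- l) _) => z; lia.
Qed.

(** The pull-back of q and W^2 q have the same divisor, which is a first-order equation for F. Its
    three top coefficients determine the constant and q, which is even because F is centred.
    Clearing denominators leaves integral coefficients, so that the equation can be lifted from
    infinitely many p. *)
Lemma poly_ode_mod : (d ^ 2)%:R * ((d%:R * F`_d)%:P * F ^+ 2 + (4 * F`_d.-2 * c0 ^+ 2)%:P) =
  F^`() ^+ 2 * ((d%:R * F`_d)%:P * 'X^2 + (4 * F`_d.-2)%:P).
Proof.
have [q [sq q2 mq]] := poly_quadratic; have [pull bd dv sumL _] := om.
have q0 : q != 0 by rewrite -size_poly_gt0 sq.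
have sq' : (size q <= 3)%N by rewrite sq.
have W0 : wron F G != 0 by have [] := wron_ord Kc sF sG d2 cop top chd None.
have EW : wron F G = c0 *: F^`() by rewrite /wron EG derivC mulr0 subr0 mulrC mul_polyC.
have H0 : homp F G 2 q != 0 by have [] := ord_homp Kc sF sG d2 cop top None q0 sq'.
have [||x|k k0 Ek] := @prop_of_ord K Kc (homp F G 2 q) (wron F G ^+ 2 * q).
- by [].
- by rewrite mulf_neq0 ?expf_neq0.
- have [o1 _ _] := ord_homp Kc sF sG d2 cop top (Some x) q0 sq'.
  have [_ _ o2] := wron_ord Kc sF sG d2 cop top chd (Some x).
  have r0 := ram_gt0 Kc sF sG d2 cop top (Some x).
  have ph : rphi F G d (Some x) = Some (F.[x] / G.[x]) by rewrite /= EG hornerC c00.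
  rewrite ph in o1.
  have e1 : mup x (homp F G 2 q) = (mup (F.[x] / G.[x]) q * ram F G d (Some x))%N := o1.
  have e2 : mup x (wron F G) = (ram F G d (Some x)).-1 := o2.
  rewrite e1 mupM ?expf_neq0 ?mulf_neq0 ?expf_neq0 // expr2 mupM // e2.
  have := pull (Some x); rewrite ph; have := mq x; have := mq (F.[x] / G.[x]).
  move: (m (Some (_ / _))) (m (Some x)) (mup (_ / _) q) (mup x q) (ram _ _ _ _) r0 => x1 x2 n1 n2 e r0 h1 h2 h3.
  have : (p.-1 * (n1 * e))%:Z = (p.-1 * (e.-1 + e.-1 + n2))%:Z.
    rewrite mulnDr PoszD -h2 h3 mulnA PoszM -h1 -[in RHS](prednK r0).
    have -> : e%:Z = e.-1%:Z + 1 by lia.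
    rewrite !PoszM !PoszD; nia.
  move=> [] /eqP; rewrite eqn_pmul2l; last by lia.
  exact/eqP.
have Gm : homp F G 2 q = F ^+ 2 + (q`_1 * c0)%:P * F + (q`_0 * c0 ^+ 2)%:P.
  rewrite /homp !big_ord_recl big_ord0.
  transitivity (q`_0 *: (F ^+ 0 * G ^+ 2) + (q`_1 *: (F ^+ 1 * G ^+ 1) + (q`_2 *: (F ^+ 2 * G ^+ 0) + 0))); first by [].
  rewrite q2 EG -!mul_polyC !polyCM polyC1; move: (c0%:P) (q`_1)%:P (q`_0)%:P => B C D; ring.
rewrite Gm EW in Ek.
have Eq : q = 'X^2 + (q`_1)%:P * 'X + (q`_0)%:P.
  apply/polyP => -[|[|[|i]]]; rewrite !coefD coefCM coefXn coefX coefC /= ?mulr0 ?mulr1 ?add0r ?addr0 //.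
  by rewrite nth_default // sq.
pose a := F`_d; pose a2 := F`_d.-2; pose A := q`_1; pose B := q`_0.
have a0 : a != 0.
  by apply/eqP => z; apply: top => //; rewrite EG coefC; case: (d) d2.
pose E := 'X * F^`().
have cE i : E`_i = F`_i * i%:R by rewrite mulr_natr /E coefXM; case: i => [|i] /=; rewrite ?mulr0n // coef_deriv.
have sE : (size E <= d.+1)%N.
  by apply/leq_sizeP => j lt; rewrite cE nth_default ?mul0r //; apply: leq_trans sF lt.
pose k' := k * c0 ^+ 2.
have Ek' : 'X^2 * (F ^+ 2 + (A * c0)%:P * F + (B * c0 ^+ 2)%:P) = k' *: (E ^+ 2 * q).
  by rewrite Ek /E /k' exprZn -!mul_polyC !polyCM; move: ('X) (k%:P) => x1 x2; ring.
have [n Ed] : exists n, d = n.+2 by move: d2; case: (d) => [|[|n]] // _; exists n.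
have Ea2 : a2 = F`_n by rewrite /a2 Ed.
have F1' : F`_n.+1 = 0 by move: F1; rewrite Ed.
have sF3 : (size F <= n.+3)%N by rewrite -Ed.
have sE3 : (size E <= n.+3)%N by rewrite -Ed.
have [f4 f3 f2] := top3M sF3 sF3; have [e4 e3 e2] := top3M sE3 sE3.
have sEE : (size (E ^+ 2) <= (n + n).+2.+3)%N.
  rewrite expr2; apply: leq_trans (size_polyMleq _ _) _; move: sE3; move: (size E) => s; lia.
have [g4 g3 g2] := @top3M _ (E ^+ 2) q (n + n).+2 0 sEE sq'.
have lhs j : ('X^2 * (F ^+ 2 + (A * c0)%:P * F + (B * c0 ^+ 2)%:P))`_j.+2 = (F ^+ 2)`_j + A * c0 * F`_j + (B * c0 ^+ 2) *+ (j == 0%N).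
  by rewrite coefXnM /= subn2 /= !coefD coefCM coefC; case: (j).
have hi j : (n.+3 <= j)%N -> F`_j = 0 by move=> le; rewrite nth_default //; apply: leq_trans sF3 le.
have T4 := congr1 (fun q : {poly K} => q`_((n + n).+4).+2) Ek'.
have T3 := congr1 (fun q : {poly K} => q`_((n + n).+3).+2) Ek'.
have T2 := congr1 (fun q : {poly K} => q`_((n + n).+2).+2) Ek'.
rewrite lhs coefZ in T4; rewrite lhs coefZ in T3; rewrite lhs coefZ in T2.
rewrite addn0 in g4 g3 g2.
rewrite g4 q2 mulr1 !expr2 f4 e4 !cE hi ?mulr0 ?addr0 in T4; last by lia.
rewrite g3 q2 mulr1 !expr2 f3 e3 e4 !cE F1' hi ?mul0rn ?mulr0 ?mul0r ?addr0 in T3; last by lia.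
rewrite g2 q2 mulr1 !expr2 f2 e3 e4 e2 !cE F1' ?mul0rn ?mulr0 ?mul0r ?addr0 in T2.
rewrite !(mulr0, mul0r, addr0, add0r) in T3; rewrite !(mulr0, mul0r, addr0, add0r) in T2.
have aE : F`_n.+2 = a by rewrite /a Ed.
rewrite aE -Ea2 in T4 T3 T2.
have dK : (d%:R : K) != 0 by apply: chd => //; apply: ltnW.
have kd : k' * d%:R ^+ 2 = 1.
  apply: (mulfI (mulf_neq0 a0 a0)); rewrite mulr1 [RHS]T4 -Ed; ring.
have k'0 : k' != 0 by apply/eqP => z; move: kd; rewrite z mul0r => /eqP; rewrite eq_sym oner_eq0.
have A0 : A = 0.
  have /eqP : k' * (a * d%:R * (a * d%:R) * A) = 0 by rewrite [RHS]T3 -Ed.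
  rewrite mulf_eq0 (negPf k'0) /= mulf_eq0 => /orP[|/eqP //].
  by rewrite mulf_eq0 orbb mulf_eq0 (negPf a0) (negPf dK).
have HB : B * d%:R * a = 4 * a2.
  have ze : (F`_((n + n).+2) * A = 0) by rewrite A0 mulr0.
  move: T2; rewrite -/A A0 !(mul0r, mulr0, addr0) -Ed => T2.
  have En : (n%:R : K) = d%:R - 2 by rewrite Ed -addn2 natrD addrK.
  apply: (mulfI (mulf_neq0 dK a0)).
  transitivity ((d%:R ^+ 2 * (k' * ((a * d%:R) * (a * d%:R) * B) ))); first by transitivity ((k' * d%:R ^+ 2) * (d%:R * a * (B * d%:R * a))); [rewrite kd mul1r|ring].
  have T2' : k' * (a * d%:R * (a * d%:R) * B) = a * a2 + a2 * a - k' * (a * d%:R * (a2 * n%:R) + a2 * n%:R * (a * d%:R)).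
    rewrite T2 -/B; ring.
  transitivity (d%:R ^+ 2 * (a * a2 + a2 * a) - (k' * d%:R ^+ 2) * (a * d%:R * (a2 * n%:R) + a2 * n%:R * (a * d%:R))); first by rewrite T2'; ring.
  by rewrite kd En; ring.
have key : (d ^ 2)%:R * (F ^+ 2 + (B * c0 ^+ 2)%:P) = F^`() ^+ 2 * ('X^2 + B%:P).
  have X0 : 'X^2 != 0 :> {poly K} by rewrite expf_neq0 // polyX_eq0.
  apply: (mulfI X0); have := Ek'; rewrite A0 mul0r !mul0r addr0 Eq -/A -/B A0 mul0r addr0 => h.
  have kP : (d ^ 2)%:R%:P * k'%:P = 1 :> {poly K} by rewrite -polyCM natrX mulrC kd polyC1.
  rewrite mulrCA h -[k' *: _]mul_polyC -[(d ^ 2)%:R : {poly K}]polyC_natr [LHS]mulrA kP mul1r /E.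
  by move: ('X) (F^`()) (B%:P) => x1 x2 x3; ring.
rewrite -/a -/a2; have -> : 4 * a2 * c0 ^+ 2 = d%:R * a * (B * c0 ^+ 2) by rewrite -HB; ring.
rewrite -HB; have -> : B * d%:R * a = d%:R * a * B by ring.
rewrite [(d%:R * a * (_ * _))%:P]polyCM [(d%:R * a * B)%:P]polyCM.
rewrite -!mulrDr mulrCA key [RHS]mulrCA; congr (_ * _); by rewrite mulrC.
Qed.
End PolyModP.

Lemma int_poly_eq0_large (I : {poly int}) :
  ultimately (fun p v => map_poly (intr : int -> resT v) I = 0) -> I = 0.
Proof.
move=> [N H]; apply/polyP => i; rewrite coef0; apply/eqP; apply: contraT => c0.
have [p lt pp] := prime_above (N + absz (I`_i)%R)%N; have [v _] := place_exists pp.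
have ltN : (N < p)%N by apply: leq_ltn_trans lt; rewrite leq_addr.
have := congr1 (fun q : {poly resT v} => q`_i) (H p pp ltN v); rewrite coef_map coef0 /= -(pr_int v) => /eqP.
rewrite pr_int_eq0 // dvdzE => /dvdn_leq; rewrite absz_gt0 c0 => /(_ isT) le.
by move: (leq_trans lt le); rewrite ltnNge leq_addl.
Qed.

Lemma poly_ode (f : {poly rat}) al d : hyps f 1 al -> size f = d.+1 -> f`_d.-1 = 0 -> let P := polyQ f in
  (d ^ 2)%:R * ((d%:R * P`_d)%:P * P ^+ 2 + (4 * P`_d.-2)%:P) = P^`() ^+ 2 * ((d%:R * P`_d)%:P * 'X^2 + (4 * P`_d.-2)%:P).
Proof.
move=> H szf f1 P; have [cop d2 _ _] := H.
have dE : rdeg f 1 = d by rewrite /rdeg size_poly1 szf maxnSS maxn0.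
have [f0 [g0 [R [s [s0 Ef Eg rm]]]]] := rat_ratmap cop d2.
have md := setup_mdata H s0 Ef Eg rm; rewrite dE in rm md d2.
have sC : (ratr s : algC) != 0 by rewrite fmorph_eq0.
pose c := g0`_0; have Eg0 : g0 = c%:P.
  apply/polyP => -[|i]; rewrite coefC //=; apply/eqP; have := congr1 (fun q : {poly algC} => q`_i.+1) Eg.
  rewrite /polyQ rmorph1 coefZ coef_map coefC /= => /esym/eqP; rewrite mulf_eq0 (negPf sC) /= intr_eq0; exact.
have sc : ratr s * c%:~R = 1 :> algC.
  by have := congr1 (fun q : {poly algC} => q`_0) Eg; rewrite /polyQ rmorph1 coefZ coef_map coefC.
have cC : (c%:~R : algC) != 0 by apply/eqP => z; move: sc; rewrite z mulr0 => /eqP; rewrite eq_sym oner_eq0.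
have f01 : f0`_d.-1 = 0.
  have := congr1 (fun q : {poly algC} => q`_d.-1) Ef; rewrite coefZ !coef_map /= f1 rmorph0 => /esym/eqP.
  by rewrite mulf_eq0 (negPf sC) /= intr_eq0 => /eqP.
have EP : pZ f0 = c%:~R *: P by rewrite /P Ef scalerA mulrC sc scale1r.
pose I : {poly int} := (d ^ 2)%:R * ((d%:R * f0`_d)%:P * f0 ^+ 2 + (4 * f0`_d.-2 * c ^+ 2)%:P) -
  f0^`() ^+ 2 * ((d%:R * f0`_d)%:P * 'X^2 + (4 * f0`_d.-2)%:P).
have mapI (A : comNzRingType) (h : {rmorphism int -> A}) : map_poly h I =
   (d ^ 2)%:R * ((d%:R * (map_poly h f0)`_d)%:P * map_poly h f0 ^+ 2 + (4 * (map_poly h f0)`_d.-2 * h c ^+ 2)%:P) -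
   (map_poly h f0)^`() ^+ 2 * ((d%:R * (map_poly h f0)`_d)%:P * 'X^2 + (4 * (map_poly h f0)`_d.-2)%:P).
  rewrite /I -![(d ^ 2)%:R]polyC_natr !expr2 !(rmorphB, rmorphD, rmorphM) /= ?map_polyC /= ?map_polyX ?deriv_map ?rmorphM /= ?rmorphM /=.
  by rewrite ?coef_map ?rmorph_nat ?rmorph1 ?polyC_natr.
have I0 : I = 0.
  apply: int_poly_eq0_large; have [N1 H1] := md; have [N2 H2] := good_prime rm.
  have [N3 H3] := unit_large cC.
  exists (N1 + N2 + N3)%N => p pp lt v; have [nR dp] := H2 p pp ltac:(lia) v.
  have [m om] := H1 p pp ltac:(lia) v; have [_ c3] := H3 p pp ltac:(lia) v.
  rewrite pr_int in c3.
  rewrite mapI; apply/eqP; rewrite subr_eq0; apply/eqP.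
  apply: (poly_ode_mod (@res_alg_closed _ v) (red_sF rm v) (red_sG rm v) d2 (red_cop rm pp nR) (red_top rm pp nR) (red_chd v pp nR dp) (prime_gt1 pp) om) => //.
  - by rewrite Eg0 map_polyC.
  - by rewrite coef_map f01.
have := mapI _ (intr : int -> algC); rewrite I0 rmorph0 EP derivZ !coefZ => /esym/eqP; rewrite subr_eq0 => /eqP E.
have C3 : ((c%:~R : algC) ^+ 3)%:P != 0 by rewrite polyC_eq0 expf_neq0.
apply: (mulfI C3); move: E; rewrite -!mul_polyC !polyCM ?[(c%:~R ^+ _)%:P]rmorphXn /=.
move: (c%:~R%:P) (P^`()) ((P`_d)%:P) ((P`_d.-2)%:P) (d%:R%:P) (4%:P) => x1 x2 x3 x4 x5 x6 E.
transitivity ((d ^ 2)%:R * (x5 * (x1 * x3) * (x1 * P) ^+ 2 + x6 * (x1 * x4) * (x1 * x1))); first by ring.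
by rewrite E; ring.
Qed.

Lemma reval_cst (f : {poly algC}) c P : c != 0 -> (1 < size f)%N ->
  reval f c%:P P = omap (fun x => f.[x] / c) P.
Proof.
move=> c0 sf; case: P => [x|] /=; first by rewrite hornerC c0.
by rewrite size_polyC c0 sf.
Qed.

Lemma conj_affine (f f' : {poly algC}) a b c : a != 0 -> c != 0 -> (1 < size f)%N -> (1 < size f')%N ->
  (forall x, f.[a * x + b] / c = a * f'.[x] + b) -> conj_by a b 0 1 f c%:P f' 1.
Proof.
move=> a0 c0 sf sf' E; split; first by rewrite mulr1 mulr0 subr0.
have M P : reval (a *: 'X + b%:P) (0 *: 'X + 1%:P) P = omap (fun x => a * x + b) P.
  rewrite scale0r add0r reval_cst ?oner_neq0 //.
    by case: P => //= x; rewrite divr1 hornerD hornerZ hornerX hornerC.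
  by rewrite size_polyDl ?size_scale ?size_polyX // size_polyC; case: eqP.
move=> P; rewrite !M -[1]polyC1 !reval_cst ?oner_neq0 //; case: P => //= x.
by rewrite E divr1.
Qed.

Lemma coef_comp_scale (A : comNzRingType) (P : {poly A}) r i : (P \Po (r *: 'X))`_i = P`_i * r ^+ i.
Proof.
rewrite comp_polyE.
have -> : \sum_(j < size P) P`_j *: (r *: 'X) ^+ j = \poly_(j < size P) (P`_j * r ^+ j).
  by rewrite poly_def; apply: eq_bigr => j _; rewrite exprZn scalerA.
by rewrite coef_poly; case: ltnP => // le; rewrite nth_default // mul0r.
Qed.

(** The constant term of the quadratic factor decides: if it is 0 the equation integrates to a
    monomial, otherwise a rescaling turns it into the Chebyshev equation. *)
Lemma poly_centered_cases (f : {poly rat}) al d : hyps f 1 al -> size f = d.+1 -> f`_d.-1 = 0 ->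
  special (polyQ f) 1 \/ polyQ f = (polyQ f)`_d *: 'X^d.
Proof.
move=> H szf f1; have [_ d2' _ _] := H; have ode := poly_ode H szf f1; rewrite /= in ode.
have dE : rdeg f 1 = d by rewrite /rdeg size_poly1 szf maxnSS maxn0.
have d2 : (2 <= d)%N by rewrite -dE.
set P := polyQ f in ode *; have szP : size P = d.+1 by rewrite size_map_poly.
pose a := P`_d; pose a2 := P`_d.-2.
have a0 : a != 0 by rewrite /a -[d]/(d.+1.-1) -szP -lead_coefE lead_coef_eq0 -size_poly_gt0 szP.
have dC : (d%:R : algC) != 0 by rewrite pnatr_eq0; case: (d) d2.
have da : (d%:R * a) != 0 by rewrite mulf_neq0.
rewrite -/a -/a2 in ode; have [z|n0] := eqVneq a2 0.
  right; have daP : (d%:R * a)%:P != 0 :> {poly algC} by rewrite polyC_eq0.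
  have : (d%:R%:P * P) ^+ 2 == ('X * P^`()) ^+ 2.
    apply/eqP; apply: (mulfI daP); move: ode; rewrite z mulr0 polyC0 !addr0 natrX -polyC_natr.
    move: (d%:R%:P) (P^`()) ((d%:R * a)%:P) ('X) => x1 x2 x3 x4 E.
    by transitivity (x1 ^+ 2 * (x3 * P ^+ 2)); [ring|rewrite E; ring].
  have cX j : ('X * P^`())`_j = P`_j * j%:R.
    by rewrite mulr_natr coefXM; case: j => [|j] /=; rewrite ?mulr0n // coef_deriv.
  rewrite eqf_sqr => /orP[/eqP E|/eqP E].
    apply/polyP => i; rewrite coefZ coefXn; case: eqP => [->|/eqP ne]; first by rewrite mulr1.
    have := congr1 (fun q : {poly algC} => q`_i) E; rewrite coefCM cX mulrC => /eqP.
    rewrite -subr_eq0 -mulrBr mulf_eq0 subr_eq0 eqr_nat [d == i]eq_sym (negPf ne) orbF mulr0; exact/eqP.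
  have := congr1 (fun q : {poly algC} => q`_d) E; rewrite coefCM coefN cX -/a mulrC => /eqP.
  by rewrite -addr_eq0 -mulr2n mulrn_eq0 /= mulf_eq0 (negPf a0) (negPf dC).
(* Scaling by [rho] turns the quadratic factor into a multiple of X^2 - 4. As the square root of a
   rational number, [rho] lies in the cyclotomic closure. *)
left; pose r : rat := - f`_d.-2 / (d%:R * f`_d); pose rho : algC := sqrtC (ratr r).
have Er : rho ^+ 2 * (d%:R * a) = - a2.
  rewrite sqrtCK /r fmorph_div rmorphN rmorphM /= rmorph_nat /a /a2 /P !coef_map /= divfK //.
  by move: da; rewrite /a /P coef_map.
have rho0 : rho != 0.
  by apply: contraNneq n0 => h; move: Er; rewrite h expr0n mul0r => /esym/eqP; rewrite oppr_eq0.
pose y := rho^-1 *: (P \Po (rho *: 'X)).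
have cy i : y`_i = rho^-1 * (P`_i * rho ^+ i) by rewrite coefZ coef_comp_scale.
have sy : (size y <= d.+1)%N by apply/leq_sizeP => j le; rewrite cy nth_default ?mul0r ?mulr0 // szP.
have yd : y`_d != 0 by rewrite cy !mulf_neq0 ?invr_eq0 ?expf_neq0.
have Ey' : y^`() = P^`() \Po (rho *: 'X).
  by rewrite derivZ deriv_comp derivZ derivX alg_polyC mulrC mul_polyC scalerA mulVf // scale1r.
have y'0 : y^`() != 0.
  apply: contraNneq yd => h; have := congr1 (fun q : {poly algC} => q`_d.-1) h.
  rewrite coef_deriv coef0 prednK ?(ltnW d2) // => /eqP; rewrite mulrn_eq0 => /orP[|/eqP -> //].
  by case: (d) d2.
have yode : ('X^2 - 4%:P) * y^`() ^+ 2 = (y ^+ 2 - 4%:P) *+ (d ^ 2).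
  have := congr1 (fun q : {poly algC} => q \Po (rho *: 'X)) ode.
  rewrite -[(d ^ 2)%:R : {poly algC}]polyC_natr !expr2 !comp_polyM !comp_polyD !comp_polyM comp_polyX !comp_polyC -Ey'.
  have -> : P \Po (rho *: 'X) = rho *: y by rewrite /y scalerA mulfV // scale1r.
  have -> : 4 * a2 = - 4 * (rho ^+ 2 * (d%:R * a)) by rewrite Er; ring.
  have K0 : (d%:R * a * rho ^+ 2)%:P != 0 :> {poly algC} by rewrite polyC_eq0 !mulf_neq0 ?expf_neq0.
  have -> : (y * y - 4%:P) *+ d ^ 2 = (y * y - 4%:P) * ((d ^ 2)%:R)%:P by rewrite [((d ^ 2)%:R)%:P]polyC_natr mulr_natr.
  move=> E; apply: (mulfI K0); move: E.
  rewrite -!mul_polyC !polyCM polyCN; move: (rho%:P) (d%:R%:P) (a%:P) ('X) (4%:P) (y^`()) ((d ^ 2)%:R%:P) => x1 x2 x3 x4 x5 x6 x7 E.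
  transitivity (x6 * x6 * (x2 * x3 * (x1 * x4 * (x1 * x4)) + - x5 * (x1 * x1 * (x2 * x3)))); first by ring.
  by rewrite -E; ring.
have [||||Ecases|Ecases] := @cheb_unique d y => //; first by apply: ltnW.
all: have rQ : in_Qc rho by apply: (@sqrt_rat_Qc r); rewrite sqrtCK.
all: have cj : conj_by rho 0 0 1 P 1 y 1 by
  (rewrite -{1}polyC1; apply: conj_affine => //; [exact: oner_neq0|by rewrite szP ltnS ltnW
   |by rewrite ltnNge; apply/negP => /size1_polyC Ey; move: y'0; rewrite Ey derivC eqxx
   |by move=> x; rewrite /y hornerZ horner_comp hornerZ hornerX !addr0 divr1 mulrA mulfV // mul1r]).
all: have dP : rdeg P 1 = d by rewrite /rdeg size_poly1 szP maxnSS maxn0.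
- rewrite Ecases in cj; apply: Or43; rewrite dP; exists rho, 0, 0, 1; split=> //; [exact: Qc_0|exact: Qc_0|exact: Qc_1].
- rewrite Ecases in cj; apply: Or44; rewrite dP; exists rho, 0, 0, 1; split=> //; [exact: Qc_0|exact: Qc_0|exact: Qc_1].
Qed.

Lemma coef_comp_shift (A : comNzRingType) (P : {poly A}) b n : (size P <= n.+2)%N ->
  (P \Po ('X + b%:P))`_n = P`_n + P`_n.+1 * (b *+ n.+1) /\ (size (P \Po ('X + b%:P)) <= n.+2)%N /\ (P \Po ('X + b%:P))`_n.+1 = P`_n.+1.
Proof.
move=> sz; have c1 m : (('X + b%:P : {poly A}) ^+ m)`_m = 1 /\ (size (('X + b%:P : {poly A}) ^+ m) <= m.+1)%N.
  have mon : ('X + b%:P : {poly A}) ^+ m \is monic by apply/monic_exp/monicXaddC.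
  have szE : size (('X + b%:P : {poly A}) ^+ m) = m.+1 by rewrite -[b]opprK polyCN size_exp_XsubC.
  by rewrite szE; split=> //; move/monicP: mon; rewrite /lead_coef szE.
have c2 m : (('X + b%:P : {poly A}) ^+ m.+1)`_m = b *+ m.+1.
  elim: m => [|m IH]; first by rewrite expr1 coefD coefX coefC /= add0r mulr1n.
  by rewrite exprS mulrDl coefD coefXM /= IH coefCM (proj1 (c1 _)) mulr1 -mulrSr.
have sC : (size (P \Po ('X + b%:P)) <= n.+2)%N.
  rewrite comp_polyE; apply: leq_trans (size_sum _ _ _) _; apply/bigmax_leqP => i _.
  apply: leq_trans (size_scale_leq _ _) _; apply: leq_trans (proj2 (c1 _)) _.
  by apply: leq_trans sz; apply: ltn_ord.
have E j : (P \Po ('X + b%:P))`_j = \sum_(i < n.+2) P`_i * (('X + b%:P) ^+ i)`_j.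
  by rewrite /comp_poly (@horner_coef_wide _ n.+2) ?size_map_polyC // coef_sum; apply: eq_bigr => i _; rewrite coef_map /= coefCM.
have hi i j : (i < j)%N -> (('X + b%:P : {poly A}) ^+ i)`_j = 0 by move=> lt; rewrite nth_default //; apply: leq_trans (proj2 (c1 _)) _.
split; last split=> //.
- rewrite E !big_ord_recr /= big1 ?add0r => [|i _]; last by rewrite (hi _ _ (ltn_ord i)) mulr0.
  by rewrite (proj1 (c1 n)) mulr1 c2.
- rewrite E !big_ord_recr /= big1 ?add0r => [|i _]; last by rewrite (hi _ _ (leqW (ltn_ord i))) mulr0.
  by rewrite (hi n n.+1) // mulr0 add0r (proj1 (c1 n.+1)) mulr1.
Qed.

(** A rational translation centres the polynomial. In the monomial case its centre is a second
    totally invariant point, left to the study of power maps. *)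
Lemma poly_case (f g : {poly rat}) al : hyps f g al ->
  (forall T, reval (polyQ f) (polyQ g) T = None <-> T = None) ->
  special (polyQ f) (polyQ g) \/
  exists2 Q, Q <> None & forall T, reval (polyQ f) (polyQ g) T = Q <-> T = Q.
Proof.
move=> H inv; have [cop d2 _ _] := H.
have sg : size (polyQ g) == 1%N.
  apply: contraT => /closed_rootP[x rx]; have [h _] := inv (Some x).
  by move: h; rewrite /= (rootP rx) eqxx => /(_ erefl).
rewrite size_map_poly in sg; have /size_poly1P[c c0 Eg] := sg.
have [n [n0 szf]] : exists n, (0 < n)%N /\ size f = n.+2.
  move: d2; rewrite /rdeg (eqP sg); move: (size f) => k le; exists (k - 2)%N; lia.
pose f1 := c^-1 *: f; have sf1 : size f1 = n.+2 by rewrite size_scale ?invr_eq0.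
have l0 : f1`_n.+1 != 0 by rewrite -[n.+1]/(n.+2.-1) -sf1 -lead_coefE lead_coef_eq0 -size_poly_gt0 sf1.
have nq : (n.+1%:R : rat) != 0 by rewrite pnatr_eq0.
pose b := - f1`_n / (f1`_n.+1 * n.+1%:R); pose f2 := f1 \Po ('X + b%:P) - b%:P.
have [|e1 [e2 e3]] := @coef_comp_shift _ f1 b n; first by rewrite sf1.
have f2n : f2`_n = 0.
  rewrite coefB coefC (gtn_eqF n0) subr0 e1 -mulr_natr /b.
  by move: (n.+1%:R : rat) nq => k k0; field; rewrite ?l0 ?k0.
have f2d : f2`_n.+1 != 0 by rewrite coefB coefC /= subr0 e3.
have sf2 : size f2 = n.+2.
  apply/eqP; rewrite eqn_leq; apply/andP; split.
    apply: leq_trans (size_polyD _ _) _; rewrite geq_max e2 size_polyN size_polyC.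
    by case: (b != 0).
  by rewrite ltnNge; apply: contra f2d => le; rewrite nth_default.
have cC : (ratr c : algC) != 0 by rewrite fmorph_eq0.
have gE : polyQ g = (ratr c)%:P by rewrite Eg /polyQ map_polyC.
have E x : (polyQ f).[x + ratr b] / ratr c = (polyQ f2).[x] + ratr b.
  rewrite /f2 /f1 /polyQ rmorphB /= map_comp_poly rmorphD /= map_polyX !map_polyC /= hornerD hornerN hornerC subrK.
  by rewrite horner_comp hornerD hornerX hornerC map_polyZ /= fmorphV hornerZ mulrC.
have szm (P : {poly rat}) : size (polyQ P) = size P by apply: size_map_poly.
have C : conj_by (ratr 1) (ratr b) (ratr 0) (ratr 1) (polyQ f) (polyQ g) (polyQ f2) (polyQ 1).
  rewrite gE rmorph1 rmorph0 /polyQ rmorph1; apply: conj_affine; rewrite ?oner_neq0 ?szm ?szf ?sf2 // => x.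
  by rewrite !mul1r E.
have dE : rdeg f2 1 = rdeg f g by rewrite /rdeg sf2 szf (eqP sg) size_poly1.
have H2 : hyps f2 1 (al - b).
  apply: (hyps_conj H _ dE C); first exact: coprimep1.
  rewrite -mob_reval; last by rewrite rmorph1 rmorph0 mulr1 mulr0 subr0 oner_neq0.
  rewrite rmorph1 rmorph0 scale0r add0r /= hornerC oner_neq0 divr1 scale1r hornerD hornerX hornerC rmorphB /= subrK.
  by [].
have [|sp|pw] := poly_centered_cases H2 sf2; first by [].
  left; apply: special_conj dE C _; by rewrite {2}/polyQ rmorph1.
right; exists (Some (ratr b)) => // T; rewrite gE reval_cst ?szm ?szf //.
have l2 : (polyQ f2)`_n.+1 != 0 by rewrite coef_map fmorph_eq0.
case: T => [x|] //=; rewrite -{1}(subrK (ratr b) x) E pw hornerZ hornerXn.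
split=> [[] /eqP|[->]]; last by rewrite subrr expr0n mulr0 add0r.
by rewrite -subr_eq0 addrK mulf_eq0 (negPf l2) /= expf_eq0 /= subr_eq0 => /eqP ->.
Qed.

(** * Power maps *)

Lemma bounded_int_roots (k B : nat) : exists s : seq algC, forall (P : {poly int}) x, P != 0 ->
  (size P <= k.+1)%N -> (forall i, (absz (P`_i)%R <= B)%N) -> root (pZ P) x -> x \in s.
Proof.
pose mk (h : {ffun 'I_k.+1 -> 'I_(B + B).+1}) : {poly int} := \poly_(i < k.+1) ((h (inord i) : nat)%:Z - B%:Z).
pose rts (P : {poly int}) := sval (closed_field_poly_normal (pZ P)).
exists (flatten [seq rts (mk h) | h <- enum {: {ffun 'I_k.+1 -> 'I_(B + B).+1}}]) => P x P0 sz bd rx.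
apply/flattenP; exists (rts P).
  apply/mapP; exists [ffun i : 'I_k.+1 => inord (absz (P`_i + B%:Z))]; first by rewrite mem_enum.
  congr rts; apply/polyP => i; rewrite coef_poly; case: ltnP => lt; last by rewrite nth_default //; apply: leq_trans sz lt.
  rewrite ffunE !inordK //; have := bd i; move: (P`_i)%R => z; lia.
have := svalP (closed_field_poly_normal (pZ P)); rewrite -/(rts P) => E.
have P0' : pZ P != 0 by rewrite map_poly_eq0_id0 // intr_eq0 lead_coef_eq0.
by move: rx; rewrite E rootZ ?lead_coef_eq0 // root_prod_XsubC.
Qed.

Lemma coef_prod_XsubC_bound (zs : seq algC) i :
  `|(\prod_(z <- zs) ('X - z%:P))`_i| <= \prod_(z <- zs) (1 + `|z|).
Proof.
elim: zs i => [|z zs IH] i; first by rewrite !big_nil coefC; case: (i == 0%N); rewrite ?normr1 ?normr0.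
rewrite !big_cons mulrBl coefB coefXM coefCM; apply: le_trans (ler_normB _ _) _.
rewrite mulrDl mul1r normrM; apply: lerD; last by apply: ler_wpM2l.
case: (i == 0%N); last exact: IH.
by rewrite normr0; apply: prodr_ge0 => y _; rewrite addr_ge0.
Qed.

(** The X n lie in one number field and are backward iterates of v under X^D, so they have bounded
    height and two of them coincide; X n = X m gives v^(D^(m-n)) = v. *)
Lemma power_tower_unity (D : nat) (del v : algC) (X : nat -> algC) : (2 <= D)%N -> v != 0 ->
  (forall n, gen del (X n)) -> (forall n, X n ^+ (D ^ n) = v) -> exists N, (0 < N)%N /\ v ^+ N = 1.
Proof.
move=> D2 v0 gX EX; have rm : ratmap 'X^D 1 D 1.
  split=> //; first by rewrite size_polyXn.
  - by rewrite size_poly1.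
  - by exists 0, 1; rewrite mul0r add0r mul1r.
  - exists 1, 0; rewrite mul0r addr0 mul1r; apply/polyP => i; rewrite coef_poly coefXn coefC.
    case: ltnP => le; last by case: i le => //; rewrite ltn0.
    by case: (i =P 0%N) => [->|/eqP ne]; rewrite ?subn0 ?eqxx // (_ : (D - i == D)%N = false) //; apply/eqP; move: ne le; lia.
have iT n x : x ^+ (D ^ n) = v -> inT 'X^D 1 [:: v] n x.
  elim: n x => [|n IH] x /=; first by rewrite expn0 expr1 => ->; exists v; [rewrite mem_head|exists idfun].
  rewrite /gC /phi /fC /gC rmorph1 hornerC oner_neq0 divr1 rmorphXn /= map_polyX hornerXn => E; split=> //.
  by apply: IH; rewrite -exprM -expnS.
have [K K0 HK] := height_T [:: v] rm.
have [gs gsP] := conj_reps_exists del; pose k := size gs; pose B := (2 ^ k * K ^ k)%N.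
have [s Hs] := bounded_int_roots k B.
have inS n : X n \in s.
  have [a la] := lcz_exists gsP (gX n); have [a0 [P pP EP]] := la.
  have mb := HK n (X n) (iT _ _ (EX n)) del gs a gsP (gX n) la.
  have EP' : pZ P = a *: \prod_(z <- [seq (t : autC) (X n) | t <- gs]) ('X - z%:P) by rewrite big_map.
  have P0 : P != 0.
    apply/eqP => z; move/eqP: EP'; rewrite z rmorph0 eq_sym scaler_eq0 (negPf a0) /=.
    by rewrite (negPf (monic_neq0 (monic_prod_XsubC _ _ _))).
  apply: (Hs P) => //.
  - rewrite -(@size_map_poly_id0 _ _ (intr : int -> algC)) ?intr_eq0 ?lead_coef_eq0 // EP' size_scale // size_prod_XsubC size_map.
    exact: leqnn.
  - move=> i; rewrite -(ler_nat algC) natr_absz intr_norm.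
    have -> : (P`_i)%:~R = (pZ P)`_i by rewrite coef_map.
    rewrite EP' coefZ normrM natrM; apply: le_trans (_ : `|a| * \prod_(z <- [seq (t : autC) (X n) | t <- gs]) (1 + `|z|) <= _).
      by apply: ler_wpM2l => //; apply: coef_prod_XsubC_bound.
    rewrite big_map; apply: le_trans (_ : `|a| * \prod_(t <- gs) (2 * mx ((t : autC) (X n))) <= _).
      apply: ler_wpM2l => //; apply: ler_prod => t _; rewrite addr_ge0 //=.
      by rewrite mulr2n mulrDl mul1r lerD ?mx_ge1 ?mx_norm.
    rewrite big_split /=.
    have -> : \prod_(t <- gs) 2 = 2 ^+ k :> algC by rewrite big_const_seq count_predT -/k iter_mulr_1.
    rewrite mulrCA !natrX; apply: ler_wpM2l; first by rewrite exprn_ge0.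
    exact: mb.
  - rewrite EP' rootZ // root_prod_XsubC; have [t tgs Et] := conj_repsP gsP idfun.
    by apply/mapP; exists t => //; rewrite -(gX n idfun t Et).
have : ~~ uniq (mkseq X (size s).+1).
  apply/negP => u; have : (size (mkseq X (size s).+1) <= size s)%N.
    by apply: uniq_leq_size => // x /mapP[n _ ->]; apply: inS.
  by rewrite size_mkseq ltnn.
case/(uniqPn 0) => n [m [nm]]; rewrite size_mkseq => ms; rewrite !nth_mkseq // ; last by apply: ltn_trans ms.
move=> E; exists (D ^ (m - n) - 1)%N.
have D1 : (1 < D ^ (m - n))%N by rewrite -(expn0 D) ltn_exp2l // subn_gt0.
split; first by rewrite subn_gt0.
apply: (mulIf v0); rewrite mul1r -exprSr -addn1 subnK; last by apply: ltnW.
by rewrite -{1}(EX n) -exprM -expnD subnKC ?(ltnW nm) // E EX.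
Qed.

(** An automorphism t over Q(c) that raises the D^n-th roots of unity to the power [ka] commutes
    with the others over Q(c) on the tower, so t(y)/y^ka lies in Q(c). Hence a fixed negative power
    of y0^(D-1) A is a D^n-th power in Q(c) for every n, and [power_tower_unity] applies. *)
Lemma kummer_tower (c y0 A : algC) (D : nat) (y : nat -> algC) : (2 <= D)%N -> A != 0 -> y0 != 0 -> y 0%N = y0 ->
  (forall n, A * y n.+1 ^+ D = y n) ->
  (forall s : autC, s c = c -> s A = A /\ s y0 = y0) -> (forall s : autC, s (s c) = c) ->
  (forall s t : autC, s c = c -> t c = c -> forall n, s (t (y n)) = t (s (y n))) ->
  exists N, (0 < N)%N /\ (y0 ^+ D.-1 * A) ^+ N = 1.
Proof.
move=> D2 A0 y00 E0 Ey fix_s invol comm.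
pose e n := (\sum_(i < n) D ^ i)%N; pose ka := (D.+1 * D.+1)%N.
have eS n : (D.-1 * e n).+1 = (D ^ n)%N.
  elim: n => [|n IH]; first by rewrite /e big_ord0 muln0 expn0.
  by rewrite /e big_ord_recr /= -/(e n) mulnDr -addSn IH expnS -mulSn prednK // ltnW.
have pw n : y n ^+ (D ^ n) * A ^+ e n = y0.
  elim: n => [|n IH]; first by rewrite expn0 expr1 /e big_ord0 expr0 mulr1.
  by rewrite /e big_ord_recr /= -/(e n) expnS exprM exprD [_ * A ^+ (D ^ n)]mulrC mulrA -exprMn [_ * A]mulrC Ey.
have yn0 n : y n != 0.
  apply: contraNneq y00 => z; rewrite -(pw n) z expr0n expn_eq0 (gtn_eqF (ltnW D2)) /= mul0r.
  by [].
have ka1 : (0 < ka.-1)%N by rewrite /ka; lia.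
have ka0 : (0 < ka)%N by [].
pose v := ((y0 ^+ D.-1 * A) ^+ ka.-1)^-1.
have key n : exists x, gen c x /\ x ^+ (D ^ n) = v.
  have cop : coprime D.+1 (D ^ n) by rewrite coprimeXr // coprimeSn.
  have [u Hu] := Qn_aut_exists cop; pose t : autC := (u \o u : autC).
  have tz z : z ^+ (D ^ n) = 1 -> t z = z ^+ ka by move=> hz; rewrite /t /= (Hu z hz) rmorphXn /= (Hu z hz) -exprM.
  have tc : t c = c by apply: invol.
  have fixY (s : autC) : s c = c -> s (y n) ^+ (D ^ n) = y n ^+ (D ^ n).
    move=> sc; have [sA sy] := fix_s s sc; apply: (mulIf (expf_neq0 (e n) A0)).
    by rewrite pw -{1}sA -!rmorphXn -rmorphM /= pw.
  pose w := t (y n) / y n ^+ ka.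
  have fw (s : autC) : s c = c -> s w = w.
    move=> sc; pose z := s (y n) / y n.
    have hz : z ^+ (D ^ n) = 1 by rewrite /z expr_div_n fixY // mulfV // expf_neq0.
    have Es : s (y n) = z * y n by rewrite /z divfK.
    have z0 : z != 0 by rewrite /z mulf_neq0 ?invr_eq0 ?fmorph_eq0.
    clearbody z; have Est : s (t (y n)) = z ^+ ka * t (y n) by rewrite comm // Es rmorphM tz.
    rewrite /w fmorph_div rmorphXn Est Es exprMn.
    have := expf_neq0 ka z0; have := expf_neq0 ka (yn0 n); move: (z ^+ ka) (y n ^+ ka) (t (y n)) => a b q b0 a0.
    by field; rewrite a0 b0.
  exists (w ^+ D.-1 / A ^+ ka.-1); split.
    move=> u1 u2 Eu; pose s : autC := (algC_invaut u1 \o u2 : autC).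
    have sc : s c = c by rewrite /s /= -Eu algC_autK.
    have [sA _] := fix_s s sc; have sw := fw s sc.
    have sx : s (w ^+ D.-1 / A ^+ ka.-1) = w ^+ D.-1 / A ^+ ka.-1 by rewrite fmorph_div !rmorphXn sA sw.
    by rewrite -[in LHS]sx /s /= algC_invautK.
  set Y := y n ^+ (D ^ n); have Y0 : Y != 0 by apply: expf_neq0.
  have wY : w ^+ (D ^ n) = (Y ^+ ka.-1)^-1.
    rewrite /w expr_div_n fixY // -/Y exprAC -/Y -{2}(prednK ka0) exprS.
    by field; rewrite Y0 expf_neq0.
  rewrite expr_div_n -!exprM [(D.-1 * _)%N]mulnC exprM wY /v -(pw n) -/Y.
  have inner : (Y * A ^+ e n) ^+ D.-1 * A = Y ^+ D.-1 * A ^+ (D ^ n).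
    by clearbody Y; rewrite exprMn -exprM -mulrA -exprSr [(e n * _)%N]mulnC eS.
  rewrite inner exprVn -exprM -invfM; congr (_^-1); clearbody Y; rewrite exprMn -!exprM.
  by congr (_ * _); congr (_ ^+ _); exact: mulnC.
have [X HX] := boolp.choice key.
have v0 : v != 0 by rewrite invr_eq0 expf_neq0 // mulf_neq0 ?expf_neq0.
have [N [N0 EN]] := power_tower_unity D2 v0 (fun n => proj1 (HX n)) (fun n => proj2 (HX n)).
exists (ka.-1 * N)%N; split; first by rewrite muln_gt0 ka1.
by rewrite exprM; apply: invr_inj; rewrite -exprVn EN invr1.
Qed.

Lemma totally_ramified (K : fieldType) (Kc : alg_closed K) (F G : {poly K}) d (P : option K) (e : K) :
  (size F <= d.+1)%N -> (size G <= d.+1)%N -> (2 <= d)%N -> (forall x, F.[x] = 0 -> G.[x] = 0 -> False) ->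
  (F`_d = 0 -> G`_d = 0 -> False) -> (forall T, rphi F G d T = P <-> T = Some e) ->
  ram F G d (Some e) = d /\ exists2 a, a != 0 & hP F G P = a *: ('X - e%:P) ^+ d.
Proof.
move=> sF sG d2 cop top fib; have re : rphi F G d (Some e) = P by apply/fib.
have rE : ram F G d (Some e) = d.
  have [rs [srs E]] := fiber Kc sF sG d2 cop top P.
  have : all (pred1 (Some e)) rs.
    by apply/allP => Q Qrs; apply/eqP/fib; have := E Q; case: eqP => // _ /eqP; rewrite -leqn0 leqNgt -has_count has_pred1 Qrs.
  by rewrite all_count srs => /eqP cE; rewrite -[RHS]cE E re eqxx.
split=> //; apply: (prop_of_ord Kc (hP_neq0 Kc d2 cop top P)); first by rewrite expf_neq0 // polyXsubC_eq0.
move=> x; have := ord_hP Kc sF sG d2 cop top P (Some x); rewrite [ord _ _ _]/= => ->; rewrite mup_XsubCX.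
case: (eqVneq e x) => [<-|ne]; first by rewrite re eqxx rE.
by case: eqP => // /fib[xe]; rewrite xe eqxx in ne.
Qed.

Lemma hv_XsubC_exp (K : fieldType) (e u w : K) d : hv d (('X - e%:P) ^+ d) u w = (u - e * w) ^+ d.
Proof.
have sz : size (('X - e%:P) ^+ d) = d.+1 by rewrite size_exp_XsubC.
have [->|w0] := eqVneq w 0.
  rewrite hv_inf mulr0 subr0; have -> : (('X - e%:P) ^+ d)`_d = 1; last by rewrite mul1r.
  have /monicP := monic_exp d (monicXsubC e); by rewrite /lead_coef sz.
rewrite hv_affine ?sz // horner_exp hornerXsubC -exprMn mulrBr mulrCA mulfV // mulr1.
by rewrite [e * w]mulrC.
Qed.

Lemma hvB (K : fieldType) n (P Q : {poly K}) u w : hv n (P - Q) u w = hv n P u w - hv n Q u w.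
Proof. by rewrite -scaleN1r hvD hvZ mulN1r. Qed.

Lemma pt_pencil (K : fieldType) (c c' F G l k y1 y2 : K) : c != c' -> k != 0 ->
  F - c * G = k * (l * y1) -> F - c' * G = k * y2 ->
  (y1 != 0) || (y2 != 0) -> pt F G = mob (c' * l) (- c) l (- 1) (pt y1 y2).
Proof.
move=> cc k0 E1 E2 ny; rewrite mob_pt //; have cd : c' - c != 0 by rewrite subr_eq0 eq_sym.
have EF : F = (k / (c' - c)) * (c' * l * y1 + - c * y2).
  apply: (mulfI cd); transitivity (c' * (F - c * G) - c * (F - c' * G)); first by ring.
  by rewrite E1 E2; field.
have EG : G = (k / (c' - c)) * (l * y1 + - 1 * y2).
  apply: (mulfI cd); transitivity ((F - c * G) - (F - c' * G)); first by ring.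
  by rewrite E1 E2; field.
by rewrite EF EG pt_scale // mulf_neq0 ?invr_eq0.
Qed.

Lemma rphi_aut (f0 g0 : {poly int}) d (t : autC) P :
  rphi (pZ f0) (pZ g0) d (omap t P) = omap t (rphi (pZ f0) (pZ g0) d P).
Proof.
have hz (Q : {poly int}) y : (pZ Q).[t y] = t (pZ Q).[y] by rewrite aut_horner_pZ.
case: P => [y|] /=; first by rewrite !hz fmorph_eq0; case: eqP => //= _; rewrite fmorph_div.
by rewrite !coef_map /=; case: eqP => //= _; rewrite fmorph_div !rmorph_int.
Qed.

Lemma reval_Xn_pt d (u w : algC) : (0 < d)%N -> (u != 0) || (w != 0) ->
  reval ('X^d) 1 (pt u w) = pt (u ^+ d) (w ^+ d) /\ reval 1 ('X^d) (pt u w) = pt (w ^+ d) (u ^+ d).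
Proof.
move=> d0 nz; rewrite /pt; have [w0|w0] := eqVneq w 0.
  have u0 : u != 0 by move: nz; rewrite w0 eqxx orbF.
  rewrite w0 expr0n (gtn_eqF d0) /= eqxx size_polyXn size_poly1 mul0r expf_neq0 //.
  have -> : (1 < d.+1)%N = true by rewrite ltnS d0.
  have -> : (d.+1 < 1)%N = false by [].
  by have -> : (1 == d.+1)%N = false by case: (d) d0.
rewrite expf_neq0 //= hornerC oner_neq0 divr1 hornerXn expr_div_n; split=> //.
rewrite mulf_eq0 !invr_eq0 !expf_eq0 d0 (negPf w0) /= orbF.
by case: eqP => //= /eqP u0; rewrite mul1r invf_div.
Qed.

Section Power.
Variables (f g : {poly rat}) (al : rat) (c c' : algC).
Hypothesis H : hyps f g al.
Hypothesis cc : c != c'.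
Local Notation ph := (reval (polyQ f) (polyQ g)).
Hypothesis sw : (forall T, ph T = Some c <-> T = Some c) /\ (forall T, ph T = Some c' <-> T = Some c') \/
  (forall T, ph T = Some c <-> T = Some c') /\ (forall T, ph T = Some c' <-> T = Some c).

(** Automorphisms permute c and c', so c is rational or quadratic and both lie in the cyclotomic
    closure. In the coordinate (x - c)/(x - c') the map is A z^d or A z^(-d), and the Kummer
    argument shows that A becomes 1 after a scaling defined over that closure. *)
Lemma power_case_finite : special (polyQ f) (polyQ g).
Proof.
have [cop d2 nex ab] := H.
have [f0 [g0 [R [s [s0 Ef Eg rm]]]]] := rat_ratmap cop d2.
have phE T : ph T = rphi (pZ f0) (pZ g0) (rdeg f g) T by apply: (setup_reval H s0 Ef Eg).
have dP : rdeg (polyQ f) (polyQ g) = rdeg f g by rewrite /rdeg !size_map_poly.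
move: (rdeg f g) d2 rm phE dP => d d2 rm phE dP.
set F := pZ f0 in phE *; set G := pZ g0 in phE *; set ra := rphi F G d in phE *.
have TR := @totally_ramified _ algC_closed F G d _ _ (C_sF rm) (C_sG rm) d2 (C_cop rm) (C_top rm).
have d0 : (0 < d)%N by apply: ltnW.
have ramd (t : autC) x : x \in [:: c; c'] -> ram F G d (Some (t x)) = d.
  move=> xs; have [P HP] : exists P, forall T, ra T = P <-> T = Some x.
    by move: xs sw; rewrite !in_cons in_nil orbF => /orP[]/eqP -> [] [h1 h2]; [exists (Some c)|exists (Some c')|exists (Some c')|exists (Some c)] => T; rewrite -phE.
  have [] // := TR (omap t P) (t x) _; move=> T; have tK := algC_invautK t.
  have -> : T = omap t (omap (algC_invaut t) T) by case: T => //= y; rewrite tK.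
  rewrite rphi_aut -/ra -/F -/G; have inj : injective (omap t) by move=> [y|] [z|] //= [] /(fmorph_inj t) ->.
  have -> : Some (t x) = omap t (Some x) by [].
  by split=> [/inj /HP ->|/inj /HP ->].
have ramd1 x : x \in [:: c; c'] -> ram F G d (Some x) = d by apply: (ramd idfun).
(* A third totally ramified point would give 3(d - 1) > 2d - 2. *)
have orb (t : autC) x : x \in [:: c; c'] -> t x = c \/ t x = c'.
  move=> xs; apply: contrapT => /not_orP[/eqP n1 /eqP n2].
  have [W0 sW _] := wron_ord algC_closed (C_sF rm) (C_sG rm) d2 (C_cop rm) (C_top rm) (@C_chd d) None.
  have oW Q := let: And3 _ _ h := wron_ord algC_closed (C_sF rm) (C_sG rm) d2 (C_cop rm) (C_top rm) (@C_chd d) Q in h.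
  have := @sum_ord_le _ algC_closed _ _ [:: Some c; Some c'; Some (t x)] W0 sW.
  rewrite /= !in_cons !in_nil !orbF /= !negb_or.
  have e1 : Some c != Some c' by apply: contra cc => /eqP[->].
  have e2 : Some c != Some (t x) by apply: contra n1 => /eqP[->].
  have e3 : Some c' != Some (t x) by apply: contra n2 => /eqP[->].
  rewrite e1 e2 e3 => /(_ isT); rewrite !big_cons big_nil !oW ramd // !ramd1 ?mem_head ?in_cons ?eqxx ?orbT //.
  by move: d2; lia.
have cin : c \in [:: c; c'] by rewrite mem_head.
have cin' : c' \in [:: c; c'] by rewrite in_cons mem_head orbT.
have perm (t : autC) : (t c = c /\ t c' = c') \/ (t c = c' /\ t c' = c).
  have inj := @fmorph_inj _ _ t.
  case: (orb t _ cin) => h; case: (orb t _ cin') => h'; [|by left|by right|];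
    by move/eqP: cc; case; apply: inj; rewrite h h'.
have rat_of x : (forall t : autC, t x = x) -> exists q : rat, x = ratr q.
  by move=> h; apply/CratP; apply: aut_fixed_Crat.
have [m Em] : exists q : rat, c + c' = ratr q.
  by apply: rat_of => t; rewrite rmorphD; case: (perm t) => -[-> ->] //; rewrite addrC.
have [dl Edl] : exists q : rat, (c - c') ^+ 2 = ratr q.
  by apply: rat_of => t; rewrite rmorphXn rmorphB; case: (perm t) => -[-> ->] //; ring.
have [nn En] : exists q : rat, (ratr al - c) * (ratr al - c') = ratr q.
  by apply: rat_of => t; rewrite rmorphM !rmorphB fmorph_rat; case: (perm t) => -[-> ->] //; ring.
have Qd : in_Qc (c - c') := sqrt_rat_Qc Edl.
have h2 : (ratr 2^-1 : algC) * 2 = 1 by rewrite fmorphV rmorph_nat mulVf // pnatr_eq0.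
have Qcc : in_Qc c.
  have -> : c = ratr 2^-1 * (ratr m + (c - c')).
    by rewrite -Em -[LHS]mul1r -h2; ring.
  by apply: Qc_mul; [apply: Qc_rat|apply: Qc_add => //; apply: Qc_rat].
have Qcc' : in_Qc c'.
  have -> : c' = ratr m + - c by rewrite -Em; ring.
  by apply: Qc_add; [apply: Qc_rat|apply: Qc_opp].
have stab T : ph T = Some c \/ ph T = Some c' -> T = Some c \/ T = Some c'.
  by case: sw => -[h1 h2'] [/h1|/h2'] ->; [left|right|right|left].
have alc e : e \in [:: c; c'] -> ratr al != e.
  move=> es; apply/eqP => E; apply: nex; exists [:: c; c'] => x [n En'].
  have : iter n ph (Some x) = Some c \/ iter n ph (Some x) = Some c'.
    by rewrite En' E; move: es; rewrite !in_cons in_nil orbF => /orP[]/eqP ->; [left|right].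
  have itst k : iter k ph (Some x) = Some c \/ iter k ph (Some x) = Some c' -> Some x = Some c \/ Some x = Some c'.
    by elim: k => // k IH /stab.
  by move=> /itst [[->]|[->]].
have ac := alc _ cin; have ac' := alc _ cin'; rewrite -subr_eq0 in ac; rewrite -subr_eq0 in ac'.
pose y0 := (ratr al - c) / (ratr al - c'); have y00 : y0 != 0 by rewrite mulf_neq0 ?invr_eq0.
have Qy0 : in_Qc y0.
  have Qa : in_Qc (ratr al - c) by apply: Qc_add; [apply: Qc_rat|apply: Qc_opp].
  have -> : y0 = (ratr al - c) * (ratr al - c) * ratr nn^-1.
    have -> : ratr nn^-1 = ((ratr al - c) * (ratr al - c'))^-1 :> algC by rewrite En fmorphV.
    by rewrite /y0; field; rewrite ac ac'.
  by apply: Qc_mul; [apply: Qc_mul|apply: Qc_rat].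
(* The inverse of the coordinate z = (x - c)/(x - c'), precomposed with the scaling of z by l. *)
pose Ml l := mob (c' * l) (- c) l (- 1); pose Mx z := Ml 1 (Some z).
have cd : c' - c != 0 by rewrite subr_eq0 eq_sym.
have detl l : l != 0 -> c' * l * -1 - - c * l != 0.
  move=> l0; have -> : c' * l * -1 - - c * l = - ((c' - c) * l) by ring.
  by rewrite oppr_eq0 mulf_neq0.
have Mscale l u w : l != 0 -> (u != 0) || (w != 0) -> Ml l (pt u w) = Ml 1 (pt (l * u) w).
  move=> l0 nz; rewrite /Ml !mob_pt ?mulf_eq0 ?(negPf l0) //; congr pt; ring.
have MxE z : Mx z = pt (c' * z - c) (z - 1).
  rewrite /Mx /Ml; have -> : Some z = pt z 1 by rewrite /pt oner_neq0 divr1.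
  by rewrite mob_pt ?oner_neq0 ?orbT //; congr pt; ring.
have Mx0 : Mx y0 = Some (ratr al).
  rewrite MxE -(pt_scale _ _ ac') /y0.
  have -> : (ratr al - c') * (c' * ((ratr al - c) / (ratr al - c')) - c) = (c' - c) * ratr al by field.
  have -> : (ratr al - c') * ((ratr al - c) / (ratr al - c') - 1) = (c' - c) * 1 by field.
  by rewrite pt_scale // /pt oner_neq0 divr1.
have fixc' (t : autC) : t c = c -> t c' = c'.
  by case: (perm t) => -[-> //] h E; move: cc; rewrite -{1}E eqxx.
have fixy0 (t : autC) : t c = c -> t y0 = y0.
  by move=> tc; rewrite /y0 fmorph_div !rmorphB tc (fixc' _ tc) !fmorph_rat.
(* The second iterate is used because its exponent d^2 is positive for both signs of d. *)
have tower A2 D : (2 <= D)%N -> A2 != 0 -> (forall z, z != 0 -> ph (ph (Mx z)) = Mx (A2 * z ^+ D)) ->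
    (forall t : autC, t c = c -> t A2 = A2) -> exists N, (0 < N)%N /\ (y0 ^+ D.-1 * A2) ^+ N = 1.
  move=> D2 A20 step fixA; pose y n := iter n (fun z => D.-root (z / A2)) y0.
  have Ey n : A2 * y n.+1 ^+ D = y n by rewrite /y /= rootCK ?(ltnW D2) // mulrCA mulfV // mulr1.
  have yn0 n : y n != 0.
    elim: n => [|n IH]; first by rewrite /y.
    by apply: contraNneq IH => z; rewrite -Ey z expr0n (gtn_eqF (ltnW D2)) mulr0.
  have back n : iter (n + n) ph (Mx (y n)) = Some (ratr al).
    by elim: n => [|n IH]; [exact: Mx0|rewrite addSn addnS !iterSr step // Ey].
  apply: (@kummer_tower c y0 A2 D y) => //.
  - by move=> t tc; split; [apply: fixA|apply: fixy0].
  - by move=> t; case: (perm t) => -[e1 e2]; rewrite !(e1, e2).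
  - move=> t1 t2 e1 e2 n; have [z1|z1] := eqVneq (y n) 1; first by rewrite z1 !rmorph1.
    rewrite -subr_eq0 in z1; pose x := (c' * y n - c) / (y n - 1).
    have Mxx : Mx (y n) = Some x by rewrite MxE /pt z1.
    have bx : backward_orbit (polyQ f) (polyQ g) (ratr al) x by exists (n + n)%N; rewrite -Mxx.
    have xc' : x - c' != 0.
      have -> : x - c' = (c' - c) / (y n - 1) by rewrite /x; field.
      by rewrite mulf_neq0 // invr_eq0.
    have Eyn : y n = (x - c) / (x - c').
      apply: (mulIf xc'); rewrite divfK // /x; field.
      exact: z1.
    rewrite Eyn; clearbody x.
    by rewrite !(fmorph_div, rmorphB) !(e1, e2, fixc' _ e1, fixc' _ e2) (ab t1 t2 _ bx).
have hvF x T u w : hP F G (Some x) = T -> hv d F u w - x * hv d G u w = hv d T u w.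
  by move=> <-; rewrite /= hvB hvZ.
have phpt u w : (u != 0) || (w != 0) -> ph (pt u w) = pt (hv d F u w) (hv d G u w).
  by move=> nz; rewrite phE /ra rphi_pt //; [apply: (C_sF rm)|apply: (C_sG rm)].
have coefd (t : autC) (x a e : algC) : t x = x -> hP F G (Some x) = a *: ('X - e%:P) ^+ d -> t a = a.
  move=> tx E; have := congr1 (fun q : {poly algC} => q`_d) E; rewrite /= coefB !coefZ.
  have -> : (('X - e%:P) ^+ d)`_d = 1.
    by have /monicP := monic_exp d (monicXsubC e); rewrite /lead_coef size_exp_XsubC.
  by rewrite mulr1 => <-; rewrite rmorphB rmorphM /= tx !coef_map /= !rmorph_int.
have QcM l : in_Qc l -> [/\ in_Qc (c' * l), in_Qc (- c), in_Qc l & in_Qc (- 1)].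
  by move=> ql; split=> //; [apply: Qc_mul|apply: Qc_opp|apply: Qc_opp; apply: Qc_1].
have root_Qc k (z : algC) N : (0 < k)%N -> (0 < N)%N -> z ^+ N = 1 -> in_Qc (k.-root z^-1).
  move=> k0 N0 zN; apply: (@Qc_root (k * N).-1); rewrite prednK ?muln_gt0 ?k0 // exprM rootCK // exprVn zN invr1.
  by [].
have conjM l F' G' : l != 0 -> in_Qc l ->
    (forall u w, (u != 0) || (w != 0) -> ph (Ml l (pt u w)) = Ml l (reval F' G' (pt u w))) ->
    Qc_conjugate (polyQ f) (polyQ g) F' G'.
  move=> l0 ql E; have [q1 q2 q3 q4] := QcM l ql; exists (c' * l), (- c), l, (- 1); split=> //; split; first exact: detl.
  by move=> P; rewrite !mob_reval ?detl //; have [u [w [nz ->]]] := ptP P; apply: E.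
have nzM l u w : l != 0 -> (u != 0) || (w != 0) -> (c' * l * u + - c * w != 0) || (l * u + - 1 * w != 0).
  by move=> l0; apply: det_nz; apply: detl.
have nzd (u w : algC) : (u != 0) || (w != 0) -> (u ^+ d != 0) || (w ^+ d != 0).
  by case/orP => h; rewrite (expf_neq0 d h) ?orbT.
have SP z : Some z = pt z 1 :> option algC by rewrite /pt oner_neq0 divr1.
have nz1 (z : algC) : (z != 0) || ((1 : algC) != 0) by rewrite oner_neq0 orbT.
have X1 l u w : c' * l * u + - c * w - c * (l * u + - 1 * w) = (c' - c) * (l * u) by ring.
have X2 l u w : c' * l * u + - c * w - c' * (l * u + - 1 * w) = (c' - c) * w by ring.
have d1 : (0 < d.-1)%N by move: d2; lia.
have dS (x : algC) : x ^+ d = x ^+ d.-1 * x :> algC by rewrite -exprSr prednK.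
have dd : (d * d).-1 = (d.-1 * d.+1)%N by move: d2; lia.
have dd2 : (2 <= d * d)%N by move: d2; nia.
case: sw => -[h1 h2'].
- have [|_ [a a0 Ea]] := TR (Some c) c; first by move=> T; rewrite -[rphi _ _ _ _]phE; apply: h1.
  have [|_ [b b0 Eb]] := TR (Some c') c'; first by move=> T; rewrite -[rphi _ _ _ _]phE; apply: h2'.
  pose A := a / b; have A0 : A != 0 by rewrite mulf_neq0 ?invr_eq0.
  have Ab : a = b * A by rewrite /A mulrC divfK.
  have step l l' u w : l != 0 -> (u != 0) || (w != 0) -> a * l ^+ d = b * l' -> ph (Ml l (pt u w)) = Ml l' (pt (u ^+ d) (w ^+ d)).
    move=> l0 nz E; rewrite /Ml mob_pt // phpt ?nzM //; apply: (pt_pencil (k := b * (c' - c) ^+ d)) => //.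
    + by rewrite mulf_neq0 ?expf_neq0.
    + rewrite (hvF _ _ _ _ Ea) hvZ hv_XsubC_exp X1 !exprMn.
      transitivity ((a * l ^+ d) * ((c' - c) ^+ d * u ^+ d)); first by ring.
      by rewrite E; ring.
    + by rewrite (hvF _ _ _ _ Eb) hvZ hv_XsubC_exp X2 !exprMn mulrA.
    + exact: nzd.
  have stepx z : ph (Mx z) = Mx (A * z ^+ d).
    rewrite /Mx SP (step 1 A) ?oner_neq0 ?orbT //; last by rewrite expr1n mulr1.
    by rewrite expr1n Mscale ?oner_neq0 ?orbT // -SP.
  have [||||N [N0 EN]] := tower (A ^+ d.+1) (d * d)%N => //; first by rewrite expf_neq0.
    by move=> z z0; rewrite !stepx exprMn -exprM mulrA -exprS.
    by move=> t tc; rewrite rmorphXn fmorph_div /= (coefd t _ _ _ tc Ea) (coefd t _ _ _ (fixc' t tc) Eb).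
  pose z := y0 ^+ d.-1 * A; have zN : z ^+ (d.+1 * N) = 1 by rewrite exprM exprMn -exprM -dd.
  have z0 : z != 0 by rewrite mulf_neq0 ?expf_neq0.
  (* The equation l^(d-1) A = 1 is what conjugates A z^d to z^d; l is y0 times a root of unity. *)
  pose l := y0 * d.-1.-root z^-1.
  have lA : l ^+ d.-1 * A = 1.
    by rewrite /l exprMn rootCK // mulrAC -/z mulfV.
  have l0 : l != 0 by apply: contra_eq_neq lA => ->; rewrite expr0n (gtn_eqF d1) mul0r eq_sym oner_neq0.
  apply: Or41; rewrite dP; apply: (conjM l) => //.
    by apply: Qc_mul => //; apply: (root_Qc _ _ (d.+1 * N)%N) => //; rewrite muln_gt0.
  move=> u w nz; rewrite (proj1 (reval_Xn_pt d0 nz)); apply: step => //.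
  rewrite dS; transitivity (b * (l ^+ d.-1 * A) * l); last by rewrite lA mulr1.
  by rewrite {1}Ab; move: (l ^+ d.-1) => q; ring.
- have [|_ [a a0 Ea]] := TR (Some c) c'; first by move=> T; rewrite -[rphi _ _ _ _]phE; apply: h1.
  have [|_ [b b0 Eb]] := TR (Some c') c; first by move=> T; rewrite -[rphi _ _ _ _]phE; apply: h2'.
  pose A := a / b; have A0 : A != 0 by rewrite mulf_neq0 ?invr_eq0.
  have Ab : a = b * A by rewrite /A mulrC divfK.
  have step l l' u w : l != 0 -> (u != 0) || (w != 0) -> a = b * l ^+ d * l' -> ph (Ml l (pt u w)) = Ml l' (pt (w ^+ d) (u ^+ d)).
    move=> l0 nz E; rewrite /Ml mob_pt // phpt ?nzM //; apply: (pt_pencil (k := b * (c' - c) ^+ d * l ^+ d)) => //.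
    + by rewrite !mulf_neq0 ?expf_neq0.
    + by rewrite (hvF _ _ _ _ Ea) hvZ hv_XsubC_exp X2 !exprMn {1}E; ring.
    + by rewrite (hvF _ _ _ _ Eb) hvZ hv_XsubC_exp X1 !exprMn; ring.
    + by rewrite orbC; apply: nzd.
  have stepx z : z != 0 -> ph (Mx z) = Mx (A / z ^+ d).
    move=> z0; have zd := expf_neq0 d z0; rewrite /Mx SP (step 1 A) ?oner_neq0 ?orbT //; last by rewrite expr1n mulr1.
    rewrite expr1n Mscale ?oner_neq0 // mulr1; congr (Ml _ _).
    by rewrite /pt zd.
  have [||||N [N0 EN]] := tower (A ^+ d.-1)^-1 (d * d)%N => //; first by rewrite invr_eq0 expf_neq0.
    move=> z z0; rewrite !stepx ?mulf_neq0 ?invr_eq0 ?expf_neq0 //; congr (Mx _).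
    rewrite expr_div_n -exprM [A ^+ d]dS; have := expf_neq0 d.-1 A0; have := expf_neq0 (d * d) z0.
    move: (A ^+ d.-1) (z ^+ (d * d)) => q r q0 r0; by field; rewrite q0 r0 A0.
    by move=> t tc; rewrite fmorphV rmorphXn fmorph_div /= (coefd t _ _ _ tc Ea) (coefd t _ _ _ (fixc' t tc) Eb).
  pose z := y0 ^+ d.+1 / A; have zN : z ^+ (d.-1 * N) = 1.
    by rewrite exprM expr_div_n -exprM [(d.+1 * _)%N]mulnC -dd.
  have z0 : z != 0 by rewrite mulf_neq0 ?invr_eq0 ?expf_neq0.
  (* For A z^(-d) the scaling equation is l^(d+1) = A. *)
  pose l := y0 * d.+1.-root z^-1.
  have lA : l ^+ d.+1 = A.
    rewrite /l exprMn rootCK // /z invf_div; have := expf_neq0 d.+1 y00; move: (y0 ^+ d.+1) => q q0.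
    by field.
  have l0 : l != 0 by apply: contra_eq_neq lA => ->; rewrite expr0n /= eq_sym.
  apply: Or42; rewrite dP; apply: (conjM l) => //.
    by apply: Qc_mul => //; apply: (root_Qc _ _ (d.-1 * N)%N) => //; rewrite muln_gt0 d1.
  move=> u w nz; rewrite (proj2 (reval_Xn_pt d0 nz)); apply: step => //.
  by rewrite Ab -lA exprSr mulrA.
Qed.
End Power.

(** An integer different from alpha and from the two points is moved to infinity, so that all three
    are finite. *)
Lemma power_case (f g : {poly rat}) al (Q Q' : option algC) : hyps f g al -> Q <> Q' ->
  let ph := reval (polyQ f) (polyQ g) in
  (forall T, ph T = Q <-> T = Q) /\ (forall T, ph T = Q' <-> T = Q') \/
  (forall T, ph T = Q <-> T = Q') /\ (forall T, ph T = Q' <-> T = Q) -> special (polyQ f) (polyQ g).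
Proof.
move=> H ne ph sw; have [cop d2 _ _] := H.
have [r nr] := fresh_nat (ratr al :: pmap id [:: Q; Q']).
have := nr; rewrite in_cons negb_or => /andP[ra rQ].
have det : (r%:R : rat) * 0 - 1 * 1 != 0 by rewrite mulr0 mulr1 sub0r oppr_eq0 oner_neq0.
have [f' [g' [cop' dE C]]] := conj_transport cop d2 det.
pose M := mob (ratr r%:R : algC) (ratr 1) (ratr 1) (ratr 0).
have [D CC] := C.
have M' P : exists S, M S = P by exists (mob (ratr 0 : algC) (- ratr 1) (- ratr 1) (ratr r%:R) P); apply: mobK'.
have Minj : injective M by move=> P S E; rewrite -(mobK P D) -(mobK S D) -/M E.
have Mph T : ph (M T) = M (reval (polyQ f') (polyQ g') T) by have := CC T; rewrite !mob_reval.
have MN : M None = Some r%:R.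
  rewrite /M /mob /rphi /mobN !coefD !coefZ coefX !coefC /= rmorph1 rmorph_nat !mulr1 !addr0 oner_neq0 divr1.
  by [].
have fin P : P \in [:: Q; Q'] -> exists x, M (Some x) = P.
  move=> Ps; have [[x|] E] := M' P; first by exists x.
  move: rQ; rewrite mem_pmap map_id; rewrite MN in E; rewrite E Ps.
  by [].
have [c Ec] := fin Q (mem_head _ _); have [c' Ec'] := fin Q' ltac:(by rewrite in_cons mem_head orbT).
have alr : (al - r%:R) != 0.
  by rewrite subr_eq0; apply: contra ra => /eqP ->; rewrite rmorph_nat.
have H' : hyps f' g' (al - r%:R)^-1.
  apply: (hyps_conj H cop' dE C).
  rewrite /mob /rphi /mobN !hornerD !hornerZ hornerX !hornerC rmorph1 rmorph0 mul1r addr0 fmorph_eq0 invr_eq0 alr; congr Some.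
  have alC : ratr al - r%:R != 0 :> algC by rewrite -(rmorph_nat (@ratr algC)) -rmorphB fmorph_eq0.
  by rewrite rmorph_nat fmorphV rmorphB /= rmorph_nat; field.
have cc : c != c' by apply/eqP => E; apply: ne; rewrite -Ec E Ec'.
apply: (special_conj dE C); apply: (power_case_finite H' cc).
have tr x y P P' : M (Some x) = P -> M (Some y) = P' -> (forall T, ph T = P <-> T = P') ->
    forall T, reval (polyQ f') (polyQ g') T = Some x <-> T = Some y.
  move=> <- <- h T; split=> [E|->].
    by apply: Minj; apply/h; rewrite Mph E.
  by apply: Minj; rewrite -Mph; apply/h.
by case: sw => -[h1 h2]; [left|right]; split; apply: tr; eauto.
Qed.

(** * Quadratic maps *)

Lemma prime_3mod4_factor n : (n %% 4 = 3)%N -> exists p, [/\ prime p, (p %| n)%N & (p %% 4 = 3)%N].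
Proof.
have [m] := ubnP n; elim: m n => // m IH n lt E.
have n1 : (1 < n)%N by move: E; case: n {lt} => [|[|n]].
have pp := pdiv_prime n1; have dv := pdiv_dvd n; set q := pdiv n in pp dv.
have En : n = (n %/ q * q)%N by rewrite divnK.
have p1 := prime_gt1 pp; have nq : (0 < n %/ q)%N by rewrite divn_gt0 ?prime_gt0 // dvdn_leq // ltnW.
have [q3|q3] := eqVneq (q %% 4)%N 3%N; first by exists q.
have Em : (((n %/ q) %% 4 * (q %% 4)) %% 4 = 3)%N by rewrite modnMm -En.
have h3 : ((n %/ q) %% 4 = 3)%N.
  have l1 : ((n %/ q) %% 4 < 4)%N by rewrite ltn_mod.
  have l2 : (q %% 4 < 4)%N by rewrite ltn_mod.
  move: Em q3 l1 l2; move: ((n %/ q) %% 4)%N (q %% 4)%N => x y.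
  by case: x => [|[|[|[|x]]]] //; case: y => [|[|[|[|y]]]].
have ltq : (n %/ q < m)%N.
  by apply: leq_trans (_ : n <= m)%N; [rewrite ltn_Pdiv // ltnW|rewrite -ltnS].
have [p [pr pd p3]] := IH _ ltq h3; exists p; split=> //; rewrite En; exact: dvdn_mulr.
Qed.

(** With x even and divisible by all primes up to N, the number k x^2 - 1 is 3 modulo 4 and prime to
    them, so it has a prime factor p = 3 mod 4 beyond N; modulo p, k is then a square. *)
Lemma prime_3mod4_square k N : (0 < k)%N -> exists p x, [/\ prime p, (N < p)%N, (p %% 4 = 3)%N, ~~ (p %| x)%N &
  (p %| k * (x * x) - 1)%N].
Proof.
move=> k0; pose x := (2 * N`!)%N; pose n := (k * (x * x) - 1)%N.
have f0 := fact_gt0 N.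
have n3 : (n %% 4 = 3)%N.
  have -> : n = ((k * (N`! * N`!) - 1) * 4 + 3)%N.
    have : (0 < k * (N`! * N`!))%N by rewrite !muln_gt0 k0 f0.
    rewrite /n /x; have -> : (k * (2 * N`! * (2 * N`!)) = k * (N`! * N`!) * 4)%N by ring.
    by move: (k * _)%N => y; lia.
  by rewrite modnMDl.
have [p [pp pd p3]] := prime_3mod4_factor n3; exists p, x; split=> //.
  rewrite ltnNge; apply/negP => le; have : (p %| x)%N by apply: dvdn_mull; apply: dvdn_fact; rewrite le prime_gt0.
  move=> px; have : (p %| 1)%N; last by rewrite dvdn1 => /eqP p1; move: pp; rewrite p1.
  have kx : (1 <= k * (x * x))%N by rewrite !muln_gt0 k0 f0.
  by rewrite -(dvdn_addr _ pd) subnK // dvdn_mull // dvdn_mull.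
apply/negP => px; have : (p %| 1)%N; last by rewrite dvdn1 => /eqP p1; move: pp; rewrite p1.
have kx : (1 <= k * (x * x))%N by rewrite !muln_gt0 k0 f0.
by rewrite -(dvdn_addr _ pd) subnK // dvdn_mull // dvdn_mull.
Qed.

(** Certificates for [ring]: the conclusion is an explicit combination of the hypotheses. *)
Lemma lin1 (K : comNzRingType) (k L R A B : K) : L = R -> A - B = k * (L - R) -> A = B.
Proof. by move=> -> /eqP; rewrite subrr mulr0 subr_eq0 => /eqP. Qed.
Lemma lin3 (K : comNzRingType) (k1 k2 k3 L1 R1 L2 R2 L3 R3 A B : K) : L1 = R1 -> L2 = R2 -> L3 = R3 ->
  A - B = k1 * (L1 - R1) + k2 * (L2 - R2) + k3 * (L3 - R3) -> A = B.
Proof. by move=> -> -> -> /eqP; rewrite !subrr !mulr0 !addr0 subr_eq0 => /eqP. Qed.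

Section Pencil.
Variable K : fieldType.
Hypothesis Kinf : forall s : seq K, exists x, x \notin s.
Hypothesis ch2 : (2 : K) != 0.
Variables (al be v1 v2 a b c : K).
Hypotheses (al0 : al != 0) (be0 : be != 0).
Hypothesis un : uniq [:: v1; v2; a; b].
(** The quadratics al (x-r)(x-s) and be (x-r')(x-s') stand for f - a g and f - b g. Up to powers of
    b - a, the left factors are f - v1 g and f - v2 g and the square is that of the Wronskian: the
    fibres over v1 and v2 are double. *)
Definition pencil_rel r s r' s' := forall x : K,
  al * be * ((v1 - a) * (be * (x - r') * (x - s')) - (v1 - b) * (al * (x - r) * (x - s))) *
   ((v2 - a) * (be * (x - r') * (x - s')) - (v2 - b) * (al * (x - r) * (x - s))) =
  c * (al * (2 * x - r - s) * (be * (x - r') * (x - s')) - al * (x - r) * (x - s) * (be * (2 * x - r' - s'))) ^+ 2.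

(** Evaluation at r, at r' and at a general point isolates the coefficients of the two squares and
    of the product of the quadratics. *)
Lemma pencil_eqs r s r' s' : r != r' -> r != s' -> s != r' -> pencil_rel r s r' s' ->
  [/\ be * ((v1 - a) * (v2 - a)) = c * al * (r - s) ^+ 2, al * ((v1 - b) * (v2 - b)) = c * be * (r' - s') ^+ 2 &
   (v1 - a) * (v2 - b) + (v1 - b) * (v2 - a) = 2 * c * ((r + s) * (r' + s') - 2 * r * s - 2 * r' * s')].
Proof.
move=> n1 n2 n3 rel.
have E1 : be * ((v1 - a) * (v2 - a)) = c * al * (r - s) ^+ 2.
  have q0 : al * (be * (r - r') * (r - s')) ^+ 2 != 0 by rewrite !mulf_neq0 ?expf_neq0 ?mulf_neq0 ?subr_eq0.
  by apply: (mulfI q0); apply: (lin1 (k := 1) (rel r)); ring.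
have E2 : al * ((v1 - b) * (v2 - b)) = c * be * (r' - s') ^+ 2.
  have q0 : be * (al * (r' - r) * (r' - s)) ^+ 2 != 0.
    by rewrite !mulf_neq0 ?expf_neq0 ?mulf_neq0 ?subr_eq0 // eq_sym.
  by apply: (mulfI q0); apply: (lin1 (k := 1) (rel r')); ring.
split=> //; have [x] := Kinf [:: r; s; r'; s'].
rewrite !in_cons in_nil orbF !negb_or => /and4P[x1 x2 x3 x4].
have q0 : al * be * (be * (x - r') * (x - s')) * (al * (x - r) * (x - s)) != 0 by rewrite !mulf_neq0 ?subr_eq0.
by apply: (mulfI q0); apply: (lin3 (k1 := - 1) (k2 := al * (be * (x - r') * (x - s')) ^+ 2) (k3 := be * (al * (x - r) * (x - s)) ^+ 2) (rel x) E1 E2); ring.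
Qed.

Let dist : [/\ v1 != v2, v1 != a, v1 != b, v2 != a & v2 != b] /\ a != b.
Proof.
by move: un; rewrite /= !in_cons !in_nil !orbF !negb_or => /and4P[/and3P[-> -> ->] /andP[-> ->] -> _].
Qed.

(** Here the fibre over a is {v1, v2} and the fibre over b is {a, b}. The third equation factors as
    (X + Y)(2c + 1) = 0; if X + Y = 0, the product of the first two gives 4c^2 + 1 = 0. *)
Lemma pencil_A : pencil_rel v1 v2 a b -> 2 * c + 1 = 0 \/ 4 * c ^+ 2 + 1 = 0.
Proof.
have [[d12 d1a d1b d2a d2b] dab] := dist => rel.
have [E1 E2 E3] := pencil_eqs d1a d1b d2a rel.
pose X := (v1 - a) * (v2 - b); pose Y := (v1 - b) * (v2 - a).
have X0 : X != 0 by rewrite mulf_neq0 ?subr_eq0.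
have : (X + Y) * (2 * c + 1) == 0 by apply/eqP; apply: (lin1 (k := 1) E3); rewrite /X /Y; ring.
rewrite mulf_eq0 => /orP[/eqP XY|/eqP]; [right|by left].
have YE : Y = - X by apply/eqP; rewrite -addr_eq0 addrC XY.
have D : (v1 - v2) * (a - b) = X + X by rewrite -{2}[X]opprK -YE /X /Y; ring.
have M : al * be * (X * Y) = al * be * (c ^+ 2 * ((v1 - v2) * (a - b)) ^+ 2).
  transitivity ((be * ((v1 - a) * (v2 - a))) * (al * ((v1 - b) * (v2 - b)))); first by rewrite /X /Y; ring.
  by rewrite E1 E2; ring.
have {}M := mulfI (mulf_neq0 al0 be0) M.
rewrite D YE in M; apply: (mulfI (mulf_neq0 X0 X0)); rewrite mulr0.
transitivity (c ^+ 2 * (X + X) ^+ 2 - X * - X); first by ring.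
by rewrite -M subrr.
Qed.

(** The root c = 1 would give X = Y, that is, coincident points; the remaining quadratic has
    discriminant -7. *)
Let cubic (X Y : K) : X != 0 -> X != Y -> Y = c ^+ 2 * X -> X + Y = 2 * c * (2 * Y - X) -> 4 * c ^+ 2 + 3 * c + 1 = 0.
Proof.
move=> X0 XY EY E; have : X * ((c - 1) * (4 * c ^+ 2 + 3 * c + 1)) == 0.
  by apply/eqP; rewrite EY in E; apply: (lin1 (k := - 1) E); ring.
rewrite mulf_eq0 (negPf X0) /= mulf_eq0 subr_eq0 => /orP[/eqP c1|/eqP //].
by move: XY; rewrite EY c1 expr1n mul1r eqxx.
Qed.

Lemma pencil_C : pencil_rel v1 a v2 b -> 4 * c ^+ 2 + 3 * c + 1 = 0.
Proof.
have [[d12 d1a d1b d2a d2b] dab] := dist => rel.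
have [|E1 E2 E3] := pencil_eqs d12 d1b _ rel; first by rewrite eq_sym.
pose X := (v1 - a) * (v2 - b); pose Y := (v1 - b) * (v2 - a).
have X0 : X != 0 by rewrite mulf_neq0 ?subr_eq0.
apply: (cubic X0 (Y := Y)).
- rewrite -subr_eq0; have -> : X - Y = (v1 - v2) * (a - b) by rewrite /X /Y; ring.
  by rewrite mulf_neq0 ?subr_eq0.
- apply: (mulfI X0); apply: (mulfI (mulf_neq0 al0 be0)).
  transitivity ((be * ((v1 - a) * (v2 - a))) * (al * ((v1 - b) * (v2 - b)))); first by rewrite /X /Y; ring.
  by rewrite E1 E2 /X; ring.
- by rewrite /X /Y E3; ring.
Qed.

Lemma pencil_D : pencil_rel v1 b v2 a -> 4 * c ^+ 2 + 3 * c + 1 = 0.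
Proof.
have [[d12 d1a d1b d2a d2b] dab] := dist => rel.
have [|E1 E2 E3] := pencil_eqs d12 d1a _ rel; first by rewrite eq_sym.
pose X := (v1 - a) * (v2 - b); pose Y := (v1 - b) * (v2 - a).
have Y0 : Y != 0 by rewrite mulf_neq0 ?subr_eq0.
apply: (cubic Y0 (Y := X)).
- rewrite -subr_eq0; have -> : Y - X = (v1 - v2) * (b - a) by rewrite /X /Y; ring.
  by rewrite mulf_neq0 ?subr_eq0 // eq_sym.
- apply: (mulfI Y0); apply: (mulfI (mulf_neq0 al0 be0)).
  transitivity ((be * ((v1 - a) * (v2 - a))) * (al * ((v1 - b) * (v2 - b)))); first by rewrite /X /Y; ring.
  by rewrite E1 E2 /Y; ring.
- by rewrite addrC /X /Y E3; ring.
Qed.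
End Pencil.

Lemma orbi_mdiv (K : fieldType) (F G : {poly K}) d p (U a : {poly K}) N' : alg_closed K ->
  (size F <= d.+1)%N -> (size G <= d.+1)%N -> (2 <= d)%N -> (forall x, F.[x] = 0 -> G.[x] = 0 -> False) ->
  (F`_d = 0 -> G`_d = 0 -> False) -> (forall e, (0 < e)%N -> (e <= d)%N -> e%:R != 0 :> K) -> (1 < p)%N ->
  U != 0 -> a != 0 -> (size U <= (p * N' + 2 * p.-1).+1)%N -> (size a <= N'.+1)%N ->
  homp F G (p * N' + 2 * p.-1) U * a ^+ p = wron F G ^+ p.-1 * U * homp F G N' a ^+ p ->
  orbi F G d p (mdiv p U a N').
Proof.
move=> cl sF sG d2 cop top chd p1 U0 a0 sU sa inv; split.
- exact: (mdiv_pull cl sF sG d2 cop top chd p1 U0 a0 sU sa inv).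
- by move=> Q; have [] := mdiv_bounds cl sF sG d2 cop top chd p1 U0 a0 sU sa inv Q.
- by move=> Q; have [] := mdiv_bounds cl sF sG d2 cop top chd p1 U0 a0 sU sa inv Q.
- exact: (mdiv_sum_le cl sF sG d2 cop top chd p1 U0 a0 sU sa inv).
- exact: (mdiv_finite cl sF sG d2 p1 U0 a0 sU sa).
Qed.

Section Quad.
Variable K : fieldType.
Hypothesis Kc : alg_closed K.
Variables (F G : {poly K}) (p : nat).
Hypotheses (sF : (size F <= 3)%N) (sG : (size G <= 3)%N).
Hypothesis cop : forall x, F.[x] = 0 -> G.[x] = 0 -> False.
Hypothesis top : F`_2 = 0 -> G`_2 = 0 -> False.
Hypothesis chd : forall e, (0 < e)%N -> (e <= 2)%N -> e%:R != 0 :> K.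
Hypotheses (chp : p \in [pchar K]) (p3 : (p %% 4 = 3)%N).
Local Notation ph := (rphi F G 2).
Local Notation rm := (ram F G 2).
Let d2 : (2 <= 2)%N := isT.
Let r12 Q : rm Q = 1%N \/ rm Q = 2%N.
Proof.
have := ram_gt0 Kc sF sG d2 cop top Q; have := ram_le Kc sF sG d2 cop top Q.
by move: (rm Q) => [|[|[|n]]] // _ _; [left|right].
Qed.
Let pj : exists j, p = (4 * j + 3)%N.
Proof. by exists (p %/ 4)%N; rewrite {1}(divn_eq p 4) p3 mulnC. Qed.

Lemma crit_fiber Q T : rm Q = 2%N -> ph T = ph Q -> T = Q.
Proof.
move=> rQ E; have [rs [srs C]] := fiber Kc sF sG d2 cop top (ph Q).
have : all (pred1 Q) rs by rewrite all_count C eqxx rQ srs.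
move/allP => /(_ T) h; apply/eqP/h; rewrite -has_pred1 has_count C E eqxx.
exact: (ram_gt0 Kc sF sG d2 cop top).
Qed.

Variables (m : option K -> int) (c1 c2 : option K).
Hypothesis om : orbi F G 2 p m.
Hypotheses (c12 : c1 != c2) (rc1 : rm c1 = 2%N) (rc2 : rm c2 = 2%N).
Hypotheses (np1 : ph (ph c1) != c1) (np2 : ph (ph c2) != c2).
Local Notation v1 := (ph c1).
Local Notation v2 := (ph c2).
Let h := p.-1./2.

Lemma crit_only Q : rm Q = 2%N -> Q = c1 \/ Q = c2.
Proof.
move=> rQ; apply: contrapT => /not_orP[/eqP n1 /eqP n2].
have [W0 sW _] := wron_ord Kc sF sG d2 cop top chd None.
have oW T := let: And3 _ _ h := wron_ord Kc sF sG d2 cop top chd T in h.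
have := @sum_ord_le _ Kc _ _ [:: c1; c2; Q] W0 sW.
rewrite /= !in_cons !in_nil !orbF !negb_or c12 [c1 == Q]eq_sym n1 [c2 == Q]eq_sym n2 => /(_ isT).
by rewrite !big_cons big_nil !oW rQ rc1 rc2.
Qed.

Let v12 : v1 != v2.
Proof. by apply: contra c12 => /eqP E; apply/eqP; apply: crit_fiber. Qed.

(** If m vanished at a critical point, three distinct points of its orbit would have m = 0, too many
    for the sum. Otherwise the zeros of m form a backward closed unramified set. *)
Let m_pos Q : m Q <> 0.
Proof.
move=> z0; have [pull bd dv sumL [L [uL offL _]]] := om; have [j Ej] := pj.
pose Z := [seq T <- L | m T == 0].
have inZ T : (T \in Z) = (m T == 0).
  rewrite mem_filter; case: eqP => //= e; apply/negPn/negP => /offL; rewrite e; lia.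
have crit T : rm T = 2%N -> m T <> 0.
  move=> rT mT; have npT : ph (ph T) != T by case: (crit_only rT) => ->.
  have m1 : m (ph T) = 0 by have := pull T; rewrite rT mT; lia.
  have m2 : m (ph (ph T)) = 0.
    by have := pull (ph T); rewrite m1; case: (r12 (ph T)) => ->; lia.
  have n1 : ph T != T by apply: contra npT => /eqP e; rewrite {1}e e.
  have n2 : ph (ph T) != ph T by apply: contra n1 => /eqP e; apply/eqP; apply: crit_fiber.
  have := sumL [:: T; ph T; ph (ph T)].
  rewrite /= !in_cons !in_nil !orbF !negb_or eq_sym n1 [T == _]eq_sym npT [ph T == _]eq_sym n2 => /(_ isT).
  by rewrite !big_cons big_nil mT m1 m2; lia.
apply: (no_unramified_cycle Kc sF sG d2 cop top (S := Z)).
- exact: filter_uniq.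
- by rewrite -has_predT; apply/hasP; exists Q => //; rewrite inZ z0.
- move=> T; rewrite !inZ => /eqP e; have := pull T; rewrite e mulr0 => mT; rewrite mT eqxx; split=> //.
  by case: (r12 T) => // rT; case: (crit T rT).
Qed.

(** Going back from a point with m even and different from p - 1 never meets a critical point, since
    there 4 would divide p - 1. Such points would form a backward closed unramified set. *)
Let m_even Q k : m Q = 2 * k -> m Q = p.-1%:Z.
Proof.
move=> Ek; have [pull bd dv sumL [L [uL offL _]]] := om; have [j Ej] := pj.
apply: contrapT => ne; pose S := [seq T <- L | (m T != p.-1%:Z) && (2 %| m T)%Z].
have inS T : (T \in S) = (m T != p.-1%:Z) && (2 %| m T)%Z.
  rewrite mem_filter; case: eqP => //= e; case: (2 %| m T)%Z => //=.
  by apply/negPn/negP => /offL.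
apply: (no_unramified_cycle Kc sF sG d2 cop top (S := S)).
- exact: filter_uniq.
- rewrite -has_predT; apply/hasP; exists Q => //; rewrite inS; apply/andP; split; first exact/eqP.
  by rewrite Ek dvdz_mulr.
- move=> T; rewrite !inS => /andP[nT /dvdzP[l El]]; have := pull T; case: (r12 T) => rT; rewrite rT => mT.
    by rewrite mT mul1r nT El dvdz_mull.
  have [z|/dvdzP[t Et]] := dv T; first by case: (m_pos z).
  have E4 : p.-1%:Z = 4 * (t * l) by rewrite Et mT El; ring.
  by move: (t * l) E4 => y; lia.
Qed.

Let hE : p.-1 = (2 * h)%N /\ odd h.
Proof.
have [j Ej] := pj; have e : p.-1 = (2 * j).+1.*2 by rewrite Ej -muln2; lia.
by rewrite /h e doubleK -mul2n /= oddM.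
Qed.

Let m_c c : rm c = 2%N -> m c = p.-1%:Z /\ m (ph c) = h%:Z.
Proof.
move=> rc; have [pull _ _ _ _] := om; have [e _] := hE; have := pull c; rewrite rc => E.
by have E' := m_even E; split=> //; lia.
Qed.

(** Critical points have even m, hence m = p - 1, so critical values have m = h. These use half of
    the total; every other point with m < p - 1 satisfies h <= p - 1 - m < 2h, and these differences
    add up to 2h, so there are exactly two: the signature is (2,2,2,2). *)
Lemma four_points : exists a b, uniq [:: v1; v2; a; b] /\
  forall Q, m Q = if Q \in [:: v1; v2; a; b] then h%:Z else p.-1%:Z.
Proof.
have [pull bd dv sumL [L [uL offL SL]]] := om; have [eh oh] := hE.
have h0 : (0 < h)%N by case: (h) oh.
have [mc1 mv1] := m_c rc1; have [mc2 mv2] := m_c rc2.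
pose L4 := [seq Q <- L | m Q != p.-1%:Z].
have in4 Q : (Q \in L4) = (m Q != p.-1%:Z).
  by rewrite mem_filter; case: eqP => //= e; apply/negPn/negP => /offL.
have u4 : uniq L4 by apply: filter_uniq.
have S4 : \sum_(Q <- L4) (p.-1%:Z - m Q) = (4 * h)%:Z.
  transitivity ((2 * p.-1)%:Z); last by rewrite eh mulnA.
  rewrite -SL /L4 big_filter [RHS](bigID (fun Q => m Q != p.-1%:Z)) /= [X in _ + X]big1 ?addr0 // => Q.
  by rewrite negbK => /eqP ->; rewrite subrr.
pose L2 := [seq Q <- L4 | (Q != v1) && (Q != v2)].
have pe : perm_eq L4 [:: v1, v2 & L2].
  apply: uniq_perm => //.
    rewrite /= !in_cons !mem_filter !eqxx /= andbF orbF v12 filter_uniq //.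
  move=> Q; rewrite in4 !in_cons mem_filter in4; case: (eqVneq Q v1) => [->|n1] /=; first by rewrite mv1; apply/eqP; lia.
  by case: (eqVneq Q v2) => [->|n2] //=; rewrite mv2; apply/eqP; lia.
have S2 : \sum_(Q <- L2) (p.-1%:Z - m Q) = (2 * h)%:Z.
  by move: S4; rewrite (perm_big _ pe) /= !big_cons mv1 mv2 eh; move: (\sum_(j <- L2) _) => y; lia.
have bnd Q : Q \in L2 -> h%:Z <= p.-1%:Z - m Q < (2 * h)%:Z.
  rewrite mem_filter in4 => /andP[_ ne]; have /andP[b0 b1] := bd Q.
  case: (dv Q) => [z|/dvdzP[k Ek]]; first by case: (m_pos z).
  have mp : 0 < m Q by rewrite lt_neqAle b0 andbT eq_sym; apply/eqP => /m_pos.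
  have lt : m Q < p.-1%:Z by rewrite lt_neqAle ne.
  have k2 : 2 <= k.
    rewrite leNgt; apply/negP => k1; have : k * m Q <= 1 * m Q by apply: ler_wpM2r => //; lia.
    by move: Ek lt; move: (m Q) => z; lia.
  have : 2 * m Q <= k * m Q by apply: ler_wpM2r.
  by move: Ek mp; rewrite eh; move: (m Q) => z; lia.
have uL2 : uniq [:: v1, v2 & L2] by rewrite -(perm_uniq pe).
have mem Q : (m Q != p.-1%:Z) = (Q \in [:: v1, v2 & L2]) by rewrite -in4 (perm_mem pe).
case E2: L2 S2 bnd uL2 mem => [|a [|b [|x l]]] S2 bnd uL2 mem.
- by move: S2; rewrite big_nil; clear -h0; lia.
- have /andP[_ l2] := bnd a (mem_head _ _); move: S2; rewrite big_seq1 => e; rewrite e ltxx in l2.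
  by [].
- have /andP[ba _] := bnd a (mem_head _ _); have /andP[bb _] := bnd b ltac:(by rewrite in_cons mem_head orbT).
  move: S2; rewrite !big_cons big_nil => S2.
  have [ma mb] : m a = h%:Z /\ m b = h%:Z.
    by clear -ba bb S2 eh; rewrite eh in ba bb S2; move: (m a) (m b) (h) ba bb S2 => x y z; split; lia.
  exists a, b; split=> // Q; rewrite -mem; case: eqP => //= ne.
  have : Q \in [:: v1; v2; a; b] by rewrite -mem; apply/eqP.
  by rewrite !in_cons in_nil orbF => /or4P[]/eqP ->.
- have /andP[ba _] := bnd a (mem_head _ _); have /andP[bb _] := bnd b ltac:(by rewrite !in_cons eqxx orbT).
  have /andP[bx _] := bnd x ltac:(by rewrite !in_cons eqxx !orbT).
  move: S2; rewrite !big_cons.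
  have : 0 <= \sum_(j <- l) (p.-1%:Z - m j) by apply: sumr_ge0 => y _; rewrite subr_ge0; case/andP: (bd y).
  clear -ba bb bx h0; move: (\sum_(j <- l) _) (p.-1%:Z - m a) (p.-1%:Z - m b) (p.-1%:Z - m x) ba bb bx => z1 z2 z3 z4; lia.
Qed.

(** As h is odd, a point with m = h is unramified and its image again has m = h. The only preimage
    of a critical value is its critical point, so the four points map into {a, b}, and the fibres
    over a and b lie among them. *)
Lemma quad_fibers : exists a b, [/\ uniq [:: v1; v2; a; b],
   forall Q, m Q = if Q \in [:: v1; v2; a; b] then h%:Z else p.-1%:Z,
   forall Q, Q \in [:: v1; v2; a; b] -> ph Q = a \/ ph Q = b &
   forall t, t \in [:: a; b] -> exists Q1 Q2, [/\ Q1 != Q2, Q1 \in [:: v1; v2; a; b], Q2 \in [:: v1; v2; a; b],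
     rm Q1 = 1%N /\ rm Q2 = 1%N & forall Q, ph Q = t <-> Q = Q1 \/ Q = Q2]].
Proof.
have [a [b [u4 mE]]] := four_points; have [pull bd dv sumL _] := om; have [eh oh] := hE.
have h0 : (0 < h)%N by case: (h) oh.
have [mc1 mv1] := m_c rc1; have [mc2 mv2] := m_c rc2.
have m4 Q : (Q \in [:: v1; v2; a; b]) = (m Q == h%:Z).
  by rewrite mE; case: ifP => _; rewrite ?eqxx //; apply/esym/eqP; lia.
have stay Q : Q \in [:: v1; v2; a; b] -> ph Q = a \/ ph Q = b.
  rewrite m4 => /eqP mQ; have := pull Q; rewrite mQ; case: (r12 Q) => rQ; rewrite rQ; last by move: oh; lia.
  rewrite mul1r => e; have : ph Q \in [:: v1; v2; a; b] by rewrite m4 -e.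
  rewrite !in_cons in_nil orbF => /or4P[]/eqP E; [| |by left|by right].
    by have EQ := crit_fiber rc1 E; rewrite EQ mc1 in mQ; lia.
  by have EQ := crit_fiber rc2 E; rewrite EQ mc2 in mQ; lia.
exists a, b; split=> // t tab.
have tn : t != v1 /\ t != v2.
  move: u4; rewrite /= !in_cons !in_nil !orbF !negb_or => /and4P[/and3P[_ n1 n2] /andP[n3 n4] _ _].
  by move: tab; rewrite !in_cons in_nil orbF => /orP[]/eqP ->; split; rewrite eq_sym.
have t4 : t \in [:: v1; v2; a; b] by move: tab; rewrite !in_cons in_nil orbF => /orP[]/eqP ->; rewrite eqxx ?orbT.
have pre Q : ph Q = t -> rm Q = 1%N /\ Q \in [:: v1; v2; a; b].
  move=> E; have r1 : rm Q = 1%N.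
    case: (r12 Q) => // rQ; case: tn => n1 n2.
    by case: (crit_only rQ) => EQ; rewrite -E EQ eqxx in n1 n2.
  split=> //; rewrite m4 pull r1 mul1r E -m4.
  exact: t4.
have [rs [srs C]] := fiber Kc sF sG d2 cop top t.
case: rs srs C => [|Q1 [|Q2 [|Q3 l]]] // _ C.
have inr Q : ph Q = t <-> Q = Q1 \/ Q = Q2.
  have := C Q; case: (ph Q =P t) => [E|nE].
    have [-> _] := pre _ E; rewrite /= addn0 => e; split=> // _.
    by move: e; case: (eqVneq Q1 Q) => [->|_]; [left|case: (eqVneq Q2 Q) => [->|_ //]; right].
  rewrite /= addn0 => e; split=> // -[] EQ; move: e; rewrite EQ eqxx ?addn1 ?add1n //.
have E1 : ph Q1 = t by apply/inr; left.
have E2 : ph Q2 = t by apply/inr; right.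
have [r1 i1] := pre _ E1; have [r2 i2] := pre _ E2.
exists Q1, Q2; split=> //; apply/eqP => EQ; have := C Q1; rewrite E1 eqxx r1 /= eqxx -EQ eqxx.
by [].
Qed.
End Quad.

(** If q is the quartic of the four points, omega is a constant times q^h. Since q pulls back to c'
    k W^2 q, the invariance of omega becomes (c' k)^h = 1. *)
Lemma unit_multiplier (K : fieldType) (Kc : alg_closed K) (F G : {poly K}) p (U fa : {poly K}) N' h (x1 x2 a b c' k : K) :
  (size F <= 3)%N -> (size G <= 3)%N -> (forall x, F.[x] = 0 -> G.[x] = 0 -> False) ->
  (F`_2 = 0 -> G`_2 = 0 -> False) -> (forall e, (0 < e)%N -> (e <= 2)%N -> e%:R != 0 :> K) ->
  U != 0 -> fa != 0 -> (size fa <= N'.+1)%N ->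
  homp F G (p * N' + 2 * p.-1) U * fa ^+ p = wron F G ^+ p.-1 * U * homp F G N' fa ^+ p ->
  p.-1 = (2 * h)%N -> uniq [:: Some x1; Some x2; Some a; Some b] ->
  (forall Q, mdiv p U fa N' Q = if Q \in [:: Some x1; Some x2; Some a; Some b] then h%:Z else p.-1%:Z) ->
  (F - x1 *: G) * (F - x2 *: G) = c' *: wron F G ^+ 2 ->
  (F - a *: G) * (F - b *: G) = k *: (('X - x1%:P) * ('X - x2%:P) * ('X - a%:P) * ('X - b%:P)) ->
  (c' * k) ^+ h = 1.
Proof.
move=> sF sG cop top chd U0 fa0 sa inv eh u4 mE E1 E2.
have d2 : (2 <= 2)%N by [].
have G0 : G != 0 := hP_neq0 Kc d2 cop top None.
pose S := [:: Some x1; Some x2; Some a; Some b]; pose q := \prod_(P <- S) @lin K P.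
have [|_ [q0 sq]] := @ord_prod K _ 1 S (@lin K) None.
  by move=> P _; split; [apply: lin_neq0|apply: size_lin].
rewrite -/q [size S]/= muln1 in q0 sq.
have mq x : mup x q = (Some x \in S).
  have := @ord_count K 4 1 S (Some x) (oner_neq0 _) erefl; rewrite scale1r [ord _ _ _]/= => ->.
  by rewrite count_uniq_mem.
have H4 : homp F G 4 q = (c' * k) *: (wron F G ^+ 2 * q).
  have := homp_factor Kc d2 cop top (N := 4) (c := 1) (rs := S) erefl; rewrite !scale1r => -> //.
  rewrite /S !big_cons big_nil mulr1 /= mulrA E1 E2 -scalerAl -scalerAr scalerA; congr (_ *: (_ * _)).
  by rewrite /q /S !big_cons big_nil /= mulr1 !mulrA.
have szX (P : {poly K}) n j : (size P <= n.+1)%N -> (size (P ^+ j) <= (j * n).+1)%N.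
  move=> sP; apply: leq_trans (size_poly_exp_leq _ _) _; rewrite ltnS mulnC leq_mul2l.
  by apply/orP; right; move: sP; move: (size P) => t; lia.
have [||x|kap kap0 EU] := @prop_of_ord K Kc U (fa ^+ p * q ^+ h) => //.
- by rewrite mulf_neq0 ?expf_neq0.
- rewrite mupM ?mulf_neq0 ?expf_neq0 //.
  have e1 : mup x (fa ^+ p) = (p * mup x fa)%N := ordX p (Some x) fa0 sa.
  have e2 : mup x (q ^+ h) = (h * mup x q)%N := ordX h (Some x) q0 sq.
  rewrite e1 e2 mq; have := mE (Some x); rewrite /mdiv /= -/S.
  by case: (Some x \in S); move: (mup x U) (p * mup x fa)%N => n1 n2; rewrite ?muln1 ?muln0; lia.
set A := homp F G N' fa in inv; set W := wron F G in inv H4.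
have A0 : A != 0 by have [] := ord_homp Kc sF sG d2 cop top None fa0 sa.
have W0 : W != 0 by have [] := wron_ord Kc sF sG d2 cop top chd None.
have EN : (2 * p.-1 = h * 4)%N by rewrite eh; lia.
have kinf := closed_inf Kc.
have HU : homp F G (p * N' + 2 * p.-1) U = kap *: (A ^+ p * ((c' * k) *: (W ^+ 2 * q)) ^+ h).
  have -> : homp F G (p * N' + 2 * p.-1) U = kap *: homp F G (p * N' + 2 * p.-1) (fa ^+ p * q ^+ h).
    by rewrite EU /homp scaler_sumr; apply: eq_bigr => i _; rewrite coefZ scalerA.
  rewrite (hompM kinf F G0) ?szX // ?EN ?szX //; congr (_ *: (_ * _)); first by rewrite (hompX kinf F G0).
  by rewrite (hompX kinf F G0) // H4.
have Z0 : kap%:P * (A ^+ p * W ^+ p.-1 * q ^+ h * fa ^+ p) != 0.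
  by rewrite mulf_neq0 ?polyC_eq0 // !mulf_neq0 ?expf_neq0.
have : ((c' * k) ^+ h)%:P = 1 :> {poly K}.
  apply: (mulIf Z0); rewrite mul1r.
  transitivity (homp F G (p * N' + 2 * p.-1) U * fa ^+ p).
    have WE : (W ^+ 2 * q) ^+ h = W ^+ p.-1 * q ^+ h by rewrite exprMn -exprM -eh.
    rewrite HU exprZn WE -!mul_polyC.
    by move: (A ^+ p) (W ^+ p.-1) (q ^+ h) (fa ^+ p) (kap%:P) (((c' * k) ^+ h)%:P) => *; ring.
  rewrite inv EU -mul_polyC.
  by move: (A ^+ p) (W ^+ p.-1) (q ^+ h) (fa ^+ p) (kap%:P) => *; ring.
by rewrite -polyC1 => /polyC_inj.
Qed.

Section QuadFinal.
Variable K : fieldType.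
Hypothesis Kc : alg_closed K.
Variables (F G : {poly K}) (p : nat).
Hypotheses (sF : (size F <= 3)%N) (sG : (size G <= 3)%N).
Hypothesis cop : forall x, F.[x] = 0 -> G.[x] = 0 -> False.
Hypothesis top : F`_2 = 0 -> G`_2 = 0 -> False.
Hypothesis chd : forall e, (0 < e)%N -> (e <= 2)%N -> e%:R != 0 :> K.
Hypotheses (chp : p \in [pchar K]) (p3 : (p %% 4 = 3)%N) (ch7 : (7 : K) != 0).
Local Notation ph := (rphi F G 2).
Local Notation rm := (ram F G 2).
Variables (U fa : {poly K}) (N' : nat).
Hypotheses (U0 : U != 0) (fa0 : fa != 0) (sU : (size U <= (p * N' + 2 * p.-1).+1)%N) (sa : (size fa <= N'.+1)%N).
Hypothesis inv : homp F G (p * N' + 2 * p.-1) U * fa ^+ p = wron F G ^+ p.-1 * U * homp F G N' fa ^+ p.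
Variables c1 c2 : option K.
Hypotheses (c12 : c1 != c2) (rc1 : rm c1 = 2%N) (rc2 : rm c2 = 2%N).
Hypotheses (np1 : ph (ph c1) != c1) (np2 : ph (ph c2) != c2).
Variables x1 x2 : K.
Hypotheses (Ev1 : ph c1 = Some x1) (Ev2 : ph c2 = Some x2).
Let d2 : (2 <= 2)%N := isT.
Let h := p.-1./2.
Let ch2 : (2 : K) != 0. Proof. exact: (chd (e := 2)). Qed.
Let pp : prime p. Proof. exact: (pcharf_prime chp). Qed.
Let fermat (n : nat) : (n%:R : K) != 0 -> (n%:R : K) ^+ p.-1 = 1.
Proof.
move=> n0; apply: (mulfI n0); rewrite mulr1 -exprS prednK ?prime_gt0 //.
by rewrite -(pFrobenius_autE chp) pFrobenius_aut_nat.
Qed.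
Let eh : p.-1 = (2 * h)%N /\ odd h.
Proof.
have Ej : p = (4 * (p %/ 4) + 3)%N by rewrite {1}(divn_eq p 4) p3 mulnC.
have e : p.-1 = (2 * (p %/ 4)).+1.*2 by rewrite {1}Ej -muln2; lia.
by rewrite /h e doubleK -mul2n /= oddM.
Qed.
Let sgn : (-1) ^+ h = -1 :> K. Proof. by rewrite -signr_odd (proj2 eh) expr1. Qed.

Lemma fiber_factor z r s : r != s -> rm (Some r) = 1%N -> rm (Some s) = 1%N ->
  (forall Q, ph Q = Some z <-> Q = Some r \/ Q = Some s) ->
  exists2 al, al != 0 & F - z *: G = al *: (('X - r%:P) * ('X - s%:P)).
Proof.
move=> rs r1 s1 fib; apply: (prop_of_ord Kc (hP_neq0 Kc d2 cop top (Some z))); first by rewrite mulf_neq0 ?polyXsubC_eq0.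
move=> x; have := ord_hP Kc sF sG d2 cop top (Some z) (Some x); rewrite [ord _ _ _]/= => ->.
rewrite mupM ?mulf_neq0 ?polyXsubC_eq0 // -[X in mup x X]expr1 mup_XsubCX -['X - s%:P]expr1 mup_XsubCX.
case: eqP => [/fib [[->]|[->]]|nE].
- by rewrite eqxx [s == r]eq_sym (negPf rs) addn0.
- by rewrite eqxx (negPf rs).
- case: eqP => [er|_]; first by case: nE; apply/fib; left; rewrite er.
  by case: eqP => [es|_] //; case: nE; apply/fib; right; rewrite es.
Qed.

(** Both sides have the two critical points as double zeros, and no other zeros. *)
Lemma crit_square : exists c', (F - x1 *: G) * (F - x2 *: G) = c' *: wron F G ^+ 2.
Proof.
have W0 : wron F G != 0 by have [] := wron_ord Kc sF sG d2 cop top chd None.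
have [||x|c _ E] := @prop_of_ord K Kc ((F - x1 *: G) * (F - x2 *: G)) (wron F G ^+ 2); last by exists c.
- by rewrite mulf_neq0 //; [apply: (hP_neq0 Kc d2 cop top (Some x1))|apply: (hP_neq0 Kc d2 cop top (Some x2))].
- by rewrite expf_neq0.
rewrite expr2 !mupM ?mulf_neq0 //; [|exact: (hP_neq0 Kc d2 cop top (Some x1))|exact: (hP_neq0 Kc d2 cop top (Some x2))].
have := ord_hP Kc sF sG d2 cop top (Some x1) (Some x); rewrite [ord _ _ _]/= => ->.
have := ord_hP Kc sF sG d2 cop top (Some x2) (Some x); rewrite [ord _ _ _]/= => ->.
have [_ _ oW] := wron_ord Kc sF sG d2 cop top chd (Some x); rewrite [ord _ _ _]/= in oW; rewrite oW -Ev1 -Ev2.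
have v12 : ph c1 != ph c2 by apply: contra c12 => /eqP e; apply/eqP; apply: (crit_fiber Kc sF sG cop top rc2).
case: eqP => [e|n1].
  have ex := crit_fiber Kc sF sG cop top rc1 e; rewrite ex (negPf v12) rc1.
  by [].
case: eqP => [e|n2]; first by have ex := crit_fiber Kc sF sG cop top rc2 e; rewrite ex rc2.
have -> : rm (Some x) = 1%N; last by [].
have := ram_gt0 Kc sF sG d2 cop top (Some x); have := ram_le Kc sF sG d2 cop top (Some x).
case Er: (rm (Some x)) => [|[|[|n]]] // _ _.
by case: (crit_only Kc sF sG cop top chd c12 rc1 rc2 Er) => ex; [case: n1|case: n2]; rewrite ex.
Qed.

Let om := orbi_mdiv Kc sF sG d2 cop top chd (prime_gt1 pp) U0 fa0 sU sa inv.

Lemma pencil_of_fibers a b r s r' s' : uniq [:: Some x1; Some x2; Some a; Some b] ->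
  (forall Q, mdiv p U fa N' Q = if Q \in [:: Some x1; Some x2; Some a; Some b] then h%:Z else p.-1%:Z) ->
  (exists2 al, al != 0 & F - a *: G = al *: (('X - r%:P) * ('X - s%:P))) ->
  (exists2 be, be != 0 & F - b *: G = be *: (('X - r'%:P) * ('X - s'%:P))) ->
  ('X - r%:P) * ('X - s%:P) * (('X - r'%:P) * ('X - s'%:P)) = ('X - x1%:P) * ('X - x2%:P) * ('X - a%:P) * ('X - b%:P) ->
  exists al be c, [/\ al != 0, be != 0, c ^+ h = 1 & pencil_rel al be x1 x2 a b c r s r' s'].
Proof.
move=> u4 mE [al al0 Ea] [be be0 Eb] Eq; have [c' Ec] := crit_square.
exists al, be, (c' * (al * be)); split=> //.
  apply: (unit_multiplier Kc sF sG cop top chd U0 fa0 sa inv (proj1 eh) u4 mE Ec).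
  by rewrite Ea Eb -scalerAl -scalerAr scalerA Eq.
move=> x.
have e1 := congr1 (fun q : {poly K} => q.[x]) Ea; have e2 := congr1 (fun q : {poly K} => q.[x]) Eb.
have e3 := congr1 (fun q : {poly K} => q^`().[x]) Ea; have e4 := congr1 (fun q : {poly K} => q^`().[x]) Eb.
have e5 := congr1 (fun q : {poly K} => q.[x]) Ec.
rewrite !(hornerD, hornerN, hornerZ, hornerM, hornerX, hornerC) in e1 e2.
rewrite !(derivD, derivN, derivZ, derivM, derivX, derivC, hornerD, hornerN, hornerZ, hornerM, hornerX, hornerC) in e3 e4.
rewrite hornerM hornerZ horner_exp /wron !(hornerD, hornerN, hornerZ, hornerM) in e5.
move: e1 e2 e3 e4 e5; move: (F.[x]) (G.[x]) (F^`().[x]) (G^`().[x]) => f g f' g' e1 e2 e3 e4 e5.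
have -> : al * (x - r) * (x - s) = f - a * g by rewrite e1; ring.
have -> : be * (x - r') * (x - s') = f - b * g by rewrite e2; ring.
have -> : al * (2 * x - r - s) = f' - a * g' by rewrite e3; ring.
have -> : be * (2 * x - r' - s') = f' - b * g' by rewrite e4; ring.
transitivity (al * be * (b - a) ^+ 2 * ((f - x1 * g) * (f - x2 * g))); first by ring.
by rewrite e5; ring.
Qed.
(** The four points are v1, v2, y1 and b. If both critical values map to y1, the fibre over b is
    {y1, b}; otherwise b = y2 and the remaining two points can be placed in two ways. Each case is
    one of the pencil lemmas, with c^h = 1. *)
Lemma quad_mod_p y1 y2 z1 : ph (Some x1) = Some y1 -> ph (Some x2) = Some y2 -> ph (Some y1) = Some z1 ->
  (y1 = y2 -> (2 : K) ^+ h = -1) /\ (y1 <> y2 -> (7 : K) ^+ h = -1).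
Proof.
move=> E1 E2 E3; have [eh1 oh] := eh; have kinf := closed_inf Kc.
(* If 2c = -1, raising to the power h gives 2^h = -1. The alternative (2c)^2 = -1 is impossible: its
   h-th power is 2^(p-1) = 1 on the left and -1 on the right, as h is odd. *)
have numA (c : K) : c ^+ h = 1 -> 2 * c + 1 = 0 \/ 4 * c ^+ 2 + 1 = 0 -> (2 : K) ^+ h = -1.
  move=> ch [e|e].
    have e' : 2 * c = -1 by apply/eqP; rewrite -addr_eq0 e.
    have : (2 * c) ^+ h = -1 by rewrite e'.
    by rewrite exprMn ch mulr1.
  have e' : 4 * c ^+ 2 = -1 by apply/eqP; rewrite -addr_eq0 e.
  have : (4 * c ^+ 2) ^+ h = -1 by rewrite e'.
  have -> : 4 * c ^+ 2 = (2 * c) ^+ 2 by ring.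
  rewrite -exprM mulnC exprM exprMn ch mulr1 -exprM mulnC -eh1 (fermat (n := 2)) // => /eqP.
  by rewrite -addr_eq0 (negPf ch2).
(* c is fixed by the Frobenius map, so -7 = (8c + 3)^2 is a square in the prime field, whereas -1 is
   not because h is odd. *)
have numB (c : K) : c ^+ h = 1 -> 4 * c ^+ 2 + 3 * c + 1 = 0 -> (7 : K) ^+ h = -1.
  move=> ch e; pose z := 8 * c + 3; have z2 : z ^+ 2 = - 7 by apply: (lin1 (k := 16) e); rewrite /z; ring.
  have cp : c ^+ p = c by rewrite -(prednK (prime_gt0 pp)) eh1 exprSr mulnC exprM ch expr1n mul1r.
  have zp : z ^+ p = z.
    by rewrite -(pFrobenius_autE chp) /z rmorphD rmorphM !rmorph_nat /= pFrobenius_autE cp.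
  have z0 : z != 0 by apply: contraNneq ch7 => z0; rewrite -oppr_eq0 -z2 z0 expr0n.
  have z1' : z ^+ p.-1 = 1 by apply: (mulfI z0); rewrite mulr1 -exprS prednK ?prime_gt0.
  have : (- 7) ^+ h = 1 :> K by rewrite -z2 -exprM -eh1.
  by rewrite exprNn sgn mulN1r => /(congr1 (@GRing.opp K)); rewrite opprK.
have [a0 [b0 [u4 mE stay fib]]] := quad_fibers Kc sF sG cop top chd chp p3 om c12 rc1 rc2 np1 np2.
rewrite Ev1 Ev2 -/h in u4 mE stay fib.
have {a0 b0 u4 mE stay fib} [b [u4 mE stay fib]] : exists b, [/\ uniq [:: Some x1; Some x2; Some y1; b],
   forall Q, mdiv p U fa N' Q = if Q \in [:: Some x1; Some x2; Some y1; b] then h%:Z else p.-1%:Z,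
   forall Q, Q \in [:: Some x1; Some x2; Some y1; b] -> ph Q = Some y1 \/ ph Q = b &
   forall t, t \in [:: Some y1; b] -> exists Q1 Q2, [/\ Q1 != Q2, Q1 \in [:: Some x1; Some x2; Some y1; b],
     Q2 \in [:: Some x1; Some x2; Some y1; b], rm Q1 = 1%N /\ rm Q2 = 1%N & forall Q, ph Q = t <-> Q = Q1 \/ Q = Q2]].
  case: (stay (Some x1) (mem_head _ _)); rewrite E1 => e; first by exists b0; rewrite e.
  exists a0; have pm : perm_eq [:: Some x1; Some x2; a0; b0] [:: Some x1; Some x2; Some y1; a0].
    by rewrite e !perm_cons; rewrite -[[:: a0; b0]]/([:: a0] ++ [:: b0]) perm_catC.
  split; first by rewrite -(perm_uniq pm).
  - by move=> Q; rewrite mE (perm_mem pm).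
  - by move=> Q; rewrite -(perm_mem pm) e => /stay[]; [right|left].
  - move=> t; rewrite !in_cons in_nil orbF e orbC => ht.
    have [|P1 [P2 [n12 i1 i2 rr HH]]] := fib t; first by rewrite !in_cons in_nil orbF.
    by exists P1, P2; rewrite -e -!(perm_mem pm).
have two t Q1 Q2 : t \in [:: Some y1; b] -> ph Q1 = t -> ph Q2 = t -> Q1 <> Q2 ->
    [/\ forall Q, ph Q = t <-> Q = Q1 \/ Q = Q2, rm Q1 = 1%N & rm Q2 = 1%N].
  move=> /fib [P1 [P2 [n12 i1 i2 [r1 r2] HH]]] e1 e2 ne.
  case: (proj1 (HH Q1) e1) ne => -> ; case: (proj1 (HH Q2) e2) => -> ne //.
  by split=> // Q; rewrite HH; split=> -[] ->; [right|left|right|left].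
have other t e : t \in [:: Some y1; b] -> ph e = t -> exists P, [/\ P <> e, P \in [:: Some x1; Some x2; Some y1; b] & ph P = t].
  move=> /fib [P1 [P2 [n12 i1 i2 _ HH]]] et.
  case: (proj1 (HH e) et) => ->; [exists P2|exists P1]; split=> //; try (by apply/HH; [right|left]).
  - by apply/eqP; rewrite eq_sym.
  - by apply/HH; right.
  - exact/eqP.
  - by apply/HH; left.
have t1 : Some y1 \in [:: Some y1; b] by rewrite mem_head.
have t2 : b \in [:: Some y1; b] by rewrite in_cons mem_head orbT.
have nb : b <> Some y1.
  by move=> e; move: u4; rewrite e /= !in_cons eqxx !andbF.
have fact z r s : Some z \in [:: Some y1; b] -> ph (Some r) = Some z -> ph (Some s) = Some z -> r <> s ->
    exists2 al, al != 0 & F - z *: G = al *: (('X - r%:P) * ('X - s%:P)).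
  move=> zt er es rs; have [|HH r1 s1] := two _ _ _ zt er es; first by move=> [].
  by apply: fiber_factor => //; apply/eqP.
have unK b' : uniq [:: Some x1; Some x2; Some y1; Some b'] -> uniq [:: x1; x2; y1; b'].
  by rewrite -(map_inj_uniq (f := @Some K)) // => x y [].
split=> [ey|ney].
  rewrite -ey in E2.
  have inb P : P \in [:: Some x1; Some x2; Some y1; b] -> ph P = b -> P = Some y1 \/ P = b.
    by rewrite !in_cons in_nil orbF => /or4P[]/eqP -> e; [case: nb; rewrite -e|case: nb; rewrite -e|left|right].
  have [P1 [P2 [n12 i1 i2 _ HH]]] := fib b t2.
  have p1 : ph P1 = b by apply/HH; left.
  have p2 : ph P2 = b by apply/HH; right.
  have [eb ebb] : ph (Some y1) = b /\ ph b = b.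
    have o1 := inb _ i1 p1; have o2 := inb _ i2 p2.
    by case: o1 => e1; case: o2 => e2; move: n12; rewrite e1 e2 ?eqxx // => _; rewrite e1 in p1; rewrite e2 in p2.
  have Eb : b = Some z1 by rewrite -eb E3.
  rewrite {}Eb in u4 mE stay fib two other t1 t2 nb fact inb eb ebb i1 i2 p1 p2 HH *.
  have unk := unK _ u4.
  have [d12 dyz] : x1 <> x2 /\ y1 <> z1.
    by split=> [e|e]; move: unk; rewrite e /= !in_cons eqxx ?andbF ?orbT ?andbF.
  have f1 := fact y1 x1 x2 t1 E1 E2 d12; have f2 := fact z1 y1 z1 t2 eb ebb dyz.
  have [|al [be [c [al0 be0 ch rel]]]] := pencil_of_fibers u4 mE f1 f2; first by rewrite !mulrA.
  by apply: (numA c) => //; apply: (pencil_A kinf al0 be0 unk rel).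
have Eb : b = Some y2.
  case: (stay (Some x2)); rewrite ?E2 => //; first by rewrite !in_cons eqxx !orbT.
  by move=> [e]; case: ney.
rewrite {}Eb in u4 mE stay fib two other t1 t2 nb fact.
have unk := unK _ u4.
have inn P : P \in [:: Some x1; Some x2; Some y1; Some y2] -> P <> Some x1 -> P <> Some x2 -> P = Some y1 \/ P = Some y2.
  by rewrite !in_cons in_nil orbF => /or4P[]/eqP -> //; [left|right].
have dd : [/\ x1 <> y1, x2 <> y2, x1 <> y2 & x2 <> y1].
  by split=> e; move: unk; rewrite e /= !in_cons !eqxx ?orbT ?andbF ?orbT ?andbF.
case: dd => d1 d2' d3 d4.
have [P [nP iP eP]] := other _ _ t1 E1; have [P' [nP' iP' eP']] := other _ _ t2 E2.
have n2 : P <> Some x2 by move=> e; rewrite e E2 in eP; case: eP => e'; case: ney.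
have n1 : P' <> Some x1 by move=> e; rewrite e E1 in eP'; case: eP' => e'; case: ney.
have PP' : P <> P' by move=> e; rewrite e eP' in eP; case: eP => e'; case: ney.
case: (inn _ iP nP n2) (inn _ iP' n1 nP') => EP [] EP'; rewrite EP EP' in eP eP' PP' => //.
- have f1 := fact y1 x1 y1 t1 E1 eP d1; have f2 := fact y2 x2 y2 t2 E2 eP' d2'.
  have [|al [be [c [al0 be0 ch rel]]]] := pencil_of_fibers u4 mE f1 f2; first by ring.
  by apply: (numB c) => //; apply: (pencil_C kinf al0 be0 unk rel).
- have f1 := fact y1 x1 y2 t1 E1 eP d3; have f2 := fact y2 x2 y1 t2 E2 eP' d4.
  have [|al [be [c [al0 be0 ch rel]]]] := pencil_of_fibers u4 mE f1 f2; first by ring.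
  by apply: (numB c) => //; apply: (pencil_D kinf al0 be0 unk rel).
Qed.
End QuadFinal.

(** * Totally invariant points and special maps *)

Lemma move_to_infinity (f g : {poly rat}) al (r : rat) : hyps f g al -> al != r ->
  exists f' g' al' (M : option algC -> option algC),
   [/\ hyps f' g' al', rdeg f' g' = rdeg f g, bijective M,
       M None = Some (ratr r) & (special (polyQ f') (polyQ g') -> special (polyQ f) (polyQ g)) /\
       forall T, reval (polyQ f) (polyQ g) (M T) = M (reval (polyQ f') (polyQ g') T)].
Proof.
move=> H alr; have [cop d2 _ _] := H.
have det : (r : rat) * 0 - 1 * 1 != 0 by rewrite mulr0 mulr1 sub0r oppr_eq0 oner_neq0.
have [f' [g' [cop' dE C]]] := conj_transport cop d2 det.
have [D CC] := C; pose M := mob (ratr r : algC) (ratr 1) (ratr 1) (ratr 0).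
exists f', g', (al - r)^-1, M; split=> //.
- apply: (hyps_conj H cop' dE C).
  have alr' : al - r != 0 by rewrite subr_eq0.
  rewrite /mob /rphi /mobN !hornerD !hornerZ hornerX !hornerC rmorph1 rmorph0 mul1r addr0 fmorph_eq0 invr_eq0 alr'; congr Some.
  have alC : ratr al - ratr r != 0 :> algC by rewrite -rmorphB fmorph_eq0.
  by rewrite fmorphV rmorphB /=; field.
- by exists (mob (ratr 0 : algC) (- ratr 1) (- ratr 1) (ratr r)) => P; [apply: mobK|apply: mobK'].
- rewrite /M /mob /rphi /mobN !coefD !coefZ coefX !coefC /= rmorph1 !mulr1 !addr0 oner_neq0 divr1.
  by [].
- by split; [exact: special_conj dE C|move=> T; have := CC T; rewrite !mob_reval].
Qed.

(** A rational Q is moved to infinity, where the map becomes a polynomial. An irrational Q has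
    another conjugate, also totally invariant, and the two points make a power map. *)
Lemma totally_invariant_special (f g : {poly rat}) al Q : hyps f g al ->
  (forall T, reval (polyQ f) (polyQ g) T = Q <-> T = Q) -> special (polyQ f) (polyQ g).
Proof.
move=> H inv; have [cop d2 nex ab] := H.
have infinity (f' g' : {poly rat}) al' : hyps f' g' al' ->
    (forall T, reval (polyQ f') (polyQ g') T = None <-> T = None) -> special (polyQ f') (polyQ g').
  move=> H' inv'; have [//|[Q' nQ' iQ']] := poly_case H' inv'.
  by apply: (power_case (Q := Q') (Q' := None) H' nQ'); left.
case: Q inv => [c|] inv; last exact: infinity H inv.
have [[r Er]|irr] := pselect (exists r : rat, c = ratr r).
  have alr : al != r.
    apply/eqP => e; apply: nex; exists [:: c] => x [n En]; rewrite e -Er in En.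
    have it k : iter k (reval (polyQ f) (polyQ g)) (Some x) = Some c -> Some x = Some c.
      by elim: k => // k IH /= /inv.
    by have [->] := it n En; rewrite mem_head.
  have [f' [g' [al' [M [H' dE bM MN [sp CC]]]]]] := move_to_infinity H alr.
  have Minj := bij_inj bM; apply: sp; apply: (infinity _ _ _ H') => T.
  rewrite Er -MN in inv; split=> [e|->].
    by apply: Minj; apply/inv; rewrite CC e.
  by apply: Minj; rewrite -CC; apply/inv.
have [t nt] : exists t : autC, t c <> c.
  apply: contrapT => h; apply: irr; apply/CratP; apply: aut_fixed_Crat => t.
  by apply: contrapT => nt; apply: h; exists t.
have [f0 [g0 [R [s [s0 Ef Eg rm]]]]] := rat_ratmap cop d2.
have phE T : reval (polyQ f) (polyQ g) T = rphi (pZ f0) (pZ g0) (rdeg f g) T by apply: (setup_reval H s0 Ef Eg).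
apply: (power_case (Q := Some (t c)) (Q' := Some c) H); first by move=> [].
left; split=> // T; have tK := algC_invautK t.
have -> : T = omap t (omap (algC_invaut t) T) by case: T => //= y; rewrite tK.
have inj : injective (omap t) by move=> [y|] [z|] //= [] /(fmorph_inj t) ->.
have -> : Some (t c) = omap t (Some c) by [].
rewrite phE rphi_aut -phE.
by split=> [/inj /inv ->|/inj /inv ->].
Qed.

Lemma critical_behaviour (f g : {poly rat}) al P : hyps f g al -> ~ special (polyQ f) (polyQ g) ->
  critical (polyQ f) (polyQ g) P ->
  finite_orbit (polyQ f) (polyQ g) P /\ strictly_preperiodic (polyQ f) (polyQ g) P.
Proof.
move=> H nsp cr; have [cop d2 _ _] := H.
have [f0 [g0 [R [s [s0 Ef Eg rm]]]]] := rat_ratmap cop d2.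
have phE T : reval (polyQ f) (polyQ g) T = rphi (pZ f0) (pZ g0) (rdeg f g) T by apply: (setup_reval H s0 Ef Eg).
have itE n T : iter n (reval (polyQ f) (polyQ g)) T = iter n (rphi (pZ f0) (pZ g0) (rdeg f g)) T by apply: (setup_iter H s0 Ef Eg).
have r2 : (2 <= ram (pZ f0) (pZ g0) (rdeg f g) P)%N by rewrite -(setup_ramif H s0 Ef Eg).
have md := setup_mdata H s0 Ef Eg rm.
have [m [n [mn Emn]]] := crit_preperiodic rm md r2.
split.
  exists (mkseq (fun k => iter k (reval (polyQ f) (polyQ g)) P) n) => k.
  have [j] := ubnP k; elim: j k => // j IH k lt; have [kn|nk] := ltnP k n.
    by apply/mapP; exists k => //; rewrite mem_iota.
  have -> : iter k (reval (polyQ f) (polyQ g)) P = iter (k - n + m) (reval (polyQ f) (polyQ g)) P.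
    by rewrite iterD [in RHS]itE [iter m _ _]itE Emn -!itE -iterD subnK.
  by apply: IH; lia.
split; first by exists m, n; rewrite !itE.
move=> [k [k0 Ek]]; apply: nsp; rewrite itE in Ek.
have [inv|[Q' ne [i1 i2]]] := periodic_structure rm md r2 (ex_intro _ k (conj k0 Ek)).
  by apply: (totally_invariant_special (Q := P) H) => T; rewrite phE.
apply: (power_case (Q := P) (Q' := Q') H); first by move=> e; rewrite e eqxx in ne.
by right; split=> T; rewrite phE.
Qed.

(** * Exclusion of quadratic maps in characteristic zero *)

Lemma fiber1_ram (K : fieldType) (Kc : alg_closed K) (F G : {poly K}) d (Q : option K) :
  (size F <= d.+1)%N -> (size G <= d.+1)%N -> (2 <= d)%N -> (forall x, F.[x] = 0 -> G.[x] = 0 -> False) ->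
  (F`_d = 0 -> G`_d = 0 -> False) -> (forall T, rphi F G d T = rphi F G d Q -> T = Q) -> ram F G d Q = d.
Proof.
move=> sF sG d2 cop top fib; have [rs [srs E]] := fiber Kc sF sG d2 cop top (rphi F G d Q).
have : all (pred1 Q) rs.
  by apply/allP => T Trs; apply/eqP/fib; have := E T; case: eqP => // _ /eqP; rewrite -leqn0 leqNgt -has_count has_pred1 Trs.
by rewrite all_count srs => /eqP cE; rewrite -[RHS]cE E eqxx.
Qed.

Lemma two_critical (f0 g0 : {poly int}) R : ratmap f0 g0 2 R -> exists c1 c2, [/\ c1 != c2,
  ram (pZ f0) (pZ g0) 2 c1 = 2%N & ram (pZ f0) (pZ g0) 2 c2 = 2%N].
Proof.
move=> rm; have d2 : (2 <= 2)%N by [].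
have [W0 sW _] := wron_ord algC_closed (C_sF rm) (C_sG rm) d2 (C_cop rm) (C_top rm) (@C_chd 2) None.
have oW T := let: And3 _ _ h := wron_ord algC_closed (C_sF rm) (C_sG rm) d2 (C_cop rm) (C_top rm) (@C_chd 2) T in h.
have [[|c1 [|c2 [|c3 l]]] [srs E]] := ord_list algC_closed W0 sW => //.
have le T := ram_le algC_closed (C_sF rm) (C_sG rm) d2 (C_cop rm) (C_top rm) T.
have e1 := E c1; have e2 := E c2; rewrite oW /= eqxx in e1; rewrite oW /= eqxx in e2.
have := le c1; have := le c2; move: e1 e2; rewrite [c2 == c1]eq_sym; case: (eqVneq c1 c2) => [<-|ne] /=.
  by move: (ram _ _ _ _) => r; lia.
move=> e1 e2 l1 l2; exists c1, c2; split=> //.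
  by move: e1 l2; move: (ram _ _ _ _) => r; lia.
by move: e2 l1; move: (ram _ _ _ _) => r; lia.
Qed.

Lemma half_3mod4 p : (p %% 4 = 3)%N -> p.-1 = (2 * p.-1./2)%N.
Proof.
move=> p3; have Ej : p = (4 * (p %/ 4) + 3)%N by rewrite {1}(divn_eq p 4) p3 mulnC.
have e : p.-1 = (2 * (p %/ 4)).+1.*2 by rewrite {1}Ej -muln2; lia.
by rewrite e doubleK -mul2n.
Qed.

(** All facts used modulo p hold at every place beyond some N, so p is still free to be 3 modulo 4
    and to make 2 or 7 a square. The condition at infinity keeps the relevant critical iterates
    finite, as the pencil computation requires. *)
Lemma quadratic_absurd_finite (f g : {poly rat}) al : hyps f g al -> rdeg f g = 2%N ->
  (forall P, critical (polyQ f) (polyQ g) P -> ~ periodic (polyQ f) (polyQ g) P) ->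
  (forall P, critical (polyQ f) (polyQ g) P -> forall k, (0 < k <= 3)%N -> iter k (reval (polyQ f) (polyQ g)) P <> None) ->
  False.
Proof.
move=> H d2E nper fin; have [cop d2 _ _] := H.
have [f0 [g0 [R [s [s0 Ef Eg rm]]]]] := rat_ratmap cop d2.
have rE P : ramif (polyQ f) (polyQ g) P = ram (pZ f0) (pZ g0) (rdeg f g) P by apply: (setup_ramif H s0 Ef Eg).
have itE n T : iter n (reval (polyQ f) (polyQ g)) T = iter n (rphi (pZ f0) (pZ g0) (rdeg f g)) T by apply: (setup_iter H s0 Ef Eg).
have forms := setup_forms H s0 Ef Eg rm.
rewrite d2E in rm rE itE; have [c1 [c2 [c12 r1 r2]]] := two_critical rm.
set ph := rphi (pZ f0) (pZ g0) 2 in itE.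
have data c : ram (pZ f0) (pZ g0) 2 c = 2%N -> ph (ph c) != c /\ forall k, (0 < k <= 3)%N -> iter k ph c != None.
  move=> rc; have cr : critical (polyQ f) (polyQ g) c by rewrite /critical rE rc.
  split; first by apply/eqP => e; apply: (nper c cr); exists 2%N; rewrite itE.
  by move=> k hk; apply/eqP; rewrite -itE; apply: fin.
have [n1 F1] := data c1 r1; have [n2 F2] := data c2 r2.
have rr1 : (2 <= ram (pZ f0) (pZ g0) 2 c1)%N by rewrite r1.
have rr2 : (2 <= ram (pZ f0) (pZ g0) 2 c2)%N by rewrite r2.
pose e := (ph (ph c1) == ph (ph c2)).
have key : ultimately (fun p v => (red v (ph (ph c1)) == red v (ph (ph c2))) = e).
  rewrite /e; case: eqP => [->|/eqP ne]; first by exists 0%N => p _ _ v; rewrite eqxx.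
  by have [N HN] := red_neq ne; exists N => p pp lt v; apply/negbTE/HN.
have V1 := ultimately_and (ultimately_and forms (good_prime rm)) (ultimately_and (@iter_red f0 g0 2 c1 3) (@iter_red f0 g0 2 c2 3)).
have V2 := ultimately_and (ultimately_and (red_ram rm rr1) (red_ram rm rr2)) (ultimately_and (red_neq c12) (ultimately_and (red_neq n1) (red_neq n2))).
have V3 := ultimately_and (ultimately_and (red_neq (F1 1%N isT)) (red_neq (F1 2%N isT))) (ultimately_and (red_neq (F1 3%N isT)) (ultimately_and (red_neq (F2 1%N isT)) (red_neq (F2 2%N isT)))).
have [N HN] := ultimately_and key (ultimately_and V1 (ultimately_and V2 V3)).
(* If the two critical values have the same image the outcome is 2^h = -1, otherwise 7^h = -1. *)
clearbody e; pose k := if e then 2%N else 7%N.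
have [p [x [pp lt p3 npx pd]]] := @prime_3mod4_square k (N + 7) ltac:(by rewrite /k; case: (e)).
have [v _] := place_exists pp.
have ltN : (N < p)%N by apply: leq_ltn_trans lt; rewrite leq_addr.
have lt7 : (7 < p)%N by apply: leq_ltn_trans lt; rewrite leq_addl.
have [Ee [[[fm [nR dp]] [it1 it2]] [[[q1 q2] [q12 [m1 m2]]] [[a1 a2] [a3 [b1 b2]]]]]] := HN p pp ltN v.
have [U [fa [N' [U0 fa0 sU sa inv]]]] := fm.
have kc := @res_alg_closed _ v; have chp := res_char v pp.
have nz n : (0 < n < p)%N -> n%:R != 0 :> resT v.
  by move=> /andP[n0 np]; rewrite (red_natr v pp); apply/negP => /dvdn_leq; rewrite n0 leqNgt np => /(_ isT).
have leR Q := ram_le kc (red_sF rm v) (red_sG rm v) (rm_d rm) (red_cop rm pp nR) (red_top rm pp nR) Q.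
have R1 : ram (map_poly (intr : int -> resT v) f0) (map_poly intr g0) 2 (red v c1) = 2%N by apply/eqP; rewrite eqn_leq leR q1.
have R2 : ram (map_poly (intr : int -> resT v) f0) (map_poly intr g0) 2 (red v c2) = 2%N by apply/eqP; rewrite eqn_leq leR q2.
have [i10 i11 i12] : [/\ rphi (map_poly (intr : int -> resT v) f0) (map_poly intr g0) 2 (red v c1) = red v (ph c1),
   rphi (map_poly (intr : int -> resT v) f0) (map_poly intr g0) 2 (red v (ph c1)) = red v (ph (ph c1)) &
   rphi (map_poly (intr : int -> resT v) f0) (map_poly intr g0) 2 (red v (ph (ph c1))) = red v (ph (ph (ph c1)))].
  by split; [exact: (it1 0%N)|exact: (it1 1%N)|exact: (it1 2%N)].
have [i20 i21] : rphi (map_poly (intr : int -> resT v) f0) (map_poly intr g0) 2 (red v c2) = red v (ph c2) /\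
   rphi (map_poly (intr : int -> resT v) f0) (map_poly intr g0) 2 (red v (ph c2)) = red v (ph (ph c2)).
  by split; [exact: (it2 0%N)|exact: (it2 1%N)].
have fin' (T : option (resT v)) : T != None -> exists y, T = Some y by case: T => // y _; exists y.
have [x1 X1] := fin' _ a1; have [y1 Y1] := fin' _ a2; have [z1 Z1] := fin' _ a3.
have [x2 X2] := fin' _ b1; have [y2 Y2] := fin' _ b2; rewrite /= -/ph in X1 Y1 Z1 X2 Y2.
rewrite -i11 -i10 in m1; rewrite -i21 -i20 in m2.
rewrite X1 in i10 i11; rewrite X2 in i20 i21; rewrite Y1 in i11 i12 Ee; rewrite Y2 in i21 Ee; rewrite Z1 in i12.
have [r2' r7] := quad_mod_p kc (red_sF rm v) (red_sG rm v) (red_cop rm pp nR) (red_top rm pp nR) (red_chd v pp nR dp) chp p3 (nz 7%N lt7)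
  U0 fa0 sU sa inv q12 R1 R2 m1 m2 i10 i20 i11 i21 i12.
have kh : (k%:R : resT v) ^+ p.-1./2 = -1.
  rewrite /k; move: Ee; case: (e) => E; first by apply: r2'; case/eqP: E.
  by apply: r7 => yy; rewrite yy eqxx in E.
have kx : (k * (x * x))%:R = 1 :> resT v.
  have k1 : (1 <= k * (x * x))%N.
    rewrite !muln_gt0; have -> : (0 < x)%N by rewrite lt0n; apply: contraNneq npx => ->.
    by rewrite /k; case: (e).
  apply/eqP; rewrite -subr_eq0 -(natrB _ k1) (red_natr v pp).
  exact: pd.
have Eh : p.-1 = (2 * p.-1./2)%N.
  exact: half_3mod4.
have xf : (x%:R : resT v) ^+ p.-1 = 1.
  have x0 : (x%:R : resT v) != 0 by rewrite (red_natr v pp).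
  apply: (mulfI x0); rewrite mulr1 -exprS prednK ?prime_gt0 //.
  by rewrite -(pFrobenius_autE chp) pFrobenius_aut_nat.
(* The h-th power of k x^2 = 1 gives -1 = 1, although p is odd. *)
have := congr1 (fun y => y ^+ p.-1./2) kx; rewrite !natrM expr1n exprMn kh -expr2 -exprM -Eh xf mulr1 => /eqP.
rewrite eq_sym -addr_eq0 -[1 + 1]/(2%:R) => /negP[]; apply/negP; apply: nz; exact: (leq_trans (isT : (3 <= 8)%N) lt7).
Qed.

(** An integer off the first three images of the critical points is moved to infinity. *)
Lemma quadratic_absurd (f g : {poly rat}) al : hyps f g al -> rdeg f g = 2%N ->
  ~ special (polyQ f) (polyQ g) -> False.
Proof.
move=> H d2E nsp; have [cop d2 _ _] := H.
have [f0 [g0 [R [s [s0 Ef Eg rm]]]]] := rat_ratmap cop d2.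
have phE T : reval (polyQ f) (polyQ g) T = rphi (pZ f0) (pZ g0) (rdeg f g) T by apply: (setup_reval H s0 Ef Eg).
rewrite d2E in rm phE; have [c1 [c2 [c12 r1 r2]]] := two_critical rm.
pose bad := [seq iter k (reval (polyQ f) (polyQ g)) c | c <- [:: c1; c2], k <- iota 1 3].
have [r nr] := fresh_nat (ratr al :: pmap id bad).
have := nr; rewrite in_cons negb_or => /andP[ra rQ].
have alr : al != r%:R by apply: contra ra => /eqP ->; rewrite rmorph_nat.
have [f' [g' [al' [M [H' dE bM MN [sp CC]]]]]] := move_to_infinity H alr.
have nsp' : ~ special (polyQ f') (polyQ g') by move=> /sp.
have Minj := bij_inj bM.
have itM k T : iter k (reval (polyQ f) (polyQ g)) (M T) = M (iter k (reval (polyQ f') (polyQ g')) T).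
  by elim: k => //= k ->; rewrite CC.
apply: (quadratic_absurd_finite H'); first by rewrite dE.
  by move=> P cr; have [_ []] := critical_behaviour H' nsp' cr.
move=> P cr k hk e.
have [cop' d2' _ _] := H'.
have [f1 [g1 [R1 [s1 [s10 Ef1 Eg1 rm1]]]]] := rat_ratmap cop' d2'.
have phE1 T : reval (polyQ f') (polyQ g') T = rphi (pZ f1) (pZ g1) (rdeg f' g') T by apply: (setup_reval H' s10 Ef1 Eg1).
have rE1 T : ramif (polyQ f') (polyQ g') T = ram (pZ f1) (pZ g1) (rdeg f' g') T by apply: (setup_ramif H' s10 Ef1 Eg1).
rewrite dE d2E in rm1 phE1 rE1.
have rP : ram (pZ f1) (pZ g1) 2 P = 2%N.
  apply/eqP; rewrite eqn_leq (ram_le algC_closed (C_sF rm1) (C_sG rm1) (rm_d rm1) (C_cop rm1) (C_top rm1)) -rE1.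
  exact: cr.
have rM : ram (pZ f0) (pZ g0) 2 (M P) = 2%N.
  apply: (fiber1_ram algC_closed (C_sF rm) (C_sG rm) (rm_d rm) (C_cop rm) (C_top rm)) => T.
  have [M' MK MK'] := bM; rewrite -(MK' T) -!phE !CC => /Minj E; congr M.
  by apply: (crit_fiber algC_closed (C_sF rm1) (C_sG rm1) (C_cop rm1) (C_top rm1) rP); rewrite -!phE1.
have MPc : M P \in [:: c1; c2].
  case: (crit_only algC_closed (C_sF rm) (C_sG rm) (C_cop rm) (C_top rm) (@C_chd 2) c12 r1 r2 rM) => ->.
    by rewrite mem_head.
  by rewrite in_cons mem_head orbT.
move/negP: rQ; apply; rewrite mem_pmap map_id; have -> : Some (r%:R : algC) = iter k (reval (polyQ f) (polyQ g)) (M P).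
  by rewrite itM e MN rmorph_nat.
by apply: (allpairs_f (fun c k => iter k (reval (polyQ f) (polyQ g)) c)) => //; rewrite mem_iota; lia.
Qed.

Theorem theorem3p8 (f g : {poly rat}) (alpha : rat) :
  coprimep f g ->
  (2 <= rdeg f g)%N ->
  ~ special (polyQ f) (polyQ g) ->
  ~ exceptional (polyQ f) (polyQ g) (ratr alpha) ->
  Ginf_abelian (polyQ f) (polyQ g) (ratr alpha) ->
  (post_critically_finite (polyQ f) (polyQ g) /\
   forall P : P1, critical (polyQ f) (polyQ g) P ->
     strictly_preperiodic (polyQ f) (polyQ g) P) /\
  (rdeg f g = 2%N ->
     Q_conjugate (polyQ f) (polyQ g)
       (polyQ (2%:P * 'X ^+ 2 + 4%:P * 'X + 4%:P)) (polyQ (- 'X ^+ 2 + 4%:P))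
   \/ Q_conjugate (polyQ f) (polyQ g)
       1 (polyQ (2%:P * ('X - 1) ^+ 2))).
Proof.
move=> cop d2 nsp nex ab; have H : hyps f g alpha by [].
split; last by move=> /(quadratic_absurd H) /(_ nsp).
by split=> P cr; have [] := critical_behaviour H nsp cr.
Qed.
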